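(* Let $\{X(t)\}_{t\ge 0}$ be the stochastic replicator process with payoff matrix $A\in\mathbb{R}^{n\times n}$, noise parameters $\sigma_1,\dots,\sigma_n$ and initial value $\mathbf{x}_0\in\operatorname{int}\Delta$, and let $\tilde A=(a_{ij}-\tfrac12\sigma_i^2)_{i,j}$. (a) If $\{X(t)\}$ is positive recurrent with invariant distribution $\pi$ on $\operatorname{int}\Delta$, then $\hat{\mathbf{y}}:=\int\mathbf{y}\,d\pi(\mathbf{y})$ is the unique interior Nash equilibrium of $\tilde A$ (i.e. the unique Nash equilibrium lying in $\operatorname{int}\Delta$) and $$\lim_{T\to\infty}\frac1T\int_0^TX(t)\,dt=\hat{\mathbf{y}}\qquad\text{a.s.}$$ (b) Let $\mathcal{N}=\{\mathbf{y}\in\Delta:\{\tilde A\mathbf{y}\}_1=\cdots=\{\tilde A\mathbf{y}\}_n\}$. If $\{X(t)\}$ is null recurrent, then $\mathcal{N}\ne\varnothing$. Moreover, if $\{X(t)\}$ is null recurrent and $(T_k)_{k=1}^\infty$ is a sequence of random times such that $$T_k\nearrow\infty\ \text{ a.s.}\quad\text{and}\quad\frac{\log X_i(T_k)}{T_k}\to0\ \text{ a.s.},\qquad i=1,\dots,n,$$ then, a.s., every accumulation point of the sequence $$\frac1{T_k}\int_0^{T_k}X(t)\,dt,\qquad k=1,2,\dots,$$ belongs to the set $\mathcal{N}$.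
   Context: Setting. $n\ge2$; $A=(a_{ij})\in\mathbb{R}^{n\times n}$ is an arbitrary payoff matrix; $\sigma_1,\dots,\sigma_n>0$; $W=(W_1,\dots,W_n)^T$ is a standard $n$-dimensional Brownian motion (independent components). $\Delta=\{\mathbf{y}\in[0,1]^n:y_1+\cdots+y_n=1\}$ and $\operatorname{int}\Delta=\{\mathbf{y}\in\Delta: y_i>0\ \forall i\}$. The stochastic replicator process $\{X(t)\}$ is a strong solution of the Itô equation $$dX(t)=\mathbf{b}(X(t))\,dt+C(X(t))\,dW(t),\qquad X(0)=\mathbf{x}_0\in\operatorname{int}\Delta,$$ with $\mathbf{b}(\mathbf{x})=[\operatorname{diag}(x_1,\dots,x_n)-\mathbf{x}\mathbf{x}^T][A-\operatorname{diag}(\sigma_1^2,\dots,\sigma_n^2)]\mathbf{x}$ and $C(\mathbf{x})=[\operatorname{diag}(x_1,\dots,x_n)-\mathbf{x}\mathbf{x}^T]\operatorname{diag}(\sigma_1,\dots,\sigma_n)$ for $\mathbf{x}\in\Delta$. Equivalently, $X_i=Z_i/(Z_1+\cdots+Z_n)$ where $dZ_i(t)=Z_i(t)[\{AX(t)\}_i\,dt+\sigma_i\,dW_i(t)]$, $Z_i(0)>0$. Almost surely $X(t)\in\operatorname{int}\Delta$ for all $t\ge0$, and $\{X(t)\}$ is a Markov process. $P_{\mathbf{x}_0}$ denotes probability under $X(0)=\mathbf{x}_0$. $\{\mathbf{v}\}_i$ denotes the $i$th component of $\mathbf{v}$. A point $\mathbf{p}\in\Delta$ is a Nash equilibrium of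 $\tilde A$ if $\mathbf{p}^T\tilde A\mathbf{p}\ge\mathbf{q}^T\tilde A\mathbf{p}$ for all $\mathbf{q}\in\Delta$; it is interior if $\mathbf{p}\in\operatorname{int}\Delta$. Recurrence. $\{X(t)\}$ is recurrent if for every $\mathbf{x}\in\operatorname{int}\Delta$ and $\varepsilon>0$, $P_{\mathbf{x}_0}\{X(T_k)\in B_\varepsilon(\mathbf{x})$ for a sequence of finite random times $T_k$ increasing to infinity$\}=1$, where $B_\varepsilon(\mathbf{x})=\{\mathbf{y}\in\Delta:\|\mathbf{y}-\mathbf{x}\|<\varepsilon\}$. If $\{X(t)\}$ is recurrent, its transition probability function has a $\sigma$-finite invariant measure $\nu$ on $\operatorname{int}\Delta$, unique up to positive multiples (known fact, Khas'minskii). A recurrent $\{X(t)\}$ is positive recurrent if $\nu(\operatorname{int}\Delta)<\infty$, in which case the invariant distribution is $\pi=\nu/\nu(\operatorname{int}\Delta)$; it is null recurrent if $\nu(\operatorname{int}\Delta)=\infty$. *)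

(* Defs.v *)
From HB Require Import structures.
From mathcomp Require Import all_boot all_order all_algebra.
From mathcomp Require Import all_classical all_reals all_analysis.
Set Implicit Arguments.
Unset Strict Implicit.
Unset Printing Implicit Defensive.
Import Order.TTheory GRing.Theory Num.Theory.
Import numFieldNormedType.Exports.
Local Open Scope classical_set_scope.
Local Open Scope ring_scope.

Section Game.
Context {R : realType} {n : nat}.

Definition simplex : set 'cV[R]_n :=
  [set y | (forall i, 0 <= y i 0 <= 1) /\ \sum_i y i 0 = 1].

Definition int_simplex : set 'cV[R]_n :=
  [set y | simplex y /\ forall i, 0 < y i 0].

Definition euclid_dist (x y : 'cV[R]_n) : R :=
  Num.sqrt (\sum_i (x i 0 - y i 0) ^+ 2).

Definition simplex_ball (x : 'cV[R]_n) (e : R) : set 'cV[R]_n :=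
  [set y | simplex y /\ euclid_dist y x < e].

Definition nash_equilibrium (A : 'M[R]_n) (p : 'cV[R]_n) : Prop :=
  simplex p /\
  forall q, simplex q -> (q^T *m A *m p) 0 0 <= (p^T *m A *m p) 0 0.

Definition modified_payoff (A : 'M[R]_n) (sigma : 'I_n -> R) : 'M[R]_n :=
  \matrix_(i, j) (A i j - sigma i ^+ 2 / 2).

Definition equal_payoff_set (A : 'M[R]_n) : set 'cV[R]_n :=
  [set y | simplex y /\ forall i j, (A *m y) i 0 = (A *m y) j 0].

Definition simplex_proj (x : 'cV[R]_n) : 'M[R]_n := diag_mx x^T - x *m x^T.

Definition drift (A : 'M[R]_n) (sigma : 'I_n -> R) (x : 'cV[R]_n) : 'cV[R]_n :=
  simplex_proj x *m (A - diag_mx (\row_i (sigma i ^+ 2))) *m x.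

Definition dispersion (sigma : 'I_n -> R) (x : 'cV[R]_n) : 'M[R]_n :=
  simplex_proj x *m diag_mx (\row_i sigma i).

End Game.

Section Stochastic.
Context {R : realType} {d : measure_display} {Omega : measurableType d}.
Variable P : probability Omega R.

Definition independent_family (I : finType) (Y : I -> Omega -> R) : Prop :=
  forall B : I -> set R, (forall i, measurable (B i)) ->
    P [set w | forall i, B i (Y i w)] = (\prod_i P (Y i @^-1` B i))%E.

Definition cvg_in_probability (Y : nat -> Omega -> R) (Z : Omega -> R) : Prop :=
  forall e : R, 0 < e ->
    (fun k => P [set w | e <= `|Y k w - Z w|]) @ \oo --> (0 : \bar R)%E.

Definition brownian_motion {n : nat} (W : 'I_n -> R -> {RV P >-> R}) : Prop :=
  [/\ forall i w, W i 0 w = 0,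
      forall i w, {within `[0, +oo[, continuous (fun t => W i t w)},
      forall i (s t : R), 0 <= s -> s < t ->
        forall B : set R, measurable B ->
          P [set w | B (W i t w - W i s w)] =
          normal_prob 0 (Num.sqrt (t - s)) B
    & forall (m : nat) (s : nat -> R), 0 <= s 0%N ->
        (forall k, s k <= s k.+1) ->
        independent_family (fun (ik : 'I_n * 'I_m) w =>
          W ik.1 (s ik.2.+1) w - W ik.1 (s ik.2) w)].

(* The filtration generated by W, augmented by the P-null events; adaptedness
   to it is what makes a solution strong. *)
Definition brownian_filtration {n : nat} (W : 'I_n -> R -> {RV P >-> R})
    (t : R) : set (set Omega) :=
  <<s [set E | exists i s (B : set R),
         [/\ 0 <= s <= t, measurable B & E = W i s @^-1` B]]
      `|` [set E | measurable E /\ P E = 0%E] >>.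

Definition adapted (F : R -> set (set Omega)) (H : R -> Omega -> R) : Prop :=
  forall t (B : set R), 0 <= t -> measurable B -> F t (H t @^-1` B).

(* Encodes u |-> \sum_(k < sp_size) sp_coef k * \1_{]sp_time k, sp_time k.+1]} u;
   the values of sp_time and sp_coef at larger indices are irrelevant. *)
Record simple_process := SimpleProcess {
  sp_size : nat ;
  sp_time : nat -> R ;
  sp_coef : nat -> Omega -> R }.

Definition simple_adapted (F : R -> set (set Omega)) (t : R)
    (S : simple_process) : Prop :=
  [/\ sp_time S 0%N = 0,
      sp_time S (sp_size S) = t,
      forall k, (k < sp_size S)%N -> sp_time S k <= sp_time S k.+1,
      forall k, (k < sp_size S)%N -> exists M : R, forall w, `|sp_coef S k w| <= M
    & forall k (B : set R), (k < sp_size S)%N -> measurable B ->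
        F (sp_time S k) (sp_coef S k @^-1` B)].

Definition simple_val (S : simple_process) (u : R) (w : Omega) : R :=
  \sum_(k < sp_size S)
    sp_coef S k w * \1_(`]sp_time S k, sp_time S k.+1]) u.

Definition simple_integral (B : R -> Omega -> R) (S : simple_process)
    (w : Omega) : R :=
  \sum_(k < sp_size S)
    sp_coef S k w * (B (sp_time S k.+1) w - B (sp_time S k) w).

Definition simple_approximation (F : R -> set (set Omega))
    (H : R -> Omega -> R) (t : R) (S : nat -> simple_process) : Prop :=
  (forall k, simple_adapted F t (S k)) /\
  cvg_in_probability
    (fun k w => \int[lebesgue_measure]_(u in `[0, t])
                  (simple_val (S k) u w - H u w) ^+ 2)
    (fun=> 0).

(* I is (a version of) the Ito integral \int_0^t H dB of a continuous adapted
   integrand: the limit in probability of the elementary integrals of simple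
   processes S k with \int_0^t |S k - H|^2 du -> 0 in probability. The limit
   does not depend on the approximating sequence, so both quantifications over
   sequences agree; asking for both avoids any vacuity. *)
Definition is_ito_integral (F : R -> set (set Omega)) (B : R -> Omega -> R)
    (H : R -> Omega -> R) (t : R) (I : {RV P >-> R}) : Prop :=
  (exists S, simple_approximation F H t S) /\
  forall S, simple_approximation F H t S ->
    cvg_in_probability (fun k => simple_integral B (S k)) I.

End Stochastic.

Section Replicator.
Context {R : realType} {n : nat} {d : measure_display} {Omega : measurableType d}.
Variable P : probability Omega R.

(* dX = drift(X) dt + dispersion(X) dW, X(0) = x, in integrated form, on the
   state space int_simplex. *)
Definition replicator_process (A : 'M[R]_n) (sigma : 'I_n -> R)
    (W : 'I_n -> R -> {RV P >-> R}) (x : 'cV[R]_n)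
    (X : R -> Omega -> 'cV[R]_n) : Prop :=
  [/\ forall i, adapted (brownian_filtration W) (fun t w => X t w i 0),
      forall i w, {within `[0, +oo[, continuous (fun t => X t w i 0)},
      {ae P, forall w, X 0 w = x},
      {ae P, forall w, forall t, 0 <= t -> int_simplex (X t w)}
    & forall t, 0 <= t ->
        exists I : 'I_n -> 'I_n -> {RV P >-> R},
          (forall i j, is_ito_integral (brownian_filtration W) (fun s => W j s)
             (fun s w => dispersion sigma (X s w) i j) t (I i j)) /\
          {ae P, forall w, forall i,
             X t w i 0 = x i 0
               + (\int[lebesgue_measure]_(s in `[0, t]) drift A sigma (X s w) i 0)
               + \sum_j I i j w}].

Definition time_average (X : R -> Omega -> 'cV[R]_n) (T : R) (w : Omega) :
    'cV[R]_n :=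
  \col_i (T^-1 * (\int[lebesgue_measure]_(t in `[0, T]) X t w i 0)).

Definition recurrent (X : R -> Omega -> 'cV[R]_n) : Prop :=
  forall x e, int_simplex x -> 0 < e ->
    exists T : nat -> {RV P >-> R},
      {ae P, forall w,
        [/\ forall k, 0 <= T k w,
            forall k, T k w <= T k.+1 w,
            (fun k => T k w) @ \oo --> +oo
          & forall k, simplex_ball x e (X (T k w) w)]}.

(* 'cV[R]_n with its Borel sigma-algebra. *)
Definition state_space := g_sigma_algebraType (@open 'cV[R]_n).

(* From here on X x is the process started at x. *)
Definition transition (X : 'cV[R]_n -> R -> Omega -> 'cV[R]_n)
    (t : R) (x : 'cV[R]_n) (B : set 'cV[R]_n) : \bar R :=
  P (X x t @^-1` B).

(* Measures on int_simplex are measures on 'cV[R]_n carried by int_simplex. *)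
Definition invariant_measure (X : 'cV[R]_n -> R -> Omega -> 'cV[R]_n)
    (nu : {measure set state_space -> \bar R}) : Prop :=
  [/\ sigma_finite setT nu,
      nu (~` int_simplex) = 0%E,
      (0 < nu int_simplex)%E
    & forall t (B : set state_space), 0 <= t -> measurable B ->
        (\int[nu]_(x in int_simplex) transition X t x B = nu B)%E].

(* For a recurrent process the invariant measure is unique up to positive
   multiples, so the existential quantifiers over nu below are harmless. *)
Definition positive_recurrent (X : 'cV[R]_n -> R -> Omega -> 'cV[R]_n)
    (x0 : 'cV[R]_n) : Prop :=
  recurrent (X x0) /\
  exists nu, invariant_measure X nu /\ (nu int_simplex < +oo)%E.

Definition null_recurrent (X : 'cV[R]_n -> R -> Omega -> 'cV[R]_n)
    (x0 : 'cV[R]_n) : Prop :=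
  recurrent (X x0) /\
  exists nu, invariant_measure X nu /\ nu int_simplex = +oo%E.

Definition invariant_distribution (X : 'cV[R]_n -> R -> Omega -> 'cV[R]_n)
    (pi : probability state_space R) : Prop :=
  exists nu, [/\ invariant_measure X nu, (nu int_simplex < +oo)%E &
    forall B, measurable B ->
      pi B = (((fine (nu int_simplex))^-1)%:E * nu B)%E].

Definition mean_point (pi : probability state_space R) : 'cV[R]_n :=
  \col_i \int[pi]_y (y : 'cV[R]_n) i 0.

End Replicator.

(* Main.v *)
Require Import Defs.
From HB Require Import structures.
From mathcomp Require Import all_boot all_order all_algebra.
From mathcomp Require Import all_classical all_reals all_analysis.
From mathcomp Require Import measurable_realfun ring lra.
Import Order.TTheory GRing.Theory Num.Theory.
Import numFieldNormedType.Exports.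
Local Open Scope classical_set_scope.
Local Open Scope ring_scope.
Set Implicit Arguments.
Unset Strict Implicit.
Unset Printing Implicit Defensive.

(** In logarithmic coordinates the noise is additive: by a second order Taylor
    expansion along fine grids, [ln X_i - ln X_j] is its initial value, plus the
    integral of the difference of the modified payoffs, plus
    [sigma_i W_i - sigma_j W_j]. So the payoff gaps of the time average over [0, T]
    are [1 / T] times a difference of logarithms of coordinates, up to Brownian terms
    that are [o(T)] by Kolmogorov's maximal inequality. When the logarithms are
    [o(T)] along a sequence of times, all accumulation points of the averages have
    equal payoffs, and recurrence provides such a sequence.

    In the positive recurrent case the logarithms are stationary under [pi]. They need
    not be integrable, but the increments of their tails beyond a high level are small
    in mean. Therefore the payoff gaps have mean zero under [pi], that is, the mean of
    [pi] has equal payoffs; and by Garsia's form of the maximal ergodic inequality the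
    logarithms grow sublinearly when started from [pi]. A Harnack inequality, obtained
    by shifting the Gaussian increments of the Euler scheme, transfers this to the
    starting point [x0]. Finally the equal payoff system is nonsingular, since a
    nonzero vector [u] of sum zero with constant payoff contrast would make
    [sum_l u_l ln X_l] a stationary Brownian motion; so small payoff gaps force the
    time average to be close to the mean of [pi]. *)

(** * Expectations *)

(** The hypotheses give one solution for each interior starting point and say nothing on how it
    depends on that point. This dependence becomes accessible because, in logarithms, the drift is
    bounded and Lipschitz and the noise additive, so that the Euler scheme converges path by path.
    For a bounded functional of finitely many states that is Lipschitz in the logarithms, the mean
    is thus a limit of iterated one-dimensional Gaussian integrals that see the starting point only
    through its logarithms. Measurability in the starting point, the Markov property, stationarity
    of path functionals and the Harnack inequality are read off from these integrals. Hence the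
    insistence on bounded, nonnegative, Lipschitz functionals: payoffs are shifted, logarithms
    clipped, indicators smoothed.

    The bound on tails has the form [4 * r * far_mass K + 2 / r * noise]: a large [r] absorbs the
    second moment of an increment, then a large [K] makes the first term small. It does not depend
    on the horizon, which is what the maximal inequality asks for. *)

Lemma eq_ler {R : numDomainType} (x y : R) : x = y -> x <= y.
Proof. by move=> ->. Qed.

Lemma cvg_dist_le0 {R : realType} (u v : nat -> R) (l : R) :
  (\forall q \near \oo, `|u q - l| <= v q) -> v @ \oo --> (0 : R) ->
  u @ \oo --> l.
Proof.
move=> uv v0; apply/cvgrPdist_le => e e0.
move/cvgrPdist_le : v0 => /(_ _ e0) v0.
near=> q; rewrite distrC (@le_trans _ _ (v q))//; first by near: q.
rewrite (le_trans (ler_norm _))// -normrN -sub0r; near: q.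
by apply: filterS v0 => q.
Unshelve. all: by end_near. Qed.

Section bounded_expectation.
Context {d : measure_display} {T : measurableType d} {R : realType}.
Variable P : probability T R.
Implicit Types f g : T -> R.

Lemma bounded_integrable f (B : R) : measurable_fun setT f ->
  (forall x, `|f x| <= B) -> P.-integrable setT (EFin \o f).
Proof.
move=> mf fB; apply: measurable_bounded_integrable => //.
  by rewrite [X in (X < _)%E]probability_setT ltry.
exists B; split; first exact: num_real.
by move=> M BM x _; apply: (le_trans (fB x)); exact: ltW.
Qed.

Lemma Ex_cst (r : R) : \int[P]_x r = r.
Proof. by rewrite Rintegral_cst// [X in fine X]probability_setT/= mulr1. Qed.

Lemma Ex_fineE f : P.-integrable setT (EFin \o f) ->
  (\int[P]_x (f x)%:E)%E = (\int[P]_x f x)%:E.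
Proof. by move=> fi; rewrite /Rintegral fineK//; exact: integrable_fin_num. Qed.

Lemma Ex_le f g : P.-integrable setT (EFin \o f) ->
  P.-integrable setT (EFin \o g) -> (forall x, f x <= g x) ->
  \int[P]_x f x <= \int[P]_x g x.
Proof. by move=> fi gi fg; apply: le_Rintegral. Qed.

Lemma Ex_dist f g (e : R) : P.-integrable setT (EFin \o f) ->
  P.-integrable setT (EFin \o g) -> (forall x, `|f x - g x| <= e) ->
  `|\int[P]_x f x - \int[P]_x g x| <= e.
Proof.
move=> fi gi fg; rewrite -RintegralB//.
have ifg : P.-integrable setT (EFin \o (fun x => f x - g x)).
  by under [X in integrable _ _ X]funext do rewrite /= EFinB; exact: integrableB.
rewrite (le_trans (le_normr_Rintegral _ ifg))//.
rewrite -[leRHS](Ex_cst e); apply: Ex_le => //.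
- exact: integrable_norm.
- by apply: (bounded_integrable (B := `|e|)).
Qed.

Lemma Ex_bound f (B : R) : measurable_fun setT f ->
  (forall x, `|f x| <= B) -> `|\int[P]_x f x| <= B.
Proof.
move=> mf fB; have := Ex_dist (f := f) (g := cst 0) (e := B).
rewrite Ex_cst subr0; apply.
- exact: (bounded_integrable (B := B)).
- by apply: (bounded_integrable (B := 0)) => // x; rewrite normr0.
- by move=> x /=; rewrite subr0.
Qed.

Lemma Ex_ae f g : measurable_fun setT f -> measurable_fun setT g ->
  {ae P, forall x, f x = g x} -> \int[P]_x f x = \int[P]_x g x.
Proof.
move=> mf mg fg; congr fine; apply: ae_eq_integral => //.
- exact/measurable_EFinP.
- exact/measurable_EFinP.
- by apply: filterS fg => x -> _.
Qed.

Lemma Ex_dct (f_ : nat -> T -> R) f (B : R) :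
  (forall k, measurable_fun setT (f_ k)) -> measurable_fun setT f ->
  (forall k x, `|f_ k x| <= B) ->
  {ae P, forall x, f_ k x @[k --> \oo] --> f x} ->
  \int[P]_x f_ k x @[k --> \oo] --> \int[P]_x f x.
Proof.
move=> mf_ mf fB fcv.
have [|||||i0 _ cv] := @dominated_convergence _ _ _ P setT measurableT
   (fun k x => (f_ k x)%:E) (fun x => (f x)%:E) (cst B%:E).
- by move=> k; exact/measurable_EFinP.
- exact/measurable_EFinP.
- by apply: filterS fcv => x fx _; apply: cvg_EFin => //; exact: nearW.
- exact: (bounded_integrable (f := cst B) (B := `|B|)).
- by apply: nearW => x k _; rewrite abse_EFin lee_fin.
apply: fine_cvg; rewrite fineK//; exact: integrable_fin_num.
Qed.

End bounded_expectation.

(** * Gaussian integrals *)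

Section density.
Context {d : measure_display} {T : measurableType d} {R : realType}.
Variables (mu nu : {measure set T -> \bar R}) (g : T -> R).
Hypothesis mg : measurable_fun setT g.
Hypothesis g0 : forall x, 0 <= g x.
Hypothesis nuE : forall A, measurable A -> nu A = (\int[mu]_(x in A) (g x)%:E)%E.
Local Open Scope ereal_scope.

Import HBNNSimple.

(** Both sides are increasing limits along the simple approximations of [f]; for an indicator the
    identity is the hypothesis [nuE]. *)
Lemma ge0_integral_density (f : T -> \bar R) : measurable_fun setT f ->
  (forall x, 0 <= f x) -> \int[nu]_x f x = \int[mu]_x (f x * (g x)%:E).
Proof.
move=> mf f0; pose f_ := nnsfun_approx measurableT mf.
have mg' : measurable_fun setT (EFin \o g) by exact/measurable_EFinP.
have f_f x : (f_ k x)%:E @[k --> \oo] --> f x by exact: cvg_nnsfun_approx.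
have nd x : {homo (fun k => (f_ k x)%:E) : a b / (a <= b)%N >-> a <= b}.
  by move=> a b ab; rewrite lee_fin; exact/lefP/nd_nnsfun_approx.
have mf_ k : measurable_fun setT (EFin \o f_ k) by exact/measurable_EFinP.
transitivity (limn (fun k => \int[nu]_x (f_ k x)%:E)).
  rewrite -monotone_convergence//=.
  - by apply: eq_integral => x _; apply/esym/cvg_lim => //; exact: f_f.
  - by move=> k x _; rewrite lee_fin.
transitivity (limn (fun k => \int[mu]_x ((f_ k x)%:E * (g x)%:E))); last first.
  rewrite -monotone_convergence//=.
  - apply: eq_integral => x _; apply/cvg_lim => //.
    by apply: cvgeZr => //.
  - move=> k; exact: (emeasurable_funM (mf_ k) mg').
  - by move=> k x _; rewrite mule_ge0// lee_fin.
  - by move=> x _ a b ab; rewrite lee_wpmul2r ?lee_fin// -lee_fin; exact: nd.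
congr (limn _); apply/funext => k.
under eq_integral do rewrite fimfunE -fsumEFin//.
under [RHS]eq_integral => x _.
  rewrite fimfunE -fsumEFin// ge0_mule_fsuml; last first.
    by move=> r; rewrite EFinM nnfun_muleindic_ge0.
  over.
have mi r : measurable_fun setT (fun x => (\1_(f_ k @^-1` [set r]) x : R)).
  by apply: measurable_indic.
rewrite [RHS]ge0_integral_fsum//; last 2 first.
  - move=> r; apply: emeasurable_funM => //; apply/measurable_EFinP.
    exact: measurable_funM.
  - by move=> r x _; rewrite mule_ge0 ?lee_fin// -lee_fin EFinM nnfun_muleindic_ge0.
rewrite [LHS]ge0_integral_fsum//; last first.
  by move=> r x _; rewrite EFinM nnfun_muleindic_ge0.
  by move=> r; apply/measurable_EFinP; exact: measurable_funM.
apply: eq_fsbigr => r.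
rewrite inE => -[y _ <-]; set r' := f_ k y.
have r0 : (0 <= r')%R by [].
under eq_integral do rewrite EFinM.
rewrite ge0_integralZl//; last exact/measurable_EFinP.
rewrite integral_indic//= setIT nuE//.
have rE B : ((fun x => (g x)%:E) \_ B) = EFin \o (g \_ B).
  by apply/funext => x; rewrite /= !patchE; case: ifP.
rewrite integral_mkcond/= rE -ge0_integralZl//.
- apply: eq_integral => x _; rewrite /= patchE indicE.
  by case: ifPn => xr; rewrite /= -?EFinM ?mulr1 ?mulr0 ?mul0r.
- apply/measurable_EFinP; apply: (measurable_restrictT _ _).1 => //; exact: measurable_funTS.
- by move=> x _; rewrite /= lee_fin patchE; case: ifPn.
Qed.

End density.

Section gaussian.
Context {R : realType}.
Notation mu := (@lebesgue_measure R).
Variable s : R.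
Hypothesis s0 : 0 < s.
Notation gam := (normal_prob (0 : R) s).
Local Open Scope ereal_scope.

Lemma ge0_integral_normal (f : R -> \bar R) : measurable_fun setT f ->
  (forall x, 0 <= f x) ->
  \int[gam]_z f z = \int[mu]_z (f z * (normal_pdf 0 s z)%:E).
Proof.
move=> mf f0; apply: ge0_integral_density => //.
- exact: measurable_normal_pdf.
- by move=> x; exact: normal_pdf_ge0.
Qed.

(** The image of Lebesgue measure under the shift has the same values on half-open intervals, and
    these characterise Lebesgue measure. *)
Lemma ge0_integral_lebesgue_shift (h : R) (f : R -> \bar R) :
  measurable_fun setT f -> (forall x, 0 <= f x) ->
  \int[mu]_z f (z + h)%R = \int[mu]_z f z.
Proof.
move=> mf f0; pose phi : R -> measurableTypeR R := fun z => (z + h)%R.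
have mphi : measurable_fun setT phi by apply: measurable_funD.
transitivity (\int[pushforward mu phi]_z f z).
  by rewrite ge0_integral_pushforward//.
apply: eq_measure_integral => A mA _; apply/esym/lebesgue_measure_unique => //.
move=> _ [[a b]] _ <-; rewrite /pushforward/=.
rewrite [X in _ = mu X](_ : _ = `](a - h)%R, (b - h)%R]%classic); last first.
  by apply/seteqP; split=> x /=; rewrite !in_itv/= ltrBlDr lerBrDr.
rewrite !lebesgue_measure_itv/= !lte_fin ltrD2r; case: ifP => // _.
by rewrite -!EFinB; congr EFin; ring.
Qed.

Lemma normal_pdf_nondeg (m r z : R) : (0 < r)%R ->
  normal_pdf m r z = (normal_peak r * normal_fun m r z)%R.
Proof. by move=> r0; rewrite /normal_pdf gt_eqF. Qed.

(** Cameron-Martin density: that of the normal law of mean [h] and deviation [s] with respect to the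
    centred one. *)
Definition cm_density (h z : R) : R := expR (h * z / s ^+ 2 - h ^+ 2 / (2 * s ^+ 2)).

Lemma measurable_cm_density h : measurable_fun setT (cm_density h).
Proof.
apply: measurableT_comp => //; apply: measurable_funB => //.
by apply: measurable_funM => //; apply: measurable_funM.
Qed.

Lemma normal_pdf_shift (h z : R) :
  normal_pdf 0 s (z - h) = (normal_pdf 0 s z * cm_density h z)%R.
Proof.
rewrite !normal_pdf_nondeg// /normal_fun /cm_density -[RHS]mulrA -expRD.
congr (_ * expR _)%R; rewrite !subr0 -[in LHS]mulr_natr.
have : s != 0%R by rewrite gt_eqF.
by move=> ?; field.
Qed.

Lemma ge0_integral_normal_shift (h : R) (f : R -> \bar R) :
  measurable_fun setT f -> (forall x, 0 <= f x) ->
  integral gam setT (fun z : R => f (z + h)%R) =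
  \int[gam]_z (f z * (cm_density h z)%:E).
Proof.
move=> mf f0.
have mfh : measurable_fun setT (fun z : R => f (z + h)%R).
  by apply: (measurableT_comp mf) => //; exact: measurable_funD.
rewrite !ge0_integral_normal//; last 2 first.
- apply: emeasurable_funM => //; apply/measurable_EFinP.
  exact: measurable_cm_density.
- by move=> x; rewrite mule_ge0// lee_fin expR_ge0.
have mpdf := @measurable_normal_pdf R 0 s.
rewrite -[RHS](ge0_integral_lebesgue_shift h); last 2 first.
- apply: emeasurable_funM; last exact/measurable_EFinP.
  by apply: emeasurable_funM => //; apply/measurable_EFinP; exact: measurable_cm_density.
- by move=> x; rewrite !mule_ge0 ?lee_fin ?expR_ge0 ?normal_pdf_ge0.
apply: eq_integral => z _; rewrite -muleA -EFinM; congr (_ * _%:E).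
by rewrite [RHS]mulrC -normal_pdf_shift addrK.
Qed.

Lemma integral_cm_density (h : R) : \int[gam]_z (cm_density h z)%:E = 1.
Proof.
have := @ge0_integral_normal_shift h (cst 1) (measurable_cst _) (fun=> lee01).
by rewrite integral_cst//= probability_setT mule1; under eq_integral do rewrite mul1e.
Qed.

(** The square of the density for [h] is [expR (h ^+ 2 / s ^+ 2)] times the density for [2 * h].
    This second moment is the price of one Gaussian shift in the Harnack inequality. *)
Lemma integral_cm_density_sqr (h : R) :
  \int[gam]_z (cm_density h z ^+ 2)%:E = (expR (h ^+ 2 / s ^+ 2))%:E.
Proof.
have s0' : s != 0%R by rewrite gt_eqF.
under eq_integral => z _.
  have -> : (cm_density h z ^+ 2 =
      expR (h ^+ 2 / s ^+ 2) * cm_density (2 * h) z)%R.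
    rewrite /cm_density -expRM_natr -expRD; congr expR; by field.
  rewrite EFinM; over.
rewrite ge0_integralZl//.
- by rewrite integral_cm_density mule1.
- by apply/measurable_EFinP; exact: measurable_cm_density.
- by move=> z _; rewrite lee_fin expR_ge0.
Qed.

(** The exponential times the normal density is, up to a constant, the normal density of variance
    [s ^+ 2 / (1 - a * s ^+ 2)]. The second and fourth moments below are extracted from this
    formula. *)
Lemma integral_normal_expR_sqr (a : R) : (a * s ^+ 2 < 1)%R ->
  \int[gam]_z (expR (a * z ^+ 2 / 2))%:E = ((Num.sqrt (1 - a * s ^+ 2))^-1)%:E.
Proof.
move=> as1; set u := (1 - a * s ^+ 2)%R.
have u0 : (0 < u)%R by rewrite subr_gt0.
have s0' : s != 0%R by rewrite gt_eqF.
have su0 : (0 < Num.sqrt u)%R by rewrite sqrtr_gt0.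
have mexp : measurable_fun setT (fun z : R => expR (a * z ^+ 2 / 2)).
  by apply: measurableT_comp => //; do 2 apply: measurable_funM => //.
rewrite ge0_integral_normal; last 2 first.
- exact/measurable_EFinP.
- by move=> x; rewrite lee_fin expR_ge0.
pose s' := (s / Num.sqrt u)%R.
have s'0 : (0 < s')%R by rewrite divr_gt0.
under eq_integral => z _.
  rewrite -EFinM.
  have -> : (expR (a * z ^+ 2 / 2) * normal_pdf 0 s z =
             (Num.sqrt u)^-1 * normal_pdf 0 s' z)%R.
    rewrite !normal_pdf_nondeg// /normal_fun !subr0.
    have -> : normal_peak s' = (Num.sqrt u * normal_peak s)%R.
      rewrite /normal_peak /s' expr_div_n sqr_sqrtr ?ltW//.
      have -> : (s ^+ 2 / u * pi *+ 2 = u^-1 * (s ^+ 2 * pi *+ 2))%R.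
        by rewrite -mulrnAr -[in RHS]mulrnAr mulrAC mulrC.
      rewrite sqrtrM ?invr_ge0 ?ltW// sqrtrV ?ltW// invfM invrK.
      by [].
    rewrite [LHS]mulrCA -expRD -[in RHS](mulrA (Num.sqrt u)) mulKf ?gt_eqF//.
    congr (_ * expR _)%R.
    rewrite /s' expr_div_n sqr_sqrtr ?ltW// -(mulr_natr (s ^+ 2)) -(mulr_natr (_ / u)).
    have -> : a = ((1 - u) / s ^+ 2)%R by rewrite /u opprB subrKC mulfK// expf_neq0.
    have : u != 0%R by rewrite gt_eqF.
    by clearbody u; move=> u0'; field; rewrite u0' s0'.
  rewrite EFinM; over.
rewrite ge0_integralZl//.
- by rewrite integral_normal_pdf mule1.
- by apply/measurable_EFinP; exact: measurable_normal_pdf.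
- by move=> z _; rewrite lee_fin normal_pdf_ge0.
Qed.

End gaussian.

Local Ltac pos_side := by try (move=> ? _); rewrite -?EFinM ?lee_fin; repeat first
  [exact: sqr_ge0 | exact: exprn_even_ge0 | exact: ler0n | apply: mulr_ge0].

Section gaussian_moments.
Context {R : realType}.
Notation mu := (@lebesgue_measure R).
Variable s : R.
Hypothesis s0 : 0 < s.
Notation gam := (normal_prob (0 : R) s).

Lemma invr_sqrt_le (v y : R) : 0 < v -> 0 <= y -> 1 <= y ^+ 2 * v ->
  (Num.sqrt v)^-1 <= y.
Proof.
move=> v0 y0 h.
rewrite -(@ler_pXn2r _ 2) ?nnegrE ?invr_ge0 ?sqrtr_ge0//.
by rewrite exprVn sqr_sqrtr ?(ltW v0)// -[leLHS]mul1r ler_pdivrMr.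
Qed.

(** With [invr_sqrt_le], bounds the inverse square root of [1 - u] by [1 + u / 2 + u ^+ 2];
    [taylor_lb] likewise bounds that of [1 + u] by [1 - u / 2 + u ^+ 2]. *)
Let taylor_ub (u : R) : 0 < u -> u <= 1 / 2 ->
  1 <= (1 + u / 2 + u ^+ 2) ^+ 2 * (1 - u).
Proof.
move=> u0 u1; rewrite -subr_ge0.
have -> : (1 + u / 2 + u ^+ 2) ^+ 2 * (1 - u) - 1 =
   u ^+ 2 * (5 / 4 - 5 / 4 * u - u ^+ 3) by field.
rewrite mulr_ge0 ?sqr_ge0//.
have : u ^+ 3 <= (1 / 2) ^+ 3 by rewrite lerXn2r ?nnegrE ?divr_ge0 ?(ltW u0).
lra.
Qed.

Let taylor_lb (u : R) : 0 < u -> 1 <= (1 - u / 2 + u ^+ 2) ^+ 2 * (1 + u).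
Proof.
move=> u0; rewrite -subr_ge0.
have -> : (1 - u / 2 + u ^+ 2) ^+ 2 * (1 + u) - 1 =
   u ^+ 2 * (5 / 4 + 5 / 4 * u + u ^+ 3) by field.
by rewrite mulr_ge0 ?sqr_ge0// !addr_ge0 ?mulr_ge0 ?exprn_ge0 ?ltW.
Qed.

Let mexp a : measurable_fun setT (fun z : R => expR (a * z ^+ 2 / 2)).
Proof. by apply: measurableT_comp => //; do 2 apply: measurable_funM => //. Qed.

Let mexpE a : measurable_fun setT (fun z : R => (expR (a * z ^+ 2 / 2))%:E).
Proof. by apply/measurable_EFinP; exact: mexp. Qed.

Let mpow k : measurable_fun setT (fun z : R => (z ^+ k)%:E).
Proof. by apply/measurable_EFinP; exact: measurable_funX. Qed.

(** Since [1 + x <= expR x], the exponential moment with [a = u / s ^+ 2] bounds the second moment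
    from above, and the one with [a = - u / s ^+ 2] bounds it from below, both up to a relative
    error [2 * u]; then [u] tends to 0. *)
Lemma integral_normal_sqr : (\int[gam]_z (z ^+ 2)%:E)%E = (s ^+ 2)%:E.
Proof.
have s20 : 0 < s ^+ 2 by rewrite exprn_gt0.
have s20' : s ^+ 2 != 0 by rewrite gt_eqF.
have s0' : s != 0 by rewrite gt_eqF.
have z20 (z : R) : 0 <= z ^+ 2 by exact: sqr_ge0.
have ub (u : R) : 0 < u <= 1 / 2 ->
    (\int[gam]_z (z ^+ 2)%:E <= (s ^+ 2 * (1 + 2 * u))%:E)%E.
  move=> /andP[u0 u1].
  have as1 : (u / s ^+ 2) * s ^+ 2 < 1 by rewrite divfK//; lra.
  have := integral_normal_expR_sqr s0 as1; rewrite divfK// => E1.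
  have c0 : 0 <= u / s ^+ 2 / 2 by rewrite !divr_ge0// ltW.
  have : (1%:E + (u / s ^+ 2 / 2)%:E * \int[gam]_z (z ^+ 2)%:E
          <= (1 + u / 2 + u ^+ 2)%:E)%E.
    apply: (@le_trans _ _ ((Num.sqrt (1 - u))^-1)%:E); last first.
      rewrite lee_fin invr_sqrt_le//; [lra|nra|exact: taylor_ub].
    rewrite -E1 -ge0_integralZl//; last 2 first.
    - exact: mpow.
    - by move=> z _; rewrite lee_fin.
    have -> : (1%:E = \int[gam]_z 1%:E)%E.
      by rewrite integral_cst//= [X in (_ * X)%E]probability_setT mule1.
    rewrite -ge0_integralD//; last 2 first.
    - by move=> z _; rewrite -EFinM lee_fin mulr_ge0.
    - by apply: emeasurable_funM => //; exact: mpow.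
    apply: ge0_le_integral => //.
    - by move=> z _; rewrite -EFinM -EFinD lee_fin addr_ge0// mulr_ge0.
    - by apply: emeasurable_funD => //; apply: emeasurable_funM => //; exact: mpow.
    - exact: mexpE.
    - move=> z _; rewrite -EFinM -EFinD lee_fin (le_trans _ (expR_ge1Dx _))//.
      by rewrite lerD2l; apply: eq_ler; field.
  have : (0 <= \int[gam]_z (z ^+ 2)%:E)%E by apply: integral_ge0 => z _; rewrite lee_fin.
  case: (\int[gam]_z (z ^+ 2)%:E)%E => [r|//|//] _; last first.
    by rewrite gt0_muley// lte_fin !divr_gt0.
  rewrite -EFinM -EFinD !lee_fin => h.
  have : (u / s ^+ 2 / 2) * r <= (u / s ^+ 2 / 2) * (s ^+ 2 * (1 + 2 * u)).
    have -> : (u / s ^+ 2 / 2) * (s ^+ 2 * (1 + 2 * u)) = u / 2 + u ^+ 2.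
      by field.
    lra.
  by rewrite ler_pM2l// !divr_gt0.
have lb (u : R) : 0 < u <= 1 / 2 ->
    ((s ^+ 2 * (1 - 2 * u))%:E <= \int[gam]_z (z ^+ 2)%:E)%E.
  move=> /andP[u0 u1].
  have as1 : (- u / s ^+ 2) * s ^+ 2 < 1 by rewrite divfK//; lra.
  have := integral_normal_expR_sqr s0 as1; rewrite divfK// opprK => E1.
  have c0 : 0 <= u / s ^+ 2 / 2 by rewrite !divr_ge0// ltW.
  have : (1%:E <= (1 - u / 2 + u ^+ 2)%:E +
               (u / s ^+ 2 / 2)%:E * \int[gam]_z (z ^+ 2)%:E)%E.
    apply: (@le_trans _ _ (((Num.sqrt (1 + u))^-1)%:E +
               (u / s ^+ 2 / 2)%:E * \int[gam]_z (z ^+ 2)%:E)%E); last first.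
      rewrite leeD2r// lee_fin invr_sqrt_le//; [lra|nra|exact: taylor_lb].
    rewrite -E1 -ge0_integralZl//; last 2 first.
    - exact: mpow.
    - by move=> z _; rewrite lee_fin.
    have {1}-> : (1%:E = \int[gam]_z 1%:E)%E.
      by rewrite integral_cst//= [X in (_ * X)%E]probability_setT mule1.
    rewrite -ge0_integralD//; last 3 first.
    - exact: mexpE.
    - by move=> z _; rewrite -EFinM lee_fin mulr_ge0.
    - by apply: emeasurable_funM => //; exact: mpow.
    apply: ge0_le_integral => //.
    - apply: emeasurable_funD => //; first exact: mexpE.
      by apply: emeasurable_funM => //; exact: mpow.
    - move=> z _; rewrite -EFinM -EFinD lee_fin -lerBlDr.
      rewrite (le_trans _ (expR_ge1Dx _))//.
      by apply: eq_ler; field.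
  have : (0 <= \int[gam]_z (z ^+ 2)%:E)%E by apply: integral_ge0 => z _; rewrite lee_fin.
  case: (\int[gam]_z (z ^+ 2)%:E)%E => [r|//|//] _; last by rewrite leey.
  rewrite -EFinM -EFinD !lee_fin => h.
  have : (u / s ^+ 2 / 2) * (s ^+ 2 * (1 - 2 * u)) <= (u / s ^+ 2 / 2) * r.
    have -> : (u / s ^+ 2 / 2) * (s ^+ 2 * (1 - 2 * u)) = u / 2 - u ^+ 2.
      by field.
    lra.
  by rewrite ler_pM2l// !divr_gt0.
move: ub lb; case: (\int[gam]_z (z ^+ 2)%:E)%E => [r|ub _|_ lb]; last 2 first.
- by have /ub : 0 < (1 / 2 : R) <= 1 / 2 by apply/andP; split; lra.
- by have /lb : 0 < (1 / 2 : R) <= 1 / 2 by apply/andP; split; lra.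
move=> ub lb; congr EFin; apply/eqP; rewrite eq_le; apply/andP; split.
(* This [u] is admissible in [ub] and makes the error [s ^+ 2 * (2 * u)] at most [e]. *)
- apply/ler_addgt0Pr => e e0; pose u := Num.min (1/2) (e / (2 * s ^+ 2)).
  have u0 : 0 < u <= 1/2.
    by rewrite lt_min ge_min lexx andbT divr_gt0//= ?divr_gt0// mulr_gt0.
  have := ub _ u0; rewrite lee_fin => /le_trans; apply.
  rewrite mulrDr mulr1 lerD2l.
  rewrite (@le_trans _ _ (s ^+ 2 * (2 * (e / (2 * s ^+ 2)))))//.
    by rewrite ler_pM2l// ler_pM2l// ge_min lexx orbT.
  by apply: eq_ler; field.
- apply/ler_addgt0Pr => e e0; pose u := Num.min (1/2) (e / (2 * s ^+ 2)).
  have u0 : 0 < u <= 1/2.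
    by rewrite lt_min ge_min lexx andbT divr_gt0//= ?divr_gt0// mulr_gt0.
  have := lb _ u0; rewrite lee_fin => h.
  rewrite -lerBlDr (le_trans _ h)// mulrBr mulr1 lerD2l lerN2.
  rewrite (@le_trans _ _ (s ^+ 2 * (2 * (e / (2 * s ^+ 2)))))//.
    by rewrite ler_pM2l// ler_pM2l// ge_min lexx orbT.
  by apply: eq_ler; field.
Qed.

(** With [x = z ^+ 2 / (4 * s ^+ 2)], the bound [(x / 2) ^+ 2 <= expR x] reads
    [z ^+ 4 <= 64 * s ^+ 4 * expR x], and the mean of [expR x] is the square root of 2, hence at
    most 2. *)
Lemma integral_normal_pow4 : (\int[gam]_z (z ^+ 4)%:E <= (128 * s ^+ 4)%:E)%E.
Proof.
have s20 : 0 < s ^+ 2 by rewrite exprn_gt0.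
have s0' : s != 0 by rewrite gt_eqF.
have as1 : (1 / 2 / s ^+ 2) * s ^+ 2 < 1 by rewrite divfK ?gt_eqF//; lra.
have := integral_normal_expR_sqr s0 as1; rewrite divfK ?gt_eqF// => E1.
have c0 : 0 <= 64 * s ^+ 4 by rewrite mulr_ge0 ?exprn_even_ge0.
apply: (@le_trans _ _ (\int[gam]_z
    ((64 * s ^+ 4)%:E * (expR (1 / 2 / s ^+ 2 * z ^+ 2 / 2))%:E))%E).
  apply: ge0_le_integral => //.
  - by move=> z _; rewrite lee_fin exprn_even_ge0.
  - exact: mpow.
  - apply: emeasurable_funM => //; exact: mexpE.
  - move=> z _; rewrite -EFinM lee_fin.
    set x := 1 / 2 / s ^+ 2 * z ^+ 2 / 2.
    have x0 : 0 <= x by rewrite /x divr_ge0// mulr_ge0 ?sqr_ge0// divr_ge0 ?sqr_ge0.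
    have -> : expR x = expR (x / 2) ^+ 2.
      by rewrite -expRM_natr; congr expR; rewrite divfK.
    have h : (x / 2) ^+ 2 <= expR (x / 2) ^+ 2.
      have x20 : 0 <= x / 2 by rewrite divr_ge0.
      apply: lerXn2r; rewrite ?nnegrE ?expR_ge0//.
      by rewrite (le_trans _ (expR_ge1Dx _))// lerDr.
    have := ler_wpM2l c0 h; apply: le_trans; apply: eq_ler; rewrite /x; field.
    by rewrite s0'.
rewrite ge0_integralZl//; last exact: mexpE.
rewrite E1 -EFinM lee_fin.
have -> : 128 * s ^+ 4 = 64 * s ^+ 4 * 2 by ring.
by apply: ler_wpM2l => //; apply: invr_sqrt_le; lra.
Qed.

Lemma ge0_integral_normalN (f : R -> \bar R) : measurable_fun setT f ->
  (forall x, (0 <= f x)%E) ->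
  (integral gam setT (fun z : R => f (- z)%R) = \int[gam]_z f z)%E.
Proof.
move=> mf f0.
have mfN : measurable_fun setT (fun z : R => f (- z)%R).
  by apply: (measurableT_comp mf).
have mpdf := @measurable_normal_pdf R 0 s.
rewrite !ge0_integral_normal//.
pose g := (fun z : R => f z * (normal_pdf 0 s z)%:E)%E.
have mg : measurable_fun setT g by apply: emeasurable_funM => //; exact/measurable_EFinP.
transitivity (\int[pushforward mu (-%R : R -> measurableTypeR R)]_z g z)%E.
  have g0 : {in setT, forall y : R, (0 <= g y)%E}.
    by move=> x _; rewrite /g mule_ge0// lee_fin normal_pdf_ge0.
  have mN : measurable_fun setT (-%R : measurableTypeR R -> measurableTypeR R).
    exact: oppr_measurable.
  rewrite (ge0_integral_pushforward mN mu measurableT mg g0).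
  apply: eq_integral => z _; rewrite /g/=; congr (_ * _%:E)%E.
  by rewrite !normal_pdf_nondeg// /normal_fun !subr0 sqrrN.
by apply: eq_measure_integral => A mA _; exact: lebesgue_measureN.
Qed.

(** Averaging over [z] and [- z] removes the cross term, so that only nonnegative integrands
    occur. *)
Lemma integral_normal_affine_sqr (S a : R) :
  (\int[gam]_z ((S + a * z) ^+ 2)%:E)%E = (S ^+ 2 + a ^+ 2 * s ^+ 2)%:E.
Proof.
have mf b : measurable_fun setT (fun z : R => ((S + b * z) ^+ 2)%:E).
  by apply/measurable_EFinP; apply: measurable_funX; exact: measurable_funD.
have f0 b (z : R) : (0 <= ((S + b * z) ^+ 2)%:E)%E by rewrite lee_fin sqr_ge0.
have E1 := ge0_integral_normalN (mf a) (f0 a).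
have : (\int[gam]_z ((S + a * z) ^+ 2)%:E + \int[gam]_z ((S + a * z) ^+ 2)%:E =
   (2 * (S ^+ 2 + a ^+ 2 * s ^+ 2))%:E)%E.
  have mfN : measurable_fun setT (fun z : R => ((S + a * - z) ^+ 2)%:E).
    exact: (measurableT_comp (mf a)).
  rewrite -{1}E1 -ge0_integralD//; try solve [exact: mf | exact: mfN].
  transitivity (\int[gam]_z ((2 * S ^+ 2)%:E + (2 * a ^+ 2)%:E * (z ^+ 2)%:E))%E.
    by apply: eq_integral => z _; rewrite -EFinM -!EFinD; congr EFin; ring.
  rewrite ge0_integralD//; try solve
    [exact: mpow | by apply: emeasurable_funM => //; exact: mpow
    |pos_side].
  rewrite integral_cst//= [X in (_ * X)%E]probability_setT mule1.
  rewrite ge0_integralZl//; try solve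
    [exact: mpow | pos_side].
  by rewrite integral_normal_sqr -EFinM -EFinD; congr EFin; ring.
have : (0 <= \int[gam]_z ((S + a * z) ^+ 2)%:E)%E by exact: integral_ge0.
case: (\int[gam]_z ((S + a * z) ^+ 2)%:E)%E => [r|//|//] _.
by rewrite -EFinD => -[] h; congr EFin; lra.
Qed.

Lemma integral_normal_quad_sqr (S a : R) :
  (\int[gam]_z ((S + a * (z ^+ 2 - s ^+ 2)) ^+ 2)%:E
    <= (S ^+ 2 + a ^+ 2 * (128 * s ^+ 4))%:E)%E.
Proof.
have f0 (z : R) : (0 <= ((S + a * (z ^+ 2 - s ^+ 2)) ^+ 2)%:E)%E.
  by rewrite lee_fin sqr_ge0.
pose c := (S - a * s ^+ 2).
(* The coefficient [2 * (c * a)] of [z ^+ 2] in the expansion has no definite sign; adding its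
   absolute value to both sides keeps every integrand nonnegative. *)
have : (\int[gam]_z ((S + a * (z ^+ 2 - s ^+ 2)) ^+ 2)%:E +
   (2 * (`|c * a|))%:E * \int[gam]_z (z ^+ 2)%:E =
   (c ^+ 2)%:E + (2 * (`|c * a| + c * a))%:E * \int[gam]_z (z ^+ 2)%:E
   + (a ^+ 2)%:E * \int[gam]_z (z ^+ 4)%:E)%E.
  have k0 : (0 <= (2 * (`|c * a|))%:E)%E by rewrite lee_fin mulr_ge0.
  have k1 : (0 <= (2 * (`|c * a| + c * a))%:E)%E.
    by rewrite lee_fin mulr_ge0// -lerBlDr sub0r -normrN ler_norm.
  have k2 : (0 <= (a ^+ 2)%:E)%E by rewrite lee_fin sqr_ge0.
  have z2 (z : R) : (0 <= (z ^+ 2)%:E)%E by rewrite lee_fin sqr_ge0.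
  have z4 (z : R) : (0 <= (z ^+ 4)%:E)%E by rewrite lee_fin exprn_even_ge0.
  have mq : measurable_fun setT (fun z : R => ((S + a * (z ^+ 2 - s ^+ 2)) ^+ 2)%:E).
    apply/measurable_EFinP; apply: measurable_funX; apply: measurable_funD => //.
    by apply: measurable_funM => //; apply: measurable_funB.
  have -> : ((c ^+ 2)%:E = \int[gam]_z (c ^+ 2)%:E)%E.
    by rewrite integral_cst//= [X in (_ * X)%E]probability_setT mule1.
  rewrite -!ge0_integralZl// -?ge0_integralD//; try solve
    [exact: mpow | exact: mq | by apply: emeasurable_funM => //; exact: mpow
    |by apply: emeasurable_funD => //; apply: emeasurable_funM => //; exact: mpow
    |by move=> z _; rewrite ?adde_ge0 ?mule_ge0// ?lee_fin ?sqr_ge0].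
  by apply: eq_integral => z _; rewrite -!EFinM -!EFinD; congr EFin; rewrite /c; ring.
rewrite integral_normal_sqr.
have := integral_normal_pow4.
have : (0 <= \int[gam]_z (z ^+ 4)%:E)%E.
  by apply: integral_ge0 => z _; rewrite lee_fin exprn_even_ge0.
case: (\int[gam]_z (z ^+ 4)%:E)%E => [m4|//|//] _; rewrite lee_fin => m4le.
have : (0 <= \int[gam]_z ((S + a * (z ^+ 2 - s ^+ 2)) ^+ 2)%:E)%E by exact: integral_ge0.
case: (\int[gam]_z ((S + a * (z ^+ 2 - s ^+ 2)) ^+ 2)%:E)%E => [r|//|//] _.
rewrite -!EFinM -!EFinD => -[] h; rewrite lee_fin.
have a20 := sqr_ge0 a; have s40 : 0 <= s ^+ 4 by rewrite exprn_even_ge0.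
have -> : r = c ^+ 2 + 2 * (c * a) * s ^+ 2 + a ^+ 2 * m4 by lra.
have -> : c ^+ 2 + 2 * (c * a) * s ^+ 2 + a ^+ 2 * m4 =
  S ^+ 2 + a ^+ 2 * (m4 - s ^+ 4) by rewrite /c; ring.
by rewrite lerD2l ler_wpM2l//; lra.
Qed.

End gaussian_moments.

(** * Measurability of Lipschitz functions of finitely many variables *)

Section lipschitz_measurability.
Context {d : measure_display} {T : measurableType d} {R : realType}.
Variables (I : finType) (Y : I -> T -> R) (F : (I -> R) -> R) (C : R).
Hypothesis mY : forall i, measurable_fun setT (Y i).
Hypothesis lipF : forall a b (e : R), (forall i, `|a i - b i| <= e) ->
  `|F a - F b| <= C * e.

(* [F o Y] is the limit of its values at the coordinates of [Y] rounded to
   multiples of [1 / q], which range over a countable set. *)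
Lemma lip_measurable : measurable_fun setT (fun x => F (fun i => Y i x)).
Proof.
pose g q (c : {ffun I -> int}) : I -> R := fun i => (c i)%:~R / q.+1%:R.
pose ix q x : {ffun I -> int} := [ffun i => Num.floor (q.+1%:R * Y i x)].
have mix q c : measurable (ix q @^-1` [set c]).
  rewrite [X in measurable X](_ : _ = \bigcap_(i in [set: I])
      [set x | (c i)%:~R <= q.+1%:R * Y i x < (c i + 1)%:~R]); last first.
    apply/seteqP; split=> x /=.
      by move=> <- i _ /=; rewrite ffunE; exact: floor_itv.
    by move=> h; apply/ffunP => i; rewrite ffunE; apply: floor_def; exact: h.
  apply: fin_bigcap_measurable => [|i _]; first exact: finite_finset.
  rewrite [X in measurable X](_ : _ = (fun x => q.+1%:R * Y i x) @^-1`
     `[(c i)%:~R, (c i + 1)%:~R[%classic); last first.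
    by apply/seteqP; split=> x /=; rewrite in_itv.
  rewrite -[X in measurable X]setTI.
  have mq : measurable_fun setT (fun x => q.+1%:R * Y i x) by apply: measurable_funM.
  by apply: mq => //; exact: measurable_itv.
have mF q : measurable_fun setT (fun x => F (g q (ix q x))).
  move=> _ B mB; rewrite setTI.
  rewrite [X in measurable X](_ : _ = \bigcup_(c in [set: {ffun I -> int}])
     (if F (g q c) \in B then ix q @^-1` [set c] else set0)); last first.
    apply/seteqP; split=> x /=.
      by move=> Bx; exists (ix q x) => //; rewrite mem_set.
    by move=> [c _]; case: ifPn => // /set_mem Bc /= ->.
  apply: countable_bigcupT_measurable => [|c]; first exact: countableP.
  by case: ifP.
apply: (measurable_fun_cvg mF) => x _.
apply: (@cvg_dist_le0 _ _ (fun q => C * harmonic q)); last first.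
  by rewrite -[X in _ --> X](mulr0 C); exact: (cvgM (cvg_cst C) cvg_harmonic).
apply: nearW => q; apply: lipF => i; rewrite /g ffunE /=.
have q0 : 0 < q.+1%:R :> R by rewrite ltr0n.
have /andP[h1 h2] := floor_itv (q.+1%:R * Y i x).
rewrite distrC ger0_norm; last by rewrite subr_ge0 ler_pdivrMr// [leRHS]mulrC.
rewrite /harmonic lerBlDr -(ler_pM2l q0) mulrDr mulfV ?gt_eqF//.
rewrite mulrCA mulfV ?gt_eqF// mulr1.
by move: h2; rewrite intrD => /ltW; rewrite addrC.
Qed.

End lipschitz_measurability.

(** * Integrating out an independent Gaussian variable *)

Section independence.
Context {d : measure_display} {Omega : measurableType d} {R : realType}.
Variables (P : probability Omega R) (G : set (set Omega)) (xi : Omega -> R) (s : R).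
Hypothesis sG : <<s G >> `<=` measurable.
Hypothesis mxi : measurable_fun setT xi.
Hypothesis ind : forall A B, <<s G >> A -> measurable B ->
  P (A `&` xi @^-1` B) = (P A * normal_prob 0 s B)%E.
Notation OG := (g_sigma_algebraType G).
Notation RT := (measurableTypeR R).
Local Open Scope ereal_scope.

(** On [Omega] with the sigma-algebra generated by [G], the identity is a random element independent
    of [xi], so the pair has the product law; Tonelli's theorem then integrates [xi] out with the
    past frozen. *)
Lemma integral_indep (H : OG * RT -> \bar R) : measurable_fun setT H ->
  (forall x, 0 <= H x) ->
  \int[P]_w H (w, xi w) = \int[P]_w \int[normal_prob 0%R s]_z H (w, z).
Proof.
move=> mH H0.
pose idG : Omega -> OG := id.
have midG : measurable_fun setT idG.
  by move=> _ A mA; rewrite setTI; exact: sG.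
pose mX : {mfun Omega >-> OG} := HB.pack idG (isMeasurableFun.Build _ _ _ _ idG midG).
pose PG := distribution P mX.
pose phi w : OG * RT := (idG w, xi w).
have mphi : measurable_fun setT phi by apply/measurable_fun_pairP; split.
pose mXphi : {mfun Omega >-> (OG * RT)%type} :=
  HB.pack phi (isMeasurableFun.Build _ _ _ _ phi mphi).
transitivity (\int[distribution P mXphi]_x H x).
  by rewrite /distribution ge0_integral_pushforward.
transitivity (\int[PG \x normal_prob 0%R s]_x H x).
  apply: eq_measure_integral => A mA _; apply/esym.
  by apply: product_measure_unique => //= B C mB mC; exact: ind.
rewrite fubini_tonelli1// /PG /distribution ge0_integral_pushforward//.
- exact: measurable_fun_fubini_tonelli_F.
- by move=> x _; apply: integral_ge0.
Qed.

Lemma measurable_integral_indep (H : OG * RT -> \bar R) : measurable_fun setT H ->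
  (forall x, 0 <= H x) ->
  measurable_fun setT (fun w : OG => \int[normal_prob 0%R s]_z H (w, z)).
Proof. by move=> mH H0; exact: measurable_fun_fubini_tonelli_F. Qed.

Lemma sub_measurable d' (T' : measurableType d') (f : Omega -> T') :
  measurable_fun [set: OG] (f : OG -> T') -> measurable_fun setT f.
Proof. by move=> mf _ A mA; apply: sG; exact: mf. Qed.

End independence.

(** * The past of a Brownian increment *)

Section brownian_independence.
Context {R : realType} {n : nat} {d : measure_display} {Omega : measurableType d}.
Variables (P : probability Omega R) (W : 'I_n -> R -> {RV P >-> R}).
Hypothesis hW : brownian_motion W.

(* Everything that is independent of the increment [W i t' - W i t]: the past up
   to [t] and the positions at [t'] of the other components. *)
Definition past (i : 'I_n) (t t' : R) : set (set Omega) :=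
  [set E | exists j s (B : set R),
     [/\ (0 <= s <= t) || ((j != i) && (s == t')), measurable B & E = W j s @^-1` B]]
  `|` [set E | measurable E /\ P E = 0%E].

Lemma sub_past i t t' : <<s past i t t' >> `<=` measurable.
Proof.
apply: smallest_sub; first exact: sigma_algebra_measurable.
move=> A [[j [s [B [_ mB ->]]]]|[]//].
by rewrite -[X in measurable X]setTI; exact: measurable_funP.
Qed.

Lemma filtration_past i t t' : brownian_filtration W t `<=` <<s past i t t' >>.
Proof.
apply: sub_sigma_algebra2 => A [[j [s [B [h mB ->]]]]|h]; last by right.
by left; exists j, s, B; rewrite h.
Qed.

Let mW j s : measurable_fun setT (W j s) := measurable_funP (W j s).

Let dynkin_indep (E : set Omega) : measurable E ->
  dynkin [set A | measurable A /\ P (A `&` E) = (P A * P E)%E].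
Proof.
move=> mE; split.
- by split => //; rewrite setTI probability_setT mul1e.
- move=> A [mA hA]; split; first exact: measurableC.
  have h : P E = (P (E `&` A) + P (E `\` A))%E by rewrite addeC -measureDI.
  rewrite probability_setC// setIC -setDE.
  move: h hA; rewrite (setIC E A).
  have -> : P E = (fine (P E))%:E by rewrite fineK// fin_num_measure.
  have -> : P (A `&` E) = (fine (P (A `&` E)))%:E.
    by rewrite fineK// fin_num_measure//; exact: measurableI.
  have -> : P (E `\` A) = (fine (P (E `\` A)))%:E.
    by rewrite fineK// fin_num_measure//; exact: measurableD.
  have -> : P A = (fine (P A))%:E by rewrite fineK// fin_num_measure.
  have -> : (1 - (fine (P A))%:E = (1 - fine (P A))%:E)%E by [].
  rewrite -!EFinM -EFinD => -[] h1 [] h2; congr EFin.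
  by rewrite mulrBl mul1r -h2; lra.
- move=> F tF hF; split; first by apply: bigcupT_measurable => k; case: (hF k).
  rewrite setI_bigcupl !measure_bigcup//.
  + have PE : P E = (fine (P E))%:E by rewrite fineK// fin_num_measure.
    rewrite muleC PE -nneseriesZl//.
    by apply: eq_eseriesr => k _; rewrite -PE muleC; case: (hF k).
  + by move=> k _; case: (hF k).
  + by move=> k _; apply: measurableI => //; case: (hF k).
  + move=> a b _ _ [w [[Fa _] [Fb _]]]; apply: (tF a b) => //.
    by exists w.
Qed.

Section grid.
Variables (i : 'I_n) (M : nat) (tau : nat -> R) (B : set R).
Hypotheses (tau0 : tau 0%N = 0) (ndtau : forall k, tau k <= tau k.+1).
Hypothesis mB : measurable B.

Let Y (jk : 'I_n * 'I_M.+1) (w : Omega) : R :=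
  W jk.1 (tau jk.2.+1) w - W jk.1 (tau jk.2) w.

Let mY jk : measurable_fun setT (Y jk).
Proof. by apply: measurable_funB; exact: mW. Qed.

Let E := Y (i, ord_max) @^-1` B.

Let mE : measurable E.
Proof. by rewrite -[X in measurable X]setTI; exact: mY. Qed.

(** Events about the increments on the grid in which the last increment of component [i] is left
    free. They are stable under intersection, and the independence of the increments is directly
    about them. *)
Let rects : set (set Omega) := [set A | exists Bs : 'I_n * 'I_M.+1 -> set R,
  [/\ forall jk, measurable (Bs jk), Bs (i, ord_max) = setT &
      A = [set w | forall jk, Bs jk (Y jk w)]]].

Let rects_setI : setI_closed rects.
Proof.
move=> _ _ [B1 [m1 h1 ->]] [B2 [m2 h2 ->]].
exists (fun jk => B1 jk `&` B2 jk); split.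
- by move=> jk; exact: measurableI.
- by rewrite h1 h2 setTI.
- apply/seteqP; split=> w /=; first by move=> [a b] jk; split.
  by move=> h; split => jk; case: (h jk).
Qed.

Let rects_indep A : <<s rects >> A -> measurable A /\ P (A `&` E) = (P A * P E)%E.
Proof.
rewrite -setI_closed_g_dynkin_g_sigma_algebra; last exact: rects_setI.
move: A; apply: smallest_sub; first exact: dynkin_indep.
move=> _ [Bs [mBs hBs ->]].
case: hW => _ _ _ /(_ M.+1 tau); rewrite tau0 lexx => /(_ isT ndtau) indep.
split.
  rewrite [X in measurable X](_ : _ = \bigcap_(jk in [set: 'I_n * 'I_M.+1])
     (Y jk @^-1` Bs jk)); last first.
    by apply/seteqP; split=> w h jk => [_|]; exact: h.
  apply: fin_bigcap_measurable => [|jk _]; first exact: finite_finset.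
  by rewrite -[X in measurable X]setTI; exact: mY.
(* The slot left free by [hBs] receives [B], so that the intersection with [E] is again an event to
   which the independence of the increments applies. *)
pose Bs' jk := if jk == (i, ord_max) then B else Bs jk.
rewrite (_ : _ `&` E = [set w | forall jk, Bs' jk (Y jk w)]); last first.
  apply/seteqP; split=> w /=.
    by move=> [h Ew] jk; rewrite /Bs'; case: eqP => [->|].
  move=> h; split; last by have := h (i, ord_max); rewrite /Bs' eqxx.
  move=> jk; have := h jk; rewrite /Bs'; case: eqP => // ->.
  by rewrite hBs.
rewrite (indep Bs'); last by move=> jk; rewrite /Bs'; case: eqP.
rewrite (indep Bs)//.
rewrite (bigD1 (i, ord_max))//= [in RHS](bigD1 (i, ord_max))//=.
rewrite {1}/Bs' eqxx hBs preimage_setT probability_setT mul1e muleC.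
congr (_ * _)%E; apply: eq_bigr => jk /negbTE; rewrite /Bs'.
by case: eqP.
Qed.

(** A position is the sum of the increments before it, since the grid and the Brownian motion start
    at 0. The one position excluded, that of component [i] at the last time, would involve the
    increment kept apart. *)
Let mWgrid j k : (k <= M.+1)%N -> (j != i) || (k != M.+1) ->
  measurable_fun [set: g_sigma_algebraType rects] (W j (tau k)).
Proof.
elim: k => [_ _|k ih kM jk].
  rewrite tau0 (_ : (W j 0 : Omega -> R) = cst 0)//.
  by apply/funext => w; case: hW.
have kM' : (k < M.+1)%N by [].
rewrite (_ : (W j (tau k.+1) : Omega -> R) =
    (fun w => W j (tau k) w + Y (j, Ordinal kM') w)); last first.
  by apply/funext => w; rewrite /Y/= addrC subrK.
apply: measurable_funD.
  by apply: ih; [exact: ltnW | rewrite (ltn_eqF kM') orbT].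
move=> _ D mD; rewrite setTI; apply: sub_sigma_algebra.
exists (fun jk => if jk == (j, Ordinal kM') then D else setT); split.
- by move=> jk'; case: ifP.
- case: eqP => // -[ji Mk]; exfalso; move: jk.
  by rewrite -ji eqxx/= -Mk/= eqxx.
- apply/seteqP; split=> w /=.
    by move=> Dw jk'; case: ifPn => // /eqP ->.
  by move/(_ (j, Ordinal kM')); rewrite eqxx.
Qed.

Lemma grid_indep (l : seq (set Omega)) :
  (forall A, List.In A l -> exists j k (D : set R),
     [/\ (k <= M.+1)%N, (j != i) || (k != M.+1), measurable D &
         A = W j (tau k) @^-1` D]) ->
  P ([set w | forall A, List.In A l -> A w] `&`
     (fun w => W i (tau M.+1) w - W i (tau M) w)%R @^-1` B) =
  (P [set w | forall A, List.In A l -> A w] *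
   P ((fun w => W i (tau M.+1) w - W i (tau M) w)%R @^-1` B))%E.
Proof.
move=> h; apply: (rects_indep _).2.
elim: l h => [|A l ih] h.
  rewrite [X in <<s _ >> X](_ : _ = setT); last by apply/seteqP; split => // w _ A [].
  exact: (@measurableT _ (g_sigma_algebraType rects)).
rewrite [X in <<s _ >> X](_ : _ = A `&` [set w | forall A, List.In A l -> A w]).
  apply: (@measurableI _ (g_sigma_algebraType rects)).
    have [|j [k [D [k1 k2 mD ->]]]] := h A; first by left.
    by rewrite -[X in measurable X]setTI; exact: mWgrid.
  by apply: ih => A' lA'; apply: h; right.
apply/seteqP; split=> w /=.
  by move=> hw; split=> [|A' lA']; apply: hw; [left|right].
by move=> [Aw hw] A' [<-//|]; exact: hw.
Qed.

End grid.

(** By Dynkin's theorem it suffices to treat finite intersections of generators. These involve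
    finitely many times, which are sorted into a grid that ends with [t] and [t']; there
    [grid_indep] applies. *)
Lemma past_indep i t t' (A : set Omega) (B : set R) : 0 <= t -> t < t' ->
  <<s past i t t' >> A -> measurable B ->
  P (A `&` (fun w => W i t' w - W i t w)%R @^-1` B) =
  (P A * normal_prob 0 (Num.sqrt (t' - t)) B)%E.
Proof.
move=> t0 tt' + mB.
have <- : P ((fun w => W i t' w - W i t w)%R @^-1` B) =
    normal_prob 0 (Num.sqrt (t' - t)) B by case: hW => _ _ h _; exact: h.
set xi := (fun w => _).
have mE : measurable (xi @^-1` B).
  rewrite -[X in measurable X]setTI; have mxi : measurable_fun setT xi.
    by apply: measurable_funB; exact: mW.
  exact: mxi.
pose fint : set (set Omega) := [set A | exists l, (forall A', List.In A' l -> past i t t' A')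
   /\ A = [set w | forall A', List.In A' l -> A' w]].
have fintI : setI_closed fint.
  move=> _ _ [l1 [h1 ->]] [l2 [h2 ->]]; exists (l1 ++ l2); split.
    by move=> A' /(List.in_app_or _ _ _)[]; [exact: h1|exact: h2].
  apply/seteqP; split=> w /=.
    by move=> [a b] A' /(List.in_app_or _ _ _)[]; [exact: a|exact: b].
  move=> h; split=> A' A'l; apply: h; apply: List.in_or_app; [by left|by right].
have pastfint : <<s past i t t' >> `<=` <<s fint >>.
  apply: sub_sigma_algebra2 => A' pA'; exists [:: A']; split.
    by move=> A'' [<-//|[]].
  apply/seteqP; split=> w /=; first by move=> A'w A'' [<-//|[]].
  by apply; left.
move/pastfint; rewrite -setI_closed_g_dynkin_g_sigma_algebra//.
move: A; suff : <<d fint >> `<=`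
    [set A | measurable A /\ P (A `&` xi @^-1` B) = (P A * P (xi @^-1` B))%E].
  by move=> h A /h [].
apply: smallest_sub; first exact: dynkin_indep.
move=> _ [l [hl ->]].
have ml : measurable [set w | forall A', List.In A' l -> A' w].
  have : forall A', List.In A' l -> measurable A'.
    by move=> A' /hl pA'; apply: (@sub_past i t t'); apply: sub_sigma_algebra.
  clear; elim: l => [|A l ih] h.
    by rewrite [X in measurable X](_ : _ = setT)//; apply/seteqP; split => // w _ A [].
  rewrite [X in measurable X](_ : _ = A `&` [set w | forall A, List.In A l -> A w]).
    apply: measurableI; first by apply: h; left.
    by apply: ih => A' lA'; apply: h; right.
  apply/seteqP; split=> w /=.
    by move=> hw; split=> [|A' lA']; apply: hw; [left|right].
  by move=> [Aw hw] A' [<-//|]; exact: hw.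
split => //.
(* If a null event takes part, the intersection is null and both sides are 0; otherwise all the
   generators in [l] are events about positions. *)
have [[N [lN [mN PN]]]|nonull] := pselect (exists N, List.In N l /\ (measurable N /\ P N = 0%E)).
  have PA0 : P [set w | forall A', List.In A' l -> A' w] = 0%E.
    by apply: (subset_measure0 _ _ _ PN) => // w; exact.
  rewrite PA0 mul0e; apply: (subset_measure0 _ _ _ PA0) => //.
  exact: measurableI.
have hl' A' : List.In A' l -> exists j s (D : set R),
     [/\ (0 <= s <= t) || ((j != i) && (s == t')), measurable D & A' = W j s @^-1` D].
  move=> lA'; have [//|nA'] := hl _ lA'.
  by exfalso; apply: nonull; exists A'.
have [L [sL hL]] : exists L : seq R, (forall s, s \in L -> 0 <= s <= t) /\
   forall A', List.In A' l -> exists j s (D : set R),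
   [/\ (s \in L) || ((j != i) && (s == t')), measurable D & A' = W j s @^-1` D].
  move: hl'; clear -t0; elim: l => [|A l ih] h; first by exists [::].
  have [|L [L1 L2]] := ih; first by move=> A' lA'; apply: h; right.
  have [|j [s [D [/orP[st|jt] mD AD]]]] := h A; first by left.
  - exists (s :: L); split.
      by move=> s'; rewrite inE => /orP[/eqP ->//|]; exact: L1.
    move=> A' /= [<-|/L2[j' [s' [D' [h1 h2 h3]]]]].
      by exists j, s, D; rewrite inE eqxx.
    by exists j', s', D'; rewrite inE -orbA h1 orbT.
  - exists L; split => // A' /= [<-|/L2//].
    by exists j, s, D; rewrite jt orbT.
pose L0 := sort <=%O (0 :: t :: L).
have sorted0 : sorted <=%O L0 by apply: sort_sorted; exact: le_total.
have memL0 s : (s \in L0) = (s \in 0 :: t :: L) by rewrite mem_sort.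
have L0t s : s \in L0 -> 0 <= s <= t.
  by rewrite memL0 !inE => /or3P[/eqP ->|/eqP ->|/sL//]; rewrite ?lexx ?t0.
(* The default value of [nth] is [t']: the grid jumps to [t'] right after its last sorted entry,
   which is [t], and stays there. *)
pose tau k := nth t' L0 k.
have szL0 : size L0 = (size L).+2 by rewrite size_sort.
pose M := (size L).+1.
have tauM : tau M.+1 = t' by rewrite /tau nth_default// szL0.
have nthle a b : (a <= b)%N -> (b < size L0)%N -> nth t' L0 a <= nth t' L0 b.
  move=> ab bL; apply: (sorted_leq_nth le_trans le_refl) => //.
  by rewrite inE (leq_ltn_trans ab).
have tau0 : tau 0%N = 0.
  apply/eqP; rewrite eq_le; apply/andP; split; last first.
    by have /L0t/andP[] : nth t' L0 0 \in L0 by rewrite mem_nth// szL0.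
  have : 0 \in L0 by rewrite memL0 inE eqxx.
  by move=> /(nthP t')[k kL <-]; exact: nthle.
have taut : tau M = t.
  apply/eqP; rewrite eq_le; apply/andP; split.
    by have /L0t/andP[] : nth t' L0 M \in L0 by rewrite mem_nth// szL0.
  have : t \in L0 by rewrite memL0 !inE eqxx orbT.
  move=> /(nthP t')[k kL <-]; apply: nthle; last by rewrite szL0.
  by rewrite -ltnS -szL0.
have ndtau k : tau k <= tau k.+1.
  rewrite /tau; have [kL|kL] := ltnP k.+1 (size L0); first exact: nthle.
  rewrite [leRHS]nth_default//; have [kL'|kL'] := ltnP k (size L0).
    have /L0t/andP[_ h] : nth t' L0 k \in L0 by rewrite mem_nth.
    by rewrite (le_trans h)// ltW.
  by rewrite nth_default.
have := @grid_indep i M tau B tau0 ndtau mB l; rewrite tauM taut; apply.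
move=> A' /hL[j [s [D [/orP[sL'|/andP[ji /eqP ->]] mD ->]]]].
- have : s \in L0 by rewrite memL0 !inE sL' !orbT.
  move=> /(nthP t')[k kL <-]; exists j, k, D; split => //.
    by rewrite ltnW// -szL0.
  by rewrite orbC; apply/orP; left; rewrite neq_ltn -szL0 kL.
- by exists j, M.+1, D; rewrite tauM ji.
Qed.

End brownian_independence.

(** * Harnack inequality for the Euler chain *)

Section lipschitz_functionals.
Context {R : realType} {I : finType}.
Implicit Types (F G : (I -> R) -> R) (a b h : I -> R).

Definition lip (C : R) F := forall a b (e : R), (forall i, `|a i - b i| <= e) ->
  `|F a - F b| <= C * e.

Definition ranges (B : R) F := forall a, 0 <= F a <= B.

Definition bump a (c : I) (x : R) : I -> R := fun i => a i + (if i == c then x else 0).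

Lemma bumpB a b c x i : bump a c x i - bump b c x i = a i - b i.
Proof. by rewrite /bump; ring. Qed.

Variables (c : I) (sg s : R).
Hypotheses (s0 : 0 < s) (sg0 : 0 < sg).
Notation gam := (normal_prob (0 : R) s).

Definition gauss_step F a : R := \int[gam]_z F (bump a c (sg * z)).

Lemma measurable_lip_bump C F a (k : R -> R) : lip C F -> measurable_fun setT k ->
  measurable_fun setT (fun z : R => F (bump a c (k z))).
Proof.
move=> lF mk; apply: (@lip_measurable _ _ _ I (fun i z => bump a c (k z) i) F C) => // i.
by rewrite /bump; apply: measurable_funD => //; case: eqP.
Qed.

Lemma integrable_bump C B F a : lip C F -> ranges B F ->
  gam.-integrable setT (EFin \o (fun z : R => F (bump a c (sg * z)))).
Proof.
move=> lF rF; apply: (@bounded_integrable _ _ _ _ _ B).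
  by apply: (measurable_lip_bump (C := C)) => //; exact: measurable_funM.
by move=> z; have /andP[h1 h2] := rF (bump a c (sg * z)); rewrite ger0_norm.
Qed.

Lemma lip_gauss_step C B F : lip C F -> ranges B F -> lip C (gauss_step F).
Proof.
move=> lF rF a b e ab; apply: Ex_dist.
- exact: (integrable_bump _ lF rF).
- exact: (integrable_bump _ lF rF).
- by move=> z; apply: lF => i; rewrite bumpB.
Qed.

Lemma ranges_gauss_step C B F : lip C F -> ranges B F -> ranges B (gauss_step F).
Proof.
move=> lF rF a; apply/andP; split.
  by apply: Rintegral_ge0 => z _; have /andP[] := rF (bump a c (sg * z)).
rewrite -[leRHS](Ex_cst gam B); apply: Ex_le.
- exact: (integrable_bump _ lF rF).
- exact: (@bounded_integrable _ _ _ _ (cst B) `|B|).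
- by move=> z; have /andP[] := rF (bump a c (sg * z)).
Qed.

(** Optimised over [lam], for nonnegative [k] and [G], this says that the square of [F] at the
    shifted point is at most [k * G a]: a dimension-free Harnack inequality, in which [G] will be
    the transition operator applied to the square. The form with a free [lam] is linear in [F] and
    [G] and therefore survives integration. *)
Definition harnack_rel F G (k : R) h := forall a (lam : R), 0 < lam ->
  F (fun i => a i + h i) <= (lam * k + lam^-1 * G a) / 2.

(** The shift by [x] is moved into the Gaussian variable at the cost of the density [r] for
    [x / sg]. The relation between [F] and [G] is used with [lam * r] in place of [lam]: multiplied
    by [r], its right side becomes half of [lam * k * r ^+ 2 + lam^-1 * G], and the new factor of
    [k] is the mean of [r ^+ 2]. *)
Lemma harnack_gauss_step C B C' B' F G k h (x : R) : lip C F -> ranges B F ->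
  lip C' G -> ranges B' G -> 0 <= k -> harnack_rel F G k h ->
  harnack_rel (gauss_step F) (gauss_step G) (k * expR (x ^+ 2 / (sg ^+ 2 * s ^+ 2)))
    (bump h c x).
Proof.
move=> lF rF lG rG k0 FG a lam lam0.
have sg0' : sg != 0 by rewrite gt_eqF.
have s0' : s != 0 by rewrite gt_eqF.
pose u (z : R) := F (bump (fun i => a i + h i) c (sg * z)).
have u0 z : (0 <= (u z)%:E)%E.
  by rewrite lee_fin /u; have /andP[] := rF (bump (fun i => a i + h i) c (sg * z)).
have mu_ : measurable_fun setT (EFin \o u).
  apply/measurable_EFinP; apply: (measurable_lip_bump (C := C)) => //; exact: measurable_funM.
have mG : measurable_fun setT (fun z : R => (G (bump a c (sg * z)))%:E).
  apply/measurable_EFinP; apply: (measurable_lip_bump (C := C')) => //; exact: measurable_funM.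
have G0 (z : R) : (0 <= (G (bump a c (sg * z)))%:E)%E.
  by rewrite lee_fin; have /andP[] := rG (bump a c (sg * z)).
have mcm : measurable_fun setT (fun z : R => (cm_density s (x / sg) z)%:E).
  by apply/measurable_EFinP; exact: measurable_cm_density.
have mcm2 : measurable_fun setT (fun z : R => (cm_density s (x / sg) z ^+ 2)%:E).
  by apply/measurable_EFinP; apply: measurable_funX; exact: measurable_cm_density.
have := ge0_integral_normal_shift s0 (x / sg) mu_ u0.
have -> : integral gam setT (fun z : R => (EFin \o u) (z + x / sg)) =
    (\int[gam]_z (F (bump (fun i => a i + bump h c x i) c (sg * z)))%:E)%E.
  apply: eq_integral => z _; rewrite /= /u; congr (F _)%:E; apply/funext => i.
  rewrite /bump; case: eqP => _; last by rewrite !addr0.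
  by rewrite mulrDr mulrCA mulfV// mulr1; ring.
rewrite Ex_fineE; last exact: (integrable_bump _ lF rF).
move=> E1; rewrite -lee_fin /gauss_step E1.
have -> : ((lam * (k * expR (x ^+ 2 / (sg ^+ 2 * s ^+ 2))) +
   lam^-1 * \int[gam]_z G (bump a c (sg * z))) / 2)%:E =
  (\int[gam]_z ((lam * k / 2)%:E * (cm_density s (x / sg) z ^+ 2)%:E +
              (lam^-1 / 2)%:E * (G (bump a c (sg * z)))%:E))%E.
  have c1 : (0 <= (lam * k / 2)%:E)%E by rewrite lee_fin !mulr_ge0// ltW.
  have c2 : (0 <= (lam^-1 / 2)%:E)%E by rewrite lee_fin !mulr_ge0// invr_ge0 ltW.
  rewrite ge0_integralD//; last 4 first.
  - by move=> z _; rewrite mule_ge0// lee_fin sqr_ge0.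
  - exact: emeasurable_funM.
  - by move=> z _; rewrite mule_ge0.
  - exact: emeasurable_funM.
  rewrite !ge0_integralZl//; last by move=> z _; rewrite lee_fin sqr_ge0.
  rewrite integral_cm_density_sqr// Ex_fineE; last exact: (integrable_bump _ lG rG).
  rewrite -!EFinM -EFinD; congr EFin.
  have -> : (x / sg) ^+ 2 / s ^+ 2 = x ^+ 2 / (sg ^+ 2 * s ^+ 2).
    by field; rewrite sg0' s0'.
  by field; rewrite gt_eqF.
apply: ge0_le_integral => //.
- by move=> z _; apply: mule_ge0; [exact: u0|rewrite lee_fin; exact: expR_ge0].
- exact: emeasurable_funM.
- by apply: emeasurable_funD; exact: emeasurable_funM.
move=> z _; rewrite -!EFinM -EFinD lee_fin.
set r := cm_density s (x / sg) z.
have r0 : 0 < r by exact: expR_gt0.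
have := FG (bump a c (sg * z)) (lam * r) (mulr_gt0 lam0 r0).
have -> : (fun i => bump a c (sg * z) i + h i) = bump (fun i => a i + h i) c (sg * z).
  by apply/funext => i; rewrite /bump; ring.
rewrite -/(u z) => h1.
have h2 : u z * r <= (lam * r * k + (lam * r)^-1 * G (bump a c (sg * z))) / 2 * r.
  by rewrite ler_pM2r.
apply: (le_trans h2); apply: eq_ler.
by field; rewrite !gt_eqF.
Qed.

End lipschitz_functionals.

Section gauss_sweep.
Context {R : realType} {I J : finType}.
Variables (c : J -> I) (sg : J -> R) (s : R).
Hypotheses (s0 : 0 < s) (sg0 : forall j, 0 < sg j).

Fixpoint gauss_sweep (l : seq J) (F : (I -> R) -> R) : (I -> R) -> R :=
  if l is j :: l' then gauss_sweep l' (gauss_step (c j) (sg j) s F) else F.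

Lemma lip_gauss_sweep l C B F : lip C F -> ranges B F ->
  lip C (gauss_sweep l F) /\ ranges B (gauss_sweep l F).
Proof.
elim: l F => [//|j l ih] F lF rF /=; apply: ih.
  exact: lip_gauss_step.
exact: ranges_gauss_step lF rF.
Qed.

End gauss_sweep.

Lemma harnack_gauss_sweep {R : realType} {I : finType} (sg : I -> R) (s : R)
  (l : seq I) (C B C' B' : R) (F G : (I -> R) -> R) (k : R) (h x : I -> R) :
  0 < s -> (forall j, 0 < sg j) -> uniq l ->
  lip C F -> ranges B F -> lip C' G -> ranges B' G -> 0 <= k -> harnack_rel F G k h ->
  harnack_rel (gauss_sweep id sg s l F) (gauss_sweep id sg s l G)
    (k * expR (\sum_(j <- l) (x j) ^+ 2 / (sg j ^+ 2 * s ^+ 2)))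
    (fun i => h i + (if i \in l then x i else 0)).
Proof.
move=> s0 sg0; elim: l F G k h => [|j l ih] F G k h ul lF rF lG rG k0 FG.
  move=> a lam lam0; rewrite /= big_nil expR0 mulr1.
  by under eq_fun do rewrite addr0; exact: FG.
move: ul => /= /andP[jl ul].
have := ih _ _ _ _ ul (lip_gauss_step j (sg j) s lF rF) (ranges_gauss_step j (sg j) s lF rF)
  (lip_gauss_step j (sg j) s lG rG) (ranges_gauss_step j (sg j) s lG rG) _
  (harnack_gauss_step j s0 (sg0 j) (x j) lF rF lG rG k0 FG).
rewrite mulr_ge0 ?expR_ge0// => /(_ isT).
have -> : k * expR (x j ^+ 2 / (sg j ^+ 2 * s ^+ 2)) *
    expR (\sum_(j' <- l) x j' ^+ 2 / (sg j' ^+ 2 * s ^+ 2)) =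
    k * expR (\sum_(j' <- j :: l) x j' ^+ 2 / (sg j' ^+ 2 * s ^+ 2)).
  by rewrite big_cons expRD mulrA.
rewrite (_ : (fun i => _) = (fun i => h i + (if i \in j :: l then x i else 0)))//.
apply/funext => i; rewrite /bump inE -addrA; congr (_ + _).
by case: eqP => [->|_] /=; rewrite ?(negbTE jl) ?addr0 ?add0r.
Qed.

Section euler_operator.
Context {R : realType} {n : nat}.
Variables (sg : 'I_n -> R) (f : ('I_n -> R) -> 'I_n -> R) (Bf Lf : R).
Hypothesis sg0 : forall j, 0 < sg j.
Hypothesis fB : forall a i, `|f a i| <= Bf.
Hypothesis fL : forall i, lip Lf (f ^~ i).
Hypothesis Lf0 : 0 <= Lf.

(** Transition operator of the Euler scheme for the equation with drift [f] and constant diagonal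
    noise [sg]. *)
Definition euler_op (dt : R) (F : ('I_n -> R) -> R) (a : 'I_n -> R) : R :=
  gauss_sweep id sg (Num.sqrt dt) (enum 'I_n) F (fun i => a i + dt * f a i).

Lemma lip_euler_op dt C B F : 0 < dt -> 0 <= C -> lip C F -> ranges B F ->
  lip (C * (1 + dt * Lf)) (euler_op dt F) /\ ranges B (euler_op dt F).
Proof.
move=> dt0 C0 lF rF; have sdt : 0 < Num.sqrt dt by rewrite sqrtr_gt0.
have [l1 r1] := lip_gauss_sweep id sg (Num.sqrt dt) (enum 'I_n) lF rF.
split; last by move=> a; exact: r1.
move=> a b e ab; rewrite -mulrA; apply: l1 => i.
have -> : a i + dt * f a i - (b i + dt * f b i) = (a i - b i) + dt * (f a i - f b i) by ring.
rewrite (le_trans (ler_normD _ _))// mulrDl mul1r lerD//.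
rewrite normrM (gtr0_norm dt0) -mulrA ler_wpM2l ?(ltW dt0)//.
by have := fL i ab.
Qed.

Lemma lip_iter_euler_op dt C B F m : 0 < dt -> 0 <= C -> lip C F -> ranges B F ->
  exists2 C', lip C' (iter m (euler_op dt) F) & 0 <= C' /\ ranges B (iter m (euler_op dt) F).
Proof.
move=> dt0 C0 lF rF; elim: m => [|m [C' l1 [C'0 r1]]]; first by exists C.
have [l2 r2] := lip_euler_op dt0 C'0 l1 r1.
exists (C' * (1 + dt * Lf)) => //; split => //.
by rewrite mulr_ge0// addr_ge0// mulr_ge0// ltW.
Qed.

Lemma lip_sqr C B F : lip C (F : ('I_n -> R) -> R) -> ranges B F ->
  lip (2 * B * C) (fun a => F a ^+ 2) /\ ranges (B ^+ 2) (fun a => F a ^+ 2).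
Proof.
move=> lF rF; split.
  move=> a b e ab.
  have -> : F a ^+ 2 - F b ^+ 2 = (F a + F b) * (F a - F b) by ring.
  rewrite normrM -mulrA ler_pM//; last exact: lF.
  have /andP[a0 aB] := rF a; have /andP[b0 bB] := rF b.
  by rewrite ger0_norm ?addr_ge0//; lra.
move=> a; rewrite sqr_ge0/=; have /andP[a0 aB] := rF a.
by rewrite lerXn2r// nnegrE// (le_trans a0).
Qed.

(* Harnack inequality for the Euler chain: the difference [h] of the initial
   states is removed linearly in time by shifting the Gaussian increments. *)
Lemma harnack_euler C B F (h : 'I_n -> R) m : 0 <= C -> lip C F -> ranges B F ->
  harnack_rel (iter m.+1 (euler_op m.+1%:R^-1) F)
    (iter m.+1 (euler_op m.+1%:R^-1) (fun a => F a ^+ 2))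
    (expR (\sum_j (`|h j| + 2 * Bf) ^+ 2 / sg j ^+ 2)) h.
Proof.
move=> C0 lF rF; set dt := m.+1%:R^-1.
have dt0 : 0 < dt by rewrite invr_gt0 ltr0n.
have sdt : 0 < Num.sqrt dt by rewrite sqrtr_gt0.
have B0 : 0 <= B by have /andP[/le_trans h1 /h1] := rF (fun=> 0).
have [l2 r2] := lip_sqr lF rF.
have C20 : 0 <= 2 * B * C by rewrite !mulr_ge0.
set D := \sum_j _.
have D0 : 0 <= D by apply: sumr_ge0 => j _; rewrite divr_ge0 ?sqr_ge0.
(* With [k] steps to go the two starting points differ by [k%:R * dt * h], hence not at all at the
   end, and each step costs a factor [expR (dt * D)]. For [k = 0] the relation is Young's
   inequality. *)
suff H k : harnack_rel (iter k (euler_op dt) F) (iter k (euler_op dt) (fun a => F a ^+ 2))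
    (expR (k%:R * dt * D)) (fun i => k%:R * dt * h i).
  have := H m.+1; rewrite mulfV ?pnatr_eq0// mul1r.
  by under [X in harnack_rel _ _ _ X]eq_fun do rewrite mul1r.
elim: k => [|k ih].
  move=> a lam lam0 /=; rewrite !mul0r expR0 mulr1.
  under eq_fun do rewrite !mul0r addr0.
  rewrite ler_pdivlMr// mulrC -subr_ge0.
  have -> : lam + lam^-1 * F a ^+ 2 - 2 * F a = lam^-1 * (lam - F a) ^+ 2.
    by field; rewrite gt_eqF.
  by rewrite mulr_ge0 ?sqr_ge0 ?invr_ge0 ?ltW.
have [Ck lk [_ rk]] := lip_iter_euler_op k dt0 C0 lF rF.
have [Ck' lk' [_ rk']] := lip_iter_euler_op k dt0 C20 l2 r2.
move=> a lam lam0; rewrite !iterS {1 2}/euler_op.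
pose a' i := a i + k.+1%:R * dt * h i.
(* The part of the distance that the noise of this step absorbs: the prescribed decrease [dt * h i]
   and the difference of the two drifts, which is at most [dt * (2 * Bf)]. *)
pose x i := dt * (h i + (f a' i - f a i)).
have := harnack_gauss_sweep x sdt sg0 (enum_uniq 'I_n) lk rk lk' rk' (expR_ge0 _) ih.
move=> /(_ (fun i => a i + dt * f a i) lam lam0).
rewrite (_ : (fun i => a i + dt * f a i + _) = (fun i => a' i + dt * f a' i)); last first.
  apply/funext => i; rewrite mem_enum inE /x /a' -addn1 natrD; ring.
move=> /le_trans; apply; rewrite ler_pM2r ?invr_gt0// lerD2r ler_pM2l// -expRD ler_expR.
rewrite -[in leRHS]addn1 natrD !mulrDl lerD2l mul1r big_enum/= mulr_sumr.
apply: ler_sum => j _; rewrite sqr_sqrtr ?(ltW dt0)// /x.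
have sgj0 : 0 < sg j ^+ 2 by rewrite exprn_gt0.
have -> : (dt * (h j + (f a' j - f a j))) ^+ 2 / (sg j ^+ 2 * dt) =
   dt * ((h j + (f a' j - f a j)) ^+ 2 / sg j ^+ 2) by field; rewrite !gt_eqF.
rewrite ler_pM2l// ler_pM2r ?invr_gt0// -real_normK ?num_real//.
have h1 : `|h j + (f a' j - f a j)| <= `|h j| + 2 * Bf.
  rewrite (le_trans (ler_normD _ _))// lerD2l (le_trans (ler_normB _ _))//.
  by have := fB a' j; have := fB a j; lra.
by rewrite lerXn2r// nnegrE// (le_trans _ h1).
Qed.

End euler_operator.

(** * Sums of Brownian increments *)

Section increments.
Context {R : realType} {n : nat} {d : measure_display} {Omega : measurableType d}.
Variables (P : probability Omega R) (W : 'I_n -> R -> {RV P >-> R}).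
Hypothesis hW : brownian_motion W.

(** The generators of [brownian_filtration], kept apart because measurability with respect to a
    generated sigma-algebra is expressed through [g_sigma_algebraType], which takes generators. *)
Definition brownian_gen (t : R) : set (set Omega) :=
  [set E | exists i s (B : set R),
         [/\ 0 <= s <= t, measurable B & E = W i s @^-1` B]]
      `|` [set E | measurable E /\ P E = 0%E].

Definition gmeasurable d' (T : measurableType d') (G : set (set Omega)) (f : Omega -> T) :=
  measurable_fun [set: g_sigma_algebraType G] (f : g_sigma_algebraType G -> T).

Lemma gmeasurable_sub d' (T : measurableType d') (G G' : set (set Omega)) (f : Omega -> T) :
  <<s G >> `<=` <<s G' >> -> gmeasurable G f -> gmeasurable G' f.
Proof. by move=> GG' mf mT A mA; apply: GG'; exact: mf. Qed.

Lemma gmeasurable_cst (G : set (set Omega)) (c : R) : gmeasurable G (fun=> c).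
Proof. exact: measurable_cst. Qed.

Lemma gmeasurableD (G : set (set Omega)) (f g : Omega -> R) :
  gmeasurable G f -> gmeasurable G g -> gmeasurable G (fun w => f w + g w).
Proof. exact: measurable_funD. Qed.

Lemma gmeasurableB (G : set (set Omega)) (f g : Omega -> R) :
  gmeasurable G f -> gmeasurable G g -> gmeasurable G (fun w => f w - g w).
Proof. exact: measurable_funB. Qed.

Lemma gmeasurableM (G : set (set Omega)) (f g : Omega -> R) :
  gmeasurable G f -> gmeasurable G g -> gmeasurable G (fun w => f w * g w).
Proof. exact: measurable_funM. Qed.

Lemma gmeasurableX (G : set (set Omega)) (f : Omega -> R) k :
  gmeasurable G f -> gmeasurable G (fun w => f w ^+ k).
Proof. exact: measurable_funX. Qed.

Lemma sub_brownian_gen s t : s <= t -> <<s brownian_gen s >> `<=` <<s brownian_gen t >>.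
Proof.
move=> st; apply: sub_sigma_algebra2 => A [[i [u [B [/andP[u0 us] mB ->]]]]|h]; last by right.
by left; exists i, u, B; rewrite u0 (le_trans us).
Qed.

Lemma brownian_gen_past i t t' : <<s brownian_gen t >> `<=` <<s past W i t t' >>.
Proof. exact: filtration_past. Qed.

Lemma brownian_gen_measurable t : <<s brownian_gen t >> `<=` measurable.
Proof.
apply: smallest_sub; first exact: sigma_algebra_measurable.
move=> A [[j [s [B [_ mB ->]]]]|[]//].
by rewrite -[X in measurable X]setTI; exact: measurable_funP.
Qed.

Lemma gmeasurableT d' (T : measurableType d') t (f : Omega -> T) :
  gmeasurable (brownian_gen t) f -> measurable_fun setT f.
Proof. by move=> mf _ A mA; apply: (@brownian_gen_measurable t); exact: mf. Qed.

Lemma gmeasurable_past d' (T : measurableType d') i t t' (f : Omega -> T) :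
  gmeasurable (brownian_gen t) f -> gmeasurable (past W i t t') f.
Proof. by apply: gmeasurable_sub; exact: brownian_gen_past. Qed.

Lemma gmeasurable_W i s t : 0 <= s <= t -> gmeasurable (brownian_gen t) (W i s).
Proof.
move=> st _ B mB; rewrite setTI; apply: sub_sigma_algebra; left.
by exists i, s, B.
Qed.

Lemma past_W i j s t t' : (0 <= s <= t) || ((j != i) && (s == t')) ->
  gmeasurable (past W i t t') (W j s).
Proof.
move=> st _ B mB; rewrite setTI; apply: sub_sigma_algebra; left.
by exists j, s, B.
Qed.

Lemma past_increment i j t t' : 0 <= t -> j != i ->
  gmeasurable (past W i t t') (fun w => W j t' w - W j t w).
Proof.
move=> t0 ji; apply: gmeasurableB; apply: past_W; first by rewrite ji eqxx orbT.
by rewrite t0 lexx.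
Qed.

Lemma gmeasurable_adapted (H : R -> Omega -> R) t : 0 <= t ->
  adapted (brownian_filtration W) H -> gmeasurable (brownian_gen t) (H t).
Proof. by move=> t0 aH _ B mB; rewrite setTI; exact: aH. Qed.

Let mincr j t t' : measurable_fun setT (fun w => W j t' w - W j t w).
Proof. by apply: measurable_funB; exact: measurable_funP. Qed.

Lemma integral_increment j t t' (H : g_sigma_algebraType (past W j t t') * measurableTypeR R -> \bar R) :
  0 <= t -> t < t' -> measurable_fun setT H -> (forall x, (0 <= H x)%E) ->
  (\int[P]_w H (w, (W j t' w - W j t w)%R) =
   \int[P]_w \int[normal_prob 0%R (Num.sqrt (t' - t))]_z H (w, z))%E.
Proof.
move=> t0 tt' mH H0; apply: integral_indep => //.
- exact: sub_past.
- by move=> A B pA mB; exact: past_indep.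
Qed.

Section one_increment.
Variables (j : 'I_n) (t t' : R).
Hypotheses (t0 : 0 <= t) (tt' : t < t').
Notation G := (past W j t t').
Notation xi := (fun w => W j t' w - W j t w).
Notation s := (Num.sqrt (t' - t)).

Let s0 : 0 < s. Proof. by rewrite sqrtr_gt0 subr_gt0. Qed.

Let fstm (f : Omega -> R) : gmeasurable G f ->
  measurable_fun setT (fun x : g_sigma_algebraType G * measurableTypeR R => f x.1).
Proof. by move=> mf; apply: (measurableT_comp mf); exact: measurable_fst. Qed.

Let sndm : measurable_fun setT (fun x : g_sigma_algebraType G * measurableTypeR R => (x.2 : R)).
Proof. exact: measurable_snd. Qed.

(** Given the past, [xi] is a centred normal variable of variance [t' - t], so the cross term
    vanishes. Both sides may be infinite. *)
Lemma L2_step_lin (S a : Omega -> R) : gmeasurable G S -> gmeasurable G a ->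
  (\int[P]_w ((S w + a w * xi w) ^+ 2)%:E =
   \int[P]_w (S w ^+ 2 + a w ^+ 2 * (t' - t))%:E)%E.
Proof.
move=> mS ma.
rewrite (integral_increment (H := fun x => ((S x.1 + a x.1 * x.2) ^+ 2)%:E) t0 tt').
- apply: eq_integral => w _; rewrite /= integral_normal_affine_sqr//.
  by rewrite sqr_sqrtr// subr_ge0 ltW.
- apply/measurable_EFinP; apply: measurable_funX; apply: measurable_funD; first exact: fstm.
  by apply: measurable_funM; [exact: fstm|exact: sndm].
- by move=> x; rewrite lee_fin sqr_ge0.
Qed.

Lemma L2_step_quad (S a : Omega -> R) : gmeasurable G S -> gmeasurable G a ->
  (\int[P]_w ((S w + a w * (xi w ^+ 2 - (t' - t))) ^+ 2)%:E <=
   \int[P]_w (S w ^+ 2 + a w ^+ 2 * (128 * (t' - t) ^+ 2))%:E)%E.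
Proof.
move=> mS ma.
have ss : s ^+ 2 = t' - t by rewrite sqr_sqrtr// subr_ge0 ltW.
pose H (x : g_sigma_algebraType G * measurableTypeR R) :=
  ((S x.1 + a x.1 * ((x.2 : R) ^+ 2 - s ^+ 2)) ^+ 2)%:E.
have mH : measurable_fun setT H.
  apply/measurable_EFinP; apply: measurable_funX; apply: measurable_funD; first exact: fstm.
  apply: measurable_funM; first exact: fstm.
  by apply: measurable_funB => //; apply: measurable_funX; exact: sndm.
have H0 x : (0 <= H x)%E by rewrite lee_fin sqr_ge0.
have -> : (\int[P]_w ((S w + a w * (xi w ^+ 2 - (t' - t))) ^+ 2)%:E =
    \int[P]_w H (w, (W j t' w - W j t w)%R))%E.
  by apply: eq_integral => w _; rewrite /H /= ss.
rewrite integral_increment//.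
have mS' : measurable_fun setT S by move=> _ A mA; apply: (@sub_past _ _ _ _ _ W j t t'); exact: mS.
have ma' : measurable_fun setT a by move=> _ A mA; apply: (@sub_past _ _ _ _ _ W j t t'); exact: ma.
apply: ge0_le_integral => //.
- by move=> w _; apply: integral_ge0.
- apply: (sub_measurable (G := G)); first exact: sub_past.
  exact: measurable_integral_indep.
- apply/measurable_EFinP; apply: measurable_funD; first exact: measurable_funX.
  by apply: measurable_funM => //; exact: measurable_funX.
- move=> w _; rewrite /H /=; apply: (le_trans (integral_normal_quad_sqr s0 _ _)).
  by rewrite lee_fin (exprM s 2 2) ss.
Qed.

Lemma Ex_gauss_step (I : finType) (Y : I -> Omega -> R) (c : I) (sg C B : R)
    (F : (I -> R) -> R) : (forall i, gmeasurable G (Y i)) -> lip C F -> ranges B F ->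
  \int[P]_w F (bump (Y^~ w) c (sg * xi w)) =
  \int[P]_w gauss_step c sg s F (Y^~ w).
Proof.
move=> mY lF rF.
pose H (x : g_sigma_algebraType G * measurableTypeR R) := (F (bump (Y^~ x.1) c (sg * x.2)))%:E.
have mH : measurable_fun setT H.
  apply/measurable_EFinP.
  apply: (@lip_measurable _ _ _ I (fun i (x : g_sigma_algebraType G * measurableTypeR R) => bump (Y^~ x.1) c (sg * x.2) i) F C) => // i.
  rewrite /bump; apply: measurable_funD; first exact: fstm.
  by case: eqP => // _; apply: measurable_funM => //; exact: sndm.
have H0 x : (0 <= H x)%E by rewrite lee_fin; have /andP[] := rF (bump (Y^~ x.1) c (sg * x.2)).
have := integral_increment t0 tt' mH H0.
rewrite /H /Rintegral => ->; congr fine; apply: eq_integral => w _.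
exact: (Ex_fineE (integrable_bump c sg s (Y^~ w) lF rF)).
Qed.

End one_increment.

Section several_increments.
Variables (I : finType) (sg : 'I_n -> R).

Definition noise (c : 'I_n -> I) (l : seq 'I_n) (t t' : R) (i : I) (w : Omega) : R :=
  \sum_(j <- l) (if i == c j then sg j * (W j t' w - W j t w) else 0).

Lemma gmeasurable_sum (G : set (set Omega)) (J : Type) (l : seq J) (f : J -> Omega -> R) :
  (forall j, gmeasurable G (f j)) -> gmeasurable G (fun w => \sum_(j <- l) f j w).
Proof.
move=> mf; elim: l => [|j l ih].
  rewrite (_ : (fun w => _) = fun=> 0); first exact: gmeasurable_cst.
  by apply/funext => w; rewrite big_nil.
rewrite (_ : (fun w => _) = (fun w => f j w + \sum_(j <- l) f j w)).
  exact: gmeasurableD.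
by apply/funext => w; rewrite big_cons.
Qed.

(** The components are integrated out one after the other. While component [j] is treated, the
    increments of the others over the same interval count as past; this is why [past] contains the
    other components at time [t']. *)
Lemma Ex_gauss_sweep (c : 'I_n -> I) (l : seq 'I_n) t t' (Y : I -> Omega -> R) C B F :
  0 <= t -> t < t' -> uniq l -> (forall i, gmeasurable (brownian_gen t) (Y i)) ->
  lip C F -> ranges B F ->
  \int[P]_w F (fun i => Y i w + noise c l t t' i w) =
  \int[P]_w gauss_sweep c sg (Num.sqrt (t' - t)) l F (Y^~ w).
Proof.
move=> t0 tt' + mY; elim: l F => [|j l ih] F ul lF rF /=.
  by apply: eq_Rintegral => w _; congr F; apply/funext => i; rewrite /noise big_nil addr0.
move: ul => /= /andP[jl ul].
rewrite -(ih _ ul (lip_gauss_step _ _ _ lF rF) (ranges_gauss_step _ _ _ lF rF)).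
have mY' i : gmeasurable (past W j t t') (fun w => Y i w + noise c l t t' i w).
  apply: gmeasurableD; first exact: gmeasurable_past.
  rewrite /noise.
  have -> : (fun w => \sum_(j0 <- l) (if i == c j0 then sg j0 * (W j0 t' w - W j0 t w) else 0)) =
    (fun w => \sum_(j0 <- l | j0 != j) (if i == c j0 then sg j0 * (W j0 t' w - W j0 t w) else 0)).
    apply/funext => w; rewrite big_seq_cond [RHS]big_seq_cond; apply: eq_bigl => k.
    case kl : (k \in l) => //=.
    by apply/esym/eqP => kj; move: jl; rewrite -kj kl.
  under eq_fun do rewrite big_mkcond.
  apply: gmeasurable_sum => k; case: (boolP (k != j)) => kj; last exact: gmeasurable_cst.
  case: eqP => _; last exact: gmeasurable_cst.
  by apply: gmeasurableM; [exact: gmeasurable_cst|exact: past_increment].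
rewrite -(Ex_gauss_step t0 tt' (c j) (sg j) mY' lF rF).
apply: eq_Rintegral => w _; congr F; apply/funext => i.
by rewrite /bump /noise big_cons /= -addrA; congr (_ + _); rewrite addrC.
Qed.

(** The last time step is integrated out first, hence sits innermost; [c k j] is the coordinate that
    receives the increment of component [j] during step [k]. *)
Fixpoint gauss_path (c : nat -> 'I_n -> I) (s : R) (M : nat) (F : (I -> R) -> R) :=
  if M is M'.+1 then gauss_path c s M' (gauss_sweep (c M') sg s (enum 'I_n) F) else F.

Lemma lip_gauss_path c s M C B F : lip C F -> ranges B F ->
  lip C (gauss_path c s M F) /\ ranges B (gauss_path c s M F).
Proof.
elim: M F => [//|M ih] F lF rF /=.
by have [l1 r1] := lip_gauss_sweep (c M) sg s (enum 'I_n) lF rF; exact: ih.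
Qed.

Definition path_noise (c : nat -> 'I_n -> I) (tau dt : R) (M : nat) (i : I) (w : Omega) : R :=
  \sum_(k < M) noise (c k) (enum 'I_n) (tau + k%:R * dt) (tau + k.+1%:R * dt) i w.

Lemma gmeasurable_noise c l t t' i : 0 <= t -> t <= t' ->
  gmeasurable (brownian_gen t') (noise c l t t' i).
Proof.
move=> t0 tt'; apply: gmeasurable_sum => k.
case: eqP => _; last exact: gmeasurable_cst.
apply: gmeasurableM; first exact: gmeasurable_cst.
apply: gmeasurableB; apply: gmeasurable_W; first by rewrite lexx (le_trans t0).
by rewrite t0.
Qed.

Lemma gmeasurable_path_noise c tau dt M i t : 0 <= tau -> 0 <= dt ->
  tau + M%:R * dt <= t -> gmeasurable (brownian_gen t) (path_noise c tau dt M i).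
Proof.
move=> tau0 dt0 Mt; apply: gmeasurable_sum => k.
apply: (@gmeasurable_sub _ _ (brownian_gen (tau + k.+1%:R * dt))).
  apply: sub_brownian_gen; apply: le_trans Mt.
  by rewrite lerD2l ler_wpM2r// ler_nat.
apply: gmeasurable_noise; first by rewrite addr_ge0// mulr_ge0.
by rewrite lerD2l ler_wpM2r// ler_nat.
Qed.

Lemma Ex_gauss_path (c : nat -> 'I_n -> I) tau dt M (Y : I -> Omega -> R) C B F :
  0 <= tau -> 0 < dt -> (forall i, gmeasurable (brownian_gen tau) (Y i)) ->
  lip C F -> ranges B F ->
  \int[P]_w F (fun i => Y i w + path_noise c tau dt M i w) =
  \int[P]_w gauss_path c (Num.sqrt dt) M F (Y^~ w).
Proof.
move=> tau0 dt0 mY; elim: M F => [|M ih] F lF rF /=.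
  by apply: eq_Rintegral => w _; congr F; apply/funext => i; rewrite /path_noise big_ord0 addr0.
have [l1 r1] := lip_gauss_sweep (c M) sg (Num.sqrt dt) (enum 'I_n) lF rF.
rewrite -(ih _ l1 r1).
have dtE : tau + M.+1%:R * dt - (tau + M%:R * dt) = dt by rewrite -addn1 natrD; ring.
have tM : tau + M%:R * dt < tau + M.+1%:R * dt by rewrite -subr_gt0 dtE.
have tM0 : 0 <= tau + M%:R * dt by rewrite addr_ge0// mulr_ge0// ltW.
have := @Ex_gauss_sweep (c M) (enum 'I_n) _ _ (fun i w => Y i w + path_noise c tau dt M i w)
  C B F tM0 tM (enum_uniq _) _ lF rF.
rewrite dtE => <-.
  apply: eq_Rintegral => w _; congr F; apply/funext => i.
  by rewrite /path_noise big_ord_recr/= addrA.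
move=> i; apply: gmeasurableD.
  apply: (gmeasurable_sub _ (mY i)); apply: sub_brownian_gen.
  by rewrite lerDl mulr_ge0// ltW.
by apply: gmeasurable_path_noise => //; exact: ltW.
Qed.

End several_increments.

Section discrete_isometry.
Variables (dt : R) (a : nat -> Omega -> R).
Hypothesis dt0 : 0 < dt.
Hypothesis ma : forall l, gmeasurable (brownian_gen (l%:R * dt)) (a l).
Notation xi j l w := (W j (l.+1%:R * dt) w - W j (l%:R * dt) w).

Let dtE l : l.+1%:R * dt - l%:R * dt = dt.
Proof. by rewrite -addn1 natrD; ring. Qed.

Let dtS l : l%:R * dt < l.+1%:R * dt.
Proof. by rewrite -subr_gt0 dtE. Qed.

Let dtl0 l : 0 <= l%:R * dt. Proof. by rewrite mulr_ge0// ltW. Qed.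

Let mxi j l N : (l < N)%N -> gmeasurable (brownian_gen (N%:R * dt)) (fun w => xi j l w).
Proof.
move=> lN; apply: gmeasurableB; apply: gmeasurable_W.
  by rewrite dtl0/= ler_pM2r// ler_nat.
by rewrite dtl0/= ler_pM2r// ler_nat ltnW.
Qed.

Let maN l N : (l <= N)%N -> gmeasurable (brownian_gen (N%:R * dt)) (a l).
Proof.
move=> lN; move: (@ma l); apply: gmeasurable_sub; apply: sub_brownian_gen.
by rewrite ler_pM2r// ler_nat.
Qed.

Let msum N (f : nat -> Omega -> R) :
  (forall l, (l < N)%N -> gmeasurable (brownian_gen (N%:R * dt)) (f l)) ->
  gmeasurable (brownian_gen (N%:R * dt)) (fun w => \sum_(l < N) f l w).
Proof. by move=> mf; apply: gmeasurable_sum => -[l lN]; exact: mf. Qed.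

(** Discrete Ito isometry: each term is orthogonal to the sum of the previous ones, which belongs to
    its past. *)
Lemma L2_sum_lin j N :
  (\int[P]_w ((\sum_(l < N) a l w * xi j l w) ^+ 2)%:E =
   \int[P]_w (\sum_(l < N) a l w ^+ 2 * dt)%:E)%E.
Proof.
elim: N => [|N ih].
  by apply: eq_integral => w _; rewrite !big_ord0 expr0n.
have mS : gmeasurable (past W j (N%:R * dt) (N.+1%:R * dt))
    (fun w => \sum_(l < N) a l w * xi j l w).
  apply: gmeasurable_past; apply: (msum (f := fun l w => a l w * xi j l w)) => l lN.
  by apply: gmeasurableM; [apply: maN; exact: ltnW|exact: mxi].
have := L2_step_lin (dtl0 N) (dtS N) mS (gmeasurable_past (@ma N)).
rewrite dtE => E1.
transitivity (\int[P]_w ((\sum_(l < N) a l w * xi j l w) ^+ 2 + a N w ^+ 2 * dt)%:E)%E.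
  by rewrite -E1; apply: eq_integral => w _; rewrite big_ord_recr.
have mST : measurable_fun setT (fun w => \sum_(l < N) a l w * xi j l w).
  apply: (@gmeasurableT _ _ (N%:R * dt)).
  apply: (msum (f := fun l w => a l w * xi j l w)) => l lN.
  by apply: gmeasurableM; [apply: maN; exact: ltnW|exact: mxi].
have maT l : measurable_fun setT (a l) by exact: gmeasurableT (@ma l).
have ma2 : measurable_fun setT (fun w => (a N w ^+ 2 * dt)%:E).
  by apply/measurable_EFinP; apply: measurable_funM => //; exact: measurable_funX.
have sq0 (f : Omega -> R) w : (0 <= (f w ^+ 2 * dt)%:E)%E.
  by rewrite lee_fin mulr_ge0 ?sqr_ge0 ?ltW.
under eq_integral do rewrite EFinD.
rewrite ge0_integralD//; last 2 first.
- by move=> w _; rewrite lee_fin sqr_ge0.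
- by apply/measurable_EFinP; exact: measurable_funX.
rewrite ih -ge0_integralD//; last 2 first.
- by move=> w _; rewrite lee_fin; apply: sumr_ge0 => l _; rewrite mulr_ge0 ?sqr_ge0 ?ltW.
- apply/measurable_EFinP.
  apply: (@measurable_sum _ _ _ setT 'I_N (index_enum _) (fun l w => a l w ^+ 2 * dt)) => l.
  by apply: measurable_funM => //; exact: measurable_funX.
by apply: eq_integral => w _; rewrite -EFinD big_ord_recr.
Qed.

Variable K : R.
Hypothesis aK : forall l w, `|a l w| <= K.

Let K0 : 0 <= K.
Proof. exact: le_trans (normr_ge0 _) (aK 0%N point). Qed.

Let step_bound (S : Omega -> R) (r : R) (c : R) : measurable_fun setT S -> 0 <= c -> 0 <= r ->
  forall b : Omega -> R, measurable_fun setT b -> (forall w, `|b w| <= K) ->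
  (\int[P]_w (S w ^+ 2)%:E <= r%:E)%E ->
  (\int[P]_w (S w ^+ 2 + b w ^+ 2 * c)%:E <= (r + K ^+ 2 * c)%:E)%E.
Proof.
move=> mS c0 r0 b mb bK Sr.
apply: (@le_trans _ _ (\int[P]_w ((S w ^+ 2)%:E + (K ^+ 2 * c)%:E))%E).
  apply: ge0_le_integral => //.
  - move=> w _; rewrite lee_fin; apply: addr_ge0; first exact: sqr_ge0.
    by apply: mulr_ge0 => //; exact: sqr_ge0.
  - apply/measurable_EFinP; apply: measurable_funD; first exact: measurable_funX.
    by apply: measurable_funM => //; exact: measurable_funX.
  - by apply: emeasurable_funD => //; apply/measurable_EFinP; exact: measurable_funX.
  - move=> w _; rewrite -EFinD lee_fin lerD2l; apply: ler_wpM2r => //.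
    by rewrite -real_normK ?num_real//; apply: lerXn2r; rewrite ?nnegrE.
rewrite ge0_integralD//; last 3 first.
- by move=> w _; rewrite lee_fin sqr_ge0.
- by apply/measurable_EFinP; exact: measurable_funX.
- by move=> w _; rewrite lee_fin; apply: mulr_ge0 => //; exact: sqr_ge0.
by rewrite integral_cst//= [X in (_ * X)%E]probability_setT mule1 EFinD leeD2r.
Qed.

Lemma L2_sum_quad j N :
  (\int[P]_w ((\sum_(l < N) a l w * (xi j l w ^+ 2 - dt)) ^+ 2)%:E <=
   (N%:R * (K ^+ 2 * (128 * dt ^+ 2)))%:E)%E.
Proof.
elim: N => [|N ih].
  by under eq_integral do rewrite big_ord0 expr0n; rewrite integral0 mul0r.
have mS : gmeasurable (brownian_gen (N%:R * dt))
    (fun w => \sum_(l < N) a l w * (xi j l w ^+ 2 - dt)).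
  apply: (msum (f := fun l w => a l w * (xi j l w ^+ 2 - dt))) => l lN.
  apply: gmeasurableM; first by apply: maN; exact: ltnW.
  apply: gmeasurableB; last exact: gmeasurable_cst.
  by apply: gmeasurableX; exact: mxi.
have := L2_step_quad (dtl0 N) (dtS N) (gmeasurable_past mS) (gmeasurable_past (@ma N)).
move=> /(_ j); rewrite dtE => E1.
apply: (@le_trans _ _ (\int[P]_w ((\sum_(l < N) a l w * (xi j l w ^+ 2 - dt)) ^+ 2 +
     a N w ^+ 2 * (128 * dt ^+ 2))%:E)%E).
  apply: le_trans E1; rewrite le_eqVlt; apply/orP; left; apply/eqP.
  by apply: eq_integral => w _; rewrite big_ord_recr.
rewrite -(natr1 N) (mulrDl N%:R) mul1r.
have c0 : 0 <= 128 * dt ^+ 2 by rewrite mulr_ge0// sqr_ge0.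
have r0 : 0 <= N%:R * (K ^+ 2 * (128 * dt ^+ 2)).
  by apply: mulr_ge0 => //; apply: mulr_ge0 => //; exact: sqr_ge0.
exact: (step_bound (gmeasurableT mS) c0 r0 (gmeasurableT (@ma N)) (@aK N) ih).
Qed.

(** The increment of component [i] belongs to the past of that of component [j], so the product acts
    as a martingale increment; a second use of [L2_step_lin], for component [i], gives its
    variance. *)
Lemma L2_sum_cross i j N : i != j ->
  (\int[P]_w ((\sum_(l < N) a l w * (xi i l w * xi j l w)) ^+ 2)%:E <=
   (N%:R * (K ^+ 2 * dt ^+ 2))%:E)%E.
Proof.
move=> ij; elim: N => [|N ih].
  by under eq_integral do rewrite big_ord0 expr0n; rewrite integral0 mul0r.
have mS : gmeasurable (brownian_gen (N%:R * dt))
    (fun w => \sum_(l < N) a l w * (xi i l w * xi j l w)).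
  apply: (msum (f := fun l w => a l w * (xi i l w * xi j l w))) => l lN.
  apply: gmeasurableM; first by apply: maN; exact: ltnW.
  by apply: gmeasurableM; exact: mxi.
have maxi : gmeasurable (past W j (N%:R * dt) (N.+1%:R * dt)) (fun w => a N w * xi i N w).
  by apply: gmeasurableM; [exact: gmeasurable_past|exact: past_increment].
have E1 := L2_step_lin (dtl0 N) (dtS N) (gmeasurable_past mS) maxi.
have h0 : gmeasurable (past W i (N%:R * dt) (N.+1%:R * dt))
   (fun w => \sum_(l < N) a l w * (xi i l w * xi j l w)) by exact: gmeasurable_past.
have aT := gmeasurableT (@ma N); have ST := gmeasurableT mS.
have cst0 (c : R) : gmeasurable (past W i (N%:R * dt) (N.+1%:R * dt)) (cst c : Omega -> R).
  exact: gmeasurable_cst.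
have E2 := L2_step_lin (dtl0 N) (dtS N) (cst0 0) (gmeasurable_past (i := i) (t' := N.+1%:R * dt) (@ma N)).
rewrite dtE in E1; rewrite dtE in E2.
have sq0 (f : Omega -> R) w : (0 <= (f w ^+ 2)%:E)%E by rewrite lee_fin sqr_ge0.
have mXi : measurable_fun setT (fun w => xi i N w) by exact: mincr.
rewrite -(natr1 N) (mulrDl N%:R) mul1r.
have E3 : (\int[P]_w ((\sum_(l < N.+1) a l w * (xi i l w * xi j l w)) ^+ 2)%:E =
   \int[P]_w ((\sum_(l < N) a l w * (xi i l w * xi j l w)) ^+ 2)%:E +
   \int[P]_w (a N w ^+ 2 * dt ^+ 2)%:E)%E.
  transitivity (\int[P]_w (((\sum_(l < N) a l w * (xi i l w * xi j l w)) ^+ 2)%:E +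
     dt%:E * ((a N w * xi i N w) ^+ 2)%:E))%E.
    transitivity (\int[P]_w ((\sum_(l < N) a l w * (xi i l w * xi j l w)) ^+ 2 +
       (a N w * xi i N w) ^+ 2 * dt)%:E)%E.
      by rewrite -E1; apply: eq_integral => w _; rewrite big_ord_recr/= mulrA.
    by apply: eq_integral => w _; rewrite -EFinM -EFinD (mulrC dt).
  have maxiT : measurable_fun setT (fun w => ((a N w * xi i N w) ^+ 2)%:E).
    by apply/measurable_EFinP; apply: measurable_funX; apply: measurable_funM.
  have dt0' : (0 <= dt%:E)%E by rewrite lee_fin ltW.
  rewrite ge0_integralD//; try solve
    [by apply/measurable_EFinP; exact: measurable_funX | exact: emeasurable_funM
    |by move=> w _; rewrite ?mule_ge0// lee_fin sqr_ge0].
  congr (_ + _)%E; rewrite ge0_integralZl//; try solve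
    [by move=> w _; rewrite lee_fin ?sqr_ge0].
  have E2' : (\int[P]_w ((a N w * xi i N w) ^+ 2)%:E = \int[P]_w (a N w ^+ 2 * dt)%:E)%E.
    transitivity (\int[P]_w ((cst 0 w + a N w * xi i N w) ^+ 2)%:E)%E.
      by apply: eq_integral => w _; rewrite /= add0r.
    by rewrite E2; apply: eq_integral => w _; rewrite /= expr0n add0r.
  rewrite E2' -ge0_integralZl//; try solve
    [by apply/measurable_EFinP; apply: measurable_funM => //; exact: measurable_funX
    |by move=> w _; rewrite lee_fin mulr_ge0 ?sqr_ge0 ?ltW].
  by apply: eq_integral => w _; rewrite -EFinM; congr EFin; ring.
rewrite E3 -ge0_integralD//; try solve
  [by apply/measurable_EFinP; exact: measurable_funX
  |by apply/measurable_EFinP; apply: measurable_funM => //; exact: measurable_funX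
  |by move=> w _; rewrite lee_fin ?sqr_ge0// mulr_ge0 ?sqr_ge0].
under eq_integral do rewrite -EFinD.
have r0 : 0 <= N%:R * (K ^+ 2 * dt ^+ 2).
  by apply: mulr_ge0 => //; apply: mulr_ge0; exact: sqr_ge0.
exact: (step_bound (gmeasurableT mS) (sqr_ge0 dt) r0 (gmeasurableT (@ma N)) (@aK N) ih).
Qed.

End discrete_isometry.

End increments.

(** * Integrals and softmax coordinates *)

Section continuity_on_half_line.
Context {R : realType}.
Implicit Types g h : R -> R.

Definition cts0 g := {within `[0, +oo[, continuous g}.

Lemma cts0_cst (c : R) : cts0 (fun=> c).
Proof. by move=> x; exact: cvg_cst. Qed.

Lemma cts0D g h : cts0 g -> cts0 h -> cts0 (fun s => g s + h s).
Proof. by move=> cg ch x; apply: cvgD; [exact: cg|exact: ch]. Qed.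

Lemma cts0M g h : cts0 g -> cts0 h -> cts0 (fun s => g s * h s).
Proof. by move=> cg ch x; apply: cvgM; [exact: cg|exact: ch]. Qed.

Lemma cts0N g : cts0 g -> cts0 (fun s => - g s).
Proof. by move=> cg x; apply: cvgN; exact: cg. Qed.

Lemma cts0B g h : cts0 g -> cts0 h -> cts0 (fun s => g s - h s).
Proof. by move=> cg ch; apply: cts0D => //; exact: cts0N. Qed.

Lemma cts0_sum (I : Type) (r : seq I) (f : I -> R -> R) :
  (forall i, cts0 (f i)) -> cts0 (fun s => \sum_(i <- r) f i s).
Proof.
move=> cf; elim: r => [|i r ih].
  rewrite (_ : (fun s => _) = fun=> 0); first exact: cts0_cst.
  by apply/funext => s; rewrite big_nil.
rewrite (_ : (fun s => _) = (fun s => f i s + \sum_(i <- r) f i s)).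
  exact: cts0D.
by apply/funext => s; rewrite big_cons.
Qed.

Definition ucont g := forall T e, 0 < e -> exists2 dl, 0 < dl &
  forall u v, 0 <= u <= T -> 0 <= v <= T -> `|u - v| <= dl -> `|g u - g v| <= e.

Lemma cts0_near g u : cts0 g -> 0 <= u -> forall e, 0 < e -> exists2 dl, 0 < dl &
  forall v, 0 <= v -> `|u - v| < dl -> `|g u - g v| <= e.
Proof.
move=> /subspace_continuousP cg u0 e e0.
have /cg : `[0, +oo[%classic u by rewrite /= in_itv/= u0.
move/cvgrPdist_le => /(_ _ e0); rewrite near_withinE => -[dl /= dl0 h].
exists dl => // v v0 uv; apply: h => //.
by rewrite /= in_itv/= v0.
Qed.

Lemma cts0_ucont g : cts0 g -> ucont g.
Proof.
move=> cg T e e0.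
have e20 : 0 < e / 2 by rewrite divr_gt0.
pose Pr (dl : R) (u : R) := forall v, 0 <= u -> 0 <= v -> `|u - v| <= dl -> `|g u - g v| <= e.
have /compact_near_coveringP ncov := @segment_compact R 0 T.
have : \forall dl \near (0 : R)^'+, `[0, T]%classic `<=` Pr dl.
  apply: ncov => u; rewrite /= in_itv/= => /andP[u0 uT].
  have [r r0 hr] := cts0_near cg u0 e20.
  have r20 : 0 < r / 2 by rewrite divr_gt0.
  exists (ball u (r / 2), [set dl | dl < r / 2]).
    split => /=; first exact: nbhsx_ballx.
    exact: nbhs_right_lt.
  move=> [x dl] /= [ux dlr] v x0 v0 xv.
  have h1 : `|g u - g x| <= e / 2 by apply: hr => //; rewrite (lt_trans ux)//; lra.
  have h2 : `|g u - g v| <= e / 2.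
    apply: hr => //; have -> : u - v = (u - x) + (x - v) by ring.
    rewrite (le_lt_trans (ler_normD _ _))// [ltRHS](splitr r).
    by rewrite ltrD// (le_lt_trans xv).
  have -> : g x - g v = - (g u - g x) + (g u - g v) by ring.
  by rewrite (le_trans (ler_normD _ _))// normrN [leRHS](splitr e) lerD.
move=> [r /= r0 hr]; exists (r / 2) => [|u v /andP[u0 uT] /andP[v0 vT] uv].
  by rewrite divr_gt0.
apply: (hr (r / 2)) => //=.
- by rewrite sub0r normrN gtr0_norm ?divr_gt0//; lra.
- by rewrite divr_gt0.
- by rewrite in_itv/= u0.
Qed.

Definition J g (t : R) : R := \int[lebesgue_measure]_(s in `[0, t]) g s.

Lemma J0 g : J g 0 = 0.
Proof. by rewrite /J set_itv1 Rintegral_set1. Qed.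

(** The form in which integrals are mostly used below: over a short interval the integral is
    compared with that of a constant rate [c], whose choice is left to the caller. *)
Lemma J_incr g (a b c e : R) : lebesgue_measure.-integrable `[0, b] (EFin \o g) ->
  0 <= a -> a <= b -> (forall u, a < u -> u <= b -> `|g u - c| <= e) ->
  `|J g b - J g a - c * (b - a)| <= e * (b - a).
Proof.
move=> ig a0 ab hc; rewrite /J Rintegral_itvB ?bnd_simp//.
have ig' : lebesgue_measure.-integrable `]a, b] (EFin \o g).
  by apply: integrableS ig => //; apply: subset_itvr; rewrite bnd_simp.
have mab : (lebesgue_measure `]a, b] = (b - a)%:E)%E.
  rewrite lebesgue_measure_itv/= lte_fin; case: ltP => //.
  by move=> ba; rewrite (_ : b = a) ?subrr//; apply/eqP; rewrite eq_le ba.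
have icst k : lebesgue_measure.-integrable `]a, b] (EFin \o (fun=> k : R)).
  apply: measurable_bounded_integrable => //=; first by rewrite mab ltry.
  by exists `|k|; split; [exact: num_real|move=> M kM x _ /=; exact: ltW].
have <- : \int[lebesgue_measure]_(x in `]a, b]) c = c * (b - a).
  by rewrite Rintegral_cst//= mab.
have <- : \int[lebesgue_measure]_(x in `]a, b]) e = e * (b - a).
  by rewrite Rintegral_cst//= mab.
rewrite -RintegralB//.
have igc : lebesgue_measure.-integrable `]a, b] (EFin \o (fun x => g x - c)).
  have mI : measurable (`]a, b]%classic : set (measurableTypeR R)) := measurable_itv _.
  have := integrableB mI ig' (icst c).
  by congr (lebesgue_measure.-integrable _ _).
rewrite (le_trans (le_normr_Rintegral _ igc))//.
apply: le_Rintegral => //; first exact: integrable_norm.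
by move=> u; rewrite /= in_itv/= => /andP[au ub]; exact: hc.
Qed.

Lemma cts0_integrable g b : cts0 g -> lebesgue_measure.-integrable `[0, b] (EFin \o g).
Proof.
move=> cg; apply: continuous_compact_integrable; first exact: segment_compact.
apply: continuous_subspaceW cg => x; rewrite /= !in_itv/= => /andP[-> _].
by rewrite andbT.
Qed.

Lemma cts0_bounded g (T : R) : cts0 g ->
  exists2 c, 0 <= c & forall u, 0 <= u -> u <= T -> `|g u| <= c.
Proof.
move=> cg; have [T0|T0] := leP 0 T; last first.
  by exists 0 => // u u0 uT; have := le_trans u0 uT; rewrite leNgt T0.
have [c hc] : exists c, forall u, u \in `[0, T] -> g u <= c /\ - c <= g u.
  have cg' : {within `[0, T], continuous g}.
    apply: continuous_subspaceW cg => y; rewrite /= !in_itv/= => /andP[-> _].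
    by rewrite andbT.
  have [M _ hM] := EVT_max T0 cg'; have [m _ hm] := EVT_min T0 cg'.
  exists (`|g M| + `|g m|) => u uI; split.
    by rewrite (le_trans (hM _ uI))// (le_trans (ler_norm _))// lerDl.
  apply: le_trans (hm _ uI); rewrite lerNl (le_trans (ler_norm _))// normrN lerDr//.
exists `|c| => // u u0 ux; have [|h1 h2] := hc u; first by rewrite in_itv/= u0.
by rewrite ler_norml; have := ler_norm c; lra.
Qed.

Lemma J_bound g (b c : R) : cts0 g -> 0 <= b -> (forall u, 0 <= u -> u <= b -> `|g u| <= c) ->
  `|J g b| <= c * b.
Proof.
move=> cg b0 hc; have := @J_incr g 0 b 0 c (cts0_integrable b cg) (lexx _) b0.
rewrite J0 !subr0 mul0r subr0; apply => u u0 ub.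
by rewrite subr0; apply: hc => //; exact: ltW.
Qed.

Lemma J_increment_bound g (a b c : R) : cts0 g -> 0 <= a -> a <= b ->
  (forall u, 0 <= u -> u <= b -> `|g u| <= c) -> `|J g b - J g a| <= c * (b - a).
Proof.
move=> cg a0 ab hc; have := @J_incr g a b 0 c (cts0_integrable b cg) a0 ab.
rewrite mul0r subr0; apply => u au ub; rewrite subr0; apply: hc => //.
by rewrite (le_trans a0)// ltW.
Qed.

Lemma J_cts0 g : cts0 g -> cts0 (J g).
Proof.
move=> cg; apply/subspace_continuousP => x; rewrite /= in_itv/= andbT => x0.
have [dl dl0 hdl] := cts0_ucont cg (x + 1) ltr01.
have bnd : exists2 c, 0 <= c & forall u, 0 <= u -> u <= x + 1 -> `|g u| <= c.
  exact: cts0_bounded.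
have [c c0 hc] := bnd.
apply/cvgrPdist_le => e e0; rewrite near_withinE.
exists (Num.min 1 (e / (c + 1))) => /=.
  by rewrite lt_min ltr01 divr_gt0// ltr_wpDl.
move=> y /=; rewrite lt_min => /andP[xy1 xye]; rewrite in_itv/= andbT => y0.
have key a b : 0 <= a -> a <= b -> b <= x + 1 -> `|a - b| < e / (c + 1) -> `|J g b - J g a| <= e.
  move=> a0 ab bx abe; apply: (le_trans (@J_increment_bound g a b c cg a0 ab _)).
    by move=> u u0 ub; apply: hc => //; exact: le_trans bx.
  rewrite -(@ger0_norm _ (b - a)) ?subr_ge0// distrC.
  have c10 : 0 < c + 1 by rewrite ltr_wpDl.
  move: abe; rewrite ltr_pdivlMr// => /ltW; apply: le_trans.
  by rewrite mulrC ler_wpM2l// lerDl.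
have [xy|yx] := leP x y.
  rewrite distrC; apply: key => //.
  by move: xy1; rewrite ltr_norml; lra.
by apply: key => //; [exact: ltW| lra| rewrite distrC].
Qed.

Lemma riemann_sum g t : cts0 g -> 0 <= t ->
  (fun N => \sum_(k < N.+1) g (k%:R * (t / N.+1%:R)) * (t / N.+1%:R)) @ \oo --> J g t.
Proof.
move=> cg t0; apply/cvgrPdist_le => e e0.
have e10 : 0 < e / (t + 1) by rewrite divr_gt0// ltr_wpDl.
have [dl dl0 hdl] := cts0_ucont cg t e10.
have [N0 hN0] : exists N0 : nat, t / dl < N0%:R.
  exists (Num.truncn (t / dl)).+1; exact: truncnS_gt.
near=> N; set dt := t / N.+1%:R.
have N0' : 0 < N.+1%:R :> R by rewrite ltr0n.
have dt0 : 0 <= dt by rewrite divr_ge0.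
have dtl : dt <= dl.
  rewrite /dt ler_pdivrMr// mulrC -ler_pdivrMr// ltW// (lt_le_trans hN0)// ler_nat.
  by rewrite ltnW// ltnS; near: N; exact: nbhs_infty_ge.
have Ndt : N.+1%:R * dt = t by rewrite /dt mulrC divfK// gt_eqF.
(* The error is at most [e / (t + 1)] per unit of time and adds up over the cells; [t + 1] instead
   of [t] covers [t = 0]. *)
have H M : (M <= N.+1)%N ->
    `|J g (M%:R * dt) - \sum_(k < M) g (k%:R * dt) * dt| <= e / (t + 1) * (M%:R * dt).
  elim: M => [_|M ih MN]; first by rewrite big_ord0 !mul0r J0 subrr normr0 mulr0.
  have MM : M%:R * dt <= M.+1%:R * dt by rewrite ler_wpM2r// ler_nat.
  have Mt : M.+1%:R * dt <= t by rewrite -Ndt ler_wpM2r// ler_nat.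
  have M0 : 0 <= M%:R * dt by rewrite mulr_ge0.
  have dtE : M.+1%:R * dt - M%:R * dt = dt by rewrite -(natr1 M); ring.
  have := @J_incr g _ _ (g (M%:R * dt)) (e / (t + 1)) (cts0_integrable _ cg) M0 MM.
  rewrite dtE => /(_ _) h; rewrite big_ord_recr/=.
  have -> : J g (M.+1%:R * dt) - (\sum_(i < M) g (i%:R * dt) * dt + g (M%:R * dt) * dt) =
    (J g (M%:R * dt) - \sum_(i < M) g (i%:R * dt) * dt) +
    (J g (M.+1%:R * dt) - J g (M%:R * dt) - g (M%:R * dt) * dt) by ring.
  rewrite (le_trans (ler_normD _ _))//.
  have -> : e / (t + 1) * (M.+1%:R * dt) = e / (t + 1) * (M%:R * dt) + e / (t + 1) * dt.
    by rewrite -(natr1 M); ring.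
  apply: lerD; first by apply: ih; exact: ltnW.
  apply: h => u u1 u2; apply: hdl.
  - by rewrite (le_trans M0 (ltW u1)) (le_trans u2).
  - by rewrite M0 (le_trans MM).
  - by rewrite ger0_norm ?subr_ge0 ?(ltW u1)//; lra.
rewrite -[X in J g X]Ndt (le_trans (H _ (leqnn _)))// Ndt.
by rewrite mulrAC ler_pdivrMr ?ltr_wpDl// ler_wpM2l ?(ltW e0)// lerDl.
Unshelve. all: by end_near. Qed.

End continuity_on_half_line.

Section log_taylor.
Context {R : realType}.

(** The function [h x = ln x - x + (x - 1) ^+ 2 / 2] has derivative [(x - 1) ^+ 2 / x], at most
    [2 * (x - 1) ^+ 2] for [x >= 1 / 2]; the mean value theorem is applied between 1 and [1 + z]. *)
Lemma ln1_taylor (z : R) : `|z| <= 1 / 2 -> `|ln (1 + z) - z + z ^+ 2 / 2| <= 2 * `|z| ^+ 3.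
Proof.
pose h (x : R) := ln x - x + (x - 1) ^+ 2 / 2.
pose dh (x : R) := x^-1 - 1 + (x - 1).
have hE : h = (@ln R - id + (2^-1 : R) *: ((id - cst 1) * (id - cst 1))) :> (R -> R).
  by apply/funext => x; rewrite /h !fctE /= /GRing.scale/= expr2 mulrC.
have dhE (x : R) : 0 < x -> is_derive x (1 : R) h (dh x).
  move=> x0; have dln := is_derive1_ln x0; rewrite hE.
  have d1 := is_deriveB (is_derive_id x 1) (is_derive_cst (1 : R) x 1).
  have d2 := is_deriveD (is_deriveB dln (is_derive_id x 1)) (is_deriveZ 2^-1 (is_deriveM d1 d1)).
  apply: (is_derive_eq d2); rewrite /dh /= !fctE /GRing.scale/=.
  by field; rewrite gt_eqF.
have dhb x : 1 / 2 <= x -> `|dh x| <= 2 * (x - 1) ^+ 2.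
  move=> x12; have x0 : 0 < x by lra.
  have -> : dh x = (x - 1) ^+ 2 / x by rewrite /dh; field; rewrite gt_eqF.
  rewrite ger0_norm; last by rewrite divr_ge0 ?sqr_ge0 ?ltW.
  rewrite mulrC ler_wpM2r ?sqr_ge0//.
  by rewrite -[leLHS]mul1r ler_pdivrMr//; lra.
have hcont (x : R) : 0 < x -> {for x, continuous h}.
  move=> x0; apply: differentiable_continuous; apply/derivable1_diffP.
  by have := dhE _ x0 => -[].
move=> z12; have := z12; rewrite ler_norml => /andP[z1 z2].
have h1 : h 1 = - 1 by rewrite /h ln1; field.
have -> : ln (1 + z) - z + z ^+ 2 / 2 = h (1 + z) - h 1.
  by rewrite h1 /h; ring.
have fin c : `|c - 1| <= `|z| -> 1 / 2 <= c -> `|dh c * z| <= 2 * `|z| ^+ 3.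
  move=> cz c12; rewrite normrM exprS mulrCA mulrC ler_wpM2l//.
  apply: (le_trans (dhb _ c12)); rewrite ler_pM2l//.
  by rewrite -(real_normK (num_real (c - 1))) lerXn2r// nnegrE.
have [z0|z0|->] := ltgtP z 0; last first.
- by rewrite addr0 subrr normr0 expr0n mulr0.
- have [|||c] := @MVT R h dh 1 (1 + z).
  + by rewrite ltrDl.
  + by move=> x; rewrite in_itv/= => /andP[x1 _]; apply: dhE; lra.
  + apply: continuous_in_subspaceT => x; rewrite inE/= in_itv/= => /andP[x1 _].
    by apply: hcont; lra.
  rewrite in_itv/= => /andP[c1 cz] ->; rewrite addrAC subrr add0r; apply: fin; last by lra.
  by rewrite !gtr0_norm//; lra.
- have [|||c] := @MVT R h dh (1 + z) 1.
  + by rewrite gtrDl.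
  + by move=> x; rewrite in_itv/= => /andP[x1 _]; apply: dhE; lra.
  + apply: continuous_in_subspaceT => x; rewrite inE/= in_itv/= => /andP[x1 _].
    by apply: hcont; lra.
  rewrite in_itv/= => /andP[c1 cz] E; rewrite distrC E.
  have -> : dh c * (1 - (1 + z)) = - (dh c * z) by ring.
  rewrite normrN; apply: fin; last by lra.
  by rewrite !ltr0_norm//; lra.
Qed.

End log_taylor.

(** * Softmax coordinates on the interior of the simplex *)

Section softmax.
Context {R : realType} {n : nat}.
Implicit Types a b : 'I_n -> R.

Definition softmax a : 'cV[R]_n := \col_i (expR (a i) / \sum_j expR (a j)).

Lemma softmax_sum_gt0 a (i : 'I_n) : 0 < \sum_j expR (a j).
Proof.
by rewrite (bigD1 i)//= ltr_pwDl ?expR_gt0// sumr_ge0.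
Qed.

Lemma softmax_gt0 a i : 0 < softmax a i 0.
Proof. by rewrite mxE divr_gt0 ?expR_gt0// (softmax_sum_gt0 a i). Qed.

Lemma softmax_sum1 a (i : 'I_n) : \sum_j softmax a j 0 = 1.
Proof.
under eq_bigr do rewrite mxE.
by rewrite -mulr_suml divff// gt_eqF// (softmax_sum_gt0 a i).
Qed.

Lemma softmax_le1 a i : softmax a i 0 <= 1.
Proof.
rewrite -(softmax_sum1 a i) (bigD1 i)//= lerDl sumr_ge0// => j _.
by rewrite ltW// softmax_gt0.
Qed.

Lemma int_simplex_softmax a : (0 < n)%N -> int_simplex (softmax a).
Proof.
move=> n0; split; last by move=> i; exact: softmax_gt0.
split; last exact: (softmax_sum1 a (Ordinal n0)).
by move=> i; rewrite ltW ?softmax_gt0//= softmax_le1.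
Qed.

Lemma softmax_ln (x : 'cV[R]_n) : int_simplex x -> softmax (fun i => ln (x i 0)) = x.
Proof.
move=> [[_ x1] x0]; apply/matrixP => i j; rewrite ord1 mxE.
under eq_bigr do rewrite lnK ?posrE//.
by rewrite x1 divr1 lnK// posrE.
Qed.

Lemma ln_softmax a i : ln (softmax a i 0) = a i - ln (\sum_j expR (a j)).
Proof.
by rewrite mxE ln_div ?posrE ?expR_gt0// ?(softmax_sum_gt0 a i)// expRK.
Qed.

(** Vectors with the same differences of coordinates differ by a constant vector, which [softmax]
    does not see. *)
Lemma softmax_lse (x : 'cV[R]_n) a : int_simplex x ->
  (forall i j, ln (x i 0) - ln (x j 0) = a i - a j) -> x = softmax a.
Proof.
move=> xI h; rewrite -[LHS]softmax_ln//; apply/matrixP => i j; rewrite ord1 !mxE.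
have E k : expR (ln (x k 0)) = expR (a k) * expR (ln (x i 0) - a i).
  by rewrite -expRD; congr expR; have := h k i; lra.
under eq_bigr do rewrite E.
by rewrite -mulr_suml E -mulf_div divff ?mulr1// gt_eqF// expR_gt0.
Qed.

Let expR_sub_le (e : R) : 0 <= e -> e <= 1 / 2 -> expR (2 * e) - 1 <= 6 * e.
Proof.
move=> e0 e1.
have h : expR e <= (1 - e)^-1.
  have e1' : 0 < 1 - e by lra.
  rewrite -[leLHS]invrK lef_pV2 ?posrE ?invr_gt0 ?expR_gt0// -expRN.
  exact: expR_ge1Dx.
have -> : expR (2 * e) = expR e ^+ 2 by rewrite -expRM_natl.
have : expR e ^+ 2 <= ((1 - e)^-1) ^+ 2.
  by apply: lerXn2r => //; rewrite nnegrE ?expR_ge0// invr_ge0; lra.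
suff : ((1 - e)^-1) ^+ 2 <= 1 + 6 * e by lra.
rewrite exprVn -[leLHS]mul1r ler_pdivrMr; last by rewrite exprn_gt0//; lra.
have -> : (1 + 6 * e) * (1 - e) ^+ 2 = 1 + e * ((1 - 2 * e) * (4 - 3 * e)) by ring.
by rewrite lerDl mulr_ge0// mulr_ge0//; lra.
Qed.

Lemma softmax_ratio a b (e : R) i : (forall i, `|a i - b i| <= e) ->
  softmax a i 0 <= expR (2 * e) * softmax b i 0.
Proof.
move=> ab; rewrite !mxE.
have sa := softmax_sum_gt0 a i; have sb := softmax_sum_gt0 b i.
have h1 : expR (a i) <= expR e * expR (b i).
  by rewrite -expRD ler_expR; have := ab i; rewrite ler_norml; lra.
have h2 : \sum_j expR (b j) <= expR e * \sum_j expR (a j).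
  rewrite mulr_sumr; apply: ler_sum => j _; rewrite -expRD ler_expR.
  by have := ab j; rewrite ler_norml; lra.
rewrite ler_pdivrMr//.
have -> : expR (2 * e) * (expR (b i) / \sum_j expR (b j)) * \sum_j expR (a j) =
    expR e * expR (b i) * (expR e * (\sum_j expR (a j)) / \sum_j expR (b j)).
  have -> : expR (2 * e) = expR e * expR e by rewrite -expRD; congr expR; ring.
  by ring.
apply: (le_trans h1); rewrite -[leLHS]mulr1 ler_pM2l ?mulr_gt0 ?expR_gt0//.
by rewrite ler_pdivlMr// mul1r.
Qed.

(** Each coordinate changes by a factor at most [expR (2 * e)], and [expR (2 * e) - 1 <= 6 * e] when
    [e <= 1 / 2]. For larger [e] the bound exceeds the length of the unit interval. *)
Lemma lip_softmax a b (e : R) i : (forall i, `|a i - b i| <= e) ->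
  `|softmax a i 0 - softmax b i 0| <= 6 * e.
Proof.
move=> ab; have e0 : 0 <= e by exact: le_trans (normr_ge0 _) (ab i).
have ba j : `|b j - a j| <= e by rewrite distrC.
have a0 := softmax_gt0 a i; have a1 := softmax_le1 a i.
have b0 := softmax_gt0 b i; have b1 := softmax_le1 b i.
have [e12|e12] := leP e (1 / 2); last first.
  rewrite ler_norml; apply/andP; split; lra.
have h := expR_sub_le e0 e12.
have h1 := softmax_ratio i ab; have h2 := softmax_ratio i ba.
have E0 : 0 <= expR (2 * e) - 1 by rewrite subr_ge0 -[leLHS]expR0 ler_expR; lra.
have h3 : (expR (2 * e) - 1) * softmax b i 0 <= expR (2 * e) - 1 by rewrite ler_piMr.
have h4 : (expR (2 * e) - 1) * softmax a i 0 <= expR (2 * e) - 1 by rewrite ler_piMr.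
move: h h1 h2 E0 h3 h4 a0 a1 b0 b1.
move: (softmax a i 0) (softmax b i 0) (expR (2 * e)) => x y E h h1 h2 E0 h3 h4 x0 x1 y0 y1.
by rewrite ler_norml; apply/andP; split; nra.
Qed.

End softmax.

(** * Convergence in probability *)

Section convergence_in_probability.
Context {d : measure_display} {T : measurableType d} {R : realType}.
Variable P : probability T R.
Implicit Types Z : nat -> T -> R.

Lemma cvge0P (u : nat -> \bar R) : (forall m, u m \is a fin_num) -> (forall m, (0 <= u m)%E) ->
  u @ \oo --> (0 : \bar R)%E <->
  forall e : R, 0 < e -> exists M, forall m, (M <= m)%N -> (u m <= e%:E)%E.
Proof.
move=> ufin u0; split.
  move=> /fine_cvgP[_ /cvgrPdist_le h] e e0.
  have [M _ hM] := h e e0; exists M => m Mm.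
  have := hM m Mm; rewrite /= sub0r normrN => h1.
  by rewrite -[u m]fineK// lee_fin (le_trans (ler_norm _)).
move=> h; apply/fine_cvgP; split; first exact: nearW.
apply/cvgrPdist_le => e /h[M hM]; near=> m.
rewrite /= sub0r normrN ger0_norm ?fine_ge0// -lee_fin fineK//; apply: hM.
by near: m; exact: nbhs_infty_ge.
Unshelve. all: by end_near. Qed.

Definition cvgp Z := forall e eta : R, 0 < e -> 0 < eta -> exists M, forall m, (M <= m)%N ->
  (P [set w | (e <= `|Z m w|)%R] <= eta%:E)%E.

Lemma measurable_ge_norm (f : T -> R) (e : R) : measurable_fun setT f ->
  measurable [set w | (e <= `|f w|)%R].
Proof.
move=> mf; rewrite -[X in measurable X]setTI.
rewrite (_ : [set w | _] = (fun w => `|f w|) @^-1` `[e, +oo[%classic); last first.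
  by apply/seteqP; split=> w /=; rewrite in_itv/= andbT.
have mnf : measurable_fun setT (fun w => `|f w|) by exact: measurableT_comp.
exact: mnf.
Qed.

Lemma markov_ge (f : T -> R) (c : R) : measurable_fun setT f -> (forall w, 0 <= f w) ->
  0 < c -> (c%:E * P [set w | (c <= f w)%R] <= \int[P]_w (f w)%:E)%E.
Proof.
move=> mf f0 c0.
have mA : measurable [set w | (c <= f w)%R].
  have := measurable_ge_norm c mf.
  rewrite (_ : [set w | (c <= `|f w|)%R] = [set w | (c <= f w)%R])//.
  by apply/seteqP; split=> w /=; rewrite ger0_norm.
rewrite -[X in P X]setIT -integral_indic//.
have mi : measurable_fun setT (fun w => (\1_[set w | (c <= f w)%R] w)%:E : \bar R).
  by apply/measurable_EFinP; exact: measurable_indic.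
rewrite -ge0_integralZl//; try solve [by move=> w _; rewrite lee_fin|by rewrite lee_fin ltW].
apply: ge0_le_integral => //; try solve [by apply: emeasurable_funM|exact/measurable_EFinP|
  by move=> w _; rewrite -EFinM lee_fin mulr_ge0 ?(ltW c0)].
move=> w _; rewrite -EFinM lee_fin indicE.
have [h|h] := pselect (c <= f w); first by rewrite mem_set//= mulr1.
by rewrite memNset//= mulr0 f0.
Qed.

Lemma cvgp_L1 Z (b : nat -> R) : (forall m, measurable_fun setT (Z m)) ->
  (forall m w, 0 <= Z m w) ->
  (forall m, (\int[P]_w (Z m w)%:E <= (b m)%:E)%E) -> b @ \oo --> (0 : R) -> cvgp Z.
Proof.
move=> mZ Z0 Zb /cvgrPdist_le b0 e eta e0 eta0.
have [M _ hM] := b0 (e * eta) (mulr_gt0 e0 eta0); exists M => m Mm.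
have := markov_ge (mZ m) (Z0 m) e0.
move=> /le_trans /(_ (Zb m)) h.
have -> : [set w | (e <= `|Z m w|)%R] = [set w | (e <= Z m w)%R].
  by apply/seteqP; split=> w /=; rewrite ger0_norm.
have := hM m Mm; rewrite /= sub0r normrN => /(le_trans (ler_norm _)) bm.
rewrite -(@lee_pmul2l _ e%:E)// -EFinM.
by rewrite (le_trans h)// lee_fin.
Qed.

Lemma cvgp_L2 Z (b : nat -> R) : (forall m, measurable_fun setT (Z m)) ->
  (forall m, (\int[P]_w (Z m w ^+ 2)%:E <= (b m)%:E)%E) -> b @ \oo --> (0 : R) -> cvgp Z.
Proof.
move=> mZ Zb b0 e eta e0 eta0.
have := @cvgp_L1 (fun m w => Z m w ^+ 2) b; case/(_ _ _ Zb b0 (e ^+ 2) eta) => //.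
- by move=> m; exact: measurable_funX.
- by move=> m w; rewrite sqr_ge0.
- by rewrite exprn_gt0.
move=> M hM; exists M => m /hM.
rewrite (_ : [set w | (e ^+ 2 <= `|Z m w ^+ 2|)%R] = [set w | (e <= `|Z m w|)%R])//.
by apply/seteqP; split=> w /=; rewrite normrX ler_pXn2r// nnegrE ltW.
Qed.

(** Dominated convergence for the indicators of the events [A m]. *)
Lemma cvgp_ae Z : (forall m, measurable_fun setT (Z m)) ->
  {ae P, forall w, Z m w @[m --> \oo] --> 0} -> cvgp Z.
Proof.
move=> mZ hZ e eta e0 eta0.
pose A m := [set w | (e <= `|Z m w|)%R].
have mA m : measurable (A m) by exact: measurable_ge_norm.
have : \int[P]_w (\1_(A m) w) @[m --> \oo] --> \int[P]_w (cst 0 w : R).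
  apply: (@Ex_dct _ _ _ P (fun m => \1_(A m)) (cst 0) 1) => //.
  - by move=> m w; rewrite indicE; case: (_ \in _); rewrite ?normr1 ?normr0.
  - apply: filterS hZ => w /cvgrPdist_lt /(_ _ e0) [M _ hM].
    apply/cvgrPdist_le => r r0; near=> m.
    rewrite /= indicE; case: (boolP (w \in A m)) => [|_]; last by rewrite subrr normr0 ltW.
    rewrite inE /A /= => h; exfalso; have : (M <= m)%N by near: m; exact: nbhs_infty_ge.
    by move=> /hM; rewrite /= sub0r normrN ltNge h.
rewrite Ex_cst => /cvgrPdist_le /(_ _ eta0)[M _ hM]; exists M => m Mm.
have := hM m Mm; rewrite /= sub0r normrN => /(le_trans (ler_norm _)).
have -> : \int[P]_w \1_(A m) w = fine (P (A m)).
  by rewrite /Rintegral integral_indic// setIT.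
by rewrite -lee_fin fineK// fin_num_measure.
Unshelve. all: by end_near. Qed.

Lemma cvgp_le Z Z' : (forall m, measurable_fun setT (Z m)) ->
  (forall m, measurable_fun setT (Z' m)) ->
  (forall m, {ae P, forall w, `|Z m w| <= `|Z' m w|}) -> cvgp Z' -> cvgp Z.
Proof.
move=> mZ mZ' ZZ' cZ' e eta e0 eta0; have [M hM] := cZ' e eta e0 eta0.
exists M => m /hM; apply: le_trans.
have [N [mN N0 hN]] := ZZ' m.
have -> : P [set w | (e <= `|Z' m w|)%R] = (P ([set w | (e <= `|Z' m w|)%R] `|` N)).
  rewrite measureU0//; exact: measurable_ge_norm.
apply: le_measure; rewrite ?inE.
- exact: measurable_ge_norm.
- by apply: measurableU => //; exact: measurable_ge_norm.
- move=> w /= ew; have [Nw|Nw] := pselect (N w); [by right|left].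
  apply: (le_trans ew); apply: contrapT => h; apply: Nw; apply: hN => /= h'; exact: h.
Qed.

Lemma cvgpD Z Z' : (forall m, measurable_fun setT (Z m)) ->
  (forall m, measurable_fun setT (Z' m)) -> cvgp Z -> cvgp Z' ->
  cvgp (fun m w => Z m w + Z' m w).
Proof.
move=> mZ mZ' cZ cZ' e eta e0 eta0.
have e20 : 0 < e / 2 by rewrite divr_gt0.
have eta20 : 0 < eta / 2 by rewrite divr_gt0.
have [M hM] := cZ _ _ e20 eta20; have [M' hM'] := cZ' _ _ e20 eta20.
exists (maxn M M') => m; rewrite geq_max => /andP[/hM h /hM' h'].
apply: (@le_trans _ _ (P ([set w | (e / 2 <= `|Z m w|)%R] `|` [set w | (e / 2 <= `|Z' m w|)%R]))).
  apply: le_measure; rewrite ?inE.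
  - by apply: measurable_ge_norm; exact: measurable_funD.
  - by apply: measurableU; exact: measurable_ge_norm.
  - move=> w /= ew; have [h1|h1] := leP (e / 2) `|Z m w|; [by left|right].
    have := ler_normD (Z m w) (Z' m w); lra.
apply: le_trans (measureU2 _ _ _) _; [exact: measurable_ge_norm|exact: measurable_ge_norm|].
by rewrite [leRHS](_ : _ = ((eta / 2)%:E + (eta / 2)%:E)%E) ?leeD// -EFinD -splitr.
Qed.

Lemma cvgp0 : cvgp (fun _ _ => 0).
Proof.
move=> e eta e0 eta0; exists 0%N => m _.
have -> : [set w : T | (e <= `|(0 : R)|)%R] = set0.
  by apply/seteqP; split=> [w|w []]; rewrite /= normr0 leNgt e0.
by rewrite measure0 lee_fin ltW.
Qed.

Lemma cvgp_sum (I : Type) (r : seq I) (Z : I -> nat -> T -> R) :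
  (forall i m, measurable_fun setT (Z i m)) -> (forall i, cvgp (Z i)) ->
  cvgp (fun m w => \sum_(i <- r) Z i m w).
Proof.
move=> mZ cZ; elim: r => [|i r ih].
  rewrite (_ : (fun m w => _) = (fun _ _ => 0)); first exact: cvgp0.
  by apply/funext => m; apply/funext => w; rewrite big_nil.
rewrite (_ : (fun m w => _) = (fun m w => Z i m w + \sum_(i <- r) Z i m w)).
  by apply: cvgpD => // m; exact: measurable_sum.
by apply/funext => m; apply/funext => w; rewrite big_cons.
Qed.

Lemma cvgp_norm Z : cvgp Z -> cvgp (fun m w => `|Z m w|).
Proof.
move=> cZ e eta e0 eta0; have [M hM] := cZ e eta e0 eta0; exists M => m /hM.
by under [X in (P [set w | is_true (_ <= X w)%R] <= _)%E -> _]eq_fun do rewrite -normr_id.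
Qed.

Lemma borel_cantelli_ae (F : nat -> set T) (b : nat -> R) (B : R) :
  (forall k, measurable (F k)) -> (forall k, (P (F k) <= (b k)%:E)%E) ->
  (forall N, \sum_(k < N) b k <= B) ->
  {ae P, forall w, exists K, forall k, (K <= k)%N -> ~ F k w}.
Proof.
move=> mF Fb bB.
have h0 : P (lim_sup_set F) = 0%E.
  apply: lim_sup_set_cvg0 => //; apply: (@le_lt_trans _ _ B%:E); last exact: ltry.
  apply: lime_le; first by apply: is_cvg_nneseries => k _ _; exact: measure_ge0.
  apply: nearW => N; rewrite big_mkord.
  apply: (@le_trans _ _ (\sum_(k < N) (b k)%:E)%E); first by apply: lee_sum => k _; exact: Fb.
  by rewrite sumEFin lee_fin.
exists (lim_sup_set F); split => //.
  apply: bigcapT_measurable => k; exact: bigcup_measurable.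
move=> w /= h k _; apply: contrapT => nk; apply: h; exists k => k' kk' Fk'.
by apply: nk; exists k'.
Qed.

Lemma sum_half (N : nat) : \sum_(k < N) (2^-1 : R) ^+ k <= 2.
Proof.
suff : \sum_(k < N) (2^-1 : R) ^+ k = 2 - 2 * 2^-1 ^+ N.
  by move=> ->; rewrite gerBl mulr_ge0// exprn_ge0// invr_ge0.
elim: N => [|N ih]; first by rewrite big_ord0 expr0 mulr1 subrr.
by rewrite big_ord_recr/= ih exprS; field.
Qed.

(** Borel-Cantelli for the events that the value at index [phi q] exceeds [1 / (q + 1)], chosen of
    probability at most [2^-q]. The bound [q <= phi q] is there to make the meshes along the
    subsequence tend to 0. *)
Lemma cvgp_subsequence Z : (forall m, measurable_fun setT (Z m)) -> cvgp Z ->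
  exists2 phi : nat -> nat, (forall q, (q <= phi q)%N) &
    {ae P, forall w, Z (phi q) w @[q --> \oo] --> 0}.
Proof.
move=> mZ cZ.
have H q : exists m, (q <= m)%N /\
    (P [set w | (q.+1%:R^-1 <= `|Z m w|)%R] <= (2^-1 ^+ q)%:E)%E.
  have [||M hM] := cZ q.+1%:R^-1 (2^-1 ^+ q).
  - by rewrite invr_gt0 ltr0n.
  - by rewrite exprn_gt0// invr_gt0.
  by exists (maxn q M); rewrite leq_maxl; split => //; apply: hM; rewrite leq_maxr.
have [phi hphi] := choice H; exists phi; first by move=> q; case: (hphi q).
have := @borel_cantelli_ae (fun q => [set w | (q.+1%:R^-1 <= `|Z (phi q) w|)%R])
  (fun q => 2^-1 ^+ q) 2 _ _ sum_half.
have h1 q : measurable [set w | (q.+1%:R^-1 <= `|Z (phi q) w|)%R] by exact: measurable_ge_norm.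
have h2 q : (P [set w | (q.+1%:R^-1 <= `|Z (phi q) w|)%R] <= (2^-1 ^+ q)%:E)%E by case: (hphi q).
move=> /(_ h1 h2); apply: filterS => w [K hK].
apply: (@cvg_dist_le0 _ _ (@harmonic R)); last exact: cvg_harmonic.
near=> q; rewrite subr0 /harmonic/=; apply: ltW; rewrite ltNge; apply/negP.
by apply: hK; near: q; exact: nbhs_infty_ge.
Unshelve. all: by end_near. Qed.

Lemma cvgp_diagonal (Z : nat -> nat -> T -> R) :
  (forall m q, measurable_fun setT (Z m q)) -> (forall m, cvgp (Z m)) ->
  exists q : nat -> nat, cvgp (fun m => Z m (q m)).
Proof.
move=> mZ cZ.
have H m : exists q, (P [set w | (m.+1%:R^-1 <= `|Z m q w|)%R] <= (m.+1%:R^-1)%:E)%E.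
  have m0 : 0 < m.+1%:R^-1 :> R by rewrite invr_gt0 ltr0n.
  by have [M hM] := cZ m _ _ m0 m0; exists M; exact: hM.
have [q hq] := choice H; exists q => e eta e0 eta0.
pose mu_ := Num.min e eta.
have mu0 : 0 < mu_ by rewrite lt_min e0.
exists (Num.truncn mu_^-1).+1 => m mM.
have mmu : m.+1%:R^-1 <= mu_.
  rewrite -[leRHS]invrK lef_pV2 ?posrE ?invr_gt0 ?ltr0n//.
  apply: ltW; apply: lt_le_trans (truncnS_gt _) _.
  by rewrite ler_nat (leq_trans mM).
apply: (@le_trans _ _ (P [set w | (m.+1%:R^-1 <= `|Z m (q m) w|)%R])).
  apply: le_measure; rewrite ?inE; [exact: measurable_ge_norm|exact: measurable_ge_norm|].
  move=> w /=; apply: le_trans; rewrite (le_trans mmu)//.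
  by rewrite /mu_ ge_min lexx.
apply: (le_trans (hq m)); rewrite lee_fin (le_trans mmu)//.
by rewrite /mu_ ge_min lexx orbT.
Qed.

End convergence_in_probability.

Lemma cvg_lin {R : realType} (u v : nat -> R) (k a b : R) :
  u @ \oo --> a -> v @ \oo --> b -> (fun q => k * u q + v q) @ \oo --> k * a + b.
Proof.
by move=> ua vb; apply: cvgD; [apply: cvgM; [exact: cvg_cst|exact: ua]|exact: vb].
Qed.
Arguments cvg_lin {R u v} k {a b}.

Lemma cvg_cst_seq {R : realType} (c : R) : (fun _ : nat => c) @ \oo --> c.
Proof. exact: cvg_cst. Qed.
Arguments cvg_cst_seq {R} c.

Lemma eq_cvg_seq {R : realType} (u v : nat -> R) (l : R) :
  u =1 v -> u @ \oo --> l -> v @ \oo --> l.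
Proof. by move=> /funext ->. Qed.
Arguments eq_cvg_seq {R u v l} _ _.

Lemma norm_mul_young {R : realType} (y a b : R) : 0 < y ->
  `|a * b| <= y / 2 * a ^+ 2 + y^-1 / 2 * b ^+ 2.
Proof.
move=> y0; rewrite ler_norml -subr_ge0 -[X in _ && X]subr_ge0.
have -> : a * b - - (y / 2 * a ^+ 2 + y^-1 / 2 * b ^+ 2) =
  y^-1 / 2 * (y * a + b) ^+ 2 by field; rewrite gt_eqF.
have -> : y / 2 * a ^+ 2 + y^-1 / 2 * b ^+ 2 - a * b =
  y^-1 / 2 * (y * a - b) ^+ 2 by field; rewrite gt_eqF.
have y20 : 0 <= y^-1 / 2 by rewrite divr_ge0 ?invr_ge0 ?(ltW y0).
by apply/andP; split; apply: mulr_ge0 => //; exact: sqr_ge0.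
Qed.

(** * Second order expansion of a logarithm along one path *)

Section log_increments.
Context {R : realType}.
Variables (t dl : R) (u b beta gam2 : R -> R) (phi : nat -> nat) (m : nat -> nat -> R).
Hypotheses (t0 : 0 < t) (dl0 : 0 < dl) (phi_ge : forall q, (q <= phi q)%N).
Hypotheses (cu : cts0 u) (cbeta : cts0 beta) (cgam2 : cts0 gam2) (cb : cts0 b).
Hypothesis udl : forall s : R, 0 <= s <= t -> dl <= u s.
Hypothesis bE : forall s : R, 0 <= s <= t -> b s = u s * beta s.
Notation N q := (phi q).+1.
Notation D q := (t / (phi q).+1%:R).
Notation tm q k := (k%:R * (t / (phi q).+1%:R)).
Let p q k := (J b (tm q k.+1) - J b (tm q k)) / u (tm q k).
Let r q k := (u (tm q k.+1) - u (tm q k)) / u (tm q k) - p q k - m q k.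
Hypothesis hr1 : \sum_(k < N q) r q k @[q --> \oo] --> 0.
Hypothesis hr2 : \sum_(k < N q) r q k ^+ 2 @[q --> \oo] --> 0.
Hypothesis hm2 : \sum_(k < N q) m q k ^+ 2 @[q --> \oo] --> J gam2 t.

Let z q k := (u (tm q k.+1) - u (tm q k)) / u (tm q k).

Let D0 q : 0 < D q. Proof. by rewrite divr_gt0// ltr0n. Qed.

Let ND q : (phi q).+1%:R * D q = t.
Proof. by rewrite mulrC divfK// pnatr_eq0. Qed.

Let tmI q k : (k <= N q)%N -> 0 <= tm q k <= t.
Proof.
move=> kN; rewrite mulr_ge0 ?(ltW (D0 q))//= -[leRHS](ND q).
by rewrite ler_wpM2r ?(ltW (D0 q))// ler_nat.
Qed.

Let tmS q k : tm q k.+1 - tm q k = D q.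
Proof. by rewrite -(natr1 k); ring. Qed.

Let tm_le q k : tm q k <= tm q k.+1.
Proof. by rewrite -subr_ge0 tmS ltW. Qed.

Let mesh (e : R) : 0 < e -> exists Q, forall q, (Q <= q)%N -> D q <= e.
Proof.
move=> e0; exists (Num.truncn (t / e)).+1 => q Qq.
rewrite ler_pdivrMr ?ltr0n// mulrC -ler_pdivrMr//.
apply: ltW; apply: lt_le_trans (truncnS_gt _) _.
by rewrite ler_nat (leq_trans Qq)// (leq_trans (phi_ge q)).
Qed.

Let u0 q k : (k <= N q)%N -> 0 < u (tm q k).
Proof. by move=> kN; rewrite (lt_le_trans dl0)// udl// tmI. Qed.

Let osc g : cts0 g -> forall e : R, 0 < e -> exists Q, forall q, (Q <= q)%N ->
  forall k v, (k < N q)%N -> tm q k <= v <= tm q k.+1 -> `|g v - g (tm q k)| <= e.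
Proof.
move=> cg e e0; have [dd dd0 h] := cts0_ucont cg t e0.
have [Q hQ] := mesh dd0; exists Q => q Qq k v kN /andP[v1 v2].
have /andP[k0 _] := tmI (ltnW kN); have /andP[_ k1] := tmI kN.
apply: h.
- by rewrite (le_trans k0)//= (le_trans v2).
- by rewrite k0/= (le_trans (tm_le q k)).
- rewrite ger0_norm ?subr_ge0//; have := hQ _ Qq; have := tmS q k.
  by move: v2; move: (tm q k.+1) (tm q k) (D q) => x1 y1 z1; lra.
Qed.

Let zsmall (e : R) : 0 < e -> exists Q, forall q, (Q <= q)%N ->
  forall k, (k < N q)%N -> `|z q k| <= e.
Proof.
move=> e0; have ed0 : 0 < e * dl by rewrite mulr_gt0.
have [Q hQ] := osc cu ed0; exists Q => q Qq k kN.
have uk := u0 (ltnW kN).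
rewrite /z normrM [X in _ * X]gtr0_norm ?invr_gt0// ler_pdivrMr//.
apply: (le_trans (hQ q Qq k _ kN _)); first by rewrite tm_le lexx.
by rewrite ler_pM2l// udl// tmI// ltnW.
Qed.

(** Over a cell [J b] grows by about [u * beta] times the mesh; division by the value of [u] at the
    left end leaves the increment of [J beta]. *)
Let hp1 : \sum_(k < N q) p q k @[q --> \oo] --> J beta t.
Proof.
apply/cvgrPdist_le => e e0.
pose e1 := e / (t * (1 / dl + 1)).
have tdl : 0 < t * (1 / dl + 1) by rewrite mulr_gt0// addr_gt0// divr_gt0.
have e10 : 0 < e1 by rewrite divr_gt0.
have [Q1 h1] := osc cb e10; have [Q2 h2] := osc cbeta e10.
near=> q.
have q1 : (Q1 <= q)%N by near: q; exact: nbhs_infty_ge.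
have q2 : (Q2 <= q)%N by near: q; exact: nbhs_infty_ge.
have H M : (M <= N q)%N ->
    `|J beta (tm q M) - \sum_(k < M) p q k| <= (e1 / dl + e1) * tm q M.
  elim: M => [_|M ih MN]; first by rewrite big_ord0 !mul0r J0 subrr normr0 mulr0.
  have /andP[M0 Mt] := tmI (ltnW MN).
  have ib := cts0_integrable (tm q M.+1) cb.
  have ibeta := cts0_integrable (tm q M.+1) cbeta.
  have := J_incr (c := b (tm q M)) (e := e1) ib M0 (tm_le q M).
  rewrite tmS => /(_ _) hb.
  have := J_incr (c := beta (tm q M)) (e := e1) ibeta M0 (tm_le q M).
  rewrite tmS => /(_ _) hbeta.
  have uM := u0 (ltnW MN).
  have udlM : dl <= u (tm q M) by apply: udl; exact: tmI (ltnW MN).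
  rewrite big_ord_recr/=.
  have -> : J beta (tm q M.+1) - (\sum_(i < M) p q i + p q M) =
     (J beta (tm q M) - \sum_(i < M) p q i) +
     ((J beta (tm q M.+1) - J beta (tm q M) - beta (tm q M) * D q) -
      (J b (tm q M.+1) - J b (tm q M) - b (tm q M) * D q) / u (tm q M)).
    move: (\sum_(i < M) p q i) => x0.
    rewrite bE ?tmI ?(ltnW MN)// /p; have := gt_eqF uM; move/negbT.
    generalize (D q) (beta (tm q M)) (u (tm q M)) (J b (tm q M)) (J b (tm q M.+1))
      (J beta (tm q M)) (J beta (tm q M.+1)).
    by move=> x1 x2 x3 x4 x5 x6 x7 x50; field.
  have -> : (e1 / dl + e1) * tm q M.+1 = (e1 / dl + e1) * tm q M + (e1 * D q + e1 / dl * D q).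
    have := tmS q M; move: (D q) (tm q M) (tm q M.+1) => w x y h.
    have -> : y = x + w by lra.
    ring.
  rewrite (le_trans (ler_normD _ _))// lerD//; first by apply: ih; exact: ltnW.
  rewrite (le_trans (ler_normB _ _))// lerD//.
    by apply: hbeta => v v1 v2; apply: h2 => //; rewrite (ltW v1).
  rewrite normrM [X in _ * X]gtr0_norm ?invr_gt0//.
  have hb' : `|J b (tm q M.+1) - J b (tm q M) - b (tm q M) * D q| <= e1 * D q.
    by apply: hb => v v1 v2; apply: h1 => //; rewrite (ltW v1).
  have -> : e1 / dl * D q = e1 * D q * dl^-1 by ring.
  apply: ler_pM => //; first by rewrite invr_ge0 ltW.
  by rewrite lef_pV2 ?posrE.
rewrite -[X in J beta X](ND q); apply: (le_trans (H _ (leqnn _))); rewrite ND.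
have -> : (e1 / dl + e1) * t = e1 * (t * (1 / dl + 1)) by ring.
by rewrite /e1 divfK// gt_eqF.
Unshelve. all: by end_near. Qed.

Let hp2 : \sum_(k < N q) p q k ^+ 2 @[q --> \oo] --> 0.
Proof.
have [c c0 hc] : exists2 c, 0 <= c & forall v, 0 <= v -> v <= t -> `|b v| <= c.
  exact: cts0_bounded.
apply/cvgrPdist_le => e e0.
pose k0 := (c / dl) ^+ 2 * t + 1.
have k00 : 0 < k0 by rewrite ltr_wpDl// mulr_ge0 ?sqr_ge0 ?ltW.
have ek : 0 < e / k0 by rewrite divr_gt0.
have [Q hQ] := mesh ek.
near=> q.
have qQ : (Q <= q)%N by near: q; exact: nbhs_infty_ge.
rewrite sub0r normrN ger0_norm; last by apply: sumr_ge0 => k _; exact: sqr_ge0.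
apply: (@le_trans _ _ (\sum_(k < N q) (c / dl * D q) ^+ 2)).
  apply: ler_sum => -[k kN] _ /=.
  have /andP[tk0 _] := tmI (ltnW kN); have /andP[_ tkt] := tmI kN.
  rewrite -(real_normK (num_real (p q k))) lerXn2r ?nnegrE//.
    by rewrite !mulr_ge0 ?invr_ge0 ?(ltW dl0) ?(ltW (D0 q))// ltW.
  rewrite /p normrM [X in _ * X]gtr0_norm ?invr_gt0 ?u0 ?(ltnW kN)//.
  have -> : c / dl * D q = c * D q * dl^-1 by ring.
  apply: ler_pM => //; first by rewrite invr_ge0 ltW// u0// ltnW.
    have := @J_increment_bound _ b (tm q k) (tm q k.+1) c cb tk0 (tm_le q k).
    rewrite tmS; apply=> v v0 vt; apply: hc => //; exact: le_trans tkt.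
  by rewrite lef_pV2 ?posrE ?u0 ?(ltnW kN)// udl// tmI// ltnW.
rewrite sumr_const card_ord -[_ *+ _]mulr_natl exprMn.
have -> : (phi q).+1%:R * ((c / dl) ^+ 2 * D q ^+ 2) =
    (c / dl) ^+ 2 * ((phi q).+1%:R * D q) * D q by ring.
rewrite ND; apply: (@le_trans _ _ (k0 * (e / k0))); last by rewrite mulrC divfK// gt_eqF.
apply: ler_pM; rewrite ?(ltW (D0 q))//; first by rewrite mulr_ge0 ?sqr_ge0 ?ltW.
  by rewrite lerDl.
exact: hQ.
Unshelve. all: by end_near. Qed.

Let rho q k := p q k + r q k.

Let zE q k : z q k = m q k + rho q k.
Proof. by rewrite /rho /r /z; ring. Qed.

Let hrho2 : \sum_(k < N q) rho q k ^+ 2 @[q --> \oo] --> 0.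
Proof.
apply: (@cvg_dist_le0 _ _ (fun q => 2 * (\sum_(k < N q) p q k ^+ 2) + 2 * (\sum_(k < N q) r q k ^+ 2))).
  apply: nearW => q; rewrite subr0 ger0_norm; last by apply: sumr_ge0 => k _; exact: sqr_ge0.
  rewrite !mulr_sumr -big_split/=; apply: ler_sum => k _.
  rewrite /rho -subr_ge0.
  have -> : 2 * p q k ^+ 2 + 2 * r q k ^+ 2 - (p q k + r q k) ^+ 2 = (p q k - r q k) ^+ 2 by ring.
  exact: sqr_ge0.
have h := cvg_lin 2 hp2 (cvg_lin 2 hr2 (cvg_cst_seq 0)).
rewrite !mulr0 !addr0 in h; apply: (eq_cvg_seq _ h) => q.
by rewrite addr0.
Qed.

Let hz2 : \sum_(k < N q) z q k ^+ 2 @[q --> \oo] --> J gam2 t.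
Proof.
(* Young's inequality with weight [la]: the squares of [m] have a bounded sum and those of [rho] a
   vanishing one, so the cross terms vanish in the limit. *)
have hmr : \sum_(k < N q) m q k * rho q k @[q --> \oo] --> 0.
  apply/cvgrPdist_le => e e0.
  pose L := J gam2 t + 1.
  have L0 : 0 < `|L| + 1 by rewrite ltr_wpDl.
  pose la := e / (`|L| + 1).
  have la0 : 0 < la by rewrite divr_gt0.
  move/cvgrPdist_le : hm2 => /(_ _ ltr01)[Q1 _ h1].
  have ela0 : 0 < e * la by rewrite mulr_gt0.
  move/cvgrPdist_le : hrho2 => /(_ _ ela0)[Q2 _ h2].
  near=> q.
  have := h1 q; have := h2 q; rewrite /= sub0r normrN => /(_ _) h2' /(_ _) h1'.
  have {}h1' : \sum_(k < N q) m q k ^+ 2 <= L.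
    have : `|J gam2 t - \sum_(k < N q) m q k ^+ 2| <= 1.
      by apply: h1'; near: q; exact: nbhs_infty_ge.
    by rewrite ler_norml /L; lra.
  have {}h2' : \sum_(k < N q) rho q k ^+ 2 <= e * la.
    apply: (le_trans (ler_norm _)); apply: h2'; near: q; exact: nbhs_infty_ge.
  rewrite sub0r normrN (le_trans (ler_norm_sum _ _ _))//.
  apply: (@le_trans _ _ (\sum_(k < N q) (la / 2 * m q k ^+ 2 + la^-1 / 2 * rho q k ^+ 2))).
    by apply: ler_sum => k _; exact: norm_mul_young.
  rewrite big_split/= -!mulr_sumr.
  have h3 : la / 2 * \sum_(i < N q) m q i ^+ 2 <= e / 2.
    apply: (@le_trans _ _ (la / 2 * (`|L| + 1))); last first.
      by apply: eq_ler; rewrite mulrAC divfK// gt_eqF.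
    apply: ler_wpM2l; first by rewrite divr_ge0 ?(ltW la0).
    by rewrite (le_trans h1')// (le_trans (ler_norm _))// lerDl.
  have h4 : la^-1 / 2 * \sum_(i < N q) rho q i ^+ 2 <= e / 2.
    apply: (@le_trans _ _ (la^-1 / 2 * (e * la))).
      by rewrite ler_wpM2l// divr_ge0 ?invr_ge0 ?(ltW la0).
    apply: eq_ler; move: la0; generalize la => y y0.
    by field; rewrite gt_eqF.
  lra.
have h := cvg_lin 2 hmr (cvg_lin 1 hm2 hrho2).
rewrite mulr0 add0r mul1r addr0 in h; apply: (eq_cvg_seq _ h) => q; rewrite mul1r mulr_sumr -!big_split/=; apply: eq_bigr => k _.
by rewrite zE; ring.
Unshelve. all: by end_near. Qed.

Let hln q : \sum_(k < N q) ln (1 + z q k) = ln (u t) - ln (u 0).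
Proof.
have H M : (M <= N q)%N -> \sum_(k < M) ln (1 + z q k) = ln (u (tm q M)) - ln (u 0).
  elim: M => [_|M ih MN]; first by rewrite big_ord0 mul0r subrr.
  rewrite big_ord_recr/= (ih (ltnW MN)).
  have uM := u0 (ltnW MN); have uM1 := u0 MN.
  have -> : 1 + z q M = u (tm q M.+1) / u (tm q M).
    have uM0 : u (tm q M) != 0 by rewrite gt_eqF.
    by rewrite /z mulrBl (divff uM0) addrC subrK.
  by rewrite ln_div ?posrE//; ring.
by rewrite (H _ (leqnn _)) ND.
Qed.

(** The cubic remainder is at most [2 * la * z ^+ 2] once all the relative increments are below
    [la], and the sum of their squares stays bounded. *)
Let htaylor : \sum_(k < N q) (ln (1 + z q k) - z q k + z q k ^+ 2 / 2) @[q --> \oo] --> 0.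
Proof.
apply/cvgrPdist_le => e e0.
pose L := J gam2 t + 1.
have L0 : 0 < `|L| + 1 by rewrite ltr_wpDl.
pose la := Num.min (1 / 2) (e / (2 * (`|L| + 1))).
have la0 : 0 < la by rewrite lt_min !divr_gt0// mulr_gt0.
move/cvgrPdist_le : hz2 => /(_ _ ltr01)[Q1 _ h1].
have [Q2 h2] := zsmall la0.
near=> q.
have h1' : \sum_(k < N q) z q k ^+ 2 <= L.
  have : `|J gam2 t - \sum_(k < N q) z q k ^+ 2| <= 1.
    by apply: h1; near: q; exact: nbhs_infty_ge.
  by rewrite ler_norml /L; lra.
have h2' k : (k < N q)%N -> `|z q k| <= la.
  by apply: h2; near: q; exact: nbhs_infty_ge.
rewrite sub0r normrN (le_trans (ler_norm_sum _ _ _))//.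
apply: (@le_trans _ _ (\sum_(k < N q) (2 * la * z q k ^+ 2))).
  apply: ler_sum => -[k kN] _ /=.
  have zk := h2' k kN.
  have z12 : `|z q k| <= 1 / 2 by rewrite (le_trans zk)// ge_min lexx.
  apply: (le_trans (ln1_taylor z12)).
  rewrite -mulrA ler_pM2l// exprS -[z q k ^+ 2](real_normK (num_real (z q k))).
  by rewrite ler_wpM2r// sqr_ge0.
rewrite -mulr_sumr.
apply: (@le_trans _ _ (2 * la * (`|L| + 1))).
  apply: ler_wpM2l; first by rewrite mulr_ge0 ?(ltW la0).
  by rewrite (le_trans h1')// (le_trans (ler_norm _))// lerDl.
apply: (@le_trans _ _ (2 * (e / (2 * (`|L| + 1))) * (`|L| + 1))).
  by rewrite ler_pM2r// ler_pM2l// ge_min lexx orbT.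
apply: eq_ler; move: L0; generalize (`|L| + 1) => y y0.
by field; rewrite gt_eqF.
Unshelve. all: by end_near. Qed.

(* Second order Taylor expansion of the logarithm along the grid: [m] is the
   relative martingale increment, [p] the relative drift increment, [r] the error. *)
Lemma log_increments : \sum_(k < N q) m q k @[q --> \oo] -->
  ln (u t) - ln (u 0) - J beta t + J gam2 t / 2.
Proof.
pose c := ln (u t) - ln (u 0).
have h := cvg_lin (-1) hp1 (cvg_lin 2^-1 hz2 (cvg_lin (-1) htaylor
  (cvg_lin (-1) hr1 (cvg_cst_seq c)))).
rewrite !mulr0 !add0r in h.
have -> : ln (u t) - ln (u 0) - J beta t + J gam2 t / 2 =
    -1 * J beta t + (2^-1 * J gam2 t + c) by rewrite /c; ring.
apply: (eq_cvg_seq _ h) => q; rewrite /c -(hln q).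
rewrite !mulr_sumr -!big_split/=.
by apply: eq_bigr => k _; have := zE q k; rewrite /rho => ->; ring.
Qed.

End log_increments.

(** * The logarithm of the process *)

Section in_probability.
Context {d : measure_display} {T : measurableType d} {R : realType}.
Variable P : probability T R.

Lemma cvg_in_probabilityP (Z : nat -> T -> R) (Z0 : T -> R) :
  (forall m, measurable_fun setT (Z m)) -> measurable_fun setT Z0 ->
  cvg_in_probability P Z Z0 <-> cvgp P (fun m w => Z m w - Z0 w).
Proof.
move=> mZ mZ0.
have mB m : measurable_fun setT (fun w => Z m w - Z0 w) by exact: measurable_funB.
have mS (e : R) m : measurable [set w | (e <= `|Z m w - Z0 w|)%R].
  exact: (measurable_ge_norm e (mB m)).
split.
  move=> h e eta e0 eta0.
  have /cvge0P := h e e0; apply=> // m; exact: fin_num_measure.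
move=> h e e0; apply/cvge0P => [m|//|eta eta0]; first exact: fin_num_measure.
exact: h.
Qed.

Lemma measurable_J (H : R -> T -> R) (t : R) : 0 <= t ->
  (forall s : R, 0 <= s -> measurable_fun setT (H s)) ->
  (forall w, cts0 (fun s => H s w)) -> measurable_fun setT (fun w => J (fun s => H s w) t).
Proof.
move=> t0 mH cH.
apply: (measurable_fun_cvg (h := fun N w =>
   \sum_(k < N.+1) H (k%:R * (t / N.+1%:R)) w * (t / N.+1%:R))); last first.
  by move=> w _; exact: riemann_sum.
move=> N; apply: measurable_sum => k; apply: measurable_funM => //.
by apply: mH; rewrite mulr_ge0// divr_ge0.
Qed.

End in_probability.

(** * Simple processes on uniform grids *)

Section simple_grid.
Context {R : realType}.
Variables (c : nat -> R) (sz : nat) (f : R) (h : R -> R).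
Hypotheses (f0 : 0 < f) (ch : cts0 h).

Let sval (u : R) : R := \sum_(l < sz) c l * \1_(`]l%:R * f, l.+1%:R * f]) u.

Let tS l : l.+1%:R * f - l%:R * f = f.
Proof. by rewrite -(natr1 l); ring. Qed.

Let t_le (l m : nat) : (l <= m)%N -> l%:R * f <= m%:R * f.
Proof. by move=> lm; rewrite ler_wpM2r ?(ltW f0)// ler_nat. Qed.

Let svalE (M : nat) (u : R) : (M < sz)%N -> M%:R * f < u -> u <= M.+1%:R * f -> sval u = c M.
Proof.
move=> Msz Mu uM; rewrite /sval (bigD1 (Ordinal Msz))//= big1 ?addr0.
  by rewrite indicE mem_set ?mulr1//= in_itv/= Mu uM.
move=> l lM; rewrite indicE memNset ?mulr0//= in_itv/= => /andP[l1 l2].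
have [lM'|Ml|lE] := ltngtP (l : nat) M.
- by have := t_le lM'; move: Mu l2; lra.
- by have := t_le Ml; move: uM l1; lra.
- by move/eqP: lM; apply; apply: val_inj.
Qed.

Let G (u : R) : R := (sval u - h u) ^+ 2.

Let G_integrable (b : R) : lebesgue_measure.-integrable `[0, b] (EFin \o G).
Proof.
have mI : measurable (`[0, b]%classic : set (measurableTypeR R)) by exact: measurable_itv.
have ch' : {within `[0, b], continuous h}.
  apply: continuous_subspaceW ch => x; rewrite /= !in_itv/= => /andP[-> _].
  by rewrite andbT.
have mh : measurable_fun `[0, b] h by exact: subspace_continuous_measurable_fun.
have msv : measurable_fun `[0, b] sval.
  by apply: measurable_sum => l; apply: measurable_funM => //; exact: measurable_indic.
have [k k0 hk] := cts0_bounded b ch.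
apply: measurable_bounded_integrable => //.
- by rewrite /= lebesgue_measure_itv/=; case: ifP => // _; rewrite -EFinB ltry.
- by apply: measurable_funX; exact: measurable_funB.
exists ((\sum_(l < sz) `|c l| + k) ^+ 2); split; first exact: num_real.
move=> M kM u; rewrite /= in_itv/= => /andP[u0 ub]; apply: le_trans (ltW kM).
rewrite /G normrX lerXn2r ?nnegrE ?addr_ge0 ?sumr_ge0//.
rewrite (le_trans (ler_normB _ _))// lerD ?hk//.
rewrite (le_trans (ler_norm_sum _ _ _))// ler_sum// => l _.
by rewrite normrM ler_piMr// indicE; case: (_ \in _); rewrite ?normr1 ?normr0.
Qed.

(** On the cell of index [l] the step function is [c l], so the squared distance to [h] can be
    integrated cell by cell, with a continuous integrand on each. *)
Lemma J_simple_sqr (M : nat) : (M <= sz)%N ->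
  J (fun u => (\sum_(l < sz) c l * \1_(`]l%:R * f, l.+1%:R * f]) u - h u) ^+ 2) (M%:R * f) =
  \sum_(l < M) (J (fun u => (c l - h u) ^+ 2) (l.+1%:R * f) -
                J (fun u => (c l - h u) ^+ 2) (l%:R * f)).
Proof.
elim: M => [_|M ih Msz]; first by rewrite mul0r J0 big_ord0.
rewrite big_ord_recr/= -(ih (ltnW Msz)).
have Mf0 : 0 <= M%:R * f by rewrite mulr_ge0// ltW.
have MM : M%:R * f <= M.+1%:R * f by exact: t_le.
have cg : cts0 (fun u => (c M - h u) ^+ 2).
  rewrite (_ : (fun u => _) = (fun u => (c M - h u) * (c M - h u))).
    by apply: cts0M; apply: cts0B => //; exact: cts0_cst.
  by apply/funext => u; rewrite expr2.
apply/eqP; rewrite addrC -subr_eq; apply/eqP.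
have itv g : lebesgue_measure.-integrable `[0, M.+1%:R * f] (EFin \o g) ->
    J g (M.+1%:R * f) - J g (M%:R * f) =
    \int[lebesgue_measure]_(u in `]M%:R * f, M.+1%:R * f]) g u.
  by move=> ig; rewrite /J Rintegral_itvB// bnd_simp.
rewrite (itv _ (G_integrable _)) itv; last exact: cts0_integrable.
apply: eq_Rintegral => u; rewrite inE/= in_itv/= => /andP[Mu uM].
by rewrite /G (svalE Msz Mu uM).
Qed.

End simple_grid.

Section grid_approximation.
Context {R : realType} {n : nat} {d : measure_display} {Omega : measurableType d}.
Variables (P : probability Omega R) (W : 'I_n -> R -> {RV P >-> R}).

Lemma gmeasurable_preimage t (f : Omega -> R) (B : set R) :
  gmeasurable (brownian_gen W t) f -> measurable B -> brownian_filtration W t (f @^-1` B).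
Proof. by move=> mf mB; have := mf measurableT B mB; rewrite setTI. Qed.

(** Covers the first [k] cells of length [dt], each cut into [q.+1] pieces, so that the coarse grid
    is contained in the fine one. *)
Definition grid_process (C : R -> Omega -> R) (dt : R) (k q : nat) : simple_process :=
  SimpleProcess (k * q.+1) (fun l => l%:R * (dt / q.+1%:R))
    (fun l => C (l%:R * (dt / q.+1%:R))).

Variables (H C : R -> Omega -> R) (K dt : R) (k : nat).
Hypotheses (dt0 : 0 < dt).
Hypothesis mH : forall s : R, 0 <= s -> gmeasurable (brownian_gen W s) (H s).
Hypothesis mC : forall s : R, 0 <= s -> gmeasurable (brownian_gen W s) (C s).
Hypothesis cH : forall w, cts0 (fun s => H s w).
Hypothesis CK : forall s w, `|C s w| <= K.
Hypothesis CH : {ae P, forall w, forall s : R, 0 <= s -> C s w = H s w}.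

Let f0 q : 0 < dt / q.+1%:R. Proof. by rewrite divr_gt0// ltr0n. Qed.

Let l0 q l : 0 <= l%:R * (dt / q.+1%:R). Proof. by rewrite mulr_ge0// ltW. Qed.

Let kE q : (k * q.+1)%:R * (dt / q.+1%:R) = k%:R * dt.
Proof. by rewrite natrM -mulrA (mulrCA q.+1%:R) divff ?mulr1// pnatr_eq0. Qed.

Let mHT (s : R) : 0 <= s -> measurable_fun setT (H s).
Proof. by move=> /mH; exact: gmeasurableT. Qed.

Let mCT (s : R) : 0 <= s -> measurable_fun setT (C s).
Proof. by move=> /mC; exact: gmeasurableT. Qed.

Let err q w := J (fun u => (simple_val (grid_process C dt k q) u w - H u w) ^+ 2) (k%:R * dt).

Let errE q w : err q w = \sum_(l < k * q.+1)
   (J (fun u => (C (l%:R * (dt / q.+1%:R)) w - H u w) ^+ 2) (l.+1%:R * (dt / q.+1%:R)) -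
    J (fun u => (C (l%:R * (dt / q.+1%:R)) w - H u w) ^+ 2) (l%:R * (dt / q.+1%:R))).
Proof.
have := J_simple_sqr (fun l => C (l%:R * (dt / q.+1%:R)) w) (f0 q) (@cH w) (leqnn (k * q.+1)).
by rewrite kE => <-.
Qed.

Let cg (c : R) w : cts0 (fun u => (c - H u w) ^+ 2).
Proof.
rewrite (_ : (fun u => _) = (fun u => (c - H u w) * (c - H u w))).
  by apply: cts0M; apply: cts0B => //; exact: cts0_cst.
by apply/funext => u; rewrite expr2.
Qed.

Let merr q : measurable_fun setT (err q).
Proof.
rewrite (_ : err q = (fun w => \sum_(l < k * q.+1)
   (J (fun u => (C (l%:R * (dt / q.+1%:R)) w - H u w) ^+ 2) (l.+1%:R * (dt / q.+1%:R)) -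
    J (fun u => (C (l%:R * (dt / q.+1%:R)) w - H u w) ^+ 2) (l%:R * (dt / q.+1%:R))))).
  apply: measurable_sum => l; apply: measurable_funB.
    apply: (measurable_J (H := fun u w => (C (l%:R * (dt / q.+1%:R)) w - H u w) ^+ 2)) => //.
    by move=> s s0; apply: measurable_funX; apply: measurable_funB; [exact: mCT|exact: mHT].
  apply: (measurable_J (H := fun u w => (C (l%:R * (dt / q.+1%:R)) w - H u w) ^+ 2)) => //.
  by move=> s s0; apply: measurable_funX; apply: measurable_funB; [exact: mCT|exact: mHT].
by apply/funext => w; rewrite errE.
Qed.

Let err_cvg : {ae P, forall w, err q w @[q --> \oo] --> 0}.
Proof.
apply: filterS CH => w CHw; apply/cvgrPdist_le => e e0.
pose k1 := k%:R * dt + 1.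
have k10 : 0 < k1 by rewrite ltr_wpDl// mulr_ge0// ltW.
pose e1 := Num.min 1 (e / k1).
have e10 : 0 < e1 by rewrite lt_min ltr01 divr_gt0.
have [dl dl0 hdl] := cts0_ucont (@cH w) (k%:R * dt) e10.
have [N0 hN0] : exists N0 : nat, dt / dl < N0%:R.
  by exists (Num.truncn (dt / dl)).+1; exact: truncnS_gt.
near=> q; rewrite sub0r normrN errE.
have fdl : dt / q.+1%:R <= dl.
  rewrite ler_pdivrMr ?ltr0n// mulrC -ler_pdivrMr// ltW// (lt_le_trans hN0)// ler_nat.
  by rewrite ltnW// ltnS; near: q; exact: nbhs_infty_ge.
rewrite (le_trans (ler_norm_sum _ _ _))//.
apply: (@le_trans _ _ (\sum_(l < k * q.+1) (e1 * (dt / q.+1%:R)))); last first.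
  rewrite sumr_const card_ord -[_ *+ _]mulr_natr -mulrA (mulrC (dt / _)) kE.
  apply: (@le_trans _ _ (e / k1 * k1)); last by rewrite divfK// gt_eqF.
  apply: ler_pM; [exact: ltW|by rewrite mulr_ge0// ltW|by rewrite ge_min lexx orbT|].
  by rewrite lerDl.
apply: ler_sum => -[l lk] _ /=.
have ll : l%:R * (dt / q.+1%:R) <= l.+1%:R * (dt / q.+1%:R).
  by rewrite ler_wpM2r ?(ltW (f0 q))// ler_nat.
have lk' : l.+1%:R * (dt / q.+1%:R) <= k%:R * dt.
  by rewrite -(kE q) ler_wpM2r ?(ltW (f0 q))// ler_nat.
have lE : l.+1%:R * (dt / q.+1%:R) - l%:R * (dt / q.+1%:R) = dt / q.+1%:R.
  by rewrite -(natr1 l); ring.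
have := @J_incr _ (fun u => (C (l%:R * (dt / q.+1%:R)) w - H u w) ^+ 2) _ _ 0 e1
  (cts0_integrable _ (@cg _ w)) (l0 q l) ll.
rewrite mul0r subr0 lE; apply=> u u1 u2; rewrite subr0 CHw//.
have h : `|H (l%:R * (dt / q.+1%:R)) w - H u w| <= e1.
  apply: hdl.
  - by rewrite (l0 q l)/= (le_trans ll).
  - by rewrite (le_trans (l0 q l) (ltW u1))/= (le_trans u2).
  - by rewrite distrC ger0_norm ?subr_ge0 ?(ltW u1)// lerBlDr (le_trans u2)// -lerBlDr lE.
rewrite normrX expr2 -[leRHS]mulr1 ler_pM//.
by rewrite (le_trans h)// ge_min lexx.
Unshelve. all: by end_near. Qed.

(** The coefficients of a simple process must be bounded at every [w], whereas [H] is bounded only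
    almost surely; hence the bounded version [C] in the coefficients. The squared error vanishes by
    uniform continuity of the paths of [H]. *)
Lemma grid_approximation : simple_approximation P (brownian_filtration W) H (k%:R * dt)
  (grid_process C dt k).
Proof.
split.
  move=> q; split => /=.
  - by rewrite mul0r.
  - exact: kE.
  - by move=> l _; rewrite ler_wpM2r ?(ltW (f0 q))// ler_nat.
  - by move=> l _; exists K => w; exact: CK.
  - by move=> l B _ mB; apply: gmeasurable_preimage => //; exact: mC.
apply/cvg_in_probabilityP; [exact: merr|exact: measurable_cst|].
apply: cvgp_ae => [m|].
  by under eq_fun do rewrite subr0; exact: merr.
apply: filterS err_cvg => w hw.
by under [X in X @ _ --> _]eq_fun do rewrite subr0; exact: hw.
Qed.

End grid_approximation.

Lemma sqr_sum_le {R : realType} (I : Type) (r : seq I) (y : I -> R) :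
  (\sum_(j <- r) y j) ^+ 2 <= 2 ^+ size r * \sum_(j <- r) y j ^+ 2.
Proof.
elim: r => [|i r ih]; first by rewrite !big_nil expr0n mulr0.
rewrite !big_cons /= [2 ^+ _.+1]exprS.
have p1 : 1 <= (2 : R) ^+ size r by rewrite exprn_ege1// ler1n.
have s0 : 0 <= \sum_(j <- r) y j ^+ 2 by apply: sumr_ge0 => j _; exact: sqr_ge0.
have a0 := sqr_ge0 (y i).
move: ih p1 s0 a0; move: (\sum_(j <- r) y j) (\sum_(j <- r) y j ^+ 2) (2 ^+ size r) (y i).
move=> S T p a ih p1 s0 a0.
have h : (a + S) ^+ 2 <= 2 * a ^+ 2 + 2 * S ^+ 2.
  rewrite -subr_ge0.
  have -> : 2 * a ^+ 2 + 2 * S ^+ 2 - (a + S) ^+ 2 = (a - S) ^+ 2 by ring.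
  exact: sqr_ge0.
apply: (le_trans h); rewrite mulrDr -!mulrA lerD//.
  by rewrite ler_pM2l// ler_peMl.
by rewrite ler_pM2l.
Qed.

Lemma sum_sqr_le {R : realType} (m : nat) (y : nat -> R) : (forall k, 0 <= y k) ->
  \sum_(k < m) y k ^+ 2 <= (\sum_(k < m) y k) ^+ 2.
Proof.
move=> y0; elim: m => [|m ih]; first by rewrite !big_ord0 expr0n.
rewrite !big_ord_recr/= sqrrD lerD// (le_trans ih)// lerDl mulrn_wge0// mulr_ge0//.
by apply: sumr_ge0 => k _; exact: y0.
Qed.

Lemma inv_lip {R : realType} (dl u v e : R) : 0 < dl -> dl <= u -> dl <= v ->
  `|u - v| <= e -> `|u^-1 - v^-1| <= dl^-1 ^+ 2 * e.
Proof.
move=> dl0 du dv uv.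
have u0 : 0 < u by exact: lt_le_trans du.
have v0 : 0 < v by exact: lt_le_trans dv.
have -> : u^-1 - v^-1 = - (u^-1 * v^-1) * (u - v).
  by field; rewrite (gt_eqF u0) (gt_eqF v0).
rewrite normrM normrN; apply: ler_pM => //.
rewrite gtr0_norm ?mulr_gt0 ?invr_gt0// expr2 ler_pM ?invr_ge0 ?(ltW u0) ?(ltW v0)//.
  by rewrite lef_pV2.
by rewrite lef_pV2.
Qed.

(** * Errors on a coarse grid, controlled through finer grids *)

Section error_terms.
Context {R : realType} {n : nat} {d : measure_display} {Omega : measurableType d}.
Variables (P : probability Omega R) (W : 'I_n -> R -> {RV P >-> R}).
Hypothesis hW : brownian_motion W.
Variables (t dl K : R) (y : R -> Omega -> R) (c : 'I_n -> R -> Omega -> R).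
Variable D : R -> Omega -> R.
Hypotheses (t0 : 0 < t) (dl0 : 0 < dl).
Hypothesis my : forall s : R, 0 <= s -> gmeasurable (brownian_gen W s) (y s).
Hypothesis mc : forall j (s : R), 0 <= s -> gmeasurable (brownian_gen W s) (c j s).
Hypothesis mD : forall s : R, 0 <= s -> measurable_fun setT (D s).
Hypothesis cy : forall w, cts0 (fun s => y s w).
Hypothesis cc : forall j w, cts0 (fun s => c j s w).
Hypothesis y01 : forall s w, 0 <= y s w <= 1.
Hypothesis cK : forall j s w, `|c j s w| <= K.
Notation C := (fun j s w => y s w * c j s w).
Notation th := (fun s w => (Num.max (y s w) dl)^-1).
Notation dt m := (t / m.+1%:R).
Notation f m q := (t / m.+1%:R / q.+1%:R).
Notation tm m k := (k%:R * (t / m.+1%:R)).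
Notation fm m q l := (l%:R * (t / m.+1%:R / q.+1%:R)).
Notation xi m q j l w := (W j (l.+1%:R * (t / m.+1%:R / q.+1%:R)) w - W j (l%:R * (t / m.+1%:R / q.+1%:R)) w).

(** [D] stands for the martingale part of a coordinate. It is accessible only as a limit in
    probability of such Ito sums on the fine grid, so its distance to them is one of the errors. *)
Definition grid_defect m q k w := D (tm m k) w -
  \sum_j \sum_(l < k * q.+1) C j (fm m q l) w * xi m q j l w.

Hypothesis hV : forall m k, cvgp P (fun q w => grid_defect m q k w).

Let dt0 m : 0 < dt m. Proof. by rewrite divr_gt0// ltr0n. Qed.
Let f0 m q : 0 < f m q. Proof. by rewrite divr_gt0// ltr0n. Qed.
Let tm0 m k : 0 <= tm m k. Proof. by rewrite mulr_ge0// ltW. Qed.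
Let fm0 m q l : 0 <= fm m q l. Proof. by rewrite mulr_ge0// ltW. Qed.

Let fmE m q k : fm m q (k * q.+1) = tm m k.
Proof. by rewrite natrM -mulrA (mulrCA q.+1%:R) divff ?mulr1// pnatr_eq0. Qed.

Let Nf m q : (m.+1 * q.+1)%:R * f m q = t.
Proof. by rewrite fmE mulrC divfK// pnatr_eq0. Qed.

Let fm_le m q l l' : (l <= l')%N -> fm m q l <= fm m q l'.
Proof. by move=> ll; rewrite ler_wpM2r ?(ltW (f0 m q))// ler_nat. Qed.

Let K0 : 0 <= K \/ n = 0%N.
Proof.
case: (n) c cK => [_ _|n' c' cK']; [by right|left].
exact: le_trans (normr_ge0 _) (cK' ord0 0 point).
Qed.

Let th_bound s w : 0 < th s w <= dl^-1.
Proof.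
have m0 : 0 < Num.max (y s w) dl by rewrite lt_max dl0 orbT.
by rewrite invr_gt0 m0 lef_pV2 ?posrE// le_max lexx orbT.
Qed.

Let gth (s : R) : 0 <= s -> gmeasurable (brownian_gen W s) (th s).
Proof.
move=> s0; apply: (@lip_measurable _ (g_sigma_algebraType (brownian_gen W s)) R 'I_1 (fun _ => y s) (fun a => (Num.max (a ord0) dl)^-1) (dl^-1 ^+ 2)).
  by move=> _; exact: my.
move=> a b e ab; have abe := ab ord0.
have ma : dl <= Num.max (a ord0) dl by rewrite le_max lexx orbT.
have mb : dl <= Num.max (b ord0) dl by rewrite le_max lexx orbT.
have mab : `|Num.max (a ord0) dl - Num.max (b ord0) dl| <= e.
  apply: le_trans abe; rewrite /Num.max; move: (a ord0) (b ord0) => u v.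
  by case: (ltP u dl); case: (ltP v dl) => h1 h2; rewrite ?subrr ?normr0// !ler_norml;
    have := ler_norm (u - v); have := ler_norm (v - u); rewrite (distrC v u); lra.
move: ma mb mab; exact: (inv_lip dl0).
Qed.

Let gC j (s : R) : 0 <= s -> gmeasurable (brownian_gen W s) (C j s).
Proof. by move=> s0; apply: gmeasurableM; [exact: my|exact: mc]. Qed.

(** Error made by freezing the integrand at the left end of the coarse cell, divided by the
    coordinate there (or by [dl] if that is larger). The quotient [l %/ q.+1] is the index of the
    coarse cell containing the fine time of index [l]. *)
Let a m q j l w := th (tm m (l %/ q.+1)) w * (C j (fm m q l) w - C j (tm m (l %/ q.+1)) w).

Let tm_fm m q l : tm m (l %/ q.+1) <= fm m q l.
Proof. by rewrite -(fmE m q) fm_le// leq_trunc_div. Qed.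

Let ga m q j l : gmeasurable (brownian_gen W (fm m q l)) (a m q j l).
Proof.
have sub : <<s brownian_gen W (tm m (l %/ q.+1)) >> `<=` <<s brownian_gen W (fm m q l) >>.
  exact: sub_brownian_gen.
apply: gmeasurableM; first exact: (gmeasurable_sub sub (gth (tm0 _ _))).
apply: gmeasurableB; first exact: gC.
exact: (gmeasurable_sub sub (gC j (tm0 _ _))).
Qed.

Let Cb j s w : `|C j s w| <= K.
Proof.
have /andP[h0 h1] := y01 s w; rewrite normrM (ger0_norm h0) (le_trans _ (cK j s w))//.
by rewrite ler_piMl.
Qed.

Let aK m q j l w : `|a m q j l w| <= dl^-1 * (2 * K).
Proof.
have /andP[h0 h1] := th_bound (tm m (l %/ q.+1)) w.
rewrite /a normrM (gtr0_norm h0); apply: ler_pM => //; first exact: ltW.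
by rewrite (le_trans (ler_normB _ _))// mulrDl mul1r lerD.
Qed.

Let rho m q j w := \sum_(0 <= l < m.+1 * q.+1) a m q j l w ^+ 2 * f m q.

Let maT m q j l : measurable_fun setT (a m q j l).
Proof. exact: (gmeasurableT (@ga m q j l)). Qed.

Let mxi m q j l : measurable_fun setT (fun w => xi m q j l w).
Proof. by apply: measurable_funB; exact: measurable_funP. Qed.

Let mrho m q j : measurable_fun setT (rho m q j).
Proof.
apply: measurable_sum => l; apply: measurable_funM => //.
by apply: measurable_funX; exact: maT.
Qed.

Let rho_ge0 m q j w : 0 <= rho m q j w.
Proof. by apply: sumr_ge0 => l _; rewrite mulr_ge0 ?sqr_ge0 ?(ltW (f0 m q)). Qed.

Let rho_le m q j w (e : R) : 0 <= e ->
  (forall l, (l < m.+1 * q.+1)%N -> `|a m q j l w| <= e) -> rho m q j w <= e ^+ 2 * t.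
Proof.
move=> e0 h; rewrite /rho big_mkord.
have -> : e ^+ 2 * t = \sum_(l < m.+1 * q.+1) e ^+ 2 * f m q.
  by rewrite sumr_const card_ord -[_ *+ _]mulr_natl mulrCA Nf.
apply: ler_sum => -[l lN] _ /=.
rewrite ler_wpM2r ?(ltW (f0 m q))// -(real_normK (num_real (a m q j l w))).
by rewrite lerXn2r// ?nnegrE// h.
Qed.

Let rho_bound m q j w : `|rho m q j w| <= (dl^-1 * (2 * K)) ^+ 2 * t.
Proof.
rewrite ger0_norm//; apply: rho_le => //.
exact: le_trans (normr_ge0 _) (aK 0 0 j 0 w).
Qed.

(** By uniform continuity of the path, the integrand varies little over a coarse cell. This holds
    for any choice of the fine meshes, which leaves [q] free to be chosen later. *)
Let rho_cvg (q : nat -> nat) j w : rho m (q m) j w @[m --> \oo] --> 0.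
Proof.
apply/cvgrPdist_le => e e0.
pose e1 := Num.min 1 (e / t).
have e10 : 0 < e1 by rewrite lt_min ltr01 divr_gt0.
have e2 : 0 < e1 * dl by rewrite mulr_gt0.
have cC : cts0 (fun s => C j s w) by apply: cts0M; [exact: cy|exact: cc].
have [r r0 hr] := cts0_ucont cC t e2.
have [N0 hN0] : exists N0 : nat, t / r < N0%:R.
  by exists (Num.truncn (t / r)).+1; exact: truncnS_gt.
near=> m; rewrite sub0r normrN ger0_norm//.
have dr : dt m <= r.
  rewrite ler_pdivrMr ?ltr0n// mulrC -ler_pdivrMr// ltW// (lt_le_trans hN0)// ler_nat.
  by rewrite ltnW// ltnS; near: m; exact: nbhs_infty_ge.
apply: (@le_trans _ _ (e1 ^+ 2 * t)).
  apply: rho_le; first exact: ltW.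
  move=> l lN; have /andP[h0 h1] := th_bound (tm m (l %/ (q m).+1)) w.
  have ft : fm m (q m) l <= t by rewrite -[leRHS](Nf m (q m)) fm_le// ltnW.
  rewrite /a normrM (gtr0_norm h0).
  apply: (@le_trans _ _ (dl^-1 * (e1 * dl))); last by rewrite mulrCA mulVf ?mulr1// gt_eqF.
  apply: ler_pM => //; first exact: ltW.
  apply: hr.
  - by rewrite fm0.
  - by rewrite tm0 (le_trans (tm_fm m (q m) l)).
  - rewrite ger0_norm ?subr_ge0 ?tm_fm// (le_trans _ dr)//.
    have : fm m (q m) l <= fm m (q m) ((l %/ (q m).+1).+1 * (q m).+1).
      by apply: fm_le; rewrite ltnW// -ltn_divLR.
    rewrite lerBlDr => /le_trans; apply.
    by rewrite fmE -(natr1 (l %/ (q m).+1)) (mulrDl _ _ (dt m)) mul1r addrC.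
apply: (@le_trans _ _ (1 * (e / t) * t)); last by rewrite mul1r divfK// gt_eqF.
rewrite ler_wpM2r ?(ltW t0)// expr2 ler_pM ?(ltW e10)//; first by rewrite ge_min lexx.
by rewrite ge_min lexx orbT.
Unshelve. all: by end_near. Qed.

Let b (q : nat -> nat) j m := \int[P]_w rho m (q m) j w.

Let b_cvg (q : nat -> nat) j : b q j @ \oo --> (0 : R).
Proof.
have := @Ex_dct _ _ _ P (fun m => rho m (q m) j) (cst 0) ((dl^-1 * (2 * K)) ^+ 2 * t).
rewrite Ex_cst; apply => //.
by apply: aeW => w; exact: rho_cvg.
Qed.

Let bE (q : nat -> nat) j m : (\int[P]_w (rho m (q m) j w)%:E = (b q j m)%:E)%E.
Proof. exact: Ex_fineE (bounded_integrable P (mrho m (q m) j) (rho_bound m (q m) j)). Qed.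

Let S1 (q : nat -> nat) j m w := \sum_(0 <= l < m.+1 * (q m).+1) a m (q m) j l w * xi m (q m) j l w.

Let mterm m q j l : measurable_fun setT (fun w => a m q j l w * xi m q j l w).
Proof. by apply: measurable_funM; [exact: maT|exact: mxi]. Qed.

Let mS1 q j m : measurable_fun setT (S1 q j m).
Proof. by apply: measurable_sum => l; exact: mterm. Qed.

Let S1_cvg q j : cvgp P (S1 q j).
Proof.
apply: (cvgp_L2 (mS1 q j) _ (b_cvg q j)) => m.
under eq_integral do rewrite /S1 big_mkord.
rewrite (L2_sum_lin hW (f0 m (q m)) (@ga m (q m) j)) -bE.
by under [leRHS]eq_integral do rewrite /rho big_mkord.
Qed.

Let Y m q j k w := \sum_(k * q.+1 <= l < k.+1 * q.+1) a m q j l w * xi m q j l w.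

Let mY m q j k : measurable_fun setT (Y m q j k).
Proof. by apply: measurable_sum => l; exact: mterm. Qed.

Let Y_L2 m q j k : (\int[P]_w (Y m q j k w ^+ 2)%:E =
  \int[P]_w (\sum_(k * q.+1 <= l < k.+1 * q.+1) a m q j l w ^+ 2 * f m q)%:E)%E.
Proof.
(* Coefficients set to 0 before the cell reduce the claim to the isometry for sums that start at
   time 0. *)
pose ak l w := if (k * q.+1 <= l)%N then a m q j l w else 0.
have gak l : gmeasurable (brownian_gen W (fm m q l)) (ak l).
  by rewrite /ak; case: leqP => _; [exact: ga|exact: gmeasurable_cst].
have := L2_sum_lin hW (f0 m q) gak j (k.+1 * q.+1).
under eq_integral => w _.
  rewrite (_ : \sum_(l < _) _ = Y m q j k w); last first.
    rewrite /Y big_geq_mkord/= [RHS]big_mkcond/=; apply: eq_bigr => l _.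
    by rewrite /ak; case: leqP => _; rewrite ?mul0r.
  over.
move=> ->; apply: eq_integral => w _; congr (_%:E).
rewrite big_geq_mkord/= [RHS]big_mkcond/=; apply: eq_bigr => l _.
by rewrite /ak; case: leqP => _; rewrite ?expr0n ?mul0r.
Qed.

Let S2 (q : nat -> nat) j m w := \sum_(0 <= k < m.+1) Y m (q m) j k w ^+ 2.

Let mS2 q j m : measurable_fun setT (S2 q j m).
Proof. by apply: measurable_sum => k; apply: measurable_funX; exact: mY. Qed.

Let S2_ge0 q j m w : 0 <= S2 q j m w.
Proof. by apply: sumr_ge0 => k _; exact: sqr_ge0. Qed.

(** Orthogonality inside each coarse cell shows that the mean of [S2] is that of [rho], as is the
    mean square of [S1]. *)
Let S2_cvg q j : cvgp P (S2 q j).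
Proof.
apply: (cvgp_L1 (mS2 q j) (S2_ge0 q j) _ (b_cvg q j)) => m.
have mY2 k : measurable_fun setT (fun w => (Y m (q m) j k w ^+ 2)%:E).
  by apply/measurable_EFinP; apply: measurable_funX; exact: mY.
have mr k : measurable_fun setT (fun w =>
    (\sum_(k * (q m).+1 <= l < k.+1 * (q m).+1) a m (q m) j l w ^+ 2 * f m (q m))%:E).
  apply/measurable_EFinP; apply: measurable_sum => l; apply: measurable_funM => //.
  by apply: measurable_funX; exact: maT.
under eq_integral do rewrite /S2 -sumEFin.
rewrite ge0_integral_sum//; last by move=> k w _; rewrite lee_fin sqr_ge0.
rewrite -bE.
under eq_bigr do rewrite Y_L2.
rewrite -ge0_integral_sum//; last first.
  move=> k w _; rewrite lee_fin; apply: sumr_ge0 => l _.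
  by rewrite mulr_ge0 ?sqr_ge0 ?(ltW (f0 _ _)).
rewrite le_eqVlt; apply/orP; left; apply/eqP.
by apply: eq_integral => w _; rewrite sumEFin /rho big_nat_mul.
Qed.

Let V m q k w := grid_defect m q k w.

Let mV m q k : measurable_fun setT (V m q k).
Proof.
apply: measurable_funB; first exact: mD.
apply: measurable_sum => j; apply: measurable_sum => l; apply: measurable_funM; last exact: mxi.
exact: (gmeasurableT (gC j (fm0 m q l))).
Qed.

Let S0 m q w := \sum_(0 <= k < m.+2) 2 / dl * `|V m q k w|.

Let mS0 m q : measurable_fun setT (S0 m q).
Proof.
apply: measurable_sum => k; apply: measurable_funM => //.
by apply: measurableT_comp => //; exact: mV.
Qed.

(** For a fixed coarse mesh, the defects at its finitely many times vanish in probability with the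
    fine mesh; a diagonal choice of the fine mesh makes their weighted sum vanish along the coarse
    ones. *)
Let qex : exists q : nat -> nat, cvgp P (fun m => S0 m (q m)).
Proof.
apply: cvgp_diagonal => [m q|m]; first exact: mS0.
apply: cvgp_sum => [k q|k].
  by apply: measurable_funM => //; apply: measurableT_comp => //; exact: mV.
move=> e eta e0 eta0.
have e1 : 0 < e / (2 / dl) by rewrite !divr_gt0.
have [M hM] := hV m k e1 eta0; exists M => q /hM.
rewrite (_ : [set w | (e / (2 / dl) <= _)%R] = [set w | (e <= `|2 / dl * `|V m q k w| |)%R])//.
have dd : 0 < 2 / dl by rewrite divr_gt0.
apply/seteqP; split => w /=.
  by rewrite ler_pdivrMr// normrM normr_id (gtr0_norm dd) mulrC.
by rewrite ler_pdivrMr// normrM normr_id (gtr0_norm dd) mulrC.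
Qed.

Notation DW m j k w := (W j (tm m k.+1) w - W j (tm m k) w).

Let cs m j j' k w := c j (tm m k) w * c j' (tm m k) w.

(** Compensated products of increments; summed over [j] and [j'] they compare the quadratic
    variation on the coarse grid with a Riemann sum. *)
Let S3 j j' m w := \sum_(0 <= k < m.+1) cs m j j' k w *
  (DW m j k w * DW m j' k w - (if j == j' then dt m else 0)).

Let gcs m j j' k : gmeasurable (brownian_gen W (tm m k)) (cs m j j' k).
Proof. by apply: gmeasurableM; exact: mc. Qed.

Let csK m j j' k w : `|cs m j j' k w| <= K ^+ 2.
Proof. by rewrite /cs normrM expr2 ler_pM. Qed.

Let mS3 j j' m : measurable_fun setT (S3 j j' m).
Proof.
apply: measurable_sum => k; apply: measurable_funM; first exact: (gmeasurableT (@gcs m j j' k)).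
apply: measurable_funB => //; apply: measurable_funM.
  by apply: measurable_funB; exact: measurable_funP.
by apply: measurable_funB; exact: measurable_funP.
Qed.

Let S3_cvg j j' : cvgp P (S3 j j').
Proof.
pose bb m : R := (K ^+ 2) ^+ 2 * 128 * t ^+ 2 * m.+1%:R^-1.
have bbE m : m.+1%:R * ((K ^+ 2) ^+ 2 * (128 * dt m ^+ 2)) = bb m.
  rewrite /bb; have : (m.+1%:R : R) != 0 by rewrite pnatr_eq0.
  by move: (m.+1%:R : R) => N N0; field.
apply: (@cvgp_L2 _ _ _ P (S3 j j') bb (mS3 j j')) => [m|]; last first.
  rewrite -[X in _ --> X](mulr0 ((K ^+ 2) ^+ 2 * 128 * t ^+ 2)).
  by apply: cvgM; [exact: cvg_cst|exact: cvg_harmonic].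
under eq_integral do rewrite /S3 big_mkord.
have [<-|jj'] := eqVneq j j'.
  have := L2_sum_quad hW (dt0 m) (@gcs m j j) (csK m j j) j m.+1.
  by rewrite bbE.
have := L2_sum_cross hW (dt0 m) (@gcs m j j') (csK m j j') m.+1 jj'.
under [X in _ -> (X <= _)%E]eq_integral do under eq_bigr do rewrite subr0.
move=> /le_trans; apply; rewrite -bbE lee_fin ler_pM2l ?ltr0n//.
rewrite ler_wpM2l ?sqr_ge0// -[leLHS]mul1r ler_wpM2r ?sqr_ge0//.
by rewrite ler1n.
Qed.

(** This is the error term [r] of [log_increments] on the paths that stay above [dl]; the maximum
    with [dl] in the denominator keeps it controlled on all the others. *)
Definition scaled_error m k w := th (tm m k) w * (D (tm m k.+1) w - D (tm m k) w) -
  \sum_j th (tm m k) w * C j (tm m k) w * DW m j k w.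

Let telW m q j k w : DW m j k w = \sum_(k * q.+1 <= l < k.+1 * q.+1) xi m q j l w.
Proof.
rewrite (telescope_sumr (fun l => W j (fm m q l) w)); first by rewrite !fmE.
by rewrite leq_mul2r leqnSn orbT.
Qed.

(** Splits the error into the defects of the fine Ito sums at both ends of the cell and the freezing
    errors inside it, for every [q]. *)
Let scaled_errorE m q k w : scaled_error m k w =
  th (tm m k) w * (V m q k.+1 w - V m q k w) + \sum_j Y m q j k w.
Proof.
have E j : Y m q j k w = th (tm m k) w * (\sum_(l < k.+1 * q.+1) C j (fm m q l) w * xi m q j l w
    - \sum_(l < k * q.+1) C j (fm m q l) w * xi m q j l w)
    - th (tm m k) w * C j (tm m k) w * DW m j k w.
  rewrite -!(big_mkord xpredT (fun l => C j (fm m q l) w * xi m q j l w)).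
  rewrite (@big_cat_nat _ _ _ (k * q.+1) 0 (k.+1 * q.+1))//=; last by rewrite leq_mul2r leqnSn orbT.
  rewrite addrAC subrr add0r (telW m q) !mulr_sumr -sumrB /Y.
  apply: eq_big_nat => l /andP[kl lk].
  have lE : (l %/ q.+1 = k)%N.
    by apply/eqP; rewrite eqn_leq -ltnS ltn_divLR// lk leq_divRL.
  by rewrite /a lE; ring.
under eq_bigr do rewrite E.
rewrite sumrB -mulr_sumr sumrB /scaled_error /V /grid_defect; ring.
Qed.

Let sum_th_V m q w : \sum_(k < m.+1) `|th (tm m k) w * (V m q k.+1 w - V m q k w)| <= S0 m q w.
Proof.
have h k : `|th (tm m k) w * (V m q k.+1 w - V m q k w)| <= dl^-1 * `|V m q k w| + dl^-1 * `|V m q k.+1 w|.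
  have /andP[h0 h1] := th_bound (tm m k) w.
  rewrite -mulrDr normrM (gtr0_norm h0); apply: ler_pM => //; first exact: ltW.
  by rewrite [leRHS]addrC ler_normB.
apply: (@le_trans _ _ (\sum_(k < m.+1) (dl^-1 * `|V m q k w| + dl^-1 * `|V m q k.+1 w|))).
  by apply: ler_sum => k _; exact: h.
rewrite big_split/= /S0.
have v0 k : 0 <= dl^-1 * `|V m q k w| by rewrite mulr_ge0// invr_ge0 ltW.
have -> : \sum_(0 <= k < m.+2) 2 / dl * `|V m q k w| =
    \sum_(k < m.+2) dl^-1 * `|V m q k w| + \sum_(k < m.+2) dl^-1 * `|V m q k w|.
  by rewrite big_mkord -big_split/=; apply: eq_bigr => k _; ring.
apply: lerD.
  by rewrite [leRHS]big_ord_recr/= lerDl.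
by rewrite [leRHS]big_ord_recl/= lerDr.
Qed.

(* [Z] collects all the error terms of the Taylor expansion on the grid of mesh
   [t / m.+1], computed through a finer grid of mesh [t / m.+1 / (q m).+1]. *)
Lemma error_terms : exists Z : nat -> Omega -> R,
  [/\ forall m, measurable_fun setT (Z m), cvgp P Z, forall m w, 0 <= Z m w &
   forall m w,
   [/\ `|\sum_(k < m.+1) scaled_error m k w| <= Z m w,
       \sum_(k < m.+1) scaled_error m k w ^+ 2 <= 2 * Z m w ^+ 2 + 2 * 2 ^+ n * Z m w &
       `|\sum_(k < m.+1) (\sum_j c j (tm m k) w * DW m j k w) ^+ 2 -
         \sum_(k < m.+1) (\sum_j c j (tm m k) w ^+ 2) * dt m| <= Z m w]].
Proof.
have [q hq] := qex.
pose Z m w := S0 m (q m) w + \sum_j `|S1 q j m w| + \sum_j S2 q j m w + \sum_j \sum_j' `|S3 j j' m w|.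
have mn (g : Omega -> R) : measurable_fun setT g -> measurable_fun setT (fun w => `|g w|).
  by move=> mg; apply: measurableT_comp.
have m1 m : measurable_fun setT (fun w => \sum_j `|S1 q j m w|).
  by apply: measurable_sum => j; apply: mn; exact: mS1.
have m2 m : measurable_fun setT (fun w => \sum_j S2 q j m w).
  by apply: measurable_sum => j; exact: mS2.
have m3' j m : measurable_fun setT (fun w => \sum_j' `|S3 j j' m w|).
  by apply: measurable_sum => j'; apply: mn; exact: mS3.
have m3 m : measurable_fun setT (fun w => \sum_j \sum_j' `|S3 j j' m w|).
  by apply: measurable_sum => j; exact: m3'.
have m01 m : measurable_fun setT (fun w => S0 m (q m) w + \sum_j `|S1 q j m w|).
  by apply: measurable_funD; [exact: mS0|exact: m1].
have m012 m : measurable_fun setT (fun w => S0 m (q m) w + \sum_j `|S1 q j m w| + \sum_j S2 q j m w).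
  by apply: measurable_funD; [exact: m01|exact: m2].
have s0 m w : 0 <= S0 m (q m) w.
  by apply: sumr_ge0 => k _; rewrite mulr_ge0// divr_ge0// ltW.
have s1 m w : 0 <= \sum_j `|S1 q j m w| by exact: sumr_ge0.
have s2 m w : 0 <= \sum_j S2 q j m w by apply: sumr_ge0 => j _; exact: S2_ge0.
have s3 m w : 0 <= \sum_j \sum_j' `|S3 j j' m w|.
  by apply: sumr_ge0 => j _; exact: sumr_ge0.
have Z0 m w : 0 <= Z m w by rewrite !addr_ge0.
exists Z; split => //.
- by move=> m; apply: measurable_funD; [exact: m012|exact: m3].
- apply: cvgpD => //.
    apply: cvgpD => //; last by apply: cvgp_sum => [j m|j]; [exact: mS2|exact: S2_cvg].
    apply: cvgpD => //.
    apply: cvgp_sum => [j m|j]; first by apply: mn; exact: mS1.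
    by apply: cvgp_norm; exact: S1_cvg.
  apply: cvgp_sum => [//|j]; apply: cvgp_sum => [j' m|j']; first by apply: mn; exact: mS3.
  by apply: cvgp_norm; exact: S3_cvg.
move=> m w.
have z0 := s0 m w; have z1 := s1 m w; have z2 := s2 m w; have z3 := s3 m w.
split.
- under eq_bigr do rewrite (scaled_errorE m (q m)).
  rewrite big_split/= (le_trans (ler_normD _ _))//.
  apply: (@le_trans _ _ (S0 m (q m) w + \sum_j `|S1 q j m w|)); last by rewrite /Z; lra.
  apply: lerD; first exact: le_trans (ler_norm_sum _ _ _) (sum_th_V m (q m) w).
  rewrite exchange_big/= (le_trans (ler_norm_sum _ _ _))//.
  apply: ler_sum => j _; rewrite le_eqVlt; apply/orP; left; apply/eqP.
  by rewrite /S1 big_nat_mul big_mkord.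
- apply: (@le_trans _ _ (2 * S0 m (q m) w ^+ 2 + 2 * 2 ^+ n * \sum_j S2 q j m w)); last first.
    apply: lerD.
      rewrite ler_pM2l// lerXn2r// ?nnegrE//; rewrite /Z; lra.
    rewrite ler_wpM2l ?mulr_ge0 ?exprn_ge0// /Z; lra.
  apply: (@le_trans _ _ (\sum_(k < m.+1) (2 * `|th (tm m k) w * (V m (q m) k.+1 w - V m (q m) k w)| ^+ 2
      + 2 * 2 ^+ n * \sum_j Y m (q m) j k w ^+ 2))).
    apply: ler_sum => k _; rewrite (scaled_errorE m (q m)) real_normK ?num_real//.
    have h := sqr_sum_le (index_enum 'I_n) (fun j => Y m (q m) j k w).
    have sz : size (index_enum 'I_n) = n by rewrite -[RHS]card_ord cardT enumT.
    rewrite sz in h; rewrite -mulrA.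
    move: h; move: (th _ _ * _) (\sum_j Y m (q m) j k w) (2 ^+ n * _) => u v z h.
    have h2 : 0 <= (u - v) ^+ 2 by exact: sqr_ge0.
    by move: h h2; rewrite !expr2; lra.
  rewrite big_split/= -!mulr_sumr; apply: lerD.
    rewrite ler_pM2l//.
    apply: (@le_trans _ _ ((\sum_(k < m.+1) `|th (tm m k) w * (V m (q m) k.+1 w - V m (q m) k w)|) ^+ 2)).
      exact: (@sum_sqr_le _ _ (fun k => `|th (tm m k) w * (V m (q m) k.+1 w - V m (q m) k w)|)).
    by rewrite lerXn2r// ?nnegrE ?sumr_ge0// sum_th_V.
  rewrite ler_wpM2l ?mulr_ge0 ?exprn_ge0// exchange_big/=; apply: ler_sum => j _.
  by rewrite /S2 big_mkord.
- apply: (@le_trans _ _ (\sum_j \sum_j' `|S3 j j' m w|)); last by rewrite /Z; lra.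
  apply: (@le_trans _ _ `|\sum_j \sum_j' S3 j j' m w|); last first.
    rewrite (le_trans (ler_norm_sum _ _ _))//; apply: ler_sum => j _; exact: ler_norm_sum.
  apply: eq_ler; congr `|_|.
  under [RHS]eq_bigr do under eq_bigr do rewrite /S3 big_mkord.
  under [RHS]eq_bigr do rewrite exchange_big.
  rewrite [RHS]exchange_big/= -sumrB; apply: eq_bigr => k _.
  rewrite expr2 mulr_suml mulr_suml -sumrB; apply: eq_bigr => j _.
  rewrite mulr_sumr.
  under [RHS]eq_bigr do rewrite mulrBr.
  rewrite sumrB; congr (_ - _).
    by apply: eq_bigr => j' _; rewrite /cs; ring.
  rewrite (bigD1 j)//= eqxx big1 ?addr0; first by rewrite /cs expr2.
  by move=> j' jj'; rewrite eq_sym (negbTE jj') mulr0.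
Qed.

End error_terms.

Section integral_linearity.
Context {R : realType}.
Implicit Types g h : R -> R.

Lemma J_lin g h (k t : R) : cts0 g -> cts0 h ->
  J (fun s => g s + k * h s) t = J g t + k * J h t.
Proof.
move=> cg ch; have ig := cts0_integrable t cg; have ih := cts0_integrable t ch.
have ckh : cts0 (fun s => k * h s) by apply: cts0M => //; exact: cts0_cst.
rewrite /J RintegralD//; last exact: cts0_integrable.
by rewrite RintegralZl.
Qed.

Lemma eq_J g h (t : R) : (forall s, 0 <= s -> s <= t -> g s = h s) -> J g t = J h t.
Proof.
by move=> gh; apply: eq_Rintegral => s; rewrite inE/= in_itv/= => /andP[]; exact: gh.
Qed.

End integral_linearity.

Lemma cvg_cst_eq {R : realType} (c l : R) : (fun _ : nat => c) @ \oo --> l -> c = l.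
Proof.
move=> /cvgrPdist_lt h; apply: contrapT => /eqP ne.
have e0 : 0 < `|l - c| by rewrite normr_gt0 subr_eq0 eq_sym.
by have [N _ hN] := h _ e0; have := hN N (leqnn N); rewrite /= ltxx.
Qed.

(** * Relative drift and volatility, and the Ito correction *)

Section coefficients.
Context {R : realType} {n : nat}.
Variables (A : 'M[R]_n) (sigma : 'I_n -> R).
Implicit Types (x : 'cV[R]_n) (i j : 'I_n).

(** The drift of coordinate [i] relative to that coordinate, see [driftE]; [volatility] plays the
    same role for the dispersion. *)
Definition growth i x : R :=
  \sum_k (A i k - (i == k)%:R * sigma i ^+ 2) * x k 0 -
  \sum_l x l 0 * \sum_k (A l k - (l == k)%:R * sigma l ^+ 2) * x k 0.

Definition volatility i j x : R := ((i == j)%:R - x j 0) * sigma j.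

Definition variance_rate i x : R := \sum_j volatility i j x ^+ 2.

Lemma simplex_proj_mulmx p (M : 'M[R]_(n, p)) x i (j : 'I_p) :
  (simplex_proj x *m M) i j = x i 0 * (M i j - \sum_l x l 0 * M l j).
Proof.
rewrite mxE mulrBr mulr_sumr.
transitivity (\sum_k ((x i 0 * (i == k)%:R) * M k j - x i 0 * (x k 0 * M k j))).
  apply: eq_bigr => k _; rewrite !mxE big_ord1 !mxE mulrBl mulr_natr.
  by congr (_ - _); rewrite mulrA.
rewrite sumrB (bigD1 i)//= eqxx mulr1 big1 ?addr0//.
by move=> k ki; rewrite eq_sym (negbTE ki) mulr0 mul0r.
Qed.

Lemma driftE x i : drift A sigma x i 0 = x i 0 * growth i x.
Proof.
rewrite /drift -mulmxA simplex_proj_mulmx /growth.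
have E k : ((A - diag_mx (\row_i sigma i ^+ 2)) *m x) k 0 =
    \sum_l (A k l - (k == l)%:R * sigma k ^+ 2) * x l 0.
  by rewrite mxE; apply: eq_bigr => l _; rewrite !mxE mulr_natl.
by rewrite E; congr (_ * (_ - _)); apply: eq_bigr => l _; rewrite E.
Qed.

Lemma dispersionE x i j : dispersion sigma x i j = x i 0 * volatility i j x.
Proof.
rewrite /dispersion simplex_proj_mulmx /volatility; congr (_ * _).
rewrite (bigD1 j)//= big1 ?addr0; last first.
  by move=> k kj; rewrite !mxE (negbTE kj) mulr0n mulr0.
rewrite !mxE eqxx mulr1n mulrBl; congr (_ - _).
by have [->|_] := eqVneq i j; rewrite ?mulr1n ?mul1r// mulr0n mul0r.
Qed.

Lemma variance_rateE x i : variance_rate i x =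
  (1 - 2 * x i 0) * sigma i ^+ 2 + \sum_j x j 0 ^+ 2 * sigma j ^+ 2.
Proof.
rewrite /variance_rate.
transitivity (\sum_j ((i == j)%:R * ((1 - 2 * x j 0) * sigma j ^+ 2) + x j 0 ^+ 2 * sigma j ^+ 2)).
  apply: eq_bigr => j _; rewrite /volatility; case: (i == j) => /=; ring.
rewrite big_split/=; congr (_ + _).
rewrite (bigD1 i)//= eqxx mul1r big1 ?addr0//.
by move=> j ji; rewrite eq_sym (negbTE ji) mul0r.
Qed.

(** Half the variance rate contains [sigma i ^+ 2 / 2] and a term [- sigma i ^+ 2 * x i 0], which
    cancels against the same term of the growth. Everything common to all coordinates drops out of
    the difference, and the modified payoffs are what is left. This is where the matrix
    [modified_payoff] comes from. *)
Lemma growth_payoff x i i' : \sum_k x k 0 = 1 ->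
  growth i x - variance_rate i x / 2 - (growth i' x - variance_rate i' x / 2) =
  (modified_payoff A sigma *m x) i 0 - (modified_payoff A sigma *m x) i' 0.
Proof.
move=> x1.
have E1 l : (modified_payoff A sigma *m x) l 0 = \sum_k A l k * x k 0 - sigma l ^+ 2 / 2.
  have -> : sigma l ^+ 2 / 2 = \sum_k sigma l ^+ 2 / 2 * x k 0 by rewrite -mulr_sumr x1 mulr1.
  rewrite mxE -sumrB; apply: eq_bigr => k _.
  by rewrite !mxE; ring.
have E2 l : \sum_k (A l k - (l == k)%:R * sigma l ^+ 2) * x k 0 =
    \sum_k A l k * x k 0 - sigma l ^+ 2 * x l 0.
  transitivity (\sum_k (A l k * x k 0 - (l == k)%:R * (sigma l ^+ 2 * x k 0))).
    by apply: eq_bigr => k _; ring.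
  rewrite sumrB; congr (_ - _).
  rewrite (bigD1 l)//= eqxx mul1r big1 ?addr0//.
  by move=> j jl; rewrite eq_sym (negbTE jl) mul0r.
rewrite !E1 /growth (E2 i) (E2 i') !variance_rateE.
by move: (\sum_l _) (\sum_j _) (\sum_k A i k * _) (\sum_k A i' k * _) => a b c e; field.
Qed.

End coefficients.

(** * Log ratios of the coordinates of the process *)

Section log_ratios.
Context {R : realType} {n : nat} {d : measure_display} {Omega : measurableType d}.
Variables (P : probability Omega R) (W : 'I_n -> R -> {RV P >-> R}).
Hypothesis hW : brownian_motion W.
Variables (A : 'M[R]_n) (sigma : 'I_n -> R) (x : 'cV[R]_n) (X : R -> Omega -> 'cV[R]_n).
Hypothesis hX : replicator_process A sigma W x X.

Lemma process_cts i w : cts0 (fun s => X s w i 0).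
Proof. by case: hX => _ cX _ _ _; exact: cX. Qed.

Lemma process_gmeasurable i (s : R) : 0 <= s -> gmeasurable (brownian_gen W s) (fun w => X s w i 0).
Proof.
move=> s0; case: hX => aX _ _ _ _.
exact: (@gmeasurable_adapted _ _ _ _ _ W (fun t w => X t w i 0)).
Qed.

Lemma process_measurable i (s : R) : 0 <= s -> measurable_fun setT (fun w => X s w i 0).
Proof. by move=> s0; exact: (gmeasurableT (process_gmeasurable i s0)). Qed.

(** The coordinates lie in the unit interval only almost surely. Clipping them yields bounds at
    every [w], and it preserves adaptedness and, almost surely, the values. *)
Let clip (z : R) := Num.max 0 (Num.min z 1).

Let clip01 z : 0 <= clip z <= 1.
Proof. by rewrite /clip le_max lexx/= ge_max ler01 ge_min lexx orbT. Qed.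

Let clip_id z : 0 <= z <= 1 -> clip z = z.
Proof. by move=> /andP[z0 z1]; rewrite /clip min_l// max_r. Qed.

Let clip_lip (u v : R) : `|clip u - clip v| <= `|u - v|.
Proof.
have hmax (a b : R) : `|Num.max 0 a - Num.max 0 b| <= `|a - b|.
  rewrite /Num.max; have := ler_norm (a - b); have := ler_norm (b - a).
  rewrite (distrC b a); move: `|a - b| (normr_ge0 (a - b)) => e.
  by case: (ltP 0 a); case: (ltP 0 b) => h1 h2 e0 h3 h4; rewrite ler_norml; apply/andP; split; lra.
have hmin (a b : R) : `|Num.min a 1 - Num.min b 1| <= `|a - b|.
  rewrite /Num.min; have := ler_norm (a - b); have := ler_norm (b - a).
  rewrite (distrC b a); move: `|a - b| (normr_ge0 (a - b)) => e.
  by case: (ltP a 1); case: (ltP b 1) => h1 h2 e0 h3 h4; rewrite ler_norml; apply/andP; split; lra.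
exact: le_trans (hmax _ _) (hmin _ _).
Qed.

Let clip_cts g : cts0 g -> cts0 (fun s => clip (g s)).
Proof.
move=> cg; apply/subspace_continuousP => s; rewrite /= in_itv/= andbT => s0.
apply/cvgrPdist_le => e e0; have [r r0 hr] := cts0_near cg s0 e0.
rewrite near_withinE; exists r => // v /= sv; rewrite in_itv/= andbT => v0.
exact: le_trans (clip_lip _ _) (hr v v0 sv).
Qed.

Let Y i s w := clip (X s w i 0).

Let gY i (s : R) : 0 <= s -> gmeasurable (brownian_gen W s) (Y i s).
Proof.
move=> s0; apply: (@lip_measurable _ (g_sigma_algebraType (brownian_gen W s)) R 'I_1
  (fun _ w => X s w i 0) (fun a => clip (a ord0)) 1).
  by move=> _; exact: process_gmeasurable.
by move=> a b e ab; rewrite mul1r (le_trans (clip_lip _ _)).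
Qed.

Let c i j s w := ((i == j)%:R - Y j s w) * sigma j.

Let gc i j (s : R) : 0 <= s -> gmeasurable (brownian_gen W s) (c i j s).
Proof.
move=> s0; apply: gmeasurableM; last exact: gmeasurable_cst.
by apply: gmeasurableB; [exact: gmeasurable_cst|exact: gY].
Qed.

Let K := \sum_j `|sigma j|.

Let cK i j s w : `|c i j s w| <= K.
Proof.
rewrite /c normrM; apply: (@le_trans _ _ (1 * `|sigma j|)).
  apply: ler_wpM2r => //; have /andP[] := clip01 (X s w j 0); rewrite -/(Y j s w) => h0 h1.
  by rewrite ler_norml; case: (i == j) => /=; lra.
by rewrite mul1r /K (bigD1 j)//= lerDl sumr_ge0.
Qed.

Let cYp i w : cts0 (fun s => Y i s w).
Proof. exact/clip_cts/process_cts. Qed.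

Let ccp i j w : cts0 (fun s => c i j s w).
Proof.
apply: cts0M; last exact: cts0_cst.
by apply: cts0B; [exact: cts0_cst|exact: cYp].
Qed.

Let D i s w := X s w i 0 - x i 0 - J (fun u => drift A sigma (X u w) i 0) s.

Let growth_cts i w : cts0 (fun s => growth A sigma i (X s w)).
Proof.
have lin l : cts0 (fun s => \sum_k (A l k - (l == k)%:R * sigma l ^+ 2) * X s w k 0).
  by apply: cts0_sum => k; apply: cts0M; [exact: cts0_cst|exact: process_cts].
apply: cts0B => //; apply: cts0_sum => l; apply: cts0M => //; exact: process_cts.
Qed.

Let drift_cts i w : cts0 (fun s => drift A sigma (X s w) i 0).
Proof.
rewrite (_ : (fun s => _) = (fun s => X s w i 0 * growth A sigma i (X s w))).
  by apply: cts0M; [exact: process_cts|exact: growth_cts].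
by apply/funext => s; rewrite driftE.
Qed.

Let drift_measurable i (s : R) : 0 <= s -> measurable_fun setT (fun w => drift A sigma (X s w) i 0).
Proof.
move=> s0; rewrite (_ : (fun w => _) = (fun w => X s w i 0 * growth A sigma i (X s w))); last first.
  by apply/funext => w; rewrite driftE.
have lin l : measurable_fun setT (fun w => \sum_k (A l k - (l == k)%:R * sigma l ^+ 2) * X s w k 0).
  by apply: measurable_sum => k; apply: measurable_funM => //; exact: process_measurable.
apply: measurable_funM; first exact: process_measurable.
apply: measurable_funB => //; apply: measurable_sum => l; apply: measurable_funM => //.
exact: process_measurable.
Qed.

Let mD i (s : R) : 0 <= s -> measurable_fun setT (D i s).
Proof.
move=> s0; apply: measurable_funB.
  by apply: measurable_funB => //; exact: process_measurable.
apply: (measurable_J (H := fun u w => drift A sigma (X u w) i 0)) => //.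
by move=> u u0; exact: drift_measurable.
Qed.

Let good : {ae P, forall w, [/\ X 0 w = x, forall s : R, 0 <= s -> int_simplex (X s w) &
  forall (s : R) i, 0 <= s -> Y i s w = X s w i 0]}.
Proof.
case: hX => _ _ X0 Xs _; apply: filterS2 X0 Xs => w X0w Xsw; split => // s i s0.
by rewrite /Y clip_id//; have [[h _] _] := Xsw s s0; exact: h.
Qed.

Let volatility_cts i j w : cts0 (fun s => volatility sigma i j (X s w)).
Proof.
apply: cts0M; last exact: cts0_cst.
by apply: cts0B; [exact: cts0_cst|exact: process_cts].
Qed.

Let dispersion_cts i j w : cts0 (fun s => dispersion sigma (X s w) i j).
Proof.
rewrite (_ : (fun s => _) = (fun s => X s w i 0 * volatility sigma i j (X s w))).
  by apply: cts0M; [exact: process_cts|exact: volatility_cts].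
by apply/funext => s; rewrite dispersionE.
Qed.

Let gdispersion i j (s : R) : 0 <= s ->
  gmeasurable (brownian_gen W s) (fun w => dispersion sigma (X s w) i j).
Proof.
move=> s0; rewrite (_ : (fun w => _) = (fun w => X s w i 0 * volatility sigma i j (X s w))); last first.
  by apply/funext => w; rewrite dispersionE.
apply: gmeasurableM; first exact: process_gmeasurable.
apply: gmeasurableM; last exact: gmeasurable_cst.
by apply: gmeasurableB; [exact: gmeasurable_cst|exact: process_gmeasurable].
Qed.

Section fixed_time.
Variables (t : R) (t0 : 0 < t).

Let dt0 m : 0 < t / m.+1%:R. Proof. by rewrite divr_gt0// ltr0n. Qed.

(** The stochastic equation enters here: [D] is almost surely a sum of Ito integrals, and an Ito
    integral is by definition the limit of the elementary integrals of any simple approximation, in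
    particular of those on the grid. *)
Let hV i m k : cvgp P (fun q w => grid_defect W t (Y i) (c i) (D i) m q k w).
Proof.
have tm0 : 0 <= k%:R * (t / m.+1%:R) by rewrite mulr_ge0// ltW.
have fm0 q l : 0 <= l%:R * (t / m.+1%:R / q.+1%:R) by rewrite mulr_ge0// divr_ge0// ltW.
case: hX => _ _ _ _ /(_ _ tm0)[I [Iito IE]].
pose C j s w := Y i s w * c i j s w.
have gC j (s : R) : 0 <= s -> gmeasurable (brownian_gen W s) (C j s).
  by move=> s0; apply: gmeasurableM; [exact: gY|exact: gc].
pose SI j q w := simple_integral (fun s => W j s) (grid_process (C j) (t / m.+1%:R) k q) w.
have mSI j q : measurable_fun setT (SI j q).
  apply: measurable_sum => l /=; apply: measurable_funM.
    exact: (gmeasurableT (gC j _ (fm0 q l))).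
  by apply: measurable_funB; exact: measurable_funP.
have cSI j : cvgp P (fun q w => SI j q w - I i j w).
  apply/cvg_in_probabilityP; [exact: mSI|exact: measurable_funP|].
  have [_] := Iito i j; apply; apply: (grid_approximation (K := K)) => //.
  - exact: gdispersion.
  - exact: gC.
  - move=> s w; have /andP[h0 h1] := clip01 (X s w i 0).
    by rewrite /C normrM (ger0_norm h0) (le_trans _ (cK i j s w))// ler_piMl.
  - apply: filterS good => w [_ _ YX] s s0.
    by rewrite /C /c !YX// dispersionE.
have mG q : measurable_fun setT (grid_defect W t (Y i) (c i) (D i) m q k).
  apply: measurable_funB; first exact: mD.
  apply: measurable_sum => j; apply: measurable_sum => l; apply: measurable_funM.
    exact: (gmeasurableT (gC j _ (fm0 q l))).
  by apply: measurable_funB; exact: measurable_funP.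
have mS q : measurable_fun setT (fun w => \sum_j (SI j q w - I i j w)).
  by apply: measurable_sum => j; apply: measurable_funB; [exact: mSI|exact: measurable_funP].
apply: (cvgp_le mG mS).
  move=> q; apply: filterS IE => w /(_ i) IEw.
  rewrite -[leRHS]normrN; apply: eq_ler; congr `|_|.
  by rewrite sumrB opprB /grid_defect /D /J IEw; congr (_ - _); ring.
apply: cvgp_sum => [j q|j]; last exact: cSI.
by apply: measurable_funB; [exact: mSI|exact: measurable_funP].
Qed.

(** A single [Z] dominates all the error terms, so that [log_increments] applies to every path on
    which [Z] vanishes along a subsequence. Paths that come below [dl] are left aside; they are
    recovered by letting [dl] run through the values [1 / (N + 1)]. *)
Lemma log_coordinate i (dl : R) : 0 < dl -> exists Z : nat -> Omega -> R,
  [/\ forall m, measurable_fun setT (Z m), cvgp P Z, forall m w, 0 <= Z m w &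
   {ae P, forall w, forall phi : nat -> nat, (forall q, (q <= phi q)%N) ->
     Z (phi q) w @[q --> \oo] --> 0 ->
     (forall s, 0 <= s <= t -> dl <= X s w i 0) ->
     \sum_(k < (phi q).+1) \sum_j volatility sigma i j (X (k%:R * (t / (phi q).+1%:R)) w) *
        (W j (k.+1%:R * (t / (phi q).+1%:R)) w - W j (k%:R * (t / (phi q).+1%:R)) w) @[q --> \oo] -->
     ln (X t w i 0) - ln (x i 0) - J (fun s => growth A sigma i (X s w)) t +
       J (fun s => variance_rate sigma i (X s w)) t / 2}].
Proof.
move=> dl0.
have [Z [mZ cZ Z0 hZ]] := error_terms hW t0 dl0 (gY i) (gc i) (mD i) (@cYp i) (@ccp i)
  (fun s w => clip01 (X s w i 0)) (cK i) (hV i).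
exists Z; split => //; apply: filterS good => w [X0 Xs YX] phi phi_ge Zcv Xdl.
have tm0 q k : 0 <= k%:R * (t / (phi q).+1%:R) by rewrite mulr_ge0// ltW.
have tmt q k : (k <= (phi q).+1)%N -> k%:R * (t / (phi q).+1%:R) <= t.
  move=> kq; have {2}-> : t = (phi q).+1%:R * (t / (phi q).+1%:R) by rewrite mulrC divfK// pnatr_eq0.
  by rewrite ler_wpM2r ?ler_nat// ltW.
have cvol : cts0 (fun s => variance_rate sigma i (X s w)).
  apply: cts0_sum => j; rewrite (_ : (fun s => _) =
    (fun s => volatility sigma i j (X s w) * volatility sigma i j (X s w))).
    by apply: cts0M; exact: volatility_cts.
  by apply/funext => s; rewrite expr2.
have cE j (s : R) : 0 <= s -> c i j s w = volatility sigma i j (X s w).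
  by move=> s0; rewrite /c YX.
have rE q k : (k < (phi q).+1)%N -> (X (k.+1%:R * (t / (phi q).+1%:R)) w i 0 - X (k%:R * (t / (phi q).+1%:R)) w i 0) /
    X (k%:R * (t / (phi q).+1%:R)) w i 0 -
   (J (fun s => drift A sigma (X s w) i 0) (k.+1%:R * (t / (phi q).+1%:R)) -
    J (fun s => drift A sigma (X s w) i 0) (k%:R * (t / (phi q).+1%:R))) /
    X (k%:R * (t / (phi q).+1%:R)) w i 0 -
   \sum_j volatility sigma i j (X (k%:R * (t / (phi q).+1%:R)) w) *
      (W j (k.+1%:R * (t / (phi q).+1%:R)) w - W j (k%:R * (t / (phi q).+1%:R)) w) =
   scaled_error W t dl (Y i) (c i) (D i) (phi q) k w.
  move=> kq; rewrite /scaled_error YX//.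
  have Xk : dl <= X (k%:R * (t / (phi q).+1%:R)) w i 0 by apply: Xdl; rewrite tm0 tmt// ltnW.
  have Xk0 : X (k%:R * (t / (phi q).+1%:R)) w i 0 != 0 by rewrite gt_eqF// (lt_le_trans dl0).
  rewrite max_l//; congr (_ - _).
    by rewrite /D; move: Xk0; move: (X (k%:R * _) w i 0) => z z0; field.
  by apply: eq_bigr => j _; rewrite cE// (mulKf Xk0).
have := @log_increments R t dl (fun s => X s w i 0) (fun s => drift A sigma (X s w) i 0)
  (fun s => growth A sigma i (X s w)) (fun s => variance_rate sigma i (X s w)) phi
  (fun q k => \sum_j volatility sigma i j (X (k%:R * (t / (phi q).+1%:R)) w) *
        (W j (k.+1%:R * (t / (phi q).+1%:R)) w - W j (k%:R * (t / (phi q).+1%:R)) w))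
  t0 dl0 phi_ge (@process_cts i w) (@growth_cts i w) (@drift_cts i w) Xdl _.
rewrite X0; apply.
- by move=> s _; rewrite driftE.
- apply: (cvg_dist_le0 (v := fun q => Z (phi q) w)) => //.
  apply: nearW => q; rewrite subr0; have [h _ _] := hZ (phi q) w; apply: le_trans h.
  by apply: eq_ler; congr `|_|; apply: eq_bigr => k _; rewrite rE.
- apply: (cvg_dist_le0 (v := fun q => 2 * Z (phi q) w ^+ 2 + 2 * 2 ^+ n * Z (phi q) w)).
    apply: nearW => q; rewrite subr0 ger0_norm; last by apply: sumr_ge0 => k _; exact: sqr_ge0.
    have [_ h _] := hZ (phi q) w; apply: le_trans h.
    by apply: eq_ler; apply: eq_bigr => k _; rewrite rE.
  have Z2 : Z (phi q) w * Z (phi q) w @[q --> \oo] --> 0.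
    by rewrite -[X in _ --> X](mulr0 0); exact: cvgM.
  have h := cvg_lin 2 Z2 (cvg_lin (2 * 2 ^+ n) Zcv (cvg_cst_seq 0)).
  rewrite !mulr0 !addr0 in h; apply: (eq_cvg_seq _ h) => q.
  by rewrite expr2 addr0.
- pose Rs q := \sum_(k < (phi q).+1) variance_rate sigma i (X (k%:R * (t / (phi q).+1%:R)) w) *
    (t / (phi q).+1%:R).
  have phioo : phi @ \oo --> \oo.
    by move=> B [N _ hN]; exists N => // q Nq; apply: hN; exact: leq_trans Nq (phi_ge q).
  have hR : Rs @ \oo --> J (fun s => variance_rate sigma i (X s w)) t.
    exact: (cvg_comp _ _ phioo (riemann_sum cvol (ltW t0))).
  pose Ms q := \sum_(k < (phi q).+1) (\sum_j volatility sigma i j (X (k%:R * (t / (phi q).+1%:R)) w) *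
        (W j (k.+1%:R * (t / (phi q).+1%:R)) w - W j (k%:R * (t / (phi q).+1%:R)) w)) ^+ 2.
  have hM : Ms q - Rs q @[q --> \oo] --> 0.
    apply: (cvg_dist_le0 (v := fun q => Z (phi q) w)) => //.
    apply: nearW => q; rewrite subr0; have [_ _ h] := hZ (phi q) w; apply: le_trans h.
    apply: eq_ler; congr `|_ - _|; apply: eq_bigr => k _.
      by congr (_ ^+ 2); apply: eq_bigr => j _; rewrite cE.
    by congr (_ * _); apply: eq_bigr => j _; rewrite cE.
  have h := cvg_lin 1 hM hR; rewrite mulr0 add0r in h.
  by apply: (eq_cvg_seq _ h) => q; rewrite mul1r subrK.
Qed.

(** The state dependent part of the volatility is the same for [i] and [i']. In the difference of
    the two expansions only constant coefficients remain and the sums telescope, so the sequence is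
    constant and equal to its limit. *)
Lemma log_ratio_fixed i i' (dl : R) : 0 < dl -> {ae P, forall w,
  (forall s, 0 <= s <= t -> dl <= X s w i 0) -> (forall s, 0 <= s <= t -> dl <= X s w i' 0) ->
  ln (X t w i 0) - ln (X t w i' 0) = ln (x i 0) - ln (x i' 0) +
    J (fun s => (modified_payoff A sigma *m X s w) i 0 - (modified_payoff A sigma *m X s w) i' 0) t +
    sigma i * W i t w - sigma i' * W i' t w}.
Proof.
move=> dl0.
have [Z1 [mZ1 cZ1 Z10 hZ1]] := log_coordinate i dl0.
have [Z2 [mZ2 cZ2 Z20 hZ2]] := log_coordinate i' dl0.
have mZ m : measurable_fun setT (fun w => Z1 m w + Z2 m w) by exact: measurable_funD.
have [phi phi_ge hphi] := cvgp_subsequence mZ (cvgpD mZ1 mZ2 cZ1 cZ2).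
apply: filterS2 (filterI hZ1 hZ2) (filterI hphi good) => w [h1 h2] [h3 [_ Xs _]] Xi Xi'.
have Z1cv : Z1 (phi q) w @[q --> \oo] --> 0.
  by apply: cvg_dist_le0 h3; apply: nearW => q; rewrite subr0 ger0_norm// lerDl.
have Z2cv : Z2 (phi q) w @[q --> \oo] --> 0.
  by apply: cvg_dist_le0 h3; apply: nearW => q; rewrite subr0 ger0_norm// lerDr.
have {h1} := h1 phi phi_ge Z1cv Xi; have {h2} := h2 phi phi_ge Z2cv Xi'.
set S1 := (fun q => _); set l1 := (X in _ --> X) => h1.
set S2 := (fun q => _); set l2 := (X in _ --> X) => h2.
have h := cvg_lin (-1) h1 h2.
have SE q : -1 * S1 q + S2 q = sigma i * W i t w - sigma i' * W i' t w.
  rewrite /S1 /S2; set f := t / (phi q).+1%:R.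
  have tel j : \sum_(k < (phi q).+1) (W j (k.+1%:R * f) w - W j (k%:R * f) w) = W j t w.
    rewrite -(big_mkord xpredT (fun k => W j (k.+1%:R * f) w - W j (k%:R * f) w)).
    rewrite (telescope_sumr (fun k => W j (k%:R * f) w))// mul0r.
    by case: hW => -> _ _ _; rewrite subr0 /f mulrC divfK// pnatr_eq0.
  rewrite -(tel i) -(tel i') !mulr_sumr -sumrB -big_split/=; apply: eq_bigr => k _.
  rewrite mulN1r addrC -sumrB.
  transitivity (\sum_j ((i == j)%:R * (sigma j * (W j (k.+1%:R * f) w - W j (k%:R * f) w)) -
     (i' == j)%:R * (sigma j * (W j (k.+1%:R * f) w - W j (k%:R * f) w)))).
    by apply: eq_bigr => j _; rewrite /volatility; ring.
  rewrite sumrB (bigD1 i)//= eqxx mul1r big1 ?addr0; last first.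
    by move=> j ji; rewrite eq_sym (negbTE ji) mul0r.
  rewrite (bigD1 i')//= eqxx mul1r big1 ?addr0//.
  by move=> j ji; rewrite eq_sym (negbTE ji) mul0r.
have hc : (fun _ : nat => sigma i * W i t w - sigma i' * W i' t w) @ \oo --> -1 * l1 + l2.
  exact: (eq_cvg_seq SE h).
have := cvg_cst_eq hc; rewrite /l1 /l2 => E.
have cvol k : cts0 (fun s => variance_rate sigma k (X s w)).
  apply: cts0_sum => j; rewrite (_ : (fun s => _) =
    (fun s => volatility sigma k j (X s w) * volatility sigma k j (X s w))).
    by apply: cts0M; exact: volatility_cts.
  by apply/funext => s; rewrite expr2.
have cgv k : cts0 (fun s => growth A sigma k (X s w) + - 2^-1 * variance_rate sigma k (X s w)).
  by apply: cts0D; [exact: growth_cts|apply: cts0M => //; exact: cts0_cst].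
have JE : J (fun s => (modified_payoff A sigma *m X s w) i 0 - (modified_payoff A sigma *m X s w) i' 0) t =
   J (fun s => growth A sigma i (X s w)) t + - 2^-1 * J (fun s => variance_rate sigma i (X s w)) t
   + (-1) * (J (fun s => growth A sigma i' (X s w)) t + - 2^-1 * J (fun s => variance_rate sigma i' (X s w)) t).
  rewrite -(J_lin _ _ (@growth_cts i w) (@cvol i)) -(J_lin _ _ (@growth_cts i' w) (@cvol i')).
  rewrite -(J_lin _ _ (@cgv i) (@cgv i')); apply: eq_J => s s0 st.
  have [[_ X1] _] := Xs s s0.
  by rewrite -(growth_payoff A sigma i i' X1); field.
rewrite JE; move: E; lra.
Qed.

End fixed_time.

Let positive_lower (g : R -> R) (t : R) : cts0 g -> (forall s, 0 <= s -> 0 < g s) ->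
  exists N : nat, forall s, 0 <= s <= t -> N.+1%:R^-1 <= g s.
Proof.
move=> cg g0; have [t0|t0] := leP 0 t; last first.
  by exists 0%N => s /andP[s0 st]; have := le_lt_trans (le_trans s0 st) t0; rewrite ltxx.
have cg' : {within `[0, t], continuous g}.
  apply: continuous_subspaceW cg => y; rewrite /= !in_itv/= => /andP[-> _].
  by rewrite andbT.
have [m mI hm] := EVT_min t0 cg'.
have gm : 0 < g m by move: mI; rewrite in_itv/= => /andP[m0 _]; exact: g0.
exists (Num.truncn (g m)^-1) => s sI; rewrite (le_trans _ (hm s _))//.
rewrite -[leRHS]invrK lef_pV2 ?posrE ?invr_gt0 ?ltr0n//.
by apply: ltW; exact: truncnS_gt.
Qed.

Let log_cts (g : R -> R) : cts0 g -> (forall s, 0 <= s -> 0 < g s) -> cts0 (fun s => ln (g s)).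
Proof.
move=> cg g0; apply/subspace_continuousP => s sI.
have s0 : 0 <= s by move: sI; rewrite /= in_itv/= andbT.
apply/cvgrPdist_le => e e0.
have /cvgrPdist_le /(_ _ e0) [r /= r0 hr] := continuous_ln (g0 s s0).
have r20 : 0 < r / 2 by rewrite divr_gt0.
have [q q0 hq] := cts0_near cg s0 r20.
rewrite near_withinE; exists q => // v /= sv; rewrite in_itv/= andbT => v0.
apply: hr => /=; apply: le_lt_trans (hq v v0 sv) _.
by rewrite ltr_pdivrMr// ltr_pMr// ltr1n.
Qed.

(** The identity holds almost surely for countably many times and thresholds at once. A path has a
    positive minimum on each compact interval, so some threshold applies to it, and both sides are
    continuous in time. *)
Lemma log_ratio : {ae P, forall w, forall t : R, 0 <= t -> forall i i',
  ln (X t w i 0) - ln (X t w i' 0) = ln (x i 0) - ln (x i' 0) +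
    J (fun s => (modified_payoff A sigma *m X s w) i 0 - (modified_payoff A sigma *m X s w) i' 0) t +
    sigma i * W i t w - sigma i' * W i' t w}.
Proof.
pose tt k m : R := k.+1%:R / m.+1%:R.
have tt0 k m : 0 < tt k m by rewrite divr_gt0 ?ltr0n.
have HH : {ae P, forall w, forall k m N : nat, forall i i',
  (forall s, 0 <= s <= tt k m -> N.+1%:R^-1 <= X s w i 0) ->
  (forall s, 0 <= s <= tt k m -> N.+1%:R^-1 <= X s w i' 0) ->
  ln (X (tt k m) w i 0) - ln (X (tt k m) w i' 0) = ln (x i 0) - ln (x i' 0) +
    J (fun s => (modified_payoff A sigma *m X s w) i 0 - (modified_payoff A sigma *m X s w) i' 0) (tt k m) +
    sigma i * W i (tt k m) w - sigma i' * W i' (tt k m) w}.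
  apply/ae_foralln => k; apply/ae_foralln => m; apply/ae_foralln => N.
  apply: filter_forall => i; apply: filter_forall => i'.
  by apply: log_ratio_fixed => //; rewrite invr_gt0 ltr0n.
apply: filterS2 HH good => w HH [X0 Xs _] t t0 i i'.
have Xp j s : 0 <= s -> 0 < X s w j 0 by move=> s0; have [_] := Xs s s0; exact.
have cp j : cts0 (fun s => (modified_payoff A sigma *m X s w) j 0).
  rewrite (_ : (fun s => _) = (fun s => \sum_k modified_payoff A sigma j k * X s w k 0)).
    by apply: cts0_sum => k; apply: cts0M; [exact: cts0_cst|exact: process_cts].
  by apply/funext => s; rewrite mxE.
have cW j : cts0 (fun s => W j s w) by case: hW => _ cW _ _; exact: cW.
pose g s := ln (X s w i 0) - ln (X s w i' 0) - (ln (x i 0) - ln (x i' 0) +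
    J (fun s => (modified_payoff A sigma *m X s w) i 0 - (modified_payoff A sigma *m X s w) i' 0) s +
    sigma i * W i s w - sigma i' * W i' s w).
have cg : cts0 g.
  apply: cts0B.
    by apply: cts0B; apply: (log_cts (@process_cts _ w)) => s; exact: Xp.
  apply: cts0B; last by apply: cts0M; [exact: cts0_cst|exact: cW].
  apply: cts0D; last by apply: cts0M; [exact: cts0_cst|exact: cW].
  apply: cts0D; first exact: cts0_cst.
  by apply: J_cts0; apply: cts0B.
have g0 k m : g (tt k m) = 0.
  have [N1 h1] := positive_lower (tt k m) (@process_cts i w) (Xp i).
  have [N2 h2] := positive_lower (tt k m) (@process_cts i' w) (Xp i').
  apply/eqP; rewrite subr_eq0; apply/eqP; apply: (HH k m (maxn N1 N2)).
    move=> s sI; apply: le_trans (h1 s sI).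
    by rewrite lef_pV2 ?posrE ?ltr0n// ler_nat ltnS leq_maxl.
  move=> s sI; apply: le_trans (h2 s sI).
  by rewrite lef_pV2 ?posrE ?ltr0n// ler_nat ltnS leq_maxr.
suff : g t = 0 by move/eqP; rewrite subr_eq0 => /eqP.
apply: contrapT => /eqP gt0.
have e0 : 0 < `|g t| / 2 by rewrite divr_gt0// normr_gt0.
have [r r0 hr] := cts0_near cg t0 e0.
(* [tt k m] is the multiple of [1 / (m + 1)] just above [t], at a distance less than [r]. *)
pose m := Num.truncn r^-1; pose k := Num.truncn (t * m.+1%:R).
have m0 : 0 < m.+1%:R :> R by rewrite ltr0n.
have tm0 : 0 <= t * m.+1%:R by rewrite mulr_ge0.
have k1 : k%:R <= t * m.+1%:R by rewrite truncn_le.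
have k2 : t * m.+1%:R < k.+1%:R by exact: truncnS_gt.
have mr : m.+1%:R^-1 < r.
  by rewrite -[ltRHS]invrK ltf_pV2 ?posrE ?invr_gt0//; exact: truncnS_gt.
have := hr (tt k m) (ltW (tt0 k m)).
rewrite g0 subr0.
have h1 : t <= tt k m by rewrite ler_pdivlMr// ltW.
have h2 : tt k m - t <= m.+1%:R^-1.
  rewrite lerBlDr ler_pdivrMr// mulrDl mulVf ?gt_eqF// -natr1 addrC lerD2l.
  exact: k1.
rewrite distrC ger0_norm ?subr_ge0// => /(_ (le_lt_trans h2 mr)).
by move: e0; lra.
Qed.

End log_ratios.

(** * Euler scheme and path functionals *)

Lemma finite_pos_lower {R : realType} (I : finType) (g : I -> R) :
  (forall i, 0 < g i) -> exists2 r, 0 < r & forall i, r <= g i.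
Proof.
move=> g0; have s0 : 0 <= \sum_i (g i)^-1 by apply: sumr_ge0 => i _; rewrite invr_ge0 ltW.
have s1 : 0 < \sum_i (g i)^-1 + 1 by rewrite ltr_wpDl.
exists (\sum_i (g i)^-1 + 1)^-1 => [|i]; first by rewrite invr_gt0.
rewrite -[leRHS]invrK lef_pV2 ?posrE ?invr_gt0// (bigD1 i)//= -addrA lerDl.
by rewrite addr_ge0// sumr_ge0// => j _; rewrite invr_ge0 ltW.
Qed.

Lemma cts0_shift {R : realType} (g : R -> R) (tau : R) : 0 <= tau -> cts0 g ->
  cts0 (fun s => g (tau + s)).
Proof.
move=> tau0 cg; apply/subspace_continuousP => s; rewrite /= in_itv/= andbT => s0.
apply/cvgrPdist_le => e e0.
have [r r0 hr] := cts0_near cg (addr_ge0 tau0 s0) e0.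
rewrite near_withinE; exists r => // v /= sv; rewrite in_itv/= andbT => v0.
by apply: hr; [rewrite addr_ge0|rewrite opprD addrACA subrr add0r].
Qed.

Section euler_scheme.
Context {R : realType} {n : nat}.
Variable M : 'M[R]_n.
Implicit Types (a b : 'I_n -> R) (xi : nat -> 'I_n -> R).

Definition payoff a (i : 'I_n) : R := (M *m softmax a) i 0.

Definition payoff_bound : R := \sum_i \sum_j `|M i j|.

Lemma payoff_bound_ge0 : 0 <= payoff_bound.
Proof. by apply: sumr_ge0 => i _; exact: sumr_ge0. Qed.

Let row_bound i : \sum_j `|M i j| <= payoff_bound.
Proof. by rewrite /payoff_bound [leRHS](bigD1 i)//= lerDl; apply: sumr_ge0 => j _; exact: sumr_ge0. Qed.

Lemma payoff_le (y : 'cV[R]_n) i : simplex y -> `|(M *m y) i 0| <= payoff_bound.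
Proof.
move=> [y01 _]; rewrite mxE (le_trans (ler_norm_sum _ _ _))// (le_trans _ (row_bound i))//.
apply: ler_sum => j _; have /andP[y0 y1] := y01 j.
by rewrite normrM (ger0_norm y0) ler_piMr.
Qed.

Lemma payoffB a i : `|payoff a i| <= payoff_bound.
Proof.
apply: payoff_le; have n0 : (0 < n)%N by case: n i => [[]|].
by have [] := int_simplex_softmax a n0.
Qed.

Lemma lip_payoff i : lip (6 * payoff_bound) (payoff ^~ i).
Proof.
move=> a b e ab; rewrite /payoff !mxE -sumrB (le_trans (ler_norm_sum _ _ _))//.
have e0 : 0 <= e by exact: le_trans (normr_ge0 _) (ab i).
apply: (@le_trans _ _ (\sum_j `|M i j| * (6 * e))).
  by apply: ler_sum => j _; rewrite -mulrBr normrM ler_wpM2l// lip_softmax.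
have -> : 6 * payoff_bound * e = payoff_bound * (6 * e) by ring.
by rewrite -mulr_suml ler_wpM2r ?mulr_ge0.
Qed.

Definition lf : R := 6 * payoff_bound.

Lemma lf_ge0 : 0 <= lf. Proof. by rewrite mulr_ge0// payoff_bound_ge0. Qed.

Fixpoint euler (dt : R) a xi (k : nat) : 'I_n -> R :=
  if k is k'.+1 then
    fun i => euler dt a xi k' i + dt * payoff (euler dt a xi k') i + xi k' i
  else a.

Lemma eq_euler dt a xi xi' k : (forall l i, (l < k)%N -> xi l i = xi' l i) ->
  euler dt a xi k = euler dt a xi' k.
Proof.
elim: k => //= k ih h; rewrite (ih (fun l i lk => h l i (ltnW lk))).
by apply/funext => i; rewrite h.
Qed.

(** The constant deteriorates with [N]. It serves to make functionals of the scheme measurable and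
    admissible for the Gaussian operators, and it enters no estimate. *)
Lemma euler_lip dt (N : nat) : 0 <= dt -> exists2 C, 0 <= C & forall a b xi eta e k i,
  (k <= N)%N -> (forall i, `|a i - b i| <= e) ->
  (forall l i, (l < N)%N -> `|xi l i - eta l i| <= e) ->
  `|euler dt a xi k i - euler dt b eta k i| <= C * e.
Proof.
move=> dt0; elim: N => [|N [C C0 ih]].
  exists 1 => // a b xi eta e k i; rewrite leqn0 => /eqP -> ab _.
  by rewrite mul1r.
have C1 : 0 <= C * (1 + dt * lf) + 1 by rewrite addr_ge0// mulr_ge0// addr_ge0// mulr_ge0// lf_ge0.
exists (C * (1 + dt * lf) + 1) => // a b xi eta e k i kN ab xe.
have e0 : 0 <= e by exact: le_trans (normr_ge0 _) (ab i).
have ih' k' i' : (k' <= N)%N -> `|euler dt a xi k' i' - euler dt b eta k' i'| <= C * e.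
  by move=> k'N; apply: ih => // l j lN; apply: xe; exact: ltnW.
move: kN; rewrite leq_eqVlt => /orP[/eqP ->|]; last first.
  rewrite ltnS => kN; apply: (le_trans (ih' _ _ kN)); rewrite ler_wpM2r//.
  have : 0 <= C * (dt * lf) by rewrite mulr_ge0// mulr_ge0// lf_ge0.
  by rewrite mulrDr mulr1; lra.
rewrite /=; set u := euler dt a xi N; set v := euler dt b eta N.
have h1 : `|u i - v i| <= C * e by exact: ih'.
have h2 : `|payoff u i - payoff v i| <= lf * (C * e) by apply: lip_payoff => j; exact: ih'.
have h3 : `|xi N i - eta N i| <= e by exact: xe.
have -> : u i + dt * payoff u i + xi N i - (v i + dt * payoff v i + eta N i) =
  (u i - v i) + dt * (payoff u i - payoff v i) + (xi N i - eta N i) by ring.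
have -> : (C * (1 + dt * lf) + 1) * e = C * e + dt * (lf * (C * e)) + e by ring.
rewrite (le_trans (ler_normD _ _))// lerD// (le_trans (ler_normD _ _))// lerD//.
by rewrite normrM (ger0_norm dt0) ler_wpM2l.
Qed.

(* [l] solves [l' = payoff l + v'], written so as to be invariant under time shifts. *)
Definition solves (l v : R -> 'I_n -> R) := forall i (s t c e : R), 0 <= s -> s <= t ->
  (forall u, s < u -> u <= t -> `|payoff (l u) i - c| <= e) ->
  `|l t i - l s i - (v t i - v s i) - c * (t - s)| <= e * (t - s).

(** Discrete Gronwall argument: inside a cell [l] moves by at most [w], which adds [lf * w * dt] to
    the error, while the error already present grows by the factor [1 + lf * dt]. The total stays
    below [w * expR (lf * (T%:R * h))], and [w] is chosen to make this [e]. *)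
Lemma euler_cvg (h : R) (l v : R -> 'I_n -> R) : 0 < h ->
  solves l v -> (forall i, cts0 (fun s => l s i)) ->
  forall (T : nat) e, 0 < e -> exists m0, forall m, (m0 <= m)%N ->
  forall k i, (k <= T * m.+1)%N ->
  `|l (k%:R * (h / m.+1%:R)) i - euler (h / m.+1%:R) (l 0)
      (fun k i => v (k.+1%:R * (h / m.+1%:R)) i - v (k%:R * (h / m.+1%:R)) i) k i| <= e.
Proof.
move=> h0 sl cl T e e0.
pose w := e / expR (lf * (T%:R * h)).
have w0 : 0 < w by rewrite divr_gt0// expR_gt0.
have H i : exists r, 0 < r /\ forall u v, 0 <= u <= T%:R * h -> 0 <= v <= T%:R * h -> `|u - v| <= r ->
    `|l u i - l v i| <= w.
  by have [r r0 hr] := cts0_ucont (@cl i) (T%:R * h) w0; exists r.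
have [r hr] := choice H.
have [r1 r10 hr1] := finite_pos_lower (fun i => (hr i).1).
exists (Num.truncn (h / r1)) => m mm k i kT.
set dt := h / m.+1%:R.
have m1 : 0 < m.+1%:R :> R by rewrite ltr0n.
have dt0 : 0 < dt by rewrite divr_gt0.
have dtr : dt <= r1.
  rewrite ler_pdivrMr// mulrC -ler_pdivrMr// ltW//.
  by rewrite (lt_le_trans (truncnS_gt _))// ler_nat ltnS.
have Tm : (T * m.+1)%:R * dt = T%:R * h.
  by rewrite natrM -mulrA (mulrCA m.+1%:R) divff ?mulr1// gt_eqF.
pose x := lf * dt.
have x0 : 0 <= x by rewrite mulr_ge0 ?lf_ge0// ltW.
suff G : forall i, `|l (k%:R * dt) i - euler dt (l 0)
      (fun k i => v (k.+1%:R * dt) i - v (k%:R * dt) i) k i| <= w * ((1 + x) ^+ k - 1).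
  apply: (le_trans (G i)).
  have : (1 + x) ^+ k <= expR (lf * (T%:R * h)).
    apply: (@le_trans _ _ (expR x ^+ k)).
      by rewrite lerXn2r ?nnegrE ?addr_ge0 ?expR_ge0// expR_ge1Dx.
    rewrite -expRM_natl ler_expR /x mulrCA ler_wpM2l ?lf_ge0//.
    by rewrite -Tm ler_pM2r// ler_nat.
  move=> hx; apply: (@le_trans _ _ (w * expR (lf * (T%:R * h)))); last by rewrite divfK// gt_eqF// expR_gt0.
  by rewrite ler_pM2l//; lra.
elim: k kT {i} => [|k ih] kT i; first by rewrite mul0r /= subrr normr0 expr0 subrr mulr0.
have {}ih := ih (ltnW kT).
set u := euler _ _ _ _ in ih *.
rewrite /= -/u.
have kk : k%:R * dt <= k.+1%:R * dt by rewrite ler_pM2r// ler_nat.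
have k0 : 0 <= k%:R * dt by rewrite mulr_ge0// ltW.
have kE : k.+1%:R * dt - k%:R * dt = dt by rewrite -(natr1 k); ring.
have kT' : k.+1%:R * dt <= T%:R * h by rewrite -Tm ler_pM2r// ler_nat.
have h1 : `|l (k.+1%:R * dt) i - l (k%:R * dt) i - (v (k.+1%:R * dt) i - v (k%:R * dt) i) -
    payoff (l (k%:R * dt)) i * dt| <= lf * w * dt.
  have := sl i _ _ (payoff (l (k%:R * dt)) i) (lf * w) k0 kk.
  rewrite kE; apply => s s1 s2; apply: lip_payoff => j.
  have [_ ] := hr j; apply.
  - by rewrite (le_trans k0 (ltW s1))/= (le_trans s2).
  - by rewrite k0/= (le_trans kk).
  - rewrite ger0_norm ?subr_ge0 ?(ltW s1)// (le_trans _ (hr1 j))// (le_trans _ dtr)//.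
    by rewrite lerBlDr (le_trans s2)// -lerBlDr kE.
have h2 : `|payoff (l (k%:R * dt)) i - payoff u i| <= lf * (w * ((1 + x) ^+ k - 1)).
  by apply: lip_payoff => j; exact: ih.
have h3 := ih i.
have -> : l (k.+1%:R * dt) i - (u i + dt * payoff u i + (v (k.+1%:R * dt) i - v (k%:R * dt) i)) =
  (l (k.+1%:R * dt) i - l (k%:R * dt) i - (v (k.+1%:R * dt) i - v (k%:R * dt) i) -
    payoff (l (k%:R * dt)) i * dt) + (l (k%:R * dt) i - u i) +
  dt * (payoff (l (k%:R * dt)) i - payoff u i) by ring.
have -> : w * ((1 + x) ^+ k.+1 - 1) = lf * w * dt + w * ((1 + x) ^+ k - 1) +
   dt * (lf * (w * ((1 + x) ^+ k - 1))) by rewrite exprS /x; ring.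
rewrite (le_trans (ler_normD _ _))// lerD//.
  by rewrite (le_trans (ler_normD _ _))// lerD.
by rewrite normrM (gtr0_norm dt0) ler_pM2l.
Qed.

End euler_scheme.

Section log_flow.
Context {R : realType} {n : nat} {d : measure_display} {Omega : measurableType d}.
Variables (P : probability Omega R) (W : 'I_n -> R -> {RV P >-> R}).
Hypothesis hW : brownian_motion W.
Variables (A : 'M[R]_n) (sigma : 'I_n -> R) (x : 'cV[R]_n) (X : R -> Omega -> 'cV[R]_n).
Hypothesis (hX : replicator_process A sigma W x X).
Notation M := (modified_payoff A sigma).

(** Differs from the logarithms of the process by a term common to all coordinates, which [softmax]
    removes. Dropping that term leaves a closed equation with additive noise, whose drift is the
    payoff at the softmax of the solution. *)
Definition flow (tau s : R) (w : Omega) (i : 'I_n) : R :=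
  ln (X tau w i 0) + (J (fun u => (M *m X u w) i 0) (tau + s) - J (fun u => (M *m X u w) i 0) tau) +
  sigma i * (W i (tau + s) w - W i tau w).

Let payoff_cts w i : cts0 (fun u => (M *m X u w) i 0).
Proof.
rewrite (_ : (fun u => _) = (fun s => \sum_k M i k * X s w k 0)).
  by apply: cts0_sum => k; apply: cts0M; [exact: cts0_cst|exact: (process_cts hX)].
by apply/funext => s; rewrite mxE.
Qed.

Lemma flow_cts tau w i : 0 <= tau -> cts0 (fun s => flow tau s w i).
Proof.
move=> tau0; have cW j : cts0 (fun s => W j s w) by case: hW => _ cW _ _; exact: cW.
apply: cts0D.
  apply: cts0D; first exact: cts0_cst.
  apply: cts0B; last exact: cts0_cst.
  by apply: (cts0_shift tau0); exact: J_cts0.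
apply: cts0M; first exact: cts0_cst.
apply: cts0B; last exact: cts0_cst.
exact: (cts0_shift tau0 (@cW i)).
Qed.

Lemma flow0 tau w i : flow tau 0 w i = ln (X tau w i 0).
Proof. by rewrite /flow addr0 !subrr addr0 mulr0 addr0. Qed.

Lemma flow_softmax : {ae P, forall w, forall tau : R, 0 <= tau ->
  (forall s, 0 <= s -> X (tau + s) w = softmax (flow tau s w)) /\
  solves M (flow tau ^~ w) (fun s i => sigma i * W i (tau + s) w)}.
Proof.
have Xs : {ae P, forall w, forall t : R, 0 <= t -> int_simplex (X t w)} by case: hX.
apply: filterS2 Xs (log_ratio hW hX) => w Xs lr tau tau0.
have XE s : 0 <= s -> X (tau + s) w = softmax (flow tau s w).
  move=> s0; have ts0 : 0 <= tau + s by rewrite addr_ge0.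
  apply: softmax_lse; first exact: Xs.
  move=> i j; rewrite (lr _ ts0 i j) /flow.
  have -> : ln (X tau w i 0) = ln (X tau w j 0) + (ln (X tau w i 0) - ln (X tau w j 0)) by ring.
  rewrite (lr _ tau0 i j).
  have JE t : J (fun s0 => (M *m X s0 w) i 0 - (M *m X s0 w) j 0) t =
      J (fun s0 => (M *m X s0 w) i 0) t - J (fun s0 => (M *m X s0 w) j 0) t.
    rewrite -[X in _ - X]mul1r -mulNr -J_lin; [|exact: payoff_cts|exact: payoff_cts].
    by apply: eq_J => u _ _; rewrite mulN1r.
  by rewrite !JE; ring.
split => // i s t c e s0 st hc.
have t0 : 0 <= t by exact: le_trans st.
have ts : 0 <= tau + s by rewrite addr_ge0.
have tst : tau + s <= tau + t by rewrite lerD2l.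
have := J_incr (c := c) (e := e) (cts0_integrable (tau + t) (@payoff_cts w i)) ts tst.
have -> : tau + t - (tau + s) = t - s by ring.
have -> : flow tau t w i - flow tau s w i - (sigma i * W i (tau + t) w - sigma i * W i (tau + s) w) =
  J (fun u => (M *m X u w) i 0) (tau + t) - J (fun u => (M *m X u w) i 0) (tau + s).
  by rewrite /flow; ring.
apply => u u1 u2.
have us : s < u - tau by rewrite ltrBrDl.
have ut : u - tau <= t by rewrite lerBlDl.
have u0 : 0 <= u - tau by rewrite (le_trans s0)// ltW.
have := hc _ us ut; rewrite /payoff -(XE _ u0).
by rewrite (_ : tau + (u - tau) = u)//; ring.
Qed.

End log_flow.

Lemma cvg_unique_seq {R : realType} (u : nat -> R) (l l' : R) :
  u @ \oo --> l -> u @ \oo --> l' -> l = l'.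
Proof.
move=> h h'; have := cvg_lin (-1) h h'.
rewrite (_ : (fun q => -1 * u q + u q) = fun=> 0); last by apply/funext => q; ring.
by move=> /cvg_cst_eq E; lra.
Qed.

Lemma le_cvg_seq {R : realType} (u v : nat -> R) (l l' : R) :
  (forall m, u m <= v m) -> u @ \oo --> l -> v @ \oo --> l' -> l <= l'.
Proof.
move=> uv ul vl; rewrite leNgt; apply/negP => ll'.
have e0 : 0 < (l - l') / 2 by rewrite divr_gt0// subr_gt0.
move/cvgrPdist_lt : ul => /(_ _ e0)[N1 _ h1].
move/cvgrPdist_lt : vl => /(_ _ e0)[N2 _ h2].
have := h1 (maxn N1 N2) (leq_maxl _ _); have := h2 (maxn N1 N2) (leq_maxr _ _).
by have := uv (maxn N1 N2); rewrite /= !ltr_norml; lra.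
Qed.
Arguments le_cvg_seq {R u v l l'}.

Section retraction.
Context {R : realType} {n : nat}.
Implicit Types (y : 'cV[R]_n) (a b : 'I_n -> R).

Definition lnv y : 'I_n -> R := fun i => ln (y i 0).

(* A retraction onto [int_simplex], the only starting points for which the processes
   are specified; it makes functions of the starting point total. *)
Definition retr y : 'cV[R]_n := softmax (lnv y).

Lemma retr_id y : int_simplex y -> retr y = y.
Proof. exact: softmax_ln. Qed.

Lemma int_simplex_retr y : (0 < n)%N -> int_simplex (retr y).
Proof. exact: int_simplex_softmax. Qed.

Lemma lnv_softmax_lip a b (e : R) i : (forall i, `|a i - b i| <= e) ->
  `|lnv (softmax a) i - lnv (softmax b) i| <= 2 * e.
Proof.
move=> ab; have sa := softmax_gt0 a i; have sb := softmax_gt0 b i.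
have h1 := softmax_ratio i ab.
have h2 : softmax b i 0 <= expR (2 * e) * softmax a i 0.
  by apply: softmax_ratio => j; rewrite distrC.
have e0 := expR_gt0 (2 * e).
have l1 : lnv (softmax a) i <= 2 * e + lnv (softmax b) i.
  rewrite /lnv -[2 * e in leRHS](expRK (2 * e)) -lnM ?posrE//.
  by rewrite ler_ln ?posrE// mulr_gt0.
have l2 : lnv (softmax b) i <= 2 * e + lnv (softmax a) i.
  rewrite /lnv -[2 * e in leRHS](expRK (2 * e)) -lnM ?posrE//.
  by rewrite ler_ln ?posrE// mulr_gt0.
by rewrite ler_norml; lra.
Qed.

End retraction.

(** * Functionals of a path sampled at finitely many times *)

Section path_functionals.
Context {R : realType} {n : nat} {d : measure_display} {Omega : measurableType d}.
Variables (P : probability Omega R) (W : 'I_n -> R -> {RV P >-> R}).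
Hypothesis hW : brownian_motion W.
Variables (A : 'M[R]_n) (sigma : 'I_n -> R).
Hypothesis sigma0 : forall i, 0 < sigma i.
Hypothesis n0 : (0 < n)%N.
Variables (h : R) (h0 : 0 < h).
Notation M := (modified_payoff A sigma).

(* Evaluating at softmax loses nothing: an interior state is the softmax of its logarithms. *)
Definition loglip (N : nat) (C : R) (Phi : (nat -> 'cV[R]_n) -> R) :=
  forall (a b : nat -> 'I_n -> R) (e : R),
  (forall k i, (k <= N)%N -> `|a k i - b k i| <= e) ->
  `|Phi (fun k => softmax (a k)) - Phi (fun k => softmax (b k))| <= C * e.

Definition prange (B : R) (Phi : (nat -> 'cV[R]_n) -> R) := forall p, 0 <= Phi p <= B.

Definition path (X : R -> Omega -> 'cV[R]_n) (tau : R) (w : Omega) (k : nat) : 'cV[R]_n :=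
  retr (X (tau + k%:R * h) w).

Definition increments (tau : R) (m : nat) (w : Omega) (l : nat) (i : 'I_n) : R :=
  sigma i * W i (tau + l.+1%:R * (h / m.+1%:R)) w - sigma i * W i (tau + l%:R * (h / m.+1%:R)) w.

Section functional.
Variables (N : nat) (C B : R) (Phi : (nat -> 'cV[R]_n) -> R).
Hypotheses (C0 : 0 <= C) (lPhi : loglip N C Phi) (rPhi : prange B Phi).

Lemma loglip_ext a b : (forall k, (k <= N)%N -> a k = b k) ->
  Phi (fun k => softmax (a k)) = Phi (fun k => softmax (b k)).
Proof.
move=> ab; apply/eqP; rewrite -subr_eq0 -normr_le0 -(mulr0 C); apply: lPhi => k i kN.
by rewrite ab// subrr normr0.
Qed.

Let norm_Phi p : `|Phi p| <= B.
Proof. by have /andP[p0 p1] := rPhi p; rewrite ger0_norm. Qed.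

(** The variables on which the Euler scheme depends, gathered in one type: the starting point on the
    left, the increment of each component at each step on the right. *)
Let I (m : nat) : finType := ('I_n + 'I_(N * m.+1).+1 * 'I_n)%type.

Let slot (m : nat) (l : nat) (j : 'I_n) : I m := inr (inord l, j).

Let embed (m : nat) (a : 'I_n -> R) (z : I m) : R := if z is inl i then a i else 0.

Let euler_functional (m : nat) (z : I m -> R) : R :=
  Phi (fun k => softmax (euler M (h / m.+1%:R) (fun i => z (inl i)) (fun l i => z (slot m l i)) (k * m.+1))).

Let lip_euler_functional m : exists C', lip C' (@euler_functional m).
Proof.
have m0 : 0 <= h / m.+1%:R by rewrite divr_ge0// ltW.
have [C' C'0 hC] := euler_lip M (N * m.+1) m0.
exists (C * C') => a b e ab; rewrite -mulrA; apply: lPhi => k i kN.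
apply: hC; first by rewrite leq_mul2r kN orbT.
  by move=> j; exact: ab.
by move=> l j _; exact: ab.
Qed.

Let ranges_euler_functional m : ranges B (@euler_functional m).
Proof. by move=> z; exact: rPhi. Qed.

(** Mean of [Phi] along the Euler scheme started at [a]: the noise slots are 0 at first, and the
    Gaussian increments of step [k] are added in the slots of index [k]. *)
Definition euler_mean (m : nat) (a : 'I_n -> R) : R :=
  gauss_path sigma (slot m) (Num.sqrt (h / m.+1%:R)) (N * m.+1) (@euler_functional m) (embed a).

Lemma lip_euler_mean m : exists C', lip C' (euler_mean m).
Proof.
have [C' l1] := lip_euler_functional m.
have [l2 _] := lip_gauss_path sigma (slot m) (Num.sqrt (h / m.+1%:R)) (N * m.+1) l1 (@ranges_euler_functional m).
exists C' => a b e ab; apply: l2 => -[i|z] /=; first exact: ab.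
by rewrite subrr normr0; case: n n0 a b ab => // n' _ a b ab; exact: le_trans (normr_ge0 _) (ab ord0).
Qed.

Lemma ranges_euler_mean m : ranges B (euler_mean m).
Proof.
move=> a; have [C' l1] := lip_euler_functional m.
have [_ r2] := lip_gauss_path sigma (slot m) (Num.sqrt (h / m.+1%:R)) (N * m.+1) l1 (@ranges_euler_functional m).
exact: r2.
Qed.

Lemma Ex_euler (tau : R) (m : nat) (Y : 'I_n -> Omega -> R) : 0 <= tau ->
  (forall i, gmeasurable (brownian_gen W tau) (Y i)) ->
  \int[P]_w Phi (fun k => softmax (euler M (h / m.+1%:R) (Y^~ w) (increments tau m w) (k * m.+1))) =
  \int[P]_w euler_mean m (Y^~ w).
Proof.
move=> tau0 mY; have dt0 : 0 < h / m.+1%:R by rewrite divr_gt0.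
have [C' l1] := lip_euler_functional m.
pose Y' (z : I m) (w : Omega) : R := embed (Y^~ w) z.
have mY' z : gmeasurable (brownian_gen W tau) (Y' z).
  by case: z => [i|z]; [exact: mY|exact: gmeasurable_cst].
have := @Ex_gauss_path R n d Omega P W hW (I m) sigma (slot m) tau (h / m.+1%:R) (N * m.+1) Y' C' B
  (@euler_functional m) tau0 dt0 mY' l1 (@ranges_euler_functional m).
rewrite (_ : (\int[P]_w gauss_path _ _ _ _ _ (Y'^~ w)) = \int[P]_w euler_mean m (Y^~ w)); last first.
  by apply: eq_Rintegral => w _.
move=> <-; apply: eq_Rintegral => w _; rewrite /euler_functional.
apply: loglip_ext => k kN.
have -> : (fun i : 'I_n => Y' (inl i) w + path_noise W sigma (slot m) tau (h / m.+1%:R) (N * m.+1) (inl i) w) =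
    Y^~ w.
  apply/funext => i; rewrite /path_noise big1 ?addr0// => l _.
  by rewrite /noise big1.
apply: eq_euler => l i lk; rewrite /Y' /embed add0r /path_noise /increments.
have lN : (l < N * m.+1)%N by rewrite (leq_trans lk)// leq_mul2r kN orbT.
rewrite (bigD1 (Ordinal lN))//= big1 ?addr0; last first.
  move=> l' ll'; rewrite /noise big1// => j _; case: eqP => // -[] /(congr1 val) /=.
  rewrite !inordK; [|by rewrite ltnW// ltnS ltn_ord|by rewrite ltnW].
  by move=> hl _; move/eqP: ll'; case; apply: val_inj; rewrite /= hl.
rewrite /noise big_enum/= (bigD1 i)//= eqxx big1 ?addr0; first by ring.
move=> j ji; case: eqP => // /(congr1 (fun z => if z is inr p then p.2 else i)) /= hj.
by rewrite hj eqxx in ji.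
Qed.

Section one_process.
Variables (x : 'cV[R]_n) (X : R -> Omega -> 'cV[R]_n).
Hypothesis (hX : replicator_process A sigma W x X).

Lemma measurable_lnv i (s : R) : 0 <= s -> gmeasurable (brownian_gen W s) (fun w => lnv (X s w) i).
Proof. by move=> s0; apply: measurableT_comp => //; exact: (process_gmeasurable hX). Qed.

Lemma measurable_lnvT i (s : R) : 0 <= s -> measurable_fun setT (fun w => lnv (X s w) i).
Proof. by move=> s0; exact: (gmeasurableT (measurable_lnv i s0)). Qed.

Lemma measurable_path tau : 0 <= tau -> measurable_fun setT (fun w => Phi (path X tau w)).
Proof.
move=> tau0.
pose F (a : 'I_N.+1 * 'I_n -> R) := Phi (fun k => softmax (fun i => a (inord k, i))).
rewrite (_ : (fun w => _) = (fun w => F (fun ki => lnv (X (tau + ki.1%:R * h) w) ki.2))); last first.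
  apply/funext => w; rewrite /F /path /retr.
  apply: (loglip_ext (a := fun k => lnv (X (tau + k%:R * h) w))) => k kN.
  by apply/funext => i /=; rewrite inordK.
apply: (@lip_measurable _ _ _ ('I_N.+1 * 'I_n)%type (fun ki w => lnv (X (tau + ki.1%:R * h) w) ki.2) F C).
  by move=> ki; apply: measurable_lnvT; rewrite addr_ge0// mulr_ge0// ltW.
by move=> a b e ab; apply: lPhi => k i _; exact: ab.
Qed.

Lemma measurable_increments tau m l i : measurable_fun setT (fun w => increments tau m w l i).
Proof. by apply: measurable_funB; apply: measurable_funM => //; exact: measurable_funP. Qed.

(** The scheme driven by the true Brownian increments after [tau] converges path by path to the
    process, by [euler_cvg] applied to [flow]; dominated convergence passes this to the means. *)
Lemma Ex_path_cvg tau : 0 <= tau ->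
  (fun m => \int[P]_w euler_mean m (lnv (X tau w))) @ \oo --> \int[P]_w Phi (path X tau w).
Proof.
move=> tau0.
pose E m w := Phi (fun k => softmax (euler M (h / m.+1%:R) (lnv (X tau w)) (increments tau m w) (k * m.+1))).
have -> : (fun m => \int[P]_w euler_mean m (lnv (X tau w))) = (fun m => \int[P]_w E m w).
  apply/funext => m; exact: (esym (@Ex_euler tau m (fun i w => lnv (X tau w) i) tau0
    (fun i => measurable_lnv i tau0))).
have mE m : measurable_fun setT (E m).
  have [C' l1] := lip_euler_functional m.
  pose Z (z : I m) w := if z is inr (l, j) then increments tau m w l j
                        else if z is inl i then lnv (X tau w) i else 0.
  rewrite (_ : E m = (fun w => @euler_functional m (fun z => Z z w))).
    apply: (@lip_measurable _ _ _ (I m) Z _ C') => //.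
    by case=> [i|[l j]]; [exact: measurable_lnvT|exact: measurable_increments].
  apply/funext => w; rewrite /E /euler_functional; apply: loglip_ext => k kN.
  apply: eq_euler => l i lk; rewrite /Z /slot inordK//.
  by rewrite ltnS ltnW// (leq_trans lk)// leq_mul2r kN orbT.
apply: (@Ex_dct _ _ _ P E _ B) => //; first exact: measurable_path.
  by move=> m w; exact: norm_Phi.
have Xs : {ae P, forall w, forall t : R, 0 <= t -> int_simplex (X t w)} by case: hX.
apply: filterS2 Xs (flow_softmax hW hX) => w Xs fs; have {fs}[XE sl] := fs tau tau0.
have cl i : cts0 (fun s => flow W A sigma X tau s w i) by exact: (flow_cts hW hX).
apply/cvgrPdist_le => e e0.
pose e1 := e / (C + 1).
have C1 : 0 < C + 1 by rewrite ltr_wpDl.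
have e10 : 0 < e1 by rewrite divr_gt0.
have [m0 hm0] := euler_cvg h0 sl cl N e10.
near=> m.
have mm : (m0 <= m)%N by near: m; exact: nbhs_infty_ge.
have pE : path X tau w = (fun k => softmax (flow W A sigma X tau (k%:R * h) w)).
  apply/funext => k; have kh0 : 0 <= k%:R * h by rewrite mulr_ge0// ltW.
  by rewrite /path XE// retr_id// -XE//; apply: Xs; rewrite addr_ge0.
rewrite pE /E; apply: (@le_trans _ _ (C * e1)).
  apply: lPhi => k i kN; have km : (k * m.+1 <= N * m.+1)%N by rewrite leq_mul2r kN orbT.
  have := hm0 m mm (k * m.+1)%N i km.
  rewrite natrM -mulrA (mulrCA m.+1%:R) divff ?pnatr_eq0// mulr1 (_ : flow W A sigma X tau 0 w = lnv (X tau w))//.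
  by apply/funext => j; rewrite flow0.
by rewrite /e1 mulrCA ler_piMr ?(ltW e0)// ler_pdivrMr// mul1r lerDl.
Unshelve. all: by end_near. Qed.

End one_process.

Lemma lip_lnv_retr C' (F : ('I_n -> R) -> R) : lip C' F -> lip (C' * 2) (fun a => F (lnv (softmax a))).
Proof. by move=> lF a b e ab; rewrite -mulrA; apply: lF => i; exact: lnv_softmax_lip. Qed.

Section family.
Variable X : 'cV[R]_n -> R -> Omega -> 'cV[R]_n.
Hypothesis hX : forall x, int_simplex x -> replicator_process A sigma W x (X x).

Definition path_mean (y : 'cV[R]_n) : R := \int[P]_w Phi (path (X (retr y)) 0 w).

Lemma path_mean_cvg y : euler_mean m (lnv (retr y)) @[m --> \oo] --> path_mean y.
Proof.
have hy := hX (int_simplex_retr y n0).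
have := Ex_path_cvg hy (lexx 0); rewrite /path_mean; apply: cvg_trans.
rewrite (_ : (fun m => \int[P]_w _) = (fun m => euler_mean m (lnv (retr y))))//.
apply/funext => m; rewrite -[RHS](Ex_cst P).
have [C' l1] := lip_euler_mean m.
apply: Ex_ae => //.
  apply: (@lip_measurable _ _ _ 'I_n (fun i w => lnv (X (retr y) 0 w) i) _ C') => //.
  by move=> i; exact: (measurable_lnvT hy).
by case: hy => _ _ X0 _ _; apply: filterS X0 => w ->.
Qed.

Lemma path_mean_range y : 0 <= path_mean y <= B.
Proof.
have hy := hX (int_simplex_retr y n0).
have mP := measurable_path hy (lexx 0).
rewrite /path_mean; apply/andP; split.
  by apply: Rintegral_ge0 => w _; have /andP[] := rPhi (path (X (retr y)) 0 w).
rewrite -[leRHS](Ex_cst P); apply: Ex_le => [| |w].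
- exact: (bounded_integrable P mP (fun w => norm_Phi _)).
- by apply: (@bounded_integrable _ _ _ P _ `|B|).
- by have /andP[] := rPhi (path (X (retr y)) 0 w).
Qed.

Lemma path_mean_int y : int_simplex y -> path_mean y = \int[P]_w Phi (path (X y) 0 w).
Proof. by move=> yI; rewrite /path_mean retr_id. Qed.

Lemma measurable_path_mean_process x (s : R) : int_simplex x -> 0 <= s ->
  measurable_fun setT (fun w => path_mean (X x s w)).
Proof.
move=> xI s0; apply: (measurable_fun_cvg (h := fun m w => euler_mean m (lnv (retr (X x s w))))).
  move=> m; have [C' l1] := lip_euler_mean m.
  apply: (@lip_measurable _ _ _ 'I_n (fun i w => lnv (X x s w) i) (fun a => euler_mean m (lnv (softmax a))) (C' * 2)).
    by move=> i; exact: (measurable_lnvT (hX xI)).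
  exact: lip_lnv_retr.
by move=> w _; exact: path_mean_cvg.
Qed.

(** Markov property at time [tau]: the scheme run after [tau] has, given the past, the mean of the
    scheme started at the state at [tau], so both sides are limits of the same sequence. *)
Lemma Ex_path_markov x tau : int_simplex x -> 0 <= tau ->
  \int[P]_w Phi (path (X x) tau w) = \int[P]_w path_mean (X x tau w).
Proof.
move=> xI tau0; have hx := hX xI.
have h1 := Ex_path_cvg hx tau0.
apply: (cvg_unique_seq h1).
apply: (@Ex_dct _ _ _ P _ _ B).
- move=> m; have [C' l1] := lip_euler_mean m.
  apply: (@lip_measurable _ _ _ 'I_n (fun i w => lnv (X x tau w) i) _ C') => //.
  by move=> i; exact: (measurable_lnvT hx).
- exact: measurable_path_mean_process.
- by move=> m w; have /andP[e0 eB] := ranges_euler_mean m (lnv (X x tau w)); rewrite ger0_norm.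
have Xs : {ae P, forall w, forall t : R, 0 <= t -> int_simplex (X x t w)} by case: hx.
apply: filterS Xs => w Xs; have := @path_mean_cvg (X x tau w).
by rewrite (retr_id (Xs _ tau0)).
Qed.

End family.
End functional.

End path_functionals.

(** * Harnack inequality for the process *)

Section harnack.
Context {R : realType} {n : nat} {d : measure_display} {Omega : measurableType d}.
Variables (P : probability Omega R) (W : 'I_n -> R -> {RV P >-> R}).
Hypothesis hW : brownian_motion W.
Variables (A : 'M[R]_n) (sigma : 'I_n -> R).
Hypothesis sigma0 : forall i, 0 < sigma i.
Hypothesis n0 : (0 < n)%N.
Notation M := (modified_payoff A sigma).
Notation path := (path 1).
Notation increments := (increments W sigma 1).
Notation euler_mean := (euler_mean A sigma 1).
Variable X : 'cV[R]_n -> R -> Omega -> 'cV[R]_n.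
Hypothesis hX : forall x, int_simplex x -> replicator_process A sigma W x (X x).

Definition harnack_cst (x0 x : 'cV[R]_n) : R :=
  expR (\sum_j (`|lnv x0 j - lnv x j| + 2 * payoff_bound M) ^+ 2 / sigma j ^+ 2).

Let gmeasurable_euler x m k i :
  gmeasurable (brownian_gen W (k%:R * (1 / m.+1%:R)))
    (fun w => euler M (1 / m.+1%:R) (lnv x) (increments 0 m w) k i).
Proof.
have m0 : 0 < 1 / m.+1%:R :> R by rewrite divr_gt0.
elim: k i => [|k ih] i /=; first exact: gmeasurable_cst.
have kk : k%:R * (1 / m.+1%:R) <= k.+1%:R * (1 / m.+1%:R) :> R by rewrite ler_pM2r// ler_nat.
have sub : <<s brownian_gen W (k%:R * (1 / m.+1%:R)) >> `<=` <<s brownian_gen W (k.+1%:R * (1 / m.+1%:R)) >>.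
  exact: sub_brownian_gen.
apply: gmeasurableD.
  apply: gmeasurableD; first exact: (gmeasurable_sub sub (ih i)).
  apply: gmeasurableM; first exact: gmeasurable_cst.
  apply: (@lip_measurable _ (g_sigma_algebraType (brownian_gen W (k.+1%:R * (1 / m.+1%:R)))) R 'I_n
    (fun i w => euler M (1 / m.+1%:R) (lnv x) (increments 0 m w) k i) (fun a => payoff M a i) (6 * payoff_bound M)).
    by move=> j; exact: (gmeasurable_sub sub (ih j)).
  exact: lip_payoff.
rewrite /increments; apply: gmeasurableB; apply: gmeasurableM; try exact: gmeasurable_cst.
  by apply: gmeasurable_W; rewrite !add0r lexx mulr_ge0// ltW.
by apply: gmeasurable_W; rewrite !add0r kk mulr_ge0// ltW.
Qed.

Let Ex_iter_euler x m C B F j k : 0 <= C -> lip C F -> ranges B F ->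
  \int[P]_w F (euler M (1 / m.+1%:R) (lnv x) (increments 0 m w) (j + k)) =
  \int[P]_w iter j (euler_op sigma (payoff M) (1 / m.+1%:R)) F
     (euler M (1 / m.+1%:R) (lnv x) (increments 0 m w) k).
Proof.
move=> C0 lF rF; have m0 : 0 < 1 / m.+1%:R :> R by rewrite divr_gt0.
elim: j k => [//|j ih] k; rewrite addSnnS ih.
have [C' l1 [_ r1]] := lip_iter_euler_op sigma (lip_payoff M) (lf_ge0 M) j m0 C0 lF rF.
rewrite iterS /euler_op.
have k0 : 0 <= k%:R * (1 / m.+1%:R) :> R by rewrite mulr_ge0// ltW.
have kk : k%:R * (1 / m.+1%:R) < k.+1%:R * (1 / m.+1%:R) :> R by rewrite ltr_pM2r// ltr_nat.
pose Y i w := euler M (1 / m.+1%:R) (lnv x) (increments 0 m w) k i +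
  (1 / m.+1%:R) * payoff M (euler M (1 / m.+1%:R) (lnv x) (increments 0 m w) k) i.
have mY i : gmeasurable (brownian_gen W (k%:R * (1 / m.+1%:R))) (Y i).
  apply: gmeasurableD; first exact: gmeasurable_euler.
  apply: gmeasurableM; first exact: gmeasurable_cst.
  apply: (@lip_measurable _ (g_sigma_algebraType (brownian_gen W (k%:R * (1 / m.+1%:R)))) R 'I_n
    (fun i w => euler M (1 / m.+1%:R) (lnv x) (increments 0 m w) k i) (fun a => payoff M a i) (6 * payoff_bound M)).
    by move=> l; exact: gmeasurable_euler.
  exact: lip_payoff.
have := @Ex_gauss_sweep R n d Omega P W hW 'I_n sigma id (enum 'I_n) _ _ Y C' B _ k0 kk
  (enum_uniq _) mY l1 r1.
have -> : k.+1%:R * (1 / m.+1%:R) - k%:R * (1 / m.+1%:R) = (1 / m.+1%:R) :> R.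
  by rewrite -(natr1 k); ring.
move=> <-; apply: eq_Rintegral => w _; congr (iter _ _ _ _); apply/funext => i.
rewrite /= /Y /noise; congr (_ + _); rewrite big_enum/= (bigD1 i)//= eqxx big1 ?addr0.
  by rewrite /increments !add0r; ring.
by move=> l li; rewrite eq_sym (negbTE li).
Qed.

(** Limit of [harnack_euler] as the mesh vanishes: the iterated operators are means of the scheme at
    time 1, and the constant does not change with the mesh. *)
Lemma harnack_limit C B (F : ('I_n -> R) -> R) (x0 x : 'cV[R]_n) (lam : R) :
  0 <= C -> lip C F -> ranges B F ->
  int_simplex x0 -> int_simplex x -> 0 < lam ->
  \int[P]_w F (lnv (retr (X x0 1 w))) <=
  (lam * harnack_cst x0 x + lam^-1 * \int[P]_w F (lnv (retr (X x 1 w))) ^+ 2) / 2.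
Proof.
move=> C0 lF rF x0I xI lam0.
have B0 : 0 <= B by have /andP[/le_trans h1 /h1] := rF (fun=> 0).
have one D (G : ('I_n -> R) -> R) K y : 0 <= D -> 0 <= K -> lip D G -> ranges K G -> int_simplex y ->
    (fun m => iter m.+1 (euler_op sigma (payoff M) (1 / m.+1%:R)) (fun a => G (lnv (softmax a))) (lnv y)) @ \oo -->
    \int[P]_w G (lnv (retr (X y 1 w))).
  move=> D0 K0 lG rG yI.
  pose Phi (p : nat -> 'cV[R]_n) := G (lnv (p 1%N)).
  have lPhi : loglip 1 (D * 2) Phi by move=> a b e ab; apply: (lip_lnv_retr lG) => i; exact: ab.
  have rPhi : prange K Phi by move=> p; exact: rG.
  have D20 : 0 <= D * 2 by rewrite mulr_ge0.
  have := path_mean_cvg hW n0 ltr01 D20 lPhi rPhi hX (y := y).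
  rewrite (path_mean_int P 1 Phi X yI) (retr_id yI) /path.
  under eq_Rintegral do rewrite /Phi add0r mul1r.
  rewrite (_ : (fun m => iter m.+1 _ _ _) = (fun m => euler_mean 1 Phi m (lnv y)))//.
  apply/funext => m.
  have gc i : gmeasurable (brownian_gen W 0) (fun _ => lnv y i) by exact: gmeasurable_cst.
  have E1 := Ex_euler hW A sigma ltr01 lPhi rPhi m (lexx 0) gc.
  rewrite Ex_cst in E1; rewrite -E1 /Phi mul1n.
  have l2 := lip_lnv_retr lG.
  have r2 : ranges K (fun a => G (lnv (softmax a))) by move=> a; exact: rG.
  have E2 := @Ex_iter_euler y m (D * 2) K (fun a => G (lnv (softmax a))) m.+1 0 D20 l2 r2.
  by rewrite addn0 in E2; rewrite E2 /= Ex_cst.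
have [lF2 rF2] := lip_sqr lF rF.
have h0 := one C F B x0 C0 B0 lF rF x0I.
have h1 := one (2 * B * C) (fun a => F a ^+ 2) (B ^+ 2) x _ (sqr_ge0 B) lF2 rF2 xI.
have BC0 : 0 <= 2 * B * C by rewrite !mulr_ge0.
have {h1} h1 := cvg_lin (lam^-1 / 2) (h1 BC0) (cvg_cst_seq (lam * harnack_cst x0 x / 2)).
rewrite (_ : (_ + _) / 2 = lam^-1 / 2 * (\int[P]_w F (lnv (retr (X x 1 w))) ^+ 2) +
  lam * harnack_cst x0 x / 2); last by ring.
apply: (le_cvg_seq _ h0 h1) => m.
have C20 : 0 <= C * 2 by rewrite mulr_ge0.
have r2 : ranges B (fun a => F (lnv (softmax a))) by move=> a; exact: rF.
have := @harnack_euler R n sigma (payoff M) (payoff_bound M) (6 * payoff_bound M) sigma0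
  (payoffB M) (lip_payoff M) (lf_ge0 M) (C * 2) B _ (fun i => lnv x0 i - lnv x i) m C20
  (lip_lnv_retr lF) r2 (lnv x) lam lam0.
rewrite -/(harnack_cst x0 x) !div1r.
rewrite (_ : (fun i => lnv x i + _) = lnv x0); last by apply/funext => i; rewrite addrC subrK.
by move=> /le_trans; apply; apply: eq_ler; rewrite /=; ring.
Qed.

(* The law of the future after time 1 from [x0] is absolutely continuous with
   respect to that from [x], quantitatively. *)
Lemma harnack_path N C Phi (x0 x : 'cV[R]_n) (lam : R) : 0 <= C ->
  loglip N C Phi -> prange 1 Phi -> int_simplex x0 -> int_simplex x -> 0 < lam ->
  \int[P]_w Phi (path (X x0) 1 w) <=
  (lam * harnack_cst x0 x + lam^-1 * \int[P]_w Phi (path (X x) 1 w)) / 2.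
Proof.
move=> C0 lPhi rPhi x0I xI lam0.
have one y : int_simplex y -> (fun m => \int[P]_w euler_mean N Phi m (lnv (retr (X y 1 w)))) @ \oo -->
    \int[P]_w Phi (path (X y) 1 w).
  move=> yI; have := Ex_path_cvg hW ltr01 C0 lPhi rPhi (hX yI) ler01.
  rewrite (_ : (fun m => _) = (fun m => \int[P]_w euler_mean N Phi m (lnv (retr (X y 1 w)))))//.
  apply/funext => m; have [C' l1] := lip_euler_mean A sigma n0 ltr01 lPhi rPhi m.
  have mL i : measurable_fun setT (fun w => lnv (X y 1 w) i) by exact: (measurable_lnvT (hX yI)).
  apply: Ex_ae.
  - exact: (@lip_measurable _ _ _ 'I_n (fun i w => lnv (X y 1 w) i) _ C' mL l1).
  - exact: (@lip_measurable _ _ _ 'I_n (fun i w => lnv (X y 1 w) i) _ (C' * 2) mL (lip_lnv_retr l1)).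
  have Xs : {ae P, forall w, forall t : R, 0 <= t -> int_simplex (X y t w)} by case: (hX yI).
  by apply: filterS Xs => w Xs; rewrite retr_id//; exact: Xs.
have h1 := cvg_lin (lam^-1 / 2) (one x xI) (cvg_cst_seq (lam * harnack_cst x0 x / 2)).
rewrite (_ : (_ + _) / 2 = lam^-1 / 2 * (\int[P]_w Phi (path (X x) 1 w)) +
  lam * harnack_cst x0 x / 2); last by ring.
apply: (le_cvg_seq _ (one x0 x0I) h1) => m /=.
have [C' l1] := lip_euler_mean A sigma n0 ltr01 lPhi rPhi m.
have r1 := ranges_euler_mean A sigma ltr01 lPhi rPhi m.
have C'0 : 0 <= C'.
  rewrite -[C']mulr1; apply: le_trans (normr_ge0 _) (l1 (fun=> 0) (fun=> 0) 1 _) => i.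
  by rewrite subrr normr0.
(* [euler_mean] turns a functional of the future after time 1 into a function of the state at time
   1, to which the inequality for one state applies. *)
apply: (le_trans (harnack_limit C'0 l1 r1 x0I xI lam0)).
rewrite (_ : _ + lam * _ / 2 = (lam * harnack_cst x0 x + lam^-1 *
  \int[P]_w euler_mean N Phi m (lnv (retr (X x 1 w)))) / 2); last by ring.
(* The square is at most the function itself, as the values lie in the unit interval; this brings
   back the mean of [Phi]. *)
rewrite ler_pM2r ?invr_gt0// lerD2l ler_pM2l ?invr_gt0//.
have mL i : measurable_fun setT (fun w => lnv (X x 1 w) i) by exact: (measurable_lnvT (hX xI)).
have mE : measurable_fun setT (fun w => euler_mean N Phi m (lnv (retr (X x 1 w)))).
  exact: (@lip_measurable _ _ _ 'I_n (fun i w => lnv (X x 1 w) i) _ (C' * 2) mL (lip_lnv_retr l1)).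
have bE w : 0 <= euler_mean N Phi m (lnv (retr (X x 1 w))) <= 1 by exact: r1.
apply: Ex_le => [| |w].
- apply: (@bounded_integrable _ _ _ P _ 1); first exact: measurable_funX.
  by move=> w; have /andP[h0 hB] := bE w; rewrite normrX expr_le1// ger0_norm.
- apply: (@bounded_integrable _ _ _ P _ 1) => // w.
  by have /andP[h0 hB] := bE w; rewrite ger0_norm.
by have /andP[h0 hB] := bE w; rewrite expr2 ler_piMr.
Qed.

End harnack.

(** * Stationarity *)

Lemma Ex_scale_sum {d : measure_display} {T : measurableType d} {R : realType}
  (P : probability T R) (q : nat) (f : nat -> T -> R) (a b : R) :
  (forall k, measurable_fun setT (f k)) -> (forall k x, `|f k x| <= b) ->
  \int[P]_x (\sum_(k < q) a * f k x) = \sum_(k < q) a * \int[P]_x f k x.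
Proof.
move=> mf fb; elim: q => [|q ih].
  under eq_Rintegral do rewrite big_ord0.
  by rewrite Ex_cst big_ord0.
under eq_Rintegral do rewrite big_ord_recr.
have iq k : P.-integrable setT (EFin \o (fun x => a * f k x)).
  apply: (@bounded_integrable _ _ _ P _ (`|a| * b)); first exact: measurable_funM.
  by move=> x; rewrite normrM ler_wpM2l.
rewrite RintegralD//=; last first.
  apply: (@bounded_integrable _ _ _ P _ (\sum_(k < q) `|a| * b)).
    by apply: measurable_sum => k; exact: measurable_funM.
  move=> x; rewrite (le_trans (ler_norm_sum _ _ _))// ler_sum// => k _.
  by rewrite normrM ler_wpM2l.
rewrite ih big_ord_recr/= RintegralZl//.
exact: (bounded_integrable P (mf q) (fb q)).
Qed.

Section step_approximation.
Context {R : realType}.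

Let count_below (N : nat) (u : R) : 0 <= u ->
  [/\ \sum_(k < N) (k.+1%:R < u)%R%:R <= u :> R,
      u <= N%:R -> u - 1 <= \sum_(k < N) (k.+1%:R < u)%R%:R :> R &
      N%:R < u -> \sum_(k < N) (k.+1%:R < u)%R%:R = N%:R :> R].
Proof.
move=> u0; elim: N => [|N [ih1 ih2 ih3]].
  by rewrite big_ord0; split => // uN; lra.
have NS : N.+1%:R = N%:R + 1 :> R by rewrite natr1.
rewrite big_ord_recr/=; have [uN|uN] := ltP N.+1%:R u; last first.
  rewrite addr0; split => // _.
  by have [/ih2//|/ih3 ->] := leP u N%:R; rewrite lerBlDr -NS.
have -> : \sum_(k < N) (k.+1%:R < u)%R%:R = N%:R :> R by apply: ih3; rewrite (lt_trans _ uN)// NS ltrDl.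
by rewrite -[true%:R]/(1 : R) -NS; split => //; exact: ltW.
Qed.

(** A discrete layer-cake formula: [v] is close to the proportion of the levels [k.+1%:R / q.+1%:R]
    that lie below it. *)
Lemma step_approx (q : nat) (v : R) : 0 <= v <= 1 ->
  `|v - \sum_(k < q.+1) q.+1%:R^-1 * (k.+1%:R / q.+1%:R < v)%R%:R| <= q.+1%:R^-1.
Proof.
move=> /andP[v0 v1].
have q0 : 0 < q.+1%:R :> R by rewrite ltr0n.
have [h1 h2 _] := count_below q.+1 (mulr_ge0 v0 (ltW q0)).
have E : \sum_(k < q.+1) q.+1%:R^-1 * (k.+1%:R / q.+1%:R < v)%R%:R =
    q.+1%:R^-1 * \sum_(k < q.+1) (k.+1%:R < v * q.+1%:R)%R%:R :> R.
  by rewrite mulr_sumr; apply: eq_bigr => k _; rewrite ltr_pdivrMr.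
rewrite E; have {}h2 : v * q.+1%:R - 1 <= \sum_(k < q.+1) (k.+1%:R < v * q.+1%:R)%R%:R.
  by apply: h2; rewrite ler_piMl// ltW.
have -> : v - q.+1%:R^-1 * \sum_(k < q.+1) (k.+1%:R < v * q.+1%:R)%R%:R =
   q.+1%:R^-1 * (v * q.+1%:R - \sum_(k < q.+1) (k.+1%:R < v * q.+1%:R)%R%:R).
  by rewrite mulrBr; congr (_ - _); rewrite mulrCA mulVf ?mulr1// gt_eqF.
rewrite normrM gtr0_norm ?invr_gt0// ler_piMr ?invr_ge0 ?(ltW q0)//.
by rewrite ler_norml; lra.
Qed.

(** Lipschitz approximation, from below, of the indicator of the values greater than [c]. *)
Definition ramp (j : nat) (c v : R) : R := Num.min 1 (Num.max 0 (j%:R * (v - c))).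

Lemma ramp01 j c v : 0 <= ramp j c v <= 1.
Proof. by rewrite /ramp le_min ler01 le_max lexx/= ge_min lexx. Qed.

Lemma ramp_lip j c u v e : `|u - v| <= e -> `|ramp j c u - ramp j c v| <= j%:R * e.
Proof.
move=> uv; have h : `|j%:R * (u - c) - j%:R * (v - c)| <= j%:R * e.
  have -> : j%:R * (u - c) - j%:R * (v - c) = j%:R * (u - v) by ring.
  by rewrite normrM ger0_norm// ler_wpM2l.
rewrite /ramp; move: h; move: (j%:R * (u - c)) (j%:R * (v - c)) (j%:R * e) => a b f.
rewrite ler_norml => /andP[h1 h2]; rewrite /Num.min /Num.max.
by case: (ltP 0 a) => a0; case: (ltP 0 b) => b0; [case: (ltP 1 a); case: (ltP 1 b)|case: (ltP 1 a); case: (ltP 1 0)|case: (ltP 1 0); case: (ltP 1 b)|case: (ltP 1 0)] => *; rewrite ler_norml; apply/andP; split; lra.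
Qed.

Lemma ramp_cvg c v : ramp j c v @[j --> \oo] --> ((c < v)%R%:R : R).
Proof.
have [cv|vc] := ltP c v; last first.
  apply: cvg_near_cst; apply: nearW => j; rewrite /ramp max_l ?min_r//.
  by rewrite mulr_ge0_le0// subr_le0.
have vc0 : 0 < v - c by rewrite subr_gt0.
apply: cvg_near_cst; near=> j; rewrite /ramp.
have h : 1 <= j%:R * (v - c).
  rewrite -ler_pdivrMr// mul1r (le_trans (ltW (truncnS_gt _)))// ler_nat.
  by near: j; exact: nbhs_infty_ge.
by rewrite max_r ?min_l// (le_trans ler01).
Unshelve. all: by end_near. Qed.

End step_approximation.

Section stationarity.
Context {R : realType} {n : nat} {d : measure_display} {Omega : measurableType d}.
Variables (P : probability Omega R) (W : 'I_n -> R -> {RV P >-> R}).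
Hypothesis hW : brownian_motion W.
Variables (A : 'M[R]_n) (sigma : 'I_n -> R).
Hypothesis n0 : (0 < n)%N.
Variable X : 'cV[R]_n -> R -> Omega -> 'cV[R]_n.
Hypothesis hX : forall x, int_simplex x -> replicator_process A sigma W x (X x).
Notation state_space := (@state_space R n).

Lemma measurable_coord i : measurable_fun [set: state_space] (fun y : state_space => (y : 'cV[R]_n) i 0 : R).
Proof.
apply: (measurability _ (RGenOInfty.measurableE R)) => //= _ [_ [r ->] <-].
rewrite setTI; apply: sub_sigma_algebra => /=.
apply: (@open_comp _ _ (fun y : 'cV[R]_n => y i 0)); last exact: interval_open.
by move=> y _; exact: coord_continuous.
Qed.

Lemma measurable_lnv_coord i : measurable_fun [set: state_space] (fun y : state_space => lnv (y : 'cV[R]_n) i).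
Proof. by apply: measurableT_comp => //; exact: measurable_coord. Qed.

Lemma measurable_lnv_retr C (F : ('I_n -> R) -> R) : lip C F ->
  measurable_fun [set: state_space] (fun y : state_space => F (lnv (retr (y : 'cV[R]_n)))).
Proof.
move=> lF; exact: (@lip_measurable _ _ _ 'I_n (fun i (y : state_space) => lnv (y : 'cV[R]_n) i) _ (C * 2)
  measurable_lnv_coord (lip_lnv_retr lF)).
Qed.

(** The interior points are exactly the fixed points of the measurable retraction [retr]. *)
Lemma measurable_int_simplex : measurable (int_simplex : set state_space).
Proof.
pose g (y : state_space) : R := \sum_i (retr (y : 'cV[R]_n) i 0 - (y : 'cV[R]_n) i 0) ^+ 2.
have mg : measurable_fun [set: state_space] g.
  apply: measurable_sum => i; apply: measurable_funX; apply: measurable_funB; last exact: measurable_coord.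
  apply: (@lip_measurable _ _ _ 'I_n (fun i (y : state_space) => lnv (y : 'cV[R]_n) i)
    (fun a => softmax a i 0) 6); first exact: measurable_lnv_coord.
  by move=> a b e ab; exact: lip_softmax.
rewrite (_ : int_simplex = g @^-1` [set 0]).
  by rewrite -[X in measurable X]setTI; exact: mg.
apply/seteqP; split => y /= yI.
  by rewrite /g big1// => i _; rewrite retr_id// subrr expr0n.
rewrite -[y](_ : retr y = y); first exact: int_simplex_retr.
apply/matrixP => i j; rewrite ord1; apply/eqP; rewrite -subr_eq0 -sqrf_eq0.
have := yI; rewrite /g (bigD1 i)//= => /eqP; rewrite paddr_eq0 ?sqr_ge0//; last first.
  by apply: sumr_ge0 => k _; exact: sqr_ge0.
by case/andP.
Qed.

Lemma measurable_path_mean h N C B Phi : 0 < h -> 0 <= C -> loglip N C Phi -> prange B Phi ->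
  measurable_fun [set: state_space] (path_mean P h Phi X : state_space -> R).
Proof.
move=> h0 C0 lPhi rPhi.
apply: (measurable_fun_cvg (h := fun m (y : state_space) => euler_mean A sigma h N Phi m (lnv (retr (y : 'cV[R]_n))))).
  move=> m; have [C' l1] := lip_euler_mean A sigma n0 h0 lPhi rPhi m.
  exact: (measurable_lnv_retr l1).
by move=> y _; exact: (path_mean_cvg hW n0 h0 C0 lPhi rPhi hX).
Qed.

Variable pi : probability state_space R.
Hypothesis pi_int : pi (~` int_simplex) = 0%E.
Hypothesis pi_inv : forall (t : R) (B : set state_space), 0 <= t -> measurable B ->
  measurable_fun (int_simplex : set state_space) (fun x : state_space => transition P X t x B) ->
  (\int[pi]_(x in int_simplex) transition P X t x B = pi B)%E.

Section one_step.
Variables (h : R) (h0 : 0 < h).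

Definition state_functional (k : nat) (F : ('I_n -> R) -> R) (p : nat -> 'cV[R]_n) : R := F (lnv (p k)).

Lemma loglip_state k C F : lip C F -> loglip k (C * 2) (state_functional k F).
Proof. by move=> lF a b e ab; apply: (lip_lnv_retr lF) => i; exact: ab. Qed.

Lemma prange_state k B F : ranges B F -> prange B (state_functional k F).
Proof. by move=> rF p; exact: rF. Qed.

Let tk (k : nat) : R := 0 + k%:R * h.

Let tk0 k : 0 <= tk k. Proof. by rewrite /tk add0r mulr_ge0// ltW. Qed.

Section one_functional.
Variables (C : R) (F : ('I_n -> R) -> R) (k : nat).
Hypotheses (C0 : 0 <= C) (lF : lip C F) (rF : ranges 1 F).

Let psi (y : 'cV[R]_n) : R := F (lnv (retr y)).

Let psi01 y : 0 <= psi y <= 1. Proof. exact: rF. Qed.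

Let mpsi : measurable_fun [set: state_space] (psi : state_space -> R).
Proof. exact: measurable_lnv_retr lF. Qed.

Let mpsiX x : int_simplex x -> measurable_fun setT (fun w => psi (X x (tk k) w)).
Proof.
move=> xI; exact: (@lip_measurable _ _ _ 'I_n (fun i w => lnv (X x (tk k) w) i) _ (C * 2)
  (fun i => measurable_lnvT (hX xI) i (tk0 k)) (lip_lnv_retr lF)).
Qed.

(** Transition probability into a level set of [psi]. Invariance speaks of such probabilities, which
    are not means of Lipschitz functionals; ramps make the link. *)
Let Tc (c : R) (x : state_space) : R := \int[P]_w (c < psi (X (retr (x : 'cV[R]_n)) (tk k) w))%R%:R.

Let mem_gt (T : Type) (f : T -> R) (c : R) w : (w \in [set w | c < f w]) = (c < f w).
Proof. by apply/idP/idP; rewrite inE. Qed.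

Let mlt (c : R) d' (T : measurableType d') (f : T -> R) : measurable_fun setT f ->
  measurable_fun setT (fun w => (c < f w)%R%:R : R).
Proof.
move=> mf; rewrite (_ : (fun w => _) = \1_[set w | c < f w]).
  apply: measurable_indic; rewrite -[X in measurable X]setTI.
  rewrite (_ : [set w | _] = f @^-1` `]c, +oo[); first exact: mf.
  by apply/seteqP; split => w /=; rewrite in_itv/= andbT.
by apply/funext => w; rewrite indicE mem_gt.
Qed.

Let b01 (b : bool) : `|b%:R : R| <= 1. Proof. by case: b; rewrite ?normr1 ?normr0. Qed.

Let mTc c : measurable_fun [set: state_space] (Tc c).
Proof.
pose Fj j a := ramp j c (F a).
have lFj j : lip (j%:R * C) (Fj j) by move=> a b e ab; rewrite -mulrA; apply: ramp_lip; exact: lF.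
have rFj j : ranges 1 (Fj j) by move=> a; exact: ramp01.
apply: (measurable_fun_cvg (h := fun j => path_mean P h (state_functional k (Fj j)) X : state_space -> R)).
  move=> j; apply: (measurable_path_mean h0 _ (@loglip_state k _ _ (lFj j)) (@prange_state k _ _ (rFj j))).
  by rewrite !mulr_ge0.
move=> x _; have xI := int_simplex_retr (x : 'cV[R]_n) n0.
apply: (@Ex_dct _ _ _ P (fun j w => Fj j (lnv (path h (X (retr (x : 'cV[R]_n))) 0 w k))) _ 1).
- move=> j; exact: (measurable_path h0 (@loglip_state k _ _ (lFj j)) (hX xI) (lexx 0)).
- by apply: mlt; exact: mpsiX.
- by move=> j w; have /andP[f0 f1] := rFj j (lnv (path h (X (retr (x : 'cV[R]_n))) 0 w k)); rewrite ger0_norm.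
- by apply: aeW => w; exact: ramp_cvg.
Qed.

Let Tc_inv c : \int[pi]_x Tc c x = \int[pi]_x (c < psi (x : 'cV[R]_n))%R%:R.
Proof.
pose B : set state_space := psi @^-1` `]c, +oo[.
have mB : measurable B by rewrite -[X in measurable X]setTI; exact: mpsi.
have TE x : int_simplex x -> transition P X (tk k) x B = (Tc c (x : state_space))%:E.
  move=> xI; rewrite /Tc (retr_id xI).
  have mE : measurable [set w | c < psi (X x (tk k) w)].
    rewrite -[X in measurable X]setTI.
    rewrite (_ : [set w | _] = (fun w => psi (X x (tk k) w)) @^-1` `]c, +oo[); first exact: (mpsiX xI).
    by apply/seteqP; split => w /=; rewrite in_itv/= andbT.
  transitivity (P [set w | c < psi (X x (tk k) w)]).
    by rewrite /transition /B; congr (P _); apply/seteqP; split => w /=; rewrite in_itv/= andbT.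
  rewrite -Ex_fineE; last first.
    by apply: (@bounded_integrable _ _ _ P _ 1); [apply: mlt; exact: mpsiX|move=> w; exact: b01].
  rewrite -[in LHS](setIT [set w | _]) -integral_indic//.
  by apply: eq_integral => w _; rewrite indicE mem_gt.
have mTcE : measurable_fun setT (fun x : state_space => (Tc c x)%:E) by apply/measurable_EFinP; exact: mTc.
have := pi_inv (tk0 k) mB.
rewrite (_ : (\int[pi]_(x in int_simplex) _ = _)%E = ((\int[pi]_(x in int_simplex) (Tc c x)%:E) = pi B)%E); last first.
  by congr (_ = _); apply: eq_integral => x; rewrite inE => xI; exact: TE.
have Tb x : `|Tc c x| <= 1.
  have xI := int_simplex_retr (x : 'cV[R]_n) n0.
  by apply: Ex_bound => [|w]; [apply: mlt; exact: mpsiX|exact: b01].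
have iT : pi.-integrable setT (EFin \o Tc c) by exact: (bounded_integrable pi (mTc c) Tb).
move=> /(_ _) E.
have {}E : (\int[pi]_(x in int_simplex) (Tc c x)%:E = pi B)%E.
  apply: E; apply: (eq_measurable_fun (fun x : state_space => (Tc c x)%:E)).
    by move=> x; rewrite inE => xI; rewrite TE.
  exact: measurable_funTS.
have mI := measurable_int_simplex.
have := negligible_integral (measurableC mI) measurableT iT pi_int.
rewrite setTD setCK E => E2.
rewrite /Rintegral E2; congr fine.
rewrite -[in LHS](setIT B) -integral_indic//.
apply: eq_integral => x _; rewrite indicE -mem_gt; congr (_%:R%:E); congr (nat_of_bool (x \in _)).
by apply/seteqP; split => y; rewrite /B /= in_itv/= andbT.
Qed.

(** Invariance gives the equality for the indicator of each level set, and on both sides [psi] is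
    within [1 / (q + 1)] of an average of such indicators. *)
Lemma stationary_state01 :
  \int[pi]_x path_mean P h (state_functional k F) X (x : state_space) =
  \int[pi]_x F (lnv (retr (x : 'cV[R]_n))).
Proof.
apply/eqP; rewrite -subr_eq0 -normr_le0; apply/ler_addgt0Pl => e e0; rewrite addr0.
pose q := Num.truncn (2 / e).
have q0 : 0 < q.+1%:R :> R by rewrite ltr0n.
have qe : 2 * q.+1%:R^-1 <= e.
  by rewrite ler_pdivrMr// mulrC -ler_pdivrMr// ltW// truncnS_gt.
have cE (v : R) : \sum_(j < q.+1) q.+1%:R^-1 * (j.+1%:R / q.+1%:R < v)%R%:R =
    \sum_(j < q.+1) q.+1%:R^-1 * ((fun j => (j.+1%:R / q.+1%:R < v)%R%:R) (j : nat) : R) by [].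
have mPhi := measurable_path_mean h0 (mulr_ge0 C0 (ler0n _ 2)) (@loglip_state k _ _ lF) (@prange_state k _ _ rF).
have iPhi : pi.-integrable setT (EFin \o (path_mean P h (state_functional k F) X : state_space -> R)).
  apply: (bounded_integrable pi mPhi (B := 1)) => x.
  have /andP[f0 f1] := path_mean_range n0 h0 (@loglip_state k _ _ lF) (@prange_state k _ _ rF) hX x.
  by rewrite ger0_norm.
have bpsi (x : state_space) : `|psi (x : 'cV[R]_n)| <= 1 by have /andP[f0 f1] := psi01 x; rewrite ger0_norm.
have ipsi : pi.-integrable setT (EFin \o (psi : state_space -> R)) by exact: (bounded_integrable pi mpsi bpsi).
have Tb c x : `|Tc c x| <= 1.
  have xI := int_simplex_retr (x : 'cV[R]_n) n0.
  by apply: Ex_bound => [|w]; [apply: mlt; exact: mpsiX|exact: b01].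
have h1 : `|\int[pi]_x path_mean P h (state_functional k F) X (x : state_space) -
    \int[pi]_x (\sum_(j < q.+1) q.+1%:R^-1 * Tc (j.+1%:R / q.+1%:R) x)| <= q.+1%:R^-1.
  apply: Ex_dist => //.
    apply: (@bounded_integrable _ _ _ pi _ (\sum_(j < q.+1) q.+1%:R^-1 * 1)).
      by apply: measurable_sum => j; apply: measurable_funM => //; exact: mTc.
    move=> x; rewrite (le_trans (ler_norm_sum _ _ _))// ler_sum// => j _.
    by rewrite normrM gtr0_norm ?invr_gt0// ler_wpM2l// invr_ge0 ltW.
  move=> x; have xI := int_simplex_retr (x : 'cV[R]_n) n0.
  have mj j : measurable_fun setT (fun w => (j.+1%:R / q.+1%:R < psi (X (retr (x : 'cV[R]_n)) (tk k) w))%R%:R : R).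
    by apply: mlt; exact: mpsiX.
  rewrite -(@Ex_scale_sum _ _ _ P q.+1 _ q.+1%:R^-1 1 mj); last by move=> j w; exact: b01.
  apply: Ex_dist.
  - apply: (@bounded_integrable _ _ _ P _ 1); first exact: (mpsiX xI).
    by move=> w; have /andP[f0 f1] := psi01 (X (retr (x : 'cV[R]_n)) (tk k) w); rewrite ger0_norm.
  - apply: (@bounded_integrable _ _ _ P _ (\sum_(j < q.+1) q.+1%:R^-1 * 1)).
      by apply: measurable_sum => j; apply: measurable_funM.
    move=> w; rewrite (le_trans (ler_norm_sum _ _ _))// ler_sum// => j _.
    by rewrite normrM gtr0_norm ?invr_gt0// ler_wpM2l// invr_ge0 ltW.
  - by move=> w; apply: step_approx; exact: psi01.
have h2 : `|\int[pi]_x psi (x : 'cV[R]_n) -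
    \int[pi]_x (\sum_(j < q.+1) q.+1%:R^-1 * (j.+1%:R / q.+1%:R < psi (x : 'cV[R]_n))%R%:R)| <= q.+1%:R^-1.
  apply: Ex_dist => //.
    apply: (@bounded_integrable _ _ _ pi _ (\sum_(j < q.+1) q.+1%:R^-1 * 1)).
      by apply: measurable_sum => j; apply: measurable_funM => //; exact: mlt.
    move=> x; rewrite (le_trans (ler_norm_sum _ _ _))// ler_sum// => j _.
    by rewrite normrM gtr0_norm ?invr_gt0// ler_wpM2l// invr_ge0 ltW.
  by move=> x; apply: step_approx; exact: psi01.
have E : \int[pi]_x (\sum_(j < q.+1) q.+1%:R^-1 * Tc (j.+1%:R / q.+1%:R) x) =
    \int[pi]_x (\sum_(j < q.+1) q.+1%:R^-1 * (j.+1%:R / q.+1%:R < psi (x : 'cV[R]_n))%R%:R).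
  rewrite (@Ex_scale_sum _ _ _ pi q.+1 (fun j => Tc (j.+1%:R / q.+1%:R)) q.+1%:R^-1 1)//.
  rewrite (@Ex_scale_sum _ _ _ pi q.+1 (fun j (x : state_space) => (j.+1%:R / q.+1%:R < psi (x : 'cV[R]_n))%R%:R) q.+1%:R^-1 1)//.
  - by apply: eq_bigr => j _; rewrite Tc_inv.
  - by move=> j; exact: mlt.
rewrite E in h1; rewrite (le_trans _ qe)// mulrDl mul1r.
rewrite (le_trans _ (lerD h1 h2))// [X in _ <= _ + X]distrC (le_trans _ (ler_normD _ _))//.
by rewrite addrA subrK.
Qed.

End one_functional.

Lemma path_meanZ N C B Phi (r : R) x : 0 <= C -> loglip N C Phi -> prange B Phi ->
  path_mean P h (fun p => r * Phi p) X x = r * path_mean P h Phi X x.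
Proof.
move=> C0 lPhi rPhi; have xI := int_simplex_retr x n0.
rewrite /path_mean RintegralZl//.
apply: (bounded_integrable P (measurable_path h0 lPhi (hX xI) (lexx 0)) (B := B)) => w.
by have /andP[f0 f1] := rPhi (path h (X (retr x)) 0 w); rewrite ger0_norm.
Qed.

Lemma path_mean_integrable N C B Phi : 0 <= C -> loglip N C Phi -> prange B Phi ->
  pi.-integrable setT (EFin \o (path_mean P h Phi X : state_space -> R)).
Proof.
move=> C0 lPhi rPhi; apply: (bounded_integrable pi (measurable_path_mean h0 C0 lPhi rPhi) (B := B)) => x.
by have /andP[f0 f1] := path_mean_range n0 h0 lPhi rPhi hX x; rewrite ger0_norm.
Qed.

Lemma stationary_state C B F k : 0 <= C -> 0 < B -> lip C F -> ranges B F ->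
  \int[pi]_x path_mean P h (state_functional k F) X (x : state_space) =
  \int[pi]_x F (lnv (retr (x : 'cV[R]_n))).
Proof.
move=> C0 B0 lF rF.
pose F' a := B^-1 * F a.
have B'0 : 0 < B^-1 by rewrite invr_gt0.
have lF' : lip (B^-1 * C) F'.
  move=> a b e ab; rewrite /F' -mulrBr normrM (gtr0_norm B'0) -mulrA ler_wpM2l ?(ltW B'0)//.
  exact: lF.
have rF' : ranges 1 F'.
  move=> a; have /andP[f0 f1] := rF a; rewrite /F' mulr_ge0 ?(ltW B'0)//=.
  by rewrite mulrC ler_pdivrMr// mul1r.
have BC0 : 0 <= B^-1 * C by rewrite mulr_ge0// ltW.
have C20 : 0 <= C * 2 by rewrite mulr_ge0.
have lS := @loglip_state k _ _ lF; have rS := @prange_state k _ _ rF.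
have := stationary_state01 k BC0 lF' rF'.
have -> : \int[pi]_x path_mean P h (state_functional k F') X (x : state_space) =
    B^-1 * \int[pi]_x path_mean P h (state_functional k F) X (x : state_space).
  rewrite -RintegralZl//; last exact: (path_mean_integrable C20 lS rS).
  by apply: eq_Rintegral => x _; rewrite -(path_meanZ _ _ C20 lS rS).
have -> : \int[pi]_x F' (lnv (retr (x : 'cV[R]_n))) = B^-1 * \int[pi]_x F (lnv (retr (x : 'cV[R]_n))).
  rewrite -RintegralZl//.
  apply: (bounded_integrable pi (measurable_lnv_retr lF) (B := B)) => x.
  by have /andP[f0 f1] := rF (lnv (retr (x : 'cV[R]_n))); rewrite ger0_norm.
by move/(mulfI (lt0r_neq0 B'0)).
Qed.

Definition shift (Phi : (nat -> 'cV[R]_n) -> R) (p : nat -> 'cV[R]_n) : R := Phi (fun k => p k.+1).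

Lemma loglip_shift N C Phi : loglip N C Phi -> loglip N.+1 C (shift Phi).
Proof. by move=> lPhi a b e ab; apply: lPhi => k i kN; exact: ab. Qed.

Lemma prange_shift B Phi : prange B Phi -> prange B (shift Phi).
Proof. by move=> rPhi p; exact: rPhi. Qed.

(** By the Markov property the shifted functional has the mean of a function of the state at time
    [h]. That function is a limit of [euler_mean], Lipschitz in the logarithms, for which
    [stationary_state] is available. *)
Lemma stationary_path N C B Phi : 0 <= C -> 0 < B -> loglip N C Phi -> prange B Phi ->
  \int[pi]_x path_mean P h (shift Phi) X (x : state_space) =
  \int[pi]_x path_mean P h Phi X (x : state_space).
Proof.
move=> C0 B0 lPhi rPhi.
pose Psi m := euler_mean A sigma h N Phi m.
have lPsi m : exists C', 0 <= C' /\ lip C' (Psi m).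
  have [C' l1] := lip_euler_mean A sigma n0 h0 lPhi rPhi m; exists C'; split => //.
  rewrite -[C']mulr1; apply: le_trans (normr_ge0 _) (l1 (fun=> 0) (fun=> 0) 1 _) => i.
  by rewrite subrr normr0.
have rPsi m : ranges B (Psi m) by exact: (ranges_euler_mean A sigma h0 lPhi rPhi m).
have nPsi m a : `|Psi m a| <= B by have /andP[f0 f1] := rPsi m a; rewrite ger0_norm.
have nG x : `|path_mean P h Phi X x| <= B.
  by have /andP[f0 f1] := path_mean_range n0 h0 lPhi rPhi hX x; rewrite ger0_norm.
have shiftE x : path_mean P h (shift Phi) X x = \int[P]_w path_mean P h Phi X (X (retr x) h w).
  rewrite -(Ex_path_markov hW n0 h0 C0 lPhi rPhi hX (int_simplex_retr x n0) (ltW h0)).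
  apply: eq_Rintegral => w _; rewrite /shift; congr Phi; apply/funext => k.
  by rewrite /path -(natr1 k) mulrDl mul1r add0r addrC.
have hv : (fun m => \int[pi]_x Psi m (lnv (retr (x : 'cV[R]_n)))) @ \oo -->
    \int[pi]_x path_mean P h Phi X (x : state_space).
  apply: (@Ex_dct _ _ _ pi (fun m (x : state_space) => Psi m (lnv (retr (x : 'cV[R]_n)))) _ B).
  - by move=> m; have [C' [_ l1]] := lPsi m; exact: (measurable_lnv_retr l1).
  - exact: (measurable_path_mean h0 C0 lPhi rPhi).
  - by move=> m x; exact: nPsi.
  - by apply: aeW => x; exact: (path_mean_cvg hW n0 h0 C0 lPhi rPhi hX).
have hu : (fun m => \int[pi]_x path_mean P h (state_functional 1 (Psi m)) X (x : state_space)) @ \oo -->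
    \int[pi]_x path_mean P h (shift Phi) X (x : state_space).
  apply: (@Ex_dct _ _ _ pi (fun m => path_mean P h (state_functional 1 (Psi m)) X : state_space -> R) _ B).
  - move=> m; have [C' [C'0 l1]] := lPsi m.
    exact: (measurable_path_mean h0 (mulr_ge0 C'0 (ler0n _ 2)) (@loglip_state 1 _ _ l1) (@prange_state 1 _ _ (rPsi m))).
  - exact: (measurable_path_mean h0 C0 (loglip_shift lPhi) (prange_shift rPhi)).
  - move=> m x; have [C' [C'0 l1]] := lPsi m.
    have /andP[f0 f1] := path_mean_range n0 h0 (@loglip_state 1 _ _ l1) (@prange_state 1 _ _ (rPsi m)) hX x.
    by rewrite ger0_norm.
  - apply: aeW => x; rewrite shiftE; have xI := int_simplex_retr (x : 'cV[R]_n) n0.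
    apply: (@Ex_dct _ _ _ P (fun m w => Psi m (lnv (path h (X (retr (x : 'cV[R]_n))) 0 w 1%N))) _ B).
    + move=> m; have [C' [_ l1]] := lPsi m.
      exact: (measurable_path h0 (@loglip_state 1 _ _ l1) (hX xI) (lexx 0)).
    + exact: (measurable_path_mean_process hW n0 h0 C0 lPhi rPhi hX xI (ltW h0)).
    + by move=> m w; exact: nPsi.
    + apply: aeW => w; rewrite /path add0r mul1r.
      exact: (path_mean_cvg hW n0 h0 C0 lPhi rPhi hX).
apply: (cvg_unique_seq hu).
apply: (eq_cvg_seq _ hv) => m; have [C' [C'0 l1]] := lPsi m.
exact: (esym (stationary_state 1 C'0 B0 l1 (rPsi m))).
Qed.

End one_step.
End stationarity.

(** * Tails of the logarithms *)

Section almost_everywhere_comparison.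
Context {d : measure_display} {T : measurableType d} {R : realType}.
Variable P : probability T R.

Lemma Ex_le_ae (f g : T -> R) : measurable_fun setT f -> (forall x, 0 <= f x) ->
  (forall x, 0 <= g x) -> P.-integrable setT (EFin \o g) -> {ae P, forall x, f x <= g x} ->
  P.-integrable setT (EFin \o f) /\ \int[P]_x f x <= \int[P]_x g x.
Proof.
move=> mf f0 g0 ig fg.
have mg : measurable_fun setT (EFin \o g) by case/integrableP : ig.
have le : (\int[P]_x (f x)%:E <= \int[P]_x (g x)%:E)%E.
  apply: ae_ge0_le_integral => //.
  - by move=> x _; rewrite lee_fin.
  - by apply/measurable_EFinP.
  - by move=> x _; rewrite lee_fin.
  - by apply: filterS fg => x fgx _; rewrite lee_fin.
have fi : P.-integrable setT (EFin \o f).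
  apply/integrableP; split; first exact/measurable_EFinP.
  under eq_integral => x _ do rewrite /= ger0_norm//.
  by apply: le_lt_trans le _; rewrite (Ex_fineE ig) ltry.
by split => //; move: le; rewrite (Ex_fineE fi) (Ex_fineE ig) lee_fin.
Qed.

Lemma Ex_integrableD (f g : T -> R) : P.-integrable setT (EFin \o f) ->
  P.-integrable setT (EFin \o g) -> P.-integrable setT (EFin \o (fun x => f x + g x)).
Proof.
move=> fi gi; rewrite (_ : (_ \o _) = (fun x => (f x)%:E + (g x)%:E)%E); last by apply/funext.
exact: integrableD.
Qed.

Lemma Ex_integrableZ (c : R) (f : T -> R) : P.-integrable setT (EFin \o f) ->
  P.-integrable setT (EFin \o (fun x => c * f x)).
Proof.
move=> fi; rewrite (_ : (_ \o _) = (fun x => c%:E * (f x)%:E)%E); last by apply/funext.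
by apply: integrableZl => //; exact: fi.
Qed.

Lemma Ex_integrable_cst (c : R) : P.-integrable setT (EFin \o (fun _ : T => c)).
Proof. exact: (@bounded_integrable _ _ _ P _ `|c|). Qed.

End almost_everywhere_comparison.

Section truncation.
Context {R : realType}.
Implicit Types (K v u : R) (g : R -> R).

Definition clip K v : R := Num.max (- K) (Num.min v K).

Lemma clip_bound K v : 0 <= K -> `|clip K v| <= K.
Proof.
move=> K0; rewrite /clip ler_norml le_max lexx/= ge_max ge_min lexx orbT andbT.
by rewrite -subr_ge0 opprK addr_ge0.
Qed.

Lemma clip_id K v : `|v| <= K -> clip K v = v.
Proof. by rewrite ler_norml => /andP[h1 h2]; rewrite /clip min_l// max_r. Qed.

Lemma clip_lip K u v : `|clip K u - clip K v| <= `|u - v|.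
Proof.
rewrite /clip; have h1 := ler_norm (u - v); have := ler_norm (v - u).
rewrite (distrC v u) => h2; have h3 := normr_ge0 (u - v).
move: h1 h2 h3; move: `|u - v| => e h1 h2 h3.
have hmin : `|Num.min u K - Num.min v K| <= e.
  rewrite /Num.min; case: (ltP u K) => a; case: (ltP v K) => b;
  by rewrite ler_norml; apply/andP; split; lra.
move: hmin; move: (Num.min u K) (Num.min v K) => a b; rewrite ler_norml => /andP[k1 k2].
rewrite /Num.max; case: (ltP (- K) a) => c; case: (ltP (- K) b) => f;
by rewrite ler_norml; apply/andP; split; lra.
Qed.

(** The constant 2 suits [v - clip (K + 1) v], by the triangle inequality. The flat part extends one
    unit beyond [K] so that [chi K] is 1 wherever [g] does not vanish. *)
Definition tail_fun K g := (forall u v, `|g u - g v| <= 2 * `|u - v|) /\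
  (forall v, `|v| <= K + 1 -> g v = 0).

Lemma tail_fun_id K : 0 <= K -> tail_fun K (fun v => v - clip (K + 1) v).
Proof.
move=> K0; split=> [u v|v vK]; last by rewrite clip_id// subrr.
have -> : u - clip (K + 1) u - (v - clip (K + 1) v) = (u - v) - (clip (K + 1) u - clip (K + 1) v) by ring.
have := clip_lip (K + 1) u v; have := ler_normB (u - v) (clip (K + 1) u - clip (K + 1) v); lra.
Qed.

Definition chi K v : R := ramp 1 K `|v|.

Lemma chi01 K v : 0 <= chi K v <= 1. Proof. exact: ramp01. Qed.

Lemma chi_lip K u v : `|chi K u - chi K v| <= `|u - v|.
Proof. by rewrite -[leRHS]mul1r; apply: ramp_lip; exact: ler_dist_dist. Qed.

Lemma chi1 K v : K + 1 < `|v| -> chi K v = 1.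
Proof. by move=> h; rewrite /chi /ramp mul1r max_r ?min_l//; lra. Qed.

Lemma chi0 K v : `|v| <= K -> chi K v = 0.
Proof. by move=> h; rewrite /chi /ramp mul1r max_l ?min_r//; lra. Qed.

(** If both arguments are within [K + 1] of 0, the left side is 0. Otherwise one of the two [chi] is
    1, which pays for a distance up to [r]; a longer distance is at most its square divided by
    [r]. *)
Lemma tail_fun_bound K g r u v : tail_fun K g -> 0 < r ->
  `|g u - g v| <= 2 * r * (chi K u + chi K v) + 2 / r * (u - v) ^+ 2.
Proof.
move=> [g1 g2] r0; have /andP[u0 u1] := chi01 K u; have /andP[v0 v1] := chi01 K v.
have q0 : 0 <= 2 / r * (u - v) ^+ 2 by rewrite mulr_ge0 ?sqr_ge0// divr_ge0// ltW.
have s0 : 0 <= 2 * r * (chi K u + chi K v).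
  by rewrite mulr_ge0 ?addr_ge0// mulr_ge0// ltW.
have [uK|uK] := leP `|u| (K + 1); have [vK|vK] := leP `|v| (K + 1).
- by rewrite !g2// subrr normr0 addr_ge0.
all: have s1 : 2 * r <= 2 * r * (chi K u + chi K v)
    by rewrite ler_peMr ?mulr_ge0 ?(ltW r0)// ?(chi1 uK) ?(chi1 vK) ?lerDl ?lerDr.
all: apply: (le_trans (g1 u v)); rewrite -(real_normK (num_real (u - v))).
all: have e0 := normr_ge0 (u - v); have [ur|ur] := leP `|u - v| r.
all: try (apply: (@le_trans _ _ (2 * r)); [by rewrite ler_pM2l|];
  apply: (le_trans s1); rewrite lerDl real_normK ?num_real//).
all: apply: (@le_trans _ _ (2 / r * `|u - v| ^+ 2)); [|by rewrite lerDr].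
all: rewrite -mulrA ler_pM2l// expr2 mulrA ler_peMl// ler_pdivlMl// mulr1; exact: ltW.
Qed.

End truncation.

(** * Contrasts: linear combinations of logarithms with coefficients of sum zero *)

Section linear_functionals.
Context {R : realType} {n : nat}.
Variable u : 'I_n -> R.
Hypothesis u0 : \sum_l u l = 0.

Definition contrast (a : 'I_n -> R) : R := \sum_l u l * a l.

Definition contrast_norm : R := \sum_l `|u l|.

Lemma contrast_norm_ge0 : 0 <= contrast_norm. Proof. exact: sumr_ge0. Qed.

Lemma lip_contrast : lip contrast_norm contrast.
Proof.
move=> a b e ab; rewrite /contrast -sumrB mulr_suml (le_trans (ler_norm_sum _ _ _))//.
by apply: ler_sum => l _; rewrite -mulrBr normrM ler_wpM2l.
Qed.

Lemma contrast_shift (a : 'I_n -> R) c : contrast (fun l => a l - c) = contrast a.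
Proof.
rewrite /contrast; under eq_bigr do rewrite mulrBr.
by rewrite sumrB -mulr_suml u0 mul0r subr0.
Qed.

(** The logarithm of the normalising sum is common to all coordinates, hence cancelled by
    coefficients of sum zero. *)
Lemma contrast_lnv_softmax a : contrast (lnv (softmax a)) = contrast a.
Proof.
rewrite -(contrast_shift a (ln (\sum_j expR (a j)))); congr contrast.
by apply/funext => l; rewrite /lnv ln_softmax.
Qed.

Lemma J_sum (g : 'I_n -> R -> R) (t : R) : (forall l, cts0 (g l)) ->
  J (fun s => contrast (g ^~ s)) t = contrast (fun l => J (g l) t).
Proof.
move=> cg; rewrite /contrast.
elim: (index_enum _) => [|l r ih].
  rewrite big_nil (eq_J (h := fun=> 0)); first by rewrite /J Rintegral_cst//= mul0r.
  by move=> s _ _; rewrite big_nil.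
rewrite big_cons (eq_J (h := fun s => \sum_(j <- r) u j * g j s + u l * g l s)); last first.
  by move=> s _ _; rewrite big_cons addrC.
rewrite J_lin//; first by rewrite ih addrC.
by apply: cts0_sum => j; apply: cts0M => //; exact: cts0_cst.
Qed.

End linear_functionals.

Section contrast_increments.
Context {R : realType} {n : nat} {d : measure_display} {Omega : measurableType d}.
Variables (P : probability Omega R) (W : 'I_n -> R -> {RV P >-> R}).
Hypothesis hW : brownian_motion W.
Variables (A : 'M[R]_n) (sigma : 'I_n -> R).
Hypothesis n0 : (0 < n)%N.
Notation M := (modified_payoff A sigma).
Variables (u : 'I_n -> R) (h : R).
Hypotheses (u0 : \sum_l u l = 0) (h0 : 0 < h).
Notation V y := (contrast u (lnv y)).

Lemma Ex_W_sqr l : P.-integrable setT (EFin \o (fun w => W l h w ^+ 2)) /\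
  \int[P]_w W l h w ^+ 2 = h.
Proof.
have W0 : forall w, W l 0 w = 0 by case: hW.
have g1 k : gmeasurable (brownian_gen W (k%:R * h)) (fun _ : Omega => 1 : R) by exact: gmeasurable_cst.
have := @L2_sum_lin _ _ _ _ _ _ hW h (fun _ _ => 1) h0 g1 l 1.
under eq_integral do rewrite big_ord1 mul1r mul0r W0 subr0 mul1r.
under [X in _ = X -> _]eq_integral do rewrite big_ord1 expr1n mul1r.
rewrite integral_cst// [X in (_ * X)%E]probability_setT mule1 => E.
have iW : P.-integrable setT (EFin \o (fun w => W l h w ^+ 2)).
  apply/integrableP; split; first by apply/measurable_EFinP; apply: measurable_funX; exact: measurable_funP.
  under eq_integral => w _ do rewrite /= ger0_norm ?sqr_ge0//.
  by rewrite E ltry.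
by split => //; rewrite /Rintegral E.
Qed.

(** Dominates the squared increment of a contrast over a time [h] from any starting point: twice the
    square of the drift bound plus twice that of the noise, the latter through [sqr_sum_le]. *)
Definition noise_square (w : Omega) : R :=
  2 * (contrast_norm u * payoff_bound M * h) ^+ 2 +
  2 * (2 ^+ n * \sum_l (u l * sigma l * W l h w) ^+ 2).

Lemma noise_square_ge0 w : 0 <= noise_square w.
Proof.
have s0 : 0 <= \sum_l (u l * sigma l * W l h w) ^+ 2 by apply: sumr_ge0 => l _; exact: sqr_ge0.
by rewrite /noise_square addr_ge0// mulr_ge0 ?sqr_ge0// mulr_ge0// exprn_ge0.
Qed.

Lemma integrable_noise_square : P.-integrable setT (EFin \o noise_square).
Proof.
apply: Ex_integrableD; first exact: Ex_integrable_cst.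
apply: Ex_integrableZ; apply: Ex_integrableZ.
elim: (index_enum _) => [|l r ih].
  by under [X in _ \o X]funext do rewrite big_nil; exact: Ex_integrable_cst.
under [X in _ \o X]funext do rewrite big_cons exprMn.
by apply: Ex_integrableD => //; apply: Ex_integrableZ; exact: (Ex_W_sqr l).1.
Qed.

Lemma Ex_noise : \int[P]_w (\sum_l u l * (sigma l * W l h w)) = 0 /\
  P.-integrable setT (EFin \o (fun w => \sum_l u l * (sigma l * W l h w))).
Proof.
have iW l : P.-integrable setT (EFin \o (fun w => W l h w)).
  have [i2 _] := Ex_W_sqr l.
  have i3 := Ex_integrableD (Ex_integrable_cst P 1) i2.
  apply: (le_integrable measurableT _ _ i3).
    by apply/measurable_EFinP; exact: measurable_funP.
  move=> w _; rewrite /= lee_fin [leRHS]ger0_norm ?addr_ge0 ?sqr_ge0//.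
  have := sqr_ge0 (`|W l h w| - 1); rewrite -(real_normK (num_real (W l h w))).
  by move: `|W l h w| (normr_ge0 (W l h w)) => x x0; rewrite !expr2; nra.
have EW l : \int[P]_w W l h w = 0.
  have [i2 E2] := Ex_W_sqr l.
  have W0 : forall w, W l 0 w = 0 by case: hW.
  have g1 : gmeasurable (past W l 0 h) (fun _ : Omega => 1 : R) by exact: gmeasurable_cst.
  have := L2_step_lin hW (lexx 0) h0 g1 g1.
  under [X in _ = X -> _]eq_integral do rewrite expr1n mul1r subr0.
  (* [E] says that [1 + W l h] has second moment [1 + h]; expanding the square and using [E2] leaves
     mean zero for [W l h]. *)
  rewrite integral_cst// [X in (_ * X)%E]probability_setT mule1 => E.
  have i2W := Ex_integrableZ 2 (iW l).
  have i12 := Ex_integrableD (Ex_integrable_cst P 1) i2W.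
  have : \int[P]_w ((1 + 2 * W l h w) + W l h w ^+ 2) = 1 + h.
    rewrite /Rintegral (_ : (\int[P]_x _)%E = (1 + h)%:E)// -E.
    by apply: eq_integral => w _; congr EFin; rewrite W0; ring.
  have E3 : \int[P]_w (1 + 2 * W l h w + W l h w ^+ 2) =
    \int[P]_w (1 + 2 * W l h w) + \int[P]_w (W l h w ^+ 2) by exact: RintegralD.
  have E4 : \int[P]_w (1 + 2 * W l h w) = \int[P]_w (1 : R) + \int[P]_w (2 * W l h w).
    by apply: RintegralD => //; exact: Ex_integrable_cst.
  have E5 : \int[P]_w (2 * W l h w) = 2 * \int[P]_w W l h w by exact: RintegralZl.
  move: E3 E4; rewrite E5 E2 Ex_cst => -> ->; lra.
have iterm l : P.-integrable setT (EFin \o (fun w => u l * (sigma l * W l h w))).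
  by apply: Ex_integrableZ; apply: Ex_integrableZ; exact: iW.
have : forall r : seq 'I_n, \int[P]_w (\sum_(l <- r) u l * (sigma l * W l h w)) = 0 /\
    P.-integrable setT (EFin \o (fun w => \sum_(l <- r) u l * (sigma l * W l h w))).
  elim=> [|l r [ih1 ih2]].
    split; first by under eq_Rintegral do rewrite big_nil; rewrite Ex_cst.
    by under [X in _ \o X]funext do rewrite big_nil; exact: Ex_integrable_cst.
  split.
    under eq_Rintegral do rewrite big_cons.
    rewrite RintegralD//= ih1 addr0.
    under eq_Rintegral do rewrite mulrA.
    by rewrite RintegralZl// EW mulr0.
  under [X in _ \o X]funext do rewrite big_cons.
  exact: Ex_integrableD.
by apply.
Qed.

Section one_process.
Variables (x : 'cV[R]_n) (X : R -> Omega -> 'cV[R]_n).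
Hypotheses (xI : int_simplex x) (hX : replicator_process A sigma W x X).

Let payoff_cts w l : cts0 (fun s => (M *m X s w) l 0).
Proof.
rewrite (_ : (fun u => _) = (fun s => \sum_k M l k * X s w k 0)).
  by apply: cts0_sum => k; apply: cts0M; [exact: cts0_cst|exact: (process_cts hX)].
by apply/funext => s; rewrite mxE.
Qed.

Definition contrast_payoff (y : 'cV[R]_n) : R := contrast u (fun l => (M *m y) l 0).

Lemma contrast_payoff_cts w : cts0 (fun s => contrast_payoff (X s w)).
Proof. by apply: cts0_sum => l; apply: cts0M => //; exact: cts0_cst. Qed.

Lemma contrast_payoff_bound y : simplex y -> `|contrast_payoff y| <= contrast_norm u * payoff_bound M.
Proof.
move=> yS; rewrite /contrast_payoff /contrast (le_trans (ler_norm_sum _ _ _))// mulr_suml.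
by apply: ler_sum => l _; rewrite normrM ler_wpM2l// payoff_le.
Qed.

(** As the coefficients sum to zero, only log ratios with respect to coordinate [l0] matter, and
    [log_ratio] gives these. *)
Lemma contrast_increment : {ae P, forall w,
  V (path h X 0 w 1) - V (path h X 0 w 0) =
  J (fun s => contrast_payoff (X s w)) h + \sum_l u l * (sigma l * W l h w)}.
Proof.
have X0 : {ae P, forall w, X 0 w = x} by case: hX.
have Xs : {ae P, forall w, forall t : R, 0 <= t -> int_simplex (X t w)} by case: hX.
apply: filterS3 X0 Xs (log_ratio hW hX) => w X0 Xs lr.
pose l0 := Ordinal n0.
rewrite /path !add0r mul1r mul0r X0 (retr_id xI) (retr_id (Xs _ (ltW h0))).
rewrite -(contrast_shift u0 (lnv (X h w)) (lnv (X h w) l0)).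
have E l : lnv (X h w) l - lnv (X h w) l0 =
   (lnv x l + J (fun s => (M *m X s w) l 0) h + sigma l * W l h w) -
   (lnv x l0 + J (fun s => (M *m X s w) l0 0) h + sigma l0 * W l0 h w).
  rewrite /lnv (lr _ (ltW h0) l l0).
  have -> : J (fun s => (M *m X s w) l 0 - (M *m X s w) l0 0) h =
     J (fun s => (M *m X s w) l 0) h - J (fun s => (M *m X s w) l0 0) h.
    rewrite -[X in _ - X]mul1r -mulNr -J_lin; [|exact: payoff_cts|exact: payoff_cts].
    by apply: eq_J => s _ _; rewrite mulN1r.
  by ring.
rewrite (_ : (fun l => lnv (X h w) l - _) = (fun l =>
   (lnv x l + J (fun s => (M *m X s w) l 0) h + sigma l * W l h w) -
   (lnv x l0 + J (fun s => (M *m X s w) l0 0) h + sigma l0 * W l0 h w))); last by apply/funext.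
rewrite contrast_shift// /contrast_payoff (J_sum u h (@payoff_cts w)).
rewrite /contrast -sumrB -big_split/=; apply: eq_bigr => l _; ring.
Qed.

Lemma contrast_increment_sqr : {ae P, forall w,
  (V (path h X 0 w 1) - V (path h X 0 w 0)) ^+ 2 <= noise_square w}.
Proof.
have Xs : {ae P, forall w, forall t : R, 0 <= t -> int_simplex (X t w)} by case: hX.
apply: filterS2 Xs contrast_increment => w Xs ->.
have hJ : `|J (fun s => contrast_payoff (X s w)) h| <= contrast_norm u * payoff_bound M * h.
  apply: J_bound; [exact: contrast_payoff_cts|exact: ltW|].
  by move=> s s0 _; apply: contrast_payoff_bound; have [] := Xs s s0.
have hN := sqr_sum_le (index_enum 'I_n) (fun l => u l * sigma l * W l h w).
have sz : size (index_enum 'I_n) = n by rewrite -[RHS]card_ord cardT enumT.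
rewrite sz in hN; rewrite /noise_square.
under [X in (_ + X) ^+ 2]eq_bigr do rewrite mulrA.
move: hJ hN; move: (J _ h) (\sum_l u l * sigma l * W l h w) (2 ^+ n * _) (_ * _ * h) => a b c e ae bc.
have h2 : (a + b) ^+ 2 <= 2 * a ^+ 2 + 2 * b ^+ 2.
  rewrite -subr_ge0; have -> : 2 * a ^+ 2 + 2 * b ^+ 2 - (a + b) ^+ 2 = (a - b) ^+ 2 by ring.
  exact: sqr_ge0.
have a2 : a ^+ 2 <= e ^+ 2.
  by rewrite -(real_normK (num_real a)) lerXn2r// nnegrE// (le_trans (normr_ge0 a)).
lra.
Qed.

Let mV (g : R -> R) (c : R) k : (forall a b : R, `|g a - g b| <= c * `|a - b|) -> 0 <= c ->
  measurable_fun setT (fun w => g (V (path h X 0 w k))).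
Proof.
move=> gl c0.
have lg : lip (c * contrast_norm u) (fun a => g (contrast u a)).
  move=> a b e ab; apply: (le_trans (gl _ _)); rewrite -mulrA ler_wpM2l//.
  exact: lip_contrast.
exact: (measurable_path h0 (@loglip_state _ _ k _ _ lg) hX (lexx 0)).
Qed.

Lemma tail_mean K g r : tail_fun K g -> 0 < r ->
  P.-integrable setT (EFin \o (fun w => `|g (V (path h X 0 w 1)) - g (V (path h X 0 w 0))|)) /\
  \int[P]_w `|g (V (path h X 0 w 1)) - g (V (path h X 0 w 0))| <=
  2 * r * (\int[P]_w chi K (V (path h X 0 w 1)) + \int[P]_w chi K (V (path h X 0 w 0))) +
  2 / r * \int[P]_w noise_square w.
Proof.
move=> tg r0; have [g1 _] := tg.
have mg k : measurable_fun setT (fun w => g (V (path h X 0 w k))) by exact: (mV k g1).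
have mc k : measurable_fun setT (fun w => chi K (V (path h X 0 w k))).
  by apply: (@mV (chi K) 1) => // a b; rewrite mul1r; exact: chi_lip.
have ich k : P.-integrable setT (EFin \o (fun w => chi K (V (path h X 0 w k)))).
  apply: (bounded_integrable P (mc k) (B := 1)) => w.
  by have /andP[c0 c1] := chi01 K (V (path h X 0 w k)); rewrite ger0_norm.
have is1 := Ex_integrableD (ich 1%N) (ich 0%N).
have is2 := Ex_integrableZ (2 * r) is1.
have is3 := Ex_integrableZ (2 / r) integrable_noise_square.
have is4 := Ex_integrableD is2 is3.
have r20 : 0 <= 2 / r by rewrite divr_ge0// ltW.
have := @Ex_le_ae _ _ _ P (fun w => `|g (V (path h X 0 w 1)) - g (V (path h X 0 w 0))|) _ _ _ _ is4.
rewrite RintegralD//= RintegralZl// RintegralD//= RintegralZl//; last exact: integrable_noise_square.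
apply=> //.
- by apply: measurableT_comp => //; exact: measurable_funB.
- move=> w; have /andP[c0 _] := chi01 K (V (path h X 0 w 1)).
  have /andP[c1 _] := chi01 K (V (path h X 0 w 0)).
  have b0 := mulr_ge0 r20 (noise_square_ge0 w).
  have a0 := mulr_ge0 (mulr_ge0 (ler0n _ 2) (ltW r0)) (addr_ge0 c0 c1).
  exact: (addr_ge0 a0 b0).
- apply: filterS contrast_increment_sqr => w hw.
  apply: (le_trans (tail_fun_bound _ _ tg r0)); rewrite lerD2l ler_wpM2l//.
Qed.

End one_process.
End contrast_increments.

Section expectation.
Context {d : measure_display} {T : measurableType d} {R : realType}.
Variable P : probability T R.

Lemma Ex_integrableB (f g : T -> R) : P.-integrable setT (EFin \o f) ->
  P.-integrable setT (EFin \o g) -> P.-integrable setT (EFin \o (fun x => f x - g x)).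
Proof.
move=> fi gi; rewrite (_ : (_ \o _) = (fun x => (f x)%:E - (g x)%:E)%E); last by apply/funext.
exact: integrableB.
Qed.

Lemma Ex_norm_le (f g : T -> R) : P.-integrable setT (EFin \o f) ->
  P.-integrable setT (EFin \o g) -> (forall x, `|f x| <= g x) -> `|\int[P]_x f x| <= \int[P]_x g x.
Proof.
move=> fi gi fg; apply: (le_trans (le_normr_Rintegral _ fi)) => //.
by apply: Ex_le => //; exact: (integrable_norm fi).
Qed.

Lemma Ex_integrable_norm (f : T -> R) : measurable_fun setT f ->
  P.-integrable setT (EFin \o (fun x => `|f x|)) -> P.-integrable setT (EFin \o f).
Proof.
move=> mf; apply: (le_integrable measurableT); first exact/measurable_EFinP.
by move=> x _; rewrite /= lee_fin normr_id.
Qed.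

End expectation.

Lemma J_cst {R : realType} (c t : R) : 0 <= t -> J (fun=> c) t = c * t.
Proof.
move=> t0; rewrite /J Rintegral_cst//= lebesgue_measure_itv/= lte_fin.
by have [t1|t1] := ltP 0 t; [rewrite sube0|rewrite (_ : t = 0) ?mulr0//; apply/eqP; rewrite eq_le t1].
Qed.

Section stationary_contrasts.
Context {R : realType} {n : nat} {d : measure_display} {Omega : measurableType d}.
Variables (P : probability Omega R) (W : 'I_n -> R -> {RV P >-> R}).
Hypothesis hW : brownian_motion W.
Variables (A : 'M[R]_n) (sigma : 'I_n -> R).
Hypothesis n0 : (0 < n)%N.
Variable X : 'cV[R]_n -> R -> Omega -> 'cV[R]_n.
Hypothesis hX : forall x, int_simplex x -> replicator_process A sigma W x (X x).
Notation state_space := (@state_space R n).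
Notation M := (modified_payoff A sigma).
Variable pi : probability state_space R.
Hypothesis pi_int : pi (~` int_simplex) = 0%E.
Hypothesis pi_inv : forall (t : R) (B : set state_space), 0 <= t -> measurable B ->
  measurable_fun (int_simplex : set state_space) (fun x : state_space => transition P X t x B) ->
  (\int[pi]_(x in int_simplex) transition P X t x B = pi B)%E.
Variable u : 'I_n -> R.
Hypothesis u0 : \sum_l u l = 0.
Notation V y := (contrast u (lnv y)).

Lemma lip_comp_contrast (g : R -> R) (c : R) : 0 <= c ->
  (forall a b : R, `|g a - g b| <= c * `|a - b|) ->
  lip (c * contrast_norm u) (fun a => g (contrast u a)).
Proof.
move=> c0 gl a b e ab; apply: (le_trans (gl _ _)); rewrite -mulrA ler_wpM2l//.
exact: lip_contrast.
Qed.

Let cn0 := contrast_norm_ge0 u.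

Definition far (K : R) (a : 'I_n -> R) : R := chi K (contrast u a).

Lemma lip_far K : lip (contrast_norm u) (far K).
Proof.
rewrite -[contrast_norm u]mul1r; apply: (lip_comp_contrast (g := chi K)) => // a b.
by rewrite mul1r chi_lip.
Qed.

Lemma ranges_far K : ranges 1 (far K). Proof. by move=> a; exact: chi01. Qed.

Definition far_mass (K : R) : R := \int[pi]_x far K (lnv (retr (x : 'cV[R]_n))).

Lemma far_mass_stationary (h : R) k K : 0 < h ->
  \int[pi]_x path_mean P h (state_functional k (far K)) X (x : state_space) = far_mass K.
Proof. by move=> h0; exact: (stationary_state hW n0 hX pi_int pi_inv h0 k cn0 ltr01 (@lip_far K) (@ranges_far K)). Qed.

Lemma far_mass_cvg0 : (fun K : nat => far_mass K%:R) @ \oo --> (0 : R).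
Proof.
rewrite -[X in _ --> X](Ex_cst pi).
apply: (@Ex_dct _ _ _ pi (fun K (x : state_space) => far K%:R (lnv (retr (x : 'cV[R]_n)))) _ 1) => //.
- by move=> K; exact: (measurable_lnv_retr (@lip_far K%:R)).
- by move=> K x; have /andP[a0 a1] := ranges_far K%:R (lnv (retr x)); rewrite ger0_norm.
- apply: aeW => x; apply: cvg_near_cst; near=> K; rewrite /far chi0//.
  by near: K; exact: nbhs_infty_ger.
Unshelve. all: by end_near. Qed.

Definition noise_mean (h : R) : R := \int[P]_w noise_square W A sigma u h w.

Definition tail_bound (h K r : R) (x : 'cV[R]_n) : R :=
  2 * r * (path_mean P h (state_functional 1 (far K)) X x + path_mean P h (state_functional 0 (far K)) X x)
  + 2 / r * noise_mean h.

Let far_integrable (h : R) k K : 0 < h ->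
  pi.-integrable setT (EFin \o (path_mean P h (state_functional k (far K)) X : state_space -> R)).
Proof.
move=> h0; exact: (path_mean_integrable hW n0 hX pi h0 (mulr_ge0 cn0 (ler0n _ 2))
  (@loglip_state _ _ k _ _ (@lip_far K)) (@prange_state _ _ k _ _ (@ranges_far K))).
Qed.

Lemma tail_bound_integrable (h K r : R) : 0 < h ->
  pi.-integrable setT (EFin \o (tail_bound h K r : state_space -> R)).
Proof.
move=> h0; apply: Ex_integrableD; last exact: Ex_integrable_cst.
by apply: Ex_integrableZ; apply: Ex_integrableD; exact: far_integrable.
Qed.

Lemma Ex_tail_bound (h K r : R) : 0 < h ->
  \int[pi]_x tail_bound h K r (x : state_space) = 4 * r * far_mass K + 2 / r * noise_mean h.
Proof.
move=> h0; have i1 := @far_integrable h 1 K h0; have i0 := @far_integrable h 0 K h0.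
have i2 := Ex_integrableD i1 i0; have i3 := Ex_integrableZ (2 * r) i2.
have E1 : \int[pi]_x tail_bound h K r (x : state_space) =
   \int[pi]_x (2 * r * (path_mean P h (state_functional 1 (far K)) X (x : state_space)
      + path_mean P h (state_functional 0 (far K)) X (x : state_space))) + \int[pi]_x (2 / r * noise_mean h).
  by apply: RintegralD => //; exact: Ex_integrable_cst.
rewrite E1 Ex_cst RintegralZl//.
have -> : \int[pi]_x (path_mean P h (state_functional 1 (far K)) X (x : state_space)
      + path_mean P h (state_functional 0 (far K)) X (x : state_space)) = far_mass K + far_mass K.
  rewrite -{1}(far_mass_stationary 1 K h0) -(far_mass_stationary 0 K h0).
  exact: (RintegralD measurableT i1 i0).
ring.
Qed.

Lemma tail_increment (h K r : R) (g : R -> R) (x : 'cV[R]_n) : 0 < h -> tail_fun K g -> 0 < r ->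
  let Y := path h (X (retr x)) 0 in
  P.-integrable setT (EFin \o (fun w => `|g (V (Y w 1)) - g (V (Y w 0))|)) /\
  \int[P]_w `|g (V (Y w 1)) - g (V (Y w 0))| <= tail_bound h K r x.
Proof.
move=> h0 tg r0; have xI := int_simplex_retr x n0.
exact: (tail_mean hW n0 u0 h0 xI (hX xI) tg r0).
Qed.

Lemma stationary_tail (h K r : R) (g : R -> R) N (C B : R) Phi : 0 < h -> tail_fun K g -> 0 < r ->
  0 <= C -> loglip N C Phi -> prange B Phi ->
  (forall p, Phi p <= `|g (V (p 1)) - g (V (p 0))|) ->
  \int[pi]_x path_mean P h Phi X (x : state_space) <= 4 * r * far_mass K + 2 / r * noise_mean h.
Proof.
move=> h0 tg r0 C0 lPhi rPhi Phig; rewrite -Ex_tail_bound//; apply: Ex_le.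
- exact: (path_mean_integrable hW n0 hX pi h0 C0 lPhi rPhi).
- exact: tail_bound_integrable.
move=> x; have [i1 le1] := tail_increment x h0 tg r0; apply: le_trans le1.
apply: (Ex_le _ i1) => [|w]; last exact: Phig.
have xI := int_simplex_retr x n0.
apply: (bounded_integrable P (measurable_path h0 lPhi (hX xI) (lexx 0)) (B := B)) => w.
by have /andP[f0 f1] := rPhi (path h (X (retr x)) 0 w); rewrite ger0_norm.
Qed.

Lemma measurable_contrast_payoff x (Z : R -> Omega -> 'cV[R]_n) (s : R) :
  replicator_process A sigma W x Z -> 0 <= s ->
  measurable_fun setT (fun w => contrast_payoff A sigma u (Z s w)).
Proof.
move=> hZ s0; apply: measurable_sum => l; apply: measurable_funM => //.
rewrite (_ : (fun w => _) = (fun w => \sum_j M l j * Z s w j 0)); last by apply/funext => w; rewrite mxE.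
by apply: measurable_sum => j; apply: measurable_funM => //; exact: (process_measurable hZ).
Qed.

(** * Payoff contrasts under the invariant distribution *)

Section mean_zero.
(** A shift that makes the payoff contrast nonnegative, with a positive upper bound, as
    [stationary_state] requires. *)
Let Bf : R := contrast_norm u * payoff_bound M + 1.
Let Fp (a : 'I_n -> R) : R := contrast u (payoff M a) + Bf.

Let Bf0 : 0 < 2 * Bf.
Proof. by rewrite mulr_gt0// ltr_wpDl// mulr_ge0// payoff_bound_ge0. Qed.

Let average_cst N (c : R) : \sum_(k < N.+1) (1 / N.+1%:R) * c = c.
Proof. by rewrite sumr_const card_ord -mulrnAl -mulr_natr divfK// mul1r. Qed.

Let FpE (y : 'cV[R]_n) : Fp (lnv (retr y)) = contrast_payoff A sigma u (retr y) + Bf.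
Proof.
rewrite /Fp /contrast_payoff /payoff; congr (contrast u _ + _); apply/funext => l.
by rewrite -/(retr (retr y)) (retr_id (int_simplex_retr y n0)).
Qed.

Let lFp : lip (contrast_norm u * (6 * payoff_bound M)) Fp.
Proof.
move=> a b e ab; rewrite /Fp opprD addrACA subrr addr0 -mulrA.
by apply: lip_contrast => l; exact: lip_payoff.
Qed.

Let rFp : ranges (2 * Bf) Fp.
Proof.
move=> a; have := contrast_payoff_bound A sigma u (int_simplex_softmax a n0).1.
rewrite /Fp /Bf -[contrast_payoff _ _ _ _]/(contrast u (payoff M a)) ler_norml => /andP[h1 h2].
by apply/andP; split; lra.
Qed.

Let lF0 : 0 <= contrast_norm u * (6 * payoff_bound M).
Proof. by rewrite !mulr_ge0// payoff_bound_ge0. Qed.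

(** Mean drift accumulated over a unit of time. It is approximated by [rate_sum], each term of which
    involves the state at a single time, where stationarity applies. *)
Let rate (x : 'cV[R]_n) : R := \int[P]_w J (fun s => contrast_payoff A sigma u (X (retr x) s w) + Bf) 1.

Let rate_sum (N : nat) (x : 'cV[R]_n) : R :=
  \sum_(k < N.+1) (1 / N.+1%:R) * path_mean P (1 / N.+1%:R) (state_functional k Fp) X x.

Let step0 (N : nat) : 0 < 1 / N.+1%:R :> R. Proof. by rewrite divr_gt0. Qed.

Let nFp a : `|Fp a| <= 2 * Bf.
Proof. by have /andP[f0 f1] := rFp a; rewrite ger0_norm. Qed.

Let mFp x N k : measurable_fun setT (fun w => Fp (lnv (path (1 / N.+1%:R) (X (retr x)) 0 w k))).
Proof.
exact: (measurable_path (step0 N) (@loglip_state _ _ k _ _ lFp) (hX (int_simplex_retr x n0)) (lexx 0)).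
Qed.

Let rate_cvg x : rate_sum N x @[N --> \oo] --> rate x.
Proof.
pose S N w := \sum_(k < N.+1) (1 / N.+1%:R) * Fp (lnv (path (1 / N.+1%:R) (X (retr x)) 0 w k)).
apply: (@eq_cvg_seq _ (fun N => \int[P]_w S N w)).
  by move=> N; exact: (Ex_scale_sum P N.+1 (1 / N.+1%:R) (@mFp x N) (fun k w => nFp _)).
have mS N : measurable_fun setT (S N).
  by apply: measurable_sum => k; apply: measurable_funM => //; exact: mFp.
have xI := int_simplex_retr x n0; have hx := hX xI.
have Xs : {ae P, forall w, forall t : R, 0 <= t -> int_simplex (X (retr x) t w)} by case: hx.
pose g w s := contrast_payoff A sigma u (X (retr x) s w) + Bf.
have cg w : cts0 (g w) by apply: cts0D; [exact: (contrast_payoff_cts hx)|exact: cts0_cst].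
apply: (@Ex_dct _ _ _ P S _ (2 * Bf)) => //.
- apply: (@measurable_J _ _ _ (fun s w => g w s) 1) => //.
  by move=> s s0; apply: measurable_funD => //; exact: (measurable_contrast_payoff hx).
- move=> N w; rewrite (le_trans (ler_norm_sum _ _ _))//.
  apply: (@le_trans _ _ (\sum_(k < N.+1) (1 / N.+1%:R) * (2 * Bf))).
    by apply: ler_sum => k _; rewrite normrM (gtr0_norm (step0 N)) ler_wpM2l// ltW.
  by rewrite average_cst.
- apply: filterS Xs => w Xs.
  apply: (eq_cvg_seq _ (riemann_sum (cg w) ler01)) => N.
  apply: eq_bigr => k _; rewrite mulrC /path add0r FpE retr_id//.
  by apply: Xs; rewrite mulr_ge0// ltW.
Qed.

Let rate_sum_measurable N : measurable_fun [set: state_space] (rate_sum N : state_space -> R).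
Proof.
apply: measurable_sum => k; apply: measurable_funM => //.
exact: (measurable_path_mean hW n0 hX (step0 N) (mulr_ge0 lF0 (ler0n _ 2))
  (@loglip_state _ _ k _ _ lFp) (@prange_state _ _ k _ _ rFp)).
Qed.

Let pm_range N k x : `|path_mean P (1 / N.+1%:R) (state_functional k Fp) X x| <= 2 * Bf.
Proof.
have /andP[f0 f1] := path_mean_range n0 (step0 N) (@loglip_state _ _ k _ _ lFp)
  (@prange_state _ _ k _ _ rFp) hX x.
by rewrite ger0_norm.
Qed.

Let rate_measurable : measurable_fun [set: state_space] (rate : state_space -> R).
Proof.
apply: (measurable_fun_cvg (h := fun N => rate_sum N : state_space -> R)).
  exact: rate_sum_measurable.
by move=> x _; exact: rate_cvg.
Qed.

Let rate_sum_bound N x : `|rate_sum N x| <= 2 * Bf.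
Proof.
rewrite (le_trans (ler_norm_sum _ _ _))//.
apply: (@le_trans _ _ (\sum_(k < N.+1) (1 / N.+1%:R) * (2 * Bf))).
  by apply: ler_sum => k _; rewrite normrM (gtr0_norm (step0 N)) ler_wpM2l// ltW.
by rewrite average_cst.
Qed.

Let rate_bound x : `|rate x| <= 2 * Bf.
Proof.
rewrite leNgt; apply/negP => lt1.
have h0 : 0 < `|rate x| - 2 * Bf by rewrite subr_gt0.
have := @rate_cvg x => /cvgrPdist_lt /(_ _ h0)[N _ /(_ N (leqnn _))] /=.
have := rate_sum_bound N x; have := ler_normD (rate x - rate_sum N x) (rate_sum N x).
rewrite subrK; lra.
Qed.

Let rate_mean : \int[pi]_x rate (x : state_space) = \int[pi]_x Fp (lnv (retr (x : 'cV[R]_n))).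
Proof.
have h1 : (fun N => \int[pi]_x rate_sum N (x : state_space)) @ \oo --> \int[pi]_x rate (x : state_space).
  apply: (@Ex_dct _ _ _ pi (fun N => rate_sum N : state_space -> R) _ (2 * Bf)).
  - exact: rate_sum_measurable.
  - exact: rate_measurable.
  - by move=> N x; exact: rate_sum_bound.
  - by apply: aeW => x; exact: rate_cvg.
apply: (cvg_unique_seq h1); apply: (eq_cvg_seq _ (cvg_cst_seq _)) => N.
have mp k := measurable_path_mean hW n0 hX (step0 N) (mulr_ge0 lF0 (ler0n _ 2))
  (@loglip_state _ _ k _ _ lFp) (@prange_state _ _ k _ _ rFp).
rewrite (Ex_scale_sum pi N.+1 (1 / N.+1%:R) mp (fun k x => @pm_range N k x)).
rewrite -[LHS](average_cst N); apply: eq_bigr => k _; congr (_ * _).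
exact: (esym (stationary_state hW n0 hX pi_int pi_inv (step0 N) k lF0 Bf0 lFp rFp)).
Qed.

(** The clipped contrast, shifted to be nonnegative. Its increments have mean zero under [pi], so
    the mean of the drift is that of the increments of what the clipping removes. *)
Let truncated (K : R) (a : 'I_n -> R) : R := clip (K + 1) (contrast u a) + (K + 1).

Let lip_truncated K : lip (contrast_norm u) (truncated K).
Proof.
rewrite -[contrast_norm u]mul1r; apply: (lip_comp_contrast (g := fun v => clip (K + 1) v + (K + 1))) => // a b.
by rewrite mul1r opprD addrACA subrr addr0 clip_lip.
Qed.

Let ranges_truncated K : 0 <= K -> ranges (2 * (K + 1)) (truncated K).
Proof.
move=> K0 a; have K1 : 0 <= K + 1 by rewrite addr_ge0.
have := clip_bound (contrast u a) K1; rewrite /truncated ler_norml => /andP[h1 h2].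
by apply/andP; split; lra.
Qed.

Let rate_tail (K r : R) x : 0 <= K -> 0 < r ->
  `|rate x - Bf - (path_mean P 1 (state_functional 1 (truncated K)) X x -
                   path_mean P 1 (state_functional 0 (truncated K)) X x)| <= tail_bound 1 K r x.
Proof.
move=> K0 r0; have xI := int_simplex_retr x n0; have hx := hX xI.
have [i1 le1] := tail_increment x ltr01 (tail_fun_id K0) r0; apply: le_trans le1.
set Y := path 1 (X (retr x)) 0 in i1 *.
have [En i_n] := Ex_noise hW sigma u ltr01.
have cf w : cts0 (fun s => contrast_payoff A sigma u (X (retr x) s w)) by exact: (contrast_payoff_cts hx).
pose G w := J (fun s => contrast_payoff A sigma u (X (retr x) s w)) 1.
have Xs : {ae P, forall w, forall t : R, 0 <= t -> int_simplex (X (retr x) t w)} by case: hx.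
have mG : measurable_fun setT G.
  apply: (@measurable_J _ _ _ (fun s w => contrast_payoff A sigma u (X (retr x) s w)) 1) => //.
  by move=> s s0; exact: (measurable_contrast_payoff hx).
have E1 : (fun w => J (fun s => contrast_payoff A sigma u (X (retr x) s w) + Bf) 1) = (fun w => Bf + G w).
  apply/funext => w.
  rewrite (eq_J (h := fun s => contrast_payoff A sigma u (X (retr x) s w) + Bf * 1)); last by move=> s _ _; rewrite mulr1.
  have c1 : cts0 (fun _ : R => 1 : R) by exact: cts0_cst.
  rewrite (J_lin Bf 1 (cf w) c1) addrC; congr (_ + _).
  by rewrite J_cst// !mulr1.
have iG : P.-integrable setT (EFin \o G).
  apply: Ex_integrable_norm => //.
  apply: (Ex_le_ae _ _ _ (Ex_integrable_cst P Bf) _).1 => //.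
  - exact: measurableT_comp.
  - by move=> w; have := Bf0; lra.
  apply: filterS Xs => w Xs; rewrite -[Bf]mulr1; apply: J_bound => // s s0 _.
  apply: (le_trans (contrast_payoff_bound A sigma u (Xs s s0).1)).
  by rewrite /Bf lerDl.
have mt k := measurable_path ltr01 (@loglip_state _ _ k _ _ (lip_truncated K)) hx (lexx 0).
have it k : P.-integrable setT (EFin \o (fun w => truncated K (lnv (Y w k)))).
  apply: (bounded_integrable P (mt k) (B := 2 * (K + 1))) => w.
  have /andP[f0 f1] := ranges_truncated K0 (lnv (Y w k)).
  by rewrite [X in X <= _]ger0_norm.
have mV k := measurable_path ltr01 (@loglip_state _ _ k _ _ (lip_contrast u)) hx (lexx 0).
have id := Ex_integrableB (it 1%N) (it 0%N).
have iGn := Ex_integrableD iG i_n.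
have iGnd := Ex_integrableB iGn id.
set gd : Omega -> R := fun w => V (Y w 1) - clip (K + 1) (V (Y w 1)) - (V (Y w 0) - clip (K + 1) (V (Y w 0))).
have gdE w : gd w = V (Y w 1) - V (Y w 0) - (truncated K (lnv (Y w 1)) - truncated K (lnv (Y w 0))).
  have E (a b c e f : R) : a - c - (b - e) = a - b - (c + f - (e + f)) by ring.
  exact: E.
have mgd : measurable_fun setT gd.
  rewrite (_ : gd = fun w => V (Y w 1) - V (Y w 0) - (truncated K (lnv (Y w 1)) - truncated K (lnv (Y w 0)))).
    by apply: measurable_funB; [exact: measurable_funB (mV 1%N) (mV 0%N)|exact: measurable_funB (mt 1%N) (mt 0%N)].
  by apply/funext => w; exact: gdE.
have igd : P.-integrable setT (EFin \o gd) by exact: Ex_integrable_norm.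
have -> : rate x - Bf - (path_mean P 1 (state_functional 1 (truncated K)) X x -
    path_mean P 1 (state_functional 0 (truncated K)) X x) = \int[P]_w gd w.
  have -> : \int[P]_w gd w = \int[P]_w (G w + \sum_l u l * (sigma l * W l 1 w)
      - (truncated K (lnv (Y w 1)) - truncated K (lnv (Y w 0)))).
    apply: Ex_ae => //.
      by case/integrableP : iGnd => /measurable_EFinP.
    apply: filterS (contrast_increment hW n0 u0 ltr01 xI hx) => w E.
    by rewrite gdE E.
  have D1 := RintegralB measurableT iGn id.
  have D2 := RintegralD measurableT iG i_n.
  have D3 := RintegralB measurableT (it 1%N) (it 0%N).
  have D4 : rate x = Bf + \int[P]_w G w.
    rewrite /rate E1; have := RintegralD measurableT (Ex_integrable_cst P Bf) iG.
    by rewrite Ex_cst.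
  by rewrite D1 D2 D3 D4 En addr0 [Bf + _]addrC addrK.
exact: (Ex_norm_le igd i1).
Qed.

Let mean_defect (K r : R) : 0 <= K -> 0 < r ->
  `|\int[pi]_x Fp (lnv (retr (x : 'cV[R]_n))) - Bf| <= 4 * r * far_mass K + 2 / r * noise_mean 1.
Proof.
move=> K0 r0; have K1 : 0 < 2 * (K + 1) by rewrite mulr_gt0// ltr_wpDl.
rewrite -(Ex_tail_bound K r ltr01).
have ir : pi.-integrable setT (EFin \o (rate : state_space -> R)).
  exact: (bounded_integrable pi rate_measurable rate_bound).
have ip k := path_mean_integrable hW n0 hX pi ltr01 (mulr_ge0 cn0 (ler0n _ 2))
  (@loglip_state _ _ k _ _ (lip_truncated K)) (@prange_state _ _ k _ _ (ranges_truncated K0)).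
have Ep k := stationary_state hW n0 hX pi_int pi_inv ltr01 k cn0 K1 (lip_truncated K) (ranges_truncated K0).
have i1 := Ex_integrableB ir (Ex_integrable_cst pi Bf).
have i2 := Ex_integrableB (ip 1%N) (ip 0%N).
have i3 := Ex_integrableB i1 i2.
have D1 := RintegralB measurableT i1 i2.
have D2 := RintegralB measurableT ir (Ex_integrable_cst pi Bf).
have D3 := RintegralB measurableT (ip 1%N) (ip 0%N).
have E (a b c e f g h m : R) : a = b - c -> b = e - f -> c = g - h -> g = h -> e = m ->
    f = Bf -> a = m - Bf.
  by move=> -> -> -> -> -> ->; rewrite subrr subr0.
rewrite -(E _ _ _ _ _ _ _ _ D1 D2 D3 (etrans (Ep 1%N) (esym (Ep 0%N))) rate_mean (Ex_cst pi Bf)).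
exact: (Ex_norm_le i3 (tail_bound_integrable K r ltr01) (fun x => rate_tail x K0 r0)).
Qed.

Lemma stationary_mean_zero : \int[pi]_x contrast_payoff A sigma u (retr (x : 'cV[R]_n)) = 0.
Proof.
have iF : pi.-integrable setT (EFin \o (fun x : state_space => Fp (lnv (retr (x : 'cV[R]_n))))).
  by apply: (bounded_integrable pi (measurable_lnv_retr lFp) (B := 2 * Bf)) => x; exact: nFp.
have -> : \int[pi]_x contrast_payoff A sigma u (retr (x : 'cV[R]_n)) =
    \int[pi]_x Fp (lnv (retr (x : 'cV[R]_n))) - Bf.
  have := RintegralB measurableT iF (Ex_integrable_cst pi Bf); rewrite Ex_cst => <-.
  by apply: eq_Rintegral => x _; rewrite FpE addrK.
set m := _ - Bf; apply/eqP; rewrite -normr_le0 leNgt; apply/negP => m0.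
have c0 : 0 <= noise_mean 1.
  rewrite -(Ex_cst P 0); apply: Ex_le => [||w]; last exact: noise_square_ge0.
    exact: Ex_integrable_cst.
  exact: integrable_noise_square.
(* With this [r], and [c] for [noise_mean 1], the bound of [mean_defect] tends, as [K] grows, to the
   absolute value of [m] times [2 * c / (2 * c + 1)], which is a contradiction. *)
have r0 : 0 < (2 * noise_mean 1 + 1) / `|m| by rewrite divr_gt0// ltr_wpDl// mulr_ge0.
have : `|m| <= 4 * ((2 * noise_mean 1 + 1) / `|m|) * 0 + 2 / ((2 * noise_mean 1 + 1) / `|m|) * noise_mean 1.
  apply: (@le_cvg_seq _ (fun=> `|m|) (fun K : nat => 4 * ((2 * noise_mean 1 + 1) / `|m|) * far_mass K%:R +
     2 / ((2 * noise_mean 1 + 1) / `|m|) * noise_mean 1)).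
  - by move=> K; exact: mean_defect.
  - exact: cvg_cst_seq.
  - apply: cvgD; last exact: cvg_cst.
    by apply: cvgMr; exact: far_mass_cvg0.
move: (noise_mean 1) c0 {r0} m0 => c c0; move: `|m| => q q0.
have c1 : 0 < 2 * c + 1 by rewrite ltr_wpDl// mulr_ge0.
have -> : 4 * ((2 * c + 1) / q) * 0 + 2 / ((2 * c + 1) / q) * c = q * (2 * c) / (2 * c + 1).
  by field; rewrite !gt_eqF.
by rewrite ler_pdivlMr// ler_pM2l// gerDl ler10.
Qed.

End mean_zero.
End stationary_contrasts.

(** * Maximal ergodic inequality *)

Lemma bigcup_le {d : measure_display} {T : measurableType d} {R : realType}
  (P : probability T R) (E : nat -> set T) (b : \bar R) :
  (forall N, measurable (E N)) -> (forall N, E N `<=` E N.+1) -> (forall N, (P (E N) <= b)%E) ->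
  (P (\bigcup_N E N) <= b)%E.
Proof.
move=> mE EE Eb.
have nd : nondecreasing_seq E by apply/nondecreasing_seqP => N; rewrite subsetEset; exact: EE.
have mU : measurable (\bigcup_N E N) by exact: bigcup_measurable.
have := nondecreasing_cvg_mu mE mU nd (mu := P) => h.
rewrite -(cvg_lim _ h)//; apply: lime_le; first by apply/cvg_ex; eexists; exact: h.
by apply: nearW => N; exact: Eb.
Qed.

Section maximal_inequality.
Context {R : realType} {n : nat}.
Variable u : 'I_n -> R.
Hypothesis u0 : \sum_l u l = 0.
Notation V y := (contrast u (lnv y)).
Variables (g : R -> R) (eps : R).
Hypotheses (gl : forall a b : R, `|g a - g b| <= 2 * `|a - b|) (eps0 : 0 < eps).
Implicit Types (p : nat -> 'cV[R]_n) (B : R).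

Definition jump p : R := `|g (V (p 1)) - g (V (p 0))|.

Definition capped_jump B p : R := Num.min B (jump p).

Lemma prange_capped_jump B : 0 <= B -> prange B (capped_jump B).
Proof. by move=> B0 p; rewrite /capped_jump le_min B0 normr_ge0 ge_min lexx. Qed.

Lemma min_dist (b x y : R) : `|Num.min b x - Num.min b y| <= `|x - y|.
Proof.
have h1 := ler_norm (x - y); have := ler_norm (y - x).
rewrite (distrC y x) => h2; have := normr_ge0 (x - y); move: `|x - y| h1 h2 => e h1 h2 e0.
by rewrite /Num.min; case: (ltP b x) => ?; case: (ltP b y) => ?; rewrite ler_norml; apply/andP; split; lra.
Qed.

Lemma max0_dist (x y : R) : `|Num.max 0 x - Num.max 0 y| <= `|x - y|.
Proof.
have h1 := ler_norm (x - y); have := ler_norm (y - x).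
rewrite (distrC y x) => h2; have := normr_ge0 (x - y); move: `|x - y| h1 h2 => e h1 h2 e0.
by rewrite /Num.max; case: (ltP 0 x) => ?; case: (ltP 0 y) => ?; rewrite ler_norml; apply/andP; split; lra.
Qed.

Definition jump_lip : R := 4 * contrast_norm u.

Lemma jump_lip_ge0 : 0 <= jump_lip.
Proof. by rewrite mulr_ge0// contrast_norm_ge0. Qed.

Lemma loglip_capped_jump B N : loglip N.+1 jump_lip (capped_jump B).
Proof.
move=> a b e ab; apply: (le_trans (min_dist _ _ _)); rewrite /jump !contrast_lnv_softmax//.
apply: (le_trans (ler_dist_dist _ _)).
have l1 : `|contrast u (a 1) - contrast u (b 1)| <= contrast_norm u * e.
  by apply: lip_contrast => l; exact: ab.
have l0 : `|contrast u (a 0) - contrast u (b 0)| <= contrast_norm u * e.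
  by apply: lip_contrast => l; exact: ab.
have g1 := gl (contrast u (a 1)) (contrast u (b 1)).
have g0 := gl (contrast u (a 0)) (contrast u (b 0)).
have E (x y z t : R) : x - y - (z - t) = (x - z) - (y - t) by ring.
rewrite E; apply: (le_trans (ler_normB _ _)); rewrite /jump_lip -mulrA; lra.
Qed.

(** The maximum of 0 and of the first [N] partial sums of [capped_jump - eps] along the path, in the
    recursive form that suits the shift. *)
Fixpoint max_excess B (N : nat) p : R :=
  if N is N'.+1 then Num.max 0 (capped_jump B p - eps + max_excess B N' (fun k => p k.+1)) else 0.

Lemma max_excess_ge0 B N p : 0 <= max_excess B N p.
Proof. by case: N => [|N] //=; rewrite le_max lexx. Qed.

Lemma prange_max_excess B N : 0 <= B -> prange (N%:R * B) (max_excess B N).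
Proof.
move=> B0; elim: N => [|N ih] p /=; first by rewrite mul0r lexx.
rewrite le_max lexx/= ge_max mulr_ge0//=.
have /andP[_ h1] := ih (fun k => p k.+1); have /andP[_ h2] := prange_capped_jump B0 p.
by rewrite -natr1 mulrDl mul1r addrC lerD//; move: eps0 h2; lra.
Qed.

Lemma loglip_max_excess B N : loglip N (N%:R * jump_lip) (max_excess B N).
Proof.
elim: N => [|N ih] a b e ab /=; first by rewrite subrr normr0 !mul0r.
apply: (le_trans (max0_dist _ _)).
have h1 := loglip_capped_jump B ab.
have h2 := ih (fun k => a k.+1) (fun k => b k.+1) e (fun k i kN => ab k.+1 i kN).
rewrite -natr1; move: h1 h2.
set c1 := capped_jump B _; set c2 := capped_jump B _; set m1 := max_excess _ _ _; set m2 := max_excess _ _ _.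
move=> h1 h2; rewrite (_ : c1 - eps + m1 - (c2 - eps + m2) = (c1 - c2) + (m1 - m2)); last by ring.
by apply: (le_trans (ler_normD _ _)); lra.
Qed.

Lemma max_excess_le B B' N N' p : B <= B' -> (N <= N')%N -> max_excess B N p <= max_excess B' N' p.
Proof.
move=> BB; elim: N N' p => [|N ih] [|N'] p //= NN; first by rewrite le_max lexx.
rewrite ge_max le_max lexx/= le_max; apply/orP; right.
by rewrite lerD ?ih// lerD2r /capped_jump le_min !ge_min BB lexx orbT.
Qed.

Lemma max_excess_sum B k p : \sum_(l < k) (capped_jump B (fun j => p (l + j)%N) - eps) <= max_excess B k p.
Proof.
elim: k p => [|k ih] p; first by rewrite big_ord0.
rewrite big_ord_recl/= le_max; apply/orP; right; rewrite lerD//.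
apply: le_trans (ih (fun k => p k.+1)).
by apply: ler_sum => l _; rewrite /fintype.bump/= add1n.
Qed.

(* Garsia's argument for the maximal ergodic inequality, in pointwise form. *)
Lemma max_excess_garsia B N p : 0 <= B ->
  Num.min eps (max_excess B N p) + max_excess B N p <=
  capped_jump B p + max_excess B N (fun k => p k.+1).
Proof.
move=> B0; have /andP[c0 _] := prange_capped_jump B0 p.
case: N => [|N]; first by rewrite /= min_r ?(ltW eps0)// !addr0.
have := max_excess_le (fun k => p k.+1) (lexx B) (leqnSn N).
move: (max_excess B N.+1 (fun k => p k.+1)) (max_excess_ge0 B N.+1 (fun k => p k.+1)) => b b0.
rewrite [max_excess B N.+1 p]/=; move: (max_excess B N (fun k => p k.+1)) => a ab.
have [h1|h1] := leP (capped_jump B p - eps + a) 0; first by rewrite min_r ?(ltW eps0)// add0r addr_ge0.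
have h : Num.min eps (capped_jump B p - eps + a) <= eps by rewrite ge_min lexx.
lra.
Qed.

(** The cap on the jumps grows with the horizon, so that [excess] increases with [N] and no jump
    stays capped. Values in the unit interval are what the Harnack inequality takes. *)
Definition excess (N : nat) p : R := Num.min 1 (max_excess N%:R N p / eps).

Lemma prange_excess N : prange 1 (excess N).
Proof. by move=> p; rewrite le_min ler01 divr_ge0 ?max_excess_ge0 ?(ltW eps0)//= ge_min lexx. Qed.

Lemma loglip_excess N : loglip N (N%:R * jump_lip / eps) (excess N).
Proof.
move=> a b e ab; apply: (le_trans (min_dist _ _ _)); rewrite -mulrBl normrM (gtr0_norm (_ : 0 < eps^-1)) ?invr_gt0//.
by rewrite mulrAC ler_pM2r ?invr_gt0//; exact: loglip_max_excess.
Qed.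

Lemma excess_le N p : excess N p <= excess N.+1 p.
Proof.
rewrite /excess le_min !ge_min lexx/= ler_pM2r ?invr_gt0//; apply/orP; right.
by apply: (@max_excess_le N%:R N.+1%:R N N.+1) => //; rewrite ler_nat.
Qed.

Lemma linear_growth p : (forall N, excess N p <= 1 / 2) ->
  forall k, `|g (V (p k)) - g (V (p 0))| <= (k%:R + 1) * eps.
Proof.
move=> ex k.
(* A horizon not below [k] at which the cap is above each of the first [k] jumps. *)
pose N := maxn k (Num.truncn (\sum_(l < k) jump (fun j => p (l + j)%N))).+1.
have jN (l : 'I_k) : jump (fun j => p (l + j)%N) <= N%:R.
  apply: (@le_trans _ _ (\sum_(l < k) jump (fun j => p (l + j)%N))).
    by rewrite (bigD1 l)//= lerDl; apply: sumr_ge0 => j _; exact: normr_ge0.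
  by apply: (le_trans (ltW (truncnS_gt _))); rewrite ler_nat leq_maxr.
have h1 : max_excess N%:R N p <= eps / 2.
  have := ex N; rewrite /excess ge_min => /orP[|]; first by lra.
  by rewrite ler_pdivrMr// mulrC mul1r.
have h2 : \sum_(l < k) (jump (fun j => p (l + j)%N) - eps) <= eps / 2.
  apply: le_trans h1; apply: le_trans (max_excess_le _ (lexx _) (leq_maxl k _)).
  apply: le_trans (max_excess_sum _ _ _); apply: ler_sum => l _.
  by rewrite lerD2r /capped_jump min_r.
have h3 : `|g (V (p k)) - g (V (p 0))| <= \sum_(l < k) jump (fun j => p (l + j)%N).
  elim: (k) => [|j ih]; first by rewrite subrr normr0 big_ord0.
  rewrite big_ord_recr/= (le_trans _ (lerD ih (lexx _)))// /jump addn1 addn0.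
  by rewrite [leRHS]addrC -[X in `|X - _|](subrK (g (V (p j)))) -addrA; exact: ler_normD.
move: h2; rewrite sumrB sumr_const card_ord -mulr_natl; move: h3 eps0; lra.
Qed.

End maximal_inequality.

(** * Sublinear growth of contrasts from the given starting point *)

Section sublinear_growth.
Context {R : realType} {n : nat} {d : measure_display} {Omega : measurableType d}.
Variables (P : probability Omega R) (W : 'I_n -> R -> {RV P >-> R}).
Hypothesis hW : brownian_motion W.
Variables (A : 'M[R]_n) (sigma : 'I_n -> R).
Hypothesis sigma0 : forall i, 0 < sigma i.
Hypothesis n0 : (0 < n)%N.
Variable X : 'cV[R]_n -> R -> Omega -> 'cV[R]_n.
Hypothesis hX : forall x, int_simplex x -> replicator_process A sigma W x (X x).
Notation state_space := (@state_space R n).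
Notation M := (modified_payoff A sigma).
Variable pi : probability state_space R.
Hypothesis pi_int : pi (~` int_simplex) = 0%E.
Hypothesis pi_inv : forall (t : R) (B : set state_space), 0 <= t -> measurable B ->
  measurable_fun (int_simplex : set state_space) (fun x : state_space => transition P X t x B) ->
  (\int[pi]_(x in int_simplex) transition P X t x B = pi B)%E.
Variable x0 : 'cV[R]_n.
Hypothesis x0I : int_simplex x0.

Definition log_dist (a : 'I_n -> R) : R := \sum_j `|lnv x0 j - a j|.

(** Mass of the starting points whose logarithms are close to those of [x0], smoothed between the
    distances [K] and [K + 1]; on them the Harnack constant is bounded. *)
Definition near_mass (K : R) : R := \int[pi]_x (1 - ramp 1 K (log_dist (lnv (retr (x : 'cV[R]_n))))).

Let lip_near K : lip n%:R (fun a => 1 - ramp 1 K (log_dist a)).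
Proof.
move=> a b e ab; rewrite opprB addrC addrA subrK distrC -[n%:R * e]mul1r.
apply: ramp_lip; rewrite /log_dist -sumrB (le_trans (ler_norm_sum _ _ _))//.
apply: (@le_trans _ _ (\sum_(j < n) e)); last by rewrite sumr_const card_ord mulr_natl.
apply: ler_sum => j _; apply: (le_trans (ler_dist_dist _ _)).
by rewrite opprB addrC addrA subrK distrC.
Qed.

Let near01 K a : 0 <= 1 - ramp 1 K (log_dist a) <= 1.
Proof. by have /andP[r0 r1] := ramp01 1 K (log_dist a); rewrite subr_ge0 r1 gerBl. Qed.

Let near_integrable K :
  pi.-integrable setT (EFin \o (fun x : state_space => 1 - ramp 1 K (log_dist (lnv (retr (x : 'cV[R]_n)))))).
Proof.
apply: (bounded_integrable pi (measurable_lnv_retr (@lip_near K)) (B := 1)) => x.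
by have /andP[a0 a1] := near01 K (lnv (retr (x : 'cV[R]_n))); rewrite ger0_norm.
Qed.

Lemma near_mass_large : exists K : R, 0 <= K /\ 1 / 2 <= near_mass K.
Proof.
have : (fun K : nat => near_mass K%:R) @ \oo --> (1 : R).
  rewrite -[X in _ --> X](Ex_cst pi).
  apply: (@Ex_dct _ _ _ pi (fun K (x : state_space) => 1 - ramp 1 K%:R (log_dist (lnv (retr (x : 'cV[R]_n))))) _ 1) => //.
  - by move=> K; exact: (measurable_lnv_retr (@lip_near K%:R)).
  - by move=> K x; have /andP[a0 a1] := near01 K%:R (lnv (retr (x : 'cV[R]_n))); rewrite ger0_norm.
  - apply: aeW => x; apply: cvg_near_cst; near=> K.
    have : log_dist (lnv (retr (x : 'cV[R]_n))) <= K%:R by near: K; exact: nbhs_infty_ger.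
    by move=> h; rewrite /ramp mul1r max_l ?subr_le0// min_r// subr0.
have h2 : 0 < 1 / 2 :> R by rewrite divr_gt0.
move=> /cvgrPdist_le /(_ _ h2)[K _ /(_ K (leqnn _))] /=.
by rewrite ler_norml => /andP[_ h]; exists K%:R; split => //; move: h; lra.
Unshelve. all: by end_near. Qed.

Let harnack_sup (K : R) : R := expR (\sum_j (K + 1 + 2 * payoff_bound M) ^+ 2 / sigma j ^+ 2).

Let harnack_cst_le K x : log_dist (lnv x) <= K + 1 -> harnack_cst A sigma x0 x <= harnack_sup K.
Proof.
move=> dK; rewrite ler_expR; apply: ler_sum => j _; rewrite ler_pM2r ?invr_gt0 ?exprn_gt0//.
have p0 := payoff_bound_ge0 M; have a0 := normr_ge0 (lnv x0 j - lnv x j).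
have : `|lnv x0 j - lnv x j| <= K + 1.
  by apply: le_trans dK; rewrite /log_dist (bigD1 j)//= lerDl; exact: sumr_ge0.
move: a0; move: `|lnv x0 j - lnv x j| => a a0 aK.
by rewrite ler_pXn2r ?nnegrE//; lra.
Qed.

(* Averaging the Harnack inequality over starting points near [x0]. *)
Lemma harnack_average (delta : R) : 0 < delta -> exists eta : R, 0 < eta /\
  forall N (C : R) Phi, 0 <= C -> loglip N C Phi -> prange 1 Phi ->
  \int[pi]_x path_mean P 1 Phi X (x : state_space) <= eta -> \int[P]_w Phi (path 1 (X x0) 1 w) <= delta.
Proof.
move=> d0; have [K [K0 hK]] := near_mass_large.
have c0 : 0 < harnack_sup K by exact: expR_gt0.
pose lam := delta / (2 * harnack_sup K).
have l0 : 0 < lam by rewrite divr_gt0// mulr_gt0.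
(* For this [lam] the term with the Harnack constant is [delta / 4], and this bound on the mean
   makes the other one at most [delta / 4]. The remaining factor 2 comes from [near_mass K] being at
   least [1 / 2]. *)
exists (lam * delta / 2); split; first by rewrite divr_gt0// mulr_gt0.
move=> N C Phi C0 lPhi rPhi small.
set E0 := \int[P]_w _.
have ls := loglip_shift lPhi; have rs := prange_shift rPhi.
have iG := path_mean_integrable hW n0 hX pi ltr01 C0 ls rs.
have iR := Ex_integrableZ (lam^-1 / 2) iG.
have iL := Ex_integrableZ E0 (near_integrable K).
have iR2 := Ex_integrableD (Ex_integrable_cst pi (lam * harnack_sup K / 2)) iR.
have : E0 * near_mass K <= lam * harnack_sup K / 2 + lam^-1 / 2 * \int[pi]_x path_mean P 1 (shift Phi) X (x : state_space).
  rewrite /near_mass -RintegralZl//.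
  rewrite -[X in _ <= _ + X]RintegralZl//.
  rewrite -[X in _ <= X + _](Ex_cst pi) -[leRHS]RintegralD//; last exact: Ex_integrable_cst.
  apply: Ex_le => // x.
  have xI := int_simplex_retr x n0.
  have H := harnack_path hW sigma0 n0 hX C0 lPhi rPhi x0I xI l0.
  have EG : \int[P]_w Phi (path 1 (X (retr x)) 1 w) = path_mean P 1 (shift Phi) X x.
    apply: eq_Rintegral => w _; rewrite /shift; congr Phi; apply/funext => k.
    by rewrite /path -(natr1 k) mulrDl mul1r add0r addrC.
  have /andP[G0 _] := path_mean_range n0 ltr01 ls rs hX x.
  move: H; rewrite EG -/E0; move: (path_mean P 1 (shift Phi) X x) G0 => G G0 H.
  have /andP[q0 q1] := near01 K (lnv (retr (x : 'cV[R]_n))).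
  have li : 0 < lam^-1 by rewrite invr_gt0.
  have hp : 0 <= lam * harnack_sup K / 2 + lam^-1 / 2 * G.
    apply: addr_ge0; first exact: (divr_ge0 (mulr_ge0 (ltW l0) (ltW c0)) (ler0n _ 2)).
    exact: (mulr_ge0 (divr_ge0 (ltW li) (ler0n _ 2)) G0).
  have [far|nr] := ltP (K + 1) (log_dist (lnv (retr (x : 'cV[R]_n)))).
    rewrite /ramp mul1r max_r; last by lra.
    rewrite min_l; last by lra.
    by rewrite subrr mulr0.
  have hc := harnack_cst_le nr.
  have hb : E0 <= lam * harnack_sup K / 2 + lam^-1 / 2 * G.
    apply: (le_trans H); have := ler_wpM2l (ltW l0) hc.
    move: (lam * harnack_cst A sigma x0 _) (lam * harnack_sup K) (lam^-1) => a b c; lra.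
  apply: le_trans (_ : (lam * harnack_sup K / 2 + lam^-1 / 2 * G) * (1 - ramp 1 K (log_dist (lnv (retr (x : 'cV[R]_n))))) <= _).
    by rewrite ler_wpM2r.
  by rewrite ler_piMr.
rewrite (stationary_path hW n0 hX pi_int pi_inv ltr01 C0 ltr01 lPhi rPhi) => h.
have E1 : lam * harnack_sup K = delta / 2 by rewrite /lam; field; rewrite gt_eqF.
have h2 : lam^-1 / 2 * \int[pi]_x path_mean P 1 Phi X (x : state_space) <= delta / 4.
  have -> : delta / 4 = lam^-1 / 2 * (lam * delta / 2) by field; rewrite gt_eqF.
  by rewrite ler_pM2l// divr_gt0// invr_gt0.
have E00 : 0 <= E0.
  rewrite -(Ex_cst P 0); apply: Ex_le => [||w]; first exact: Ex_integrable_cst.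
    apply: (bounded_integrable P (measurable_path ltr01 lPhi (hX x0I) ler01) (B := 1)) => w.
    by have /andP[f0 f1] := rPhi (path 1 (X x0) 1 w); rewrite ger0_norm.
  by have /andP[] := rPhi (path 1 (X x0) 1 w).
have : E0 * (1 / 2) <= E0 * near_mass K by rewrite ler_wpM2l.
rewrite E1 in h; move: h h2; lra.
Qed.

Definition tame (Phi : (nat -> 'cV[R]_n) -> R) := exists N C B,
  [/\ 0 <= C, 0 < B, loglip N C Phi & prange B Phi].

Let tame_path Phi x : tame Phi -> P.-integrable setT (EFin \o (fun w => Phi (path 1 (X (retr x)) 0 w))).
Proof.
move=> [N [C [B [C0 B0 lPhi rPhi]]]].
apply: (bounded_integrable P (measurable_path ltr01 lPhi (hX (int_simplex_retr x n0)) (lexx 0)) (B := B)) => w.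
by have /andP[f0 f1] := rPhi (path 1 (X (retr x)) 0 w); rewrite ger0_norm.
Qed.

Let tame_mean Phi : tame Phi -> pi.-integrable setT (EFin \o (path_mean P 1 Phi X : state_space -> R)).
Proof.
move=> [N [C [B [C0 B0 lPhi rPhi]]]]; exact: (path_mean_integrable hW n0 hX pi ltr01 C0 lPhi rPhi).
Qed.

Let tame_shift Phi : tame Phi -> tame (shift Phi).
Proof.
move=> [N [C [B [C0 B0 lPhi rPhi]]]]; exists N.+1, C, B.
by split => //; [exact: loglip_shift|exact: prange_shift].
Qed.

(** In the mean under [pi], [Psi] and its shift cancel. With [max_excess] for [Psi] and the
    inequality [max_excess_garsia] this is the maximal ergodic inequality. *)
Lemma stationary_maximal Phi Psi D : tame Phi -> tame Psi -> tame D ->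
  (forall p, Phi p + Psi p <= D p + shift Psi p) ->
  \int[pi]_x path_mean P 1 Phi X (x : state_space) <= \int[pi]_x path_mean P 1 D X (x : state_space).
Proof.
move=> tPhi tPsi tD le1; have tS := tame_shift tPsi.
have i1 := Ex_integrableD (tame_mean tPhi) (tame_mean tPsi).
have i2 := Ex_integrableD (tame_mean tD) (tame_mean tS).
have : \int[pi]_x (path_mean P 1 Phi X (x : state_space) + path_mean P 1 Psi X (x : state_space)) <=
       \int[pi]_x (path_mean P 1 D X (x : state_space) + path_mean P 1 (shift Psi) X (x : state_space)).
  apply: (Ex_le i1 i2) => x.
  have j1 := Ex_integrableD (tame_path x tPhi) (tame_path x tPsi).
  have j2 := Ex_integrableD (tame_path x tD) (tame_path x tS).
  have := Ex_le j1 j2 (fun w => le1 _).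
  by rewrite (RintegralD measurableT (tame_path x tPhi) (tame_path x tPsi))
    (RintegralD measurableT (tame_path x tD) (tame_path x tS)).
have D1 := RintegralD measurableT (tame_mean tPhi) (tame_mean tPsi).
have D2 := RintegralD measurableT (tame_mean tD) (tame_mean tS).
case: tPsi => [N [C [B [C0 B0 lPsi rPsi]]]].
have D3 := stationary_path hW n0 hX pi_int pi_inv ltr01 C0 B0 lPsi rPsi.
have E (a b c e f k : R) : a = b + c -> e = f + k -> k = c -> a <= e -> b <= f.
  by move=> -> -> ->; rewrite lerD2r.
exact: (E _ _ _ _ _ _ D1 D2 D3).
Qed.

Variable u : 'I_n -> R.
Hypothesis u0 : \sum_l u l = 0.
Notation V y := (contrast u (lnv y)).

Lemma tail_small (eta : R) : 0 < eta -> exists K r : R, [/\ 0 <= K, 0 < r &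
  4 * r * far_mass pi u K + 2 / r * noise_mean W A sigma u 1 <= eta].
Proof.
move=> e0.
have c0 : 0 <= noise_mean W A sigma u 1.
  rewrite -(Ex_cst P 0); apply: Ex_le => [||w]; last exact: noise_square_ge0.
    exact: Ex_integrable_cst.
  exact: integrable_noise_square.
move: (noise_mean W A sigma u 1) c0 => c c0.
(* Makes the second term [eta / 2 * (c / (c + 1))]; then [K] is taken so large that the first is at
   most [eta / 2]. *)
pose r := 4 * (c + 1) / eta; have c1 : 0 < c + 1 by rewrite ltr_wpDl.
have r0 : 0 < r by rewrite divr_gt0// mulr_gt0.
have h0 : 0 < eta / 2 / (4 * r) by rewrite divr_gt0// ?divr_gt0// mulr_gt0.
move/cvgrPdist_le : (far_mass_cvg0 pi u) => /(_ _ h0)[K _ /(_ K (leqnn _))].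
rewrite /= sub0r normrN => /(le_trans (ler_norm _)) hK.
exists K%:R, r; split => //.
have h1 : 4 * r * far_mass pi u K%:R <= eta / 2.
  by move: hK; rewrite ler_pdivlMr 1?mulrC// mulr_gt0.
have h2 : 2 / r * c <= eta / 2.
  have -> : 2 / r * c = eta / 2 * (c / (c + 1)) by rewrite /r; field; rewrite !gt_eqF.
  by rewrite ler_piMr ?divr_ge0 ?(ltW e0)// ler_pdivrMr// mul1r lerDl.
lra.
Qed.

Let beyond (K v : R) : R := v - clip (K + 1) v.

(** The level [K] comes before [N]: the maximal inequality bounds the mean of [excess] by that of a
    single jump divided by [eps], whatever the horizon, and [harnack_average] carries the bound from
    [pi] to [x0]. *)
Lemma excess_small (eps delta : R) : 0 < eps -> 0 < delta -> exists K : R, 0 <= K /\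
  forall N, \int[P]_w excess u (beyond K) eps N (path 1 (X x0) 1 w) <= delta.
Proof.
move=> e0 d0; have [eta [eta0 hH]] := harnack_average d0.
have [K [r [K0 r0 hK]]] := tail_small (mulr_gt0 eta0 e0).
exists K; split => // N.
have tg := tail_fun_id K0; have gl : forall a b : R, `|beyond K a - beyond K b| <= 2 * `|a - b| by case: tg.
have jl := jump_lip_ge0 u; have N0 : 0 <= N%:R :> R by [].
have C0 : 0 <= N%:R * jump_lip u / eps by rewrite divr_ge0 ?(ltW e0)// mulr_ge0.
apply: (hH _ _ _ C0 (loglip_excess u0 gl e0 (N := N)) (prange_excess u (beyond K) e0 N)).
have tM : tame (max_excess u (beyond K) eps N%:R N).
  exists N, (N%:R * jump_lip u), (N%:R * N%:R + 1); split.
  - exact: mulr_ge0.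
  - by rewrite ltr_wpDl// mulr_ge0.
  - exact: loglip_max_excess.
  - move=> p; have /andP[f0 f1] := prange_max_excess u (beyond K) e0 N N0 p.
    by rewrite f0 (le_trans f1)// lerDl.
have rD : prange (N%:R + 1) (capped_jump u (beyond K) N%:R).
  move=> p; have /andP[f0 f1] := prange_capped_jump u (beyond K) N0 p.
  by rewrite f0 (le_trans f1)// lerDl.
have lD : loglip 1 (jump_lip u) (capped_jump u (beyond K) N%:R) by exact: loglip_capped_jump.
have tD : tame (capped_jump u (beyond K) N%:R).
  by exists 1%N, (jump_lip u), (N%:R + 1); split => //; rewrite ltr_wpDl.
have lE : loglip N (N%:R * jump_lip u) (fun p => Num.min eps (max_excess u (beyond K) eps N%:R N p)).
  by move=> a b e ab; apply: (le_trans (min_dist _ _ _)); exact: loglip_max_excess.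
have rE : prange eps (fun p => Num.min eps (max_excess u (beyond K) eps N%:R N p)).
  by move=> p; rewrite le_min (ltW e0) max_excess_ge0 ge_min lexx.
have tE : tame (fun p => Num.min eps (max_excess u (beyond K) eps N%:R N p)).
  by exists N, (N%:R * jump_lip u), eps; split => //; exact: mulr_ge0.
have h1 := stationary_maximal tE tM tD (fun p => max_excess_garsia u (beyond K) e0 N p N0).
have jD p : capped_jump u (beyond K) N%:R p <= `|beyond K (V (p 1)) - beyond K (V (p 0))|.
  by rewrite /capped_jump ge_min lexx orbT.
have h2 := stationary_tail hW n0 hX pi_int pi_inv u0 ltr01 tg r0 jl lD rD jD.
have h3 := le_trans (le_trans h1 h2) hK.
have EE : excess u (beyond K) eps N = (fun p => eps^-1 * Num.min eps (max_excess u (beyond K) eps N%:R N p)).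
  apply/funext => p; rewrite minr_pMr ?invr_ge0 ?(ltW e0)// mulVf ?gt_eqF//.
  by rewrite /excess mulrC.
have E2 : \int[pi]_x path_mean P 1 (excess u (beyond K) eps N) X (x : state_space) =
   eps^-1 * \int[pi]_x path_mean P 1 (fun p => Num.min eps (max_excess u (beyond K) eps N%:R N p)) X (x : state_space).
  rewrite -(RintegralZl _ measurableT (tame_mean tE)); apply: eq_Rintegral => x _.
  by rewrite EE (path_meanZ n0 hX ltr01 _ _ (mulr_ge0 N0 jl) lE rE).
by rewrite E2 mulrC ler_pdivrMr.
Qed.

(** Times start at 1 because the Harnack inequality compares the laws from time 1 on. For a fixed
    slope there are levels [K j] such that [excess] reaches [1 / 2] at some horizon with probability
    at most [2^-j], so almost surely some level works; what clipping keeps at that level is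
    bounded. *)
Lemma contrast_sublinear : {ae P, forall w, forall eps : R, 0 < eps ->
  exists C : R, forall k : nat, `|V (X x0 (1 + k%:R) w)| <= C + (k%:R + 1) * eps}.
Proof.
have Xs : {ae P, forall w, forall t : R, 0 <= t -> int_simplex (X x0 t w)} by case: (hX x0I).
have main (q : nat) : {ae P, forall w, exists C : R, forall k : nat,
    `|V (X x0 (1 + k%:R) w)| <= C + (k%:R + 1) * q.+1%:R^-1}.
  have q0 : 0 < q.+1%:R^-1 :> R by rewrite invr_gt0.
  have hj (j : nat) : {K : R | 0 <= K /\
      forall N, \int[P]_w excess u (beyond K) q.+1%:R^-1 N (path 1 (X x0) 1 w) <= 2^-1 ^+ j / 2}.
    by apply: cid; apply: excess_small => //; rewrite divr_gt0// exprn_gt0// invr_gt0.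
  pose K j := sval (hj j).
  have K0 j : 0 <= K j by rewrite /K; case: (hj j) => ? [].
  have hK j N : \int[P]_w excess u (beyond (K j)) q.+1%:R^-1 N (path 1 (X x0) 1 w) <= 2^-1 ^+ j / 2.
    by rewrite /K; case: (hj j) => ? [].
  have gl j : forall a b : R, `|beyond (K j) a - beyond (K j) b| <= 2 * `|a - b| by case: (tail_fun_id (K0 j)).
  pose E j N := [set w | 1 / 2 <= excess u (beyond (K j)) q.+1%:R^-1 N (path 1 (X x0) 1 w)].
  have me j N : measurable_fun setT (fun w => excess u (beyond (K j)) q.+1%:R^-1 N (path 1 (X x0) 1 w)).
    exact: (measurable_path ltr01 (loglip_excess u0 (gl j) q0 (N := N)) (hX x0I) ler01).
  have e0 j N w : 0 <= excess u (beyond (K j)) q.+1%:R^-1 N (path 1 (X x0) 1 w).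
    by have /andP[] := prange_excess u (beyond (K j)) q0 N (path 1 (X x0) 1 w).
  have mE j N : measurable (E j N).
    rewrite (_ : E j N = [set w | 1 / 2 <= `|excess u (beyond (K j)) q.+1%:R^-1 N (path 1 (X x0) 1 w)|]).
      exact: measurable_ge_norm.
    by apply/seteqP; split=> w /=; rewrite ger0_norm.
  have h20 : 0 < 1 / 2 :> R by rewrite divr_gt0.
  have PE j N : (P (E j N) <= (2^-1 ^+ j)%:E)%E.
    have := markov_ge P (me j N) (e0 j N) h20.
    rewrite Ex_fineE; last first.
      apply: (bounded_integrable P (me j N) (B := 1)) => w; rewrite ger0_norm//.
      by have /andP[] := prange_excess u (beyond (K j)) q0 N (path 1 (X x0) 1 w).
    have h : ((\int[P]_w excess u (beyond (K j)) q.+1%:R^-1 N (path 1 (X x0) 1 w))%:E <= (1 / 2)%:E * (2^-1 ^+ j)%:E)%E.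
      by rewrite -EFinM lee_fin mulrC mulrA mulr1; exact: hK.
    by move=> /le_trans /(_ h); rewrite lee_pmul2l// lte_fin.
  have mF j : measurable (\bigcup_N E j N) by exact: bigcup_measurable.
  have PF j : (P (\bigcup_N E j N) <= (2^-1 ^+ j)%:E)%E.
    apply: bigcup_le => // N w /= /le_trans; apply.
    exact: (excess_le u (beyond (K j)) q0).
  have := borel_cantelli_ae mF PF (@sum_half R).
  apply: filterS2 Xs => w Xs [j /(_ j (leqnn _)) hE].
  have ex N : excess u (beyond (K j)) q.+1%:R^-1 N (path 1 (X x0) 1 w) <= 1 / 2.
    by rewrite leNgt; apply/negP => lt1; apply: hE; exists N => //; exact: ltW.
  have lg := linear_growth q0 ex.
  have pE k : path 1 (X x0) 1 w k = X x0 (1 + k%:R) w.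
    by rewrite /path mulr1 retr_id//; apply: Xs; rewrite addr_ge0.
  exists (`|beyond (K j) (V (X x0 (1 + 0%:R) w))| + (K j + 1)) => k.
  have := lg k; rewrite !pE.
  have K1 : 0 <= K j + 1 by rewrite addr_ge0.
  have := clip_bound (V (X x0 (1 + k%:R) w)) K1.
  set v := V (X x0 (1 + k%:R) w); set v0 := V _.
  have := ler_normD (beyond (K j) v) (clip (K j + 1) v); rewrite {1}/beyond subrK.
  have := ler_normD (beyond (K j) v - beyond (K j) v0) (beyond (K j) v0); rewrite subrK.
  have E' (a b c f m y z : R) : a <= b + c -> y <= a + m -> m <= f -> b <= z -> y <= c + f + z by lra.
  exact: E'.
have := ae_foralln main; apply: filterS => w hw eps e0.
have [C hC] := hw (Num.truncn eps^-1); exists C => k; apply: (le_trans (hC k)).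
rewrite lerD2l ler_wpM2l ?addr_ge0// -[leRHS]invrK lef_pV2 ?posrE ?invr_gt0//.
exact: ltW (truncnS_gt _).
Qed.

End sublinear_growth.

(** * Growth of Brownian motion *)

Section brownian_growth.
Context {R : realType} {n : nat} {d : measure_display} {Omega : measurableType d}.
Variables (P : probability Omega R) (W : 'I_n -> R -> {RV P >-> R}).
Hypothesis hW : brownian_motion W.
Variable j : 'I_n.

Let W0 w : W j 0 w = 0. Proof. by case: hW => ->. Qed.

(* Previsible, so that the walk stopped on leaving ]-lam, lam[ is a sum of orthogonal
   increments [alive l * (W ((l + 1) * h) - W (l * h))]. *)
Fixpoint alive (h lam : R) (l : nat) (w : Omega) : R :=
  (if l is l'.+1 then alive h lam l' w else 1) * (`|W j (l%:R * h) w| < lam)%R%:R.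

Let alive01 h lam l w : alive h lam l w = 0 \/ alive h lam l w = 1.
Proof.
elim: l => [|l ih] /=; first by rewrite mul1r; case: (_ < _); [right|left].
by case: ih => ->; rewrite ?mul0r ?mul1r; [left|case: (_ < _); [right|left]].
Qed.

Let gmeasurable_lt (h lam : R) k : 0 < h ->
  gmeasurable (brownian_gen W (k%:R * h)) (fun w => (`|W j (k%:R * h) w| < lam)%R%:R : R).
Proof.
move=> h0; have k0 : 0 <= k%:R * h by rewrite mulr_ge0// ltW.
have mW : gmeasurable (brownian_gen W (k%:R * h)) (W j (k%:R * h)) by apply: gmeasurable_W; rewrite k0 lexx.
have mL : measurable_fun [set: R] (fun x : R => (`|x| < lam)%R%:R : R).
  rewrite (_ : (fun x => _) = \1_[set x : R | `|x| < lam]).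
    apply: measurable_indic; rewrite (_ : [set x : R | `|x| < lam] = `]-lam, lam[%classic)//.
    by apply/seteqP; split=> x /=; rewrite in_itv/= ltr_norml.
  have mem (x : R) : (x \in [set x : R | `|x| < lam]) = (`|x| < lam) by apply/idP/idP; rewrite inE.
  by apply/funext => x; rewrite indicE mem.
exact: (measurableT_comp mL mW).
Qed.

Let gmeasurable_alive (h lam : R) k : 0 < h -> gmeasurable (brownian_gen W (k%:R * h)) (alive h lam k).
Proof.
move=> h0; elim: k => [|k ih].
  apply: gmeasurableM; last exact: gmeasurable_lt.
  exact: gmeasurable_cst.
apply: gmeasurableM; last exact: gmeasurable_lt.
apply: (gmeasurable_sub _ ih); apply: sub_brownian_gen.
by rewrite ler_pM2r// ler_nat.
Qed.

Let stopped (h lam : R) N w : R := \sum_(l < N) alive h lam l w * (W j (l.+1%:R * h) w - W j (l%:R * h) w).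

Let stoppedE h lam N w : 0 < lam ->
  (alive h lam N w = 1 -> stopped h lam N w = W j (N%:R * h) w) /\
  (alive h lam N w = 0 -> lam <= `|stopped h lam N w|).
Proof.
move=> l0; rewrite /stopped; elim: N => [|N [ih1 ih2]].
  by rewrite big_ord0 /= mul0r W0 normr0 l0 mulr1; split => // /eqP; rewrite oner_eq0.
rewrite big_ord_recr/=; case: (alive01 h lam N w) => E; rewrite E ?mul0r ?mul1r.
  by split => [/esym/eqP|_]; [rewrite oner_eq0|rewrite addr0 ih2].
rewrite ih1// addrCA subrr addr0; split => //.
by case: ltP => // _ /eqP; rewrite oner_eq0.
Qed.

Let alive_exit h lam N l w : (l <= N)%N -> lam <= `|W j (l%:R * h) w| -> alive h lam N w = 0.
Proof.
elim: N => [|N ih]; first by rewrite leqn0 => /eqP ->; rewrite /= ltNge => ->; rewrite mulr0.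
rewrite leq_eqVlt => /orP[/eqP ->|lN] h1; last by rewrite /= ih// mul0r.
by rewrite /= [`|_| < lam]ltNge h1 mulr0.
Qed.

Let alive_exitP h lam N w : alive h lam N w = 0 -> exists2 l, (l <= N)%N & lam <= `|W j (l%:R * h) w|.
Proof.
elim: N => [|N ih] /=; first by rewrite mul1r; case: ltP => [_ /eqP|le _]; [rewrite oner_eq0|exists 0%N].
case: ltP => [_|le _]; last by exists N.+1.
by rewrite mulr1 => /ih[l lN hl]; exists l => //; exact: leqW.
Qed.

Let measurable_dead (h lam : R) N : 0 < h -> measurable [set w | alive h lam N w = 0].
Proof.
move=> h0; rewrite (_ : [set w | _] = alive h lam N @^-1` [set 0])//.
rewrite -[X in measurable X]setTI; exact: (gmeasurableT (@gmeasurable_alive h lam N h0)).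
Qed.

(** Kolmogorov's inequality: the stopped walk has second moment at most [N%:R * h], and it is at
    least [lam] in absolute value when the walk has left the interval. *)
Lemma maximal_walk (h lam : R) N : 0 < h -> 0 < lam ->
  (P [set w | alive h lam N w = 0%R] <= (N%:R * h / lam ^+ 2)%:E)%E.
Proof.
move=> h0 l0; have l2 : 0 < lam ^+ 2 by rewrite exprn_gt0.
have ma l := @gmeasurable_alive h lam l h0.
have mS : measurable_fun setT (stopped h lam N).
  apply: measurable_sum => l; apply: measurable_funM; first exact: (gmeasurableT (ma l)).
  by apply: measurable_funB; exact: measurable_funP.
have mS2 : measurable_fun setT (fun w => stopped h lam N w ^+ 2) by exact: measurable_funX.
have E := L2_sum_lin hW h0 ma j N.
have le1 : (\int[P]_w ((stopped h lam N w) ^+ 2)%:E <= (N%:R * h)%:E)%E.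
  rewrite E.
  have mA : measurable_fun setT (fun w => \sum_(l < N) alive h lam l w ^+ 2 * h).
    apply: measurable_sum => l; apply: measurable_funM => //; apply: measurable_funX.
    exact: (gmeasurableT (ma l)).
  have bA w : 0 <= \sum_(l < N) alive h lam l w ^+ 2 * h <= N%:R * h.
    apply/andP; split; first by apply: sumr_ge0 => l _; rewrite mulr_ge0 ?sqr_ge0 ?ltW.
    apply: (@le_trans _ _ (\sum_(l < N) h)); last by rewrite sumr_const card_ord mulr_natl.
    apply: ler_sum => l _; rewrite ger_pMl//.
    by case: (alive01 h lam l w) => ->; rewrite ?expr0n ?expr1n.
  have iA : P.-integrable setT (EFin \o (fun w => \sum_(l < N) alive h lam l w ^+ 2 * h)).
    apply: (bounded_integrable P mA (B := N%:R * h)) => w.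
    by have /andP[b0 b1] := bA w; rewrite ger0_norm.
  rewrite (Ex_fineE iA) lee_fin -[leRHS](Ex_cst P); apply: Ex_le => //.
    exact: Ex_integrable_cst.
  by move=> w; have /andP[] := bA w.
have := markov_ge P mS2 (fun w => sqr_ge0 _) l2.
move=> /le_trans /(_ le1) h1.
rewrite -(@lee_pmul2l _ (lam ^+ 2)%:E)// -EFinM mulrC divfK ?gt_eqF//.
apply: le_trans h1; rewrite lee_pmul2l//; apply: le_measure.
- by rewrite inE; exact: measurable_dead.
- rewrite inE (_ : [set w | _] = [set w | lam ^+ 2 <= `|stopped h lam N w ^+ 2|]).
    exact: measurable_ge_norm.
  by apply/seteqP; split=> w /=; rewrite ger0_norm ?sqr_ge0.
- move=> w /= /(stoppedE h N w l0).2 h2.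
  by rewrite -[stopped h lam N w ^+ 2]real_normK ?num_real// lerXn2r// nnegrE// ltW.
Qed.

Lemma brownian_dyadic (eps : R) : 0 < eps -> {ae P, forall w, exists K, forall m, (K <= m)%N ->
  forall t : R, 0 <= t -> t <= 2 ^+ m -> `|W j t w| <= eps * 2 ^+ m}.
Proof.
move=> e0.
(* Dyadic grids on the interval from 0 to [2 ^+ m]. They are nested as [q] grows, so the exit events
   increase, and the bound on their probabilities depends on [m] only and is summable. *)
pose h (m q : nat) : R := 2 ^+ m / 2 ^+ q.
have h0 m q : 0 < h m q by rewrite divr_gt0// exprn_gt0.
pose E m q := [set w | alive (h m q) (eps * 2 ^+ m) (2 ^ q) w = 0].
have l0 m : 0 < eps * 2 ^+ m by rewrite mulr_gt0// exprn_gt0.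
have q0 q : (2 ^ q)%:R = 2 ^+ q :> R by rewrite natrX.
have mE m q : measurable (E m q) by exact: measurable_dead.
have PE m q : (P (E m q) <= (eps ^- 2 * 2^-1 ^+ m)%:E)%E.
  apply: (le_trans (maximal_walk (2 ^ q) (h0 m q) (l0 m))); rewrite lee_fin q0 /h.
  have a0 : 2 ^+ q != 0 :> R by rewrite gt_eqF// exprn_gt0.
  have b0 : 2 ^+ m != 0 :> R by rewrite gt_eqF// exprn_gt0.
  apply: eq_ler; rewrite exprVn; move: (2 ^+ q : R) a0 (2 ^+ m : R) b0 => a a0 b b0.
  by field; rewrite a0 b0 gt_eqF.
have EE m q : E m q `<=` E m q.+1.
  move=> w /= /alive_exitP[l lq hl]; apply: (@alive_exit _ _ _ (2 * l)%N).
    by rewrite expnS leq_mul2l.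
  suff -> : (2 * l)%:R * h m q.+1 = l%:R * h m q by [].
  by rewrite /h natrM exprS; field; rewrite gt_eqF// exprn_gt0.
have PF m : (P (\bigcup_q E m q) <= (eps ^- 2 * 2^-1 ^+ m)%:E)%E by apply: bigcup_le.
have mF m : measurable (\bigcup_q E m q) by exact: bigcup_measurable.
have sB N : \sum_(k < N) eps ^- 2 * 2^-1 ^+ k <= eps ^- 2 * 2.
  by rewrite -mulr_sumr ler_pM2l ?sum_half// invr_gt0 exprn_gt0.
apply: filterS (borel_cantelli_ae mF PF sB) => w [K hK]; exists K => m Km t t0 tm.
have cW : cts0 (fun t => W j t w) by case: hW => _ cW _ _; exact: cW.
apply/ler_addgt0Pr => e e00.
have [dl dl0 hdl] := cts0_ucont cW (2 ^+ m) e00.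
have [q hq] : exists q, h m q <= dl.
  have [k hk] : exists k : nat, 2 ^+ m / dl < k%:R by exists (Num.truncn (2 ^+ m / dl)).+1; exact: truncnS_gt.
  exists k; rewrite /h ler_pdivrMr ?exprn_gt0// mulrC -ler_pdivrMr// (le_trans (ltW hk))//.
  by rewrite -q0 ler_nat ltnW// ltn_expl.
pose l := Num.truncn (t / h m q).
have hl : l%:R * h m q <= t by rewrite -ler_pdivlMr// truncn_le// divr_ge0// ltW.
have hu : t < l.+1%:R * h m q by rewrite -ltr_pdivrMr// truncnS_gt.
have lN : (l <= 2 ^ q)%N.
  rewrite -(ler_nat R) q0 -(ler_pM2r (h0 m q)) (le_trans hl)// (le_trans tm)// /h.
  by rewrite mulrC divfK// gt_eqF// exprn_gt0.
have lW : `|W j (l%:R * h m q) w| < eps * 2 ^+ m.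
  rewrite ltNge; apply/negP => le1; apply: (hK m Km); exists q => //.
  exact: (alive_exit lN le1).
have dW : `|W j t w - W j (l%:R * h m q) w| <= e.
  have lh0 : 0 <= l%:R * h m q by rewrite mulr_ge0// ltW.
  apply: hdl; rewrite ?t0 ?lh0//=; first exact: le_trans hl tm.
  rewrite ger0_norm ?subr_ge0// (le_trans _ hq)// lerBlDl -[X in _ + X]mul1r -mulrDl natr1.
  exact: ltW.
have := ler_normD (W j t w - W j (l%:R * h m q) w) (W j (l%:R * h m q) w); rewrite subrK.
move=> /le_trans; apply; rewrite addrC lerD//; exact: ltW.
Qed.

(** The least exponent [m] with [t <= 2 ^+ m] satisfies [2 ^+ m < 2 * t] for large [t]; the slopes
    used in [brownian_dyadic] are halved to make up for this factor 2. *)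
Lemma brownian_sublinear : {ae P, forall w, forall eps : R, 0 < eps ->
  exists C : R, forall t : R, 0 <= t -> `|W j t w| <= C + t * eps}.
Proof.
have q0 (q : nat) : 0 < (2 * q.+1%:R)^-1 :> R by rewrite invr_gt0 mulr_gt0.
have := ae_foralln (fun q => brownian_dyadic (q0 q)); apply: filterS => w hw eps e0.
have [K hK] := hw (Num.truncn eps^-1).
set q := Num.truncn eps^-1 in hK *.
have qe : q.+1%:R^-1 <= eps.
  by rewrite -[leRHS]invrK lef_pV2 ?posrE ?invr_gt0// ltW// truncnS_gt.
exists ((2 * q.+1%:R)^-1 * 2 ^+ K) => t t0.
have [tK|tK] := leP t (2 ^+ K).
  by rewrite (le_trans (hK K (leqnn K) t t0 tK))// lerDl mulr_ge0// ltW.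
have [m tm] : exists m : nat, t <= 2 ^+ m.
  exists (Num.truncn t).+1; rewrite (le_trans (ltW (truncnS_gt t)))// -natrX ler_nat ltnW// ltn_expl//.
have ex : exists m, t <= 2 ^+ m by exists m.
case: (ex_minnP ex) => [[|m']] tm' min.
  by have := lt_le_trans tK tm'; rewrite expr0 -subr_lt0 -[X in _ < X](addr0 0) => h;
   exfalso; move: tK; rewrite ltNge (le_trans tm')// exprn_ege1// ler1n.
have lt1 : 2 ^+ m' < t by rewrite ltNge; apply/negP => /min; rewrite ltnn.
have Km : (K <= m'.+1)%N.
  rewrite leqNgt; apply/negP => /ltnW mK.
  by have := lt_le_trans tK tm'; rewrite ltNge ler_eXn2l ?mK// ltr1n.
apply: (le_trans (hK _ Km t t0 tm')).
apply: (@le_trans _ _ (t * eps)); last by rewrite lerDr mulr_ge0 ?invr_ge0 ?mulr_ge0 ?exprn_ge0.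
rewrite exprS invfM mulrACA mulVf// mul1r mulrC.
by apply: ler_pM => //; exact: ltW.
Qed.

End brownian_growth.

(** * The mean of the invariant distribution *)

Lemma normal_peak_le {R : realType} (s : R) : 0 < s -> normal_peak s <= s^-1.
Proof.
move=> s0; rewrite /normal_peak lef_pV2 ?posrE ?sqrtr_gt0 ?pmulrn_lgt0 ?mulr_gt0 ?exprn_gt0 ?pi_gt0//.
rewrite -[leLHS]gtr0_norm// -sqrtr_sqr ler_wsqrtr// -mulrnAr ler_peMr ?sqr_ge0//.
by rewrite -mulr_natr; have := pi_ge2 R; lra.
Qed.

Lemma measurable_chi {R : realType} (K : R) : measurable_fun [set: R] (chi K).
Proof.
apply: continuous_measurable_fun => x; apply/cvgrPdist_le => e e0; near=> x'.
by apply: (le_trans (chi_lip K x x')); near: x'; exact: cvgr_dist_le.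
Unshelve. all: by end_near. Qed.

(** The integrand vanishes outside a window of length [2 * (K + 1)] divided by the absolute value of
    [c], and the normal density is at most [1 / s]. *)
Lemma gaussian_window {R : realType} (s c y K : R) : 0 < s -> c != 0 -> 0 <= K ->
  (\int[normal_prob 0 s]_z (1 - chi K (y + c * z))%:E <= (2 * (K + 1) / `|c| / s)%:E)%E.
Proof.
move=> s0 c0 K0; have c1 : 0 < `|c| by rewrite normr_gt0.
have r0 : 0 <= (K + 1) / `|c| by rewrite divr_ge0// addr_ge0.
have chi_le z : 0 <= 1 - chi K (y + c * z) <= 1.
  by have /andP[a0 a1] := chi01 K (y + c * z); rewrite subr_ge0 a1 gerBl.
have mchi : measurable_fun [set: R] (fun z : R => 1 - chi K (y + c * z)).
  apply: measurable_funB => //; apply: measurableT_comp; first exact: measurable_chi.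
  by apply: measurable_funD => //; exact: measurable_funM.
rewrite ge0_integral_normal//; last 2 first.
- exact/measurable_EFinP.
- by move=> z; rewrite lee_fin; have /andP[] := chi_le z.
pose I : set R := `[- (y / c) - (K + 1) / `|c|, - (y / c) + (K + 1) / `|c|]%classic.
have mI : measurable I by exact: measurable_itv.
apply: (@le_trans _ _ (\int[lebesgue_measure]_z ((normal_peak s)%:E * (\1_I z)%:E))%E).
  apply: ge0_le_integral => //.
  - by move=> z _; rewrite mule_ge0 ?lee_fin ?normal_pdf_ge0//; have /andP[] := chi_le z.
  - apply: emeasurable_funM; first exact/measurable_EFinP.
    by apply/measurable_EFinP; exact: measurable_normal_pdf.
  - by apply: emeasurable_funM => //; apply/measurable_EFinP; exact: measurable_indic.
  move=> z _; rewrite -!EFinM lee_fin.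
  have pu : normal_pdf 0 s z <= normal_peak s by apply: normal_pdf_ub; rewrite gt_eqF.
  have [h|h] := ltP (K + 1) `|y + c * z|.
    by rewrite (chi1 h) subrr mul0r mulr_ge0// normal_peak_ge0.
  have zI : z \in I.
    have : `|z + y / c| <= (K + 1) / `|c|.
      rewrite ler_pdivlMr// -normrM; move: h; congr (`|_| <= _).
      by field.
    rewrite inE /I /= in_itv/= ler_norml => /andP[a1 a2].
    by apply/andP; split; move: a1 a2; lra.
  rewrite indicE zI mulr1; apply: le_trans pu; rewrite ler_piMl ?normal_pdf_ge0//.
  by have /andP[] := chi_le z.
rewrite ge0_integralZl//; last 2 first.
- by apply/measurable_EFinP; exact: measurable_indic.
- by rewrite lee_fin normal_peak_ge0.
have r1 : 0 < (K + 1) / `|c| by rewrite divr_gt0// ltr_wpDl.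
have muI : lebesgue_measure I = (2 * (K + 1) / `|c|)%:E.
  rewrite /I lebesgue_measure_itv/= lte_fin ifT; last by rewrite ltrD2l gtrN.
  by rewrite -EFinB; congr EFin; ring.
rewrite (_ : (\int[_]_x _)%E = lebesgue_measure I); last by rewrite integral_indic// setIT.
rewrite muI -EFinM lee_fin.
rewrite mulrC ler_wpM2l ?normal_peak_le//.
by rewrite -mulrA mulr_ge0.
Qed.

Section anti_concentration.
Context {R : realType} {n : nat} {d : measure_display} {Omega : measurableType d}.
Variables (P : probability Omega R) (W : 'I_n -> R -> {RV P >-> R}).
Hypothesis hW : brownian_motion W.
Variables (u : 'I_n -> R) (l : 'I_n).
Hypothesis ul : u l != 0.

(** Only component [l] is integrated out; the other components at time [T] belong to its past and
    merely move the window. *)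
Lemma brownian_window (T y K : R) : 0 < T -> 0 <= K ->
  1 - 2 * (K + 1) / `|u l| / Num.sqrt T <= \int[P]_w chi K (y + \sum_j u j * W j T w).
Proof.
move=> T0 K0; have W0 j w : W j 0 w = 0 by case: hW => ->.
pose rest w := y + \sum_(j | j != l) u j * (W j T w - W j 0 w).
have mrest : gmeasurable (past W l 0 T) rest.
  apply: gmeasurableD; first exact: gmeasurable_cst.
  rewrite (_ : (fun w => _) = (fun w => \sum_j (if j != l then u j else 0) * (if j != l then W j T w - W j 0 w else 0))).
    apply: gmeasurable_sum => j; apply: gmeasurableM; first exact: gmeasurable_cst.
    by case: eqVneq => [_|jl]; [exact: gmeasurable_cst|exact: past_increment].
  by apply/funext => w; rewrite big_mkcond/=; apply: eq_bigr => j _; case: eqP => _ //=; rewrite mul0r.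
pose H (x : g_sigma_algebraType (past W l 0 T) * measurableTypeR R) : \bar R :=
  (1 - chi K (rest x.1 + u l * x.2))%:E.
have restE w : rest w + u l * (W l T w - W l 0 w) = y + \sum_j u j * W j T w.
  have -> : rest w = y + \sum_(j | j != l) u j * W j T w.
    by congr (y + _); apply: eq_bigr => j _; rewrite W0 subr0.
  by rewrite W0 subr0 [in RHS](bigD1 l)//= -addrA [u l * _ + _]addrC.
have mH : measurable_fun setT H.
  apply/measurable_EFinP; apply: measurable_funB => //; apply: measurableT_comp; first exact: measurable_chi.
  apply: measurable_funD; first exact: (measurableT_comp mrest measurable_fst).
  by apply: measurable_funM => //; exact: measurable_snd.
have H0 x : (0 <= H x)%E.
  by rewrite lee_fin subr_ge0; have /andP[] := chi01 K (rest x.1 + u l * x.2).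
have := integral_increment hW (lexx 0) T0 mH H0; rewrite subr0 => E.
have s0 : 0 < Num.sqrt T by rewrite sqrtr_gt0.
have mc : measurable_fun setT (fun w => chi K (y + \sum_j u j * W j T w)).
  apply: measurableT_comp; first exact: measurable_chi.
  apply: measurable_funD => //; apply: measurable_sum => j.
  by apply: measurable_funM => //; exact: measurable_funP.
have ic : P.-integrable setT (EFin \o (fun w => chi K (y + \sum_j u j * W j T w))).
  apply: (bounded_integrable P mc (B := 1)) => w.
  by have /andP[a0 a1] := chi01 K (y + \sum_j u j * W j T w); rewrite ger0_norm.
have i1 := Ex_integrableB (Ex_integrable_cst P 1) ic.
have le1 : \int[P]_w (1 - chi K (y + \sum_j u j * W j T w)) <= 2 * (K + 1) / `|u l| / Num.sqrt T.
  rewrite -lee_fin -(Ex_fineE i1).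
  have -> : (\int[P]_w (1 - chi K (y + \sum_j u j * W j T w))%:E = \int[P]_w H (w, (W l T w - W l 0 w)%R))%E.
    by apply: eq_integral => w _; rewrite /H /= restE.
  rewrite E -[X in (_ <= X%:E)%E](Ex_cst P) -(Ex_fineE (Ex_integrable_cst P _)).
  apply: ge0_le_integral => //.
  - by move=> w _; exact: integral_ge0.
  - have mG : measurable_fun setT (fun w : g_sigma_algebraType (past W l 0 T) =>
        \int[normal_prob 0 (Num.sqrt T)]_z H (w, z))%E by exact: measurable_integral_indep.
    by move=> mT A mA; apply: (@sub_past _ _ _ _ P W l 0 T); exact: mG.
  by move=> w _; exact: (@gaussian_window R (Num.sqrt T) (u l) (rest w) K s0 ul K0).
have := RintegralB measurableT (Ex_integrable_cst P 1) ic; rewrite Ex_cst; move: le1; lra.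
Qed.


End anti_concentration.

(** * The linear system of equal payoffs and the mean of the invariant distribution *)

Section stationary_point.
Context {R : realType} {n : nat} {d : measure_display} {Omega : measurableType d}.
Variables (P : probability Omega R) (W : 'I_n -> R -> {RV P >-> R}).
Hypothesis hW : brownian_motion W.
Variables (A : 'M[R]_n) (sigma : 'I_n -> R).
Hypothesis sigma0 : forall i, 0 < sigma i.
Hypothesis n0 : (0 < n)%N.
Variable X : 'cV[R]_n -> R -> Omega -> 'cV[R]_n.
Hypothesis hX : forall x, int_simplex x -> replicator_process A sigma W x (X x).
Notation state_space := (@state_space R n).
Notation M := (modified_payoff A sigma).
Variable pi : probability state_space R.
Hypothesis pi_int : pi (~` int_simplex) = 0%E.
Hypothesis pi_inv : forall (t : R) (B : set state_space), 0 <= t -> measurable B ->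
  measurable_fun (int_simplex : set state_space) (fun x : state_space => transition P X t x B) ->
  (\int[pi]_(x in int_simplex) transition P X t x B = pi B)%E.

(* If the payoff contrast were constant, it would vanish by stationarity, and the
   contrast of the logarithms would be a Brownian motion, which has no stationary law. *)
Lemma no_constant_contrast (u : 'I_n -> R) (c : R) (l : 'I_n) : \sum_l u l = 0 ->
  (forall y, simplex y -> contrast_payoff A sigma u y = c) -> u l = 0.
Proof.
move=> u0 uc; apply/eqP/negP => /negP ul.
have c0 : c = 0.
  rewrite -(stationary_mean_zero hW n0 hX pi_int pi_inv u0) -[LHS](Ex_cst pi).
  by apply: eq_Rintegral => x _; rewrite uc//; exact: (int_simplex_retr x n0).1.
have usl : u l * sigma l != 0 by rewrite mulf_neq0// gt_eqF.
(* By stationarity [far_mass] may be computed at any time [T], and at large times the Brownian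
   contrast has spread out. *)
have lower (K T : R) : 0 <= K -> 0 < T -> 1 - 2 * (K + 1) / `|u l * sigma l| / Num.sqrt T <= far_mass pi u K.
  move=> K0 T0; rewrite -(far_mass_stationary hW n0 hX pi_int pi_inv u 1 K T0).
  rewrite -[leLHS](Ex_cst pi); apply: Ex_le.
  - exact: Ex_integrable_cst.
  - exact: (path_mean_integrable hW n0 hX pi T0 (mulr_ge0 (contrast_norm_ge0 u) (ler0n _ 2))
      (@loglip_state _ _ 1 _ _ (@lip_far _ _ u K)) (@prange_state _ _ 1 _ _ (@ranges_far _ _ u K))).
  move=> x; have xI := int_simplex_retr x n0; have hx := hX xI.
  have := @brownian_window _ _ _ _ _ _ hW (fun j => u j * sigma j) l usl _ (contrast u (lnv (retr x))) _ T0 K0 => /le_trans; apply.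
  apply: eq_ler; apply: Ex_ae.
  - apply: measurableT_comp; first exact: measurable_chi.
    apply: measurable_funD => //; apply: measurable_sum => j.
    by apply: measurable_funM => //; exact: measurable_funP.
  - exact: (measurable_path T0 (@loglip_state _ _ 1 _ _ (@lip_far _ _ u K)) hx (lexx 0)).
  have X0 : {ae P, forall w, X (retr x) 0 w = retr x} by case: hx.
  have Xs : {ae P, forall w, forall t : R, 0 <= t -> int_simplex (X (retr x) t w)} by case: hx.
  apply: filterS3 X0 Xs (contrast_increment hW n0 u0 T0 xI hx) => w X0 Xs E.
  rewrite /state_functional /far; congr (chi K _).
  have e1 : path T (X (retr x)) 0 w 0 = retr x by rewrite /path mul0r addr0 X0 (retr_id xI).
  have e2 : J (fun s => contrast_payoff A sigma u (X (retr x) s w)) T = 0.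
    rewrite (eq_J (h := fun=> 0)); last by move=> s s0 _; rewrite uc ?c0//; exact: (Xs s s0).1.
    by rewrite J_cst ?(ltW T0)// mul0r.
  move: E; rewrite e1 e2 add0r => /eqP; rewrite subr_eq addrC => /eqP ->.
  by congr (contrast u (lnv (retr x)) + _); apply: eq_bigr => j _; rewrite mulrA.
have h4 : 0 < 1 / 4 :> R by rewrite divr_gt0.
move/cvgrPdist_le : (far_mass_cvg0 pi u) => /(_ _ h4)[K _ /(_ K (leqnn _))].
rewrite /= sub0r normrN => /(le_trans (ler_norm _)) hK.
pose b := 2 * (K%:R + 1) / `|u l * sigma l|.
have b0 : 0 < b by rewrite divr_gt0 ?normr_gt0// mulr_gt0// ltr_wpDl.
have b4 : 0 < 4 * b by rewrite mulr_gt0.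
(* At this time the lower bound is [3 / 4], against [far_mass] at most [1 / 4]. *)
have := lower K%:R ((4 * b) ^+ 2) (ler0n _ _) (exprn_gt0 2 b4).
rewrite sqrtr_sqr (gtr0_norm b4) -/b.
have -> : b / (4 * b) = 1 / 4 by field; rewrite gt_eqF.
move: hK; lra.
Qed.

Lemma contrast_payoffE u y : contrast_payoff A sigma u y = \sum_k (\sum_l u l * M l k) * y k 0.
Proof.
rewrite /contrast_payoff /contrast; under eq_bigr do rewrite mxE mulr_sumr.
rewrite exchange_big; apply: eq_bigr => k _; rewrite mulr_suml.
by apply: eq_bigr => l _; rewrite mulrA.
Qed.

(** Matrix of the system of equal payoffs: the unknowns are a vector and the opposite of its common
    payoff, the last equation prescribes the sum of the vector. *)
Definition bordered : 'M[R]_(n + 1) := block_mx M (const_mx 1) (const_mx 1) 0.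

(** A row vector [(u, b)] in the kernel consists of a vector [u] of sum zero whose payoff contrast
    is [- b] on the whole simplex, which [no_constant_contrast] reduces to 0. *)
Lemma bordered_unit : bordered \in unitmx.
Proof.
rewrite unitmxE unitfE; apply/negP => /det0P[v v0 vB].
pose u l := lsubmx v 0 l; pose b := rsubmx v 0 0.
move: vB; rewrite -(hsubmxK v) mul_row_block -[RHS]row_mx0 => /eq_row_mx[E1 E2].
have u0 : \sum_l u l = 0.
  have := congr1 (fun Q : 'M[R]_1 => Q 0 0) E2; rewrite /= mulmx0 addr0 [LHS]mxE [RHS]mxE => E0.
  rewrite -[RHS]E0.
  by apply: eq_bigr => l _; rewrite [const_mx _ _ _]mxE mulr1.
have ub k : \sum_l u l * M l k = - b.
  move/matrixP/(_ 0 k) : E1; rewrite !mxE big_ord1 [const_mx _ _ _]mxE mulr1.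
  by move/eqP; rewrite addr_eq0 => /eqP.
have uz l : u l = 0.
  apply: (no_constant_contrast l u0 (c := - b)) => y [_ y1].
  by rewrite contrast_payoffE; under eq_bigr do rewrite ub; rewrite -mulr_sumr y1 mulr1.
have b0 : b = 0.
  have := ub (Ordinal n0); rewrite big1 => [/esym/eqP|l _]; last by rewrite uz mul0r.
  by rewrite oppr_eq0 => /eqP.
move/eqP : v0; apply; rewrite -(hsubmxK v).
have -> : lsubmx v = 0 by apply/matrixP => i l; rewrite ord1 [RHS]mxE; exact: uz.
have -> : rsubmx v = 0 by apply/matrixP => i l; rewrite (ord1 i) (ord1 l) [RHS]mxE; exact: b0.
exact: row_mx0.
Qed.

(** The difference [z - y] solves the bordered system whose right side is the deviation [rho] of the
    payoffs of [z]; the constant is a norm of the inverse matrix. *)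
Lemma equal_payoff_stable : exists C : R, 0 <= C /\ forall z y e,
  simplex z -> equal_payoff_set M y -> (forall i j, `|(M *m z) i 0 - (M *m z) j 0| <= e) ->
  forall k, `|z k 0 - y k 0| <= C * e.
Proof.
pose B := invmx bordered.
exists (\sum_k \sum_i `|B (lshift 1 k) (lshift 1 i)|); split.
  by apply: sumr_ge0 => k _; exact: sumr_ge0.
move=> z y e [_ z1] [[_ y1] yM] zM k.
pose i0 := Ordinal n0; pose D := z - y; pose m := (M *m D) i0 0.
pose rho : 'cV[R]_n := M *m D - const_mx m.
have E : bordered *m col_mx D (const_mx (- m)) = col_mx rho 0.
  rewrite /bordered mul_block_col mul0mx addr0; congr col_mx.
    by congr (_ + _); apply/matrixP => i j; rewrite !mxE big_ord1 !mxE mul1r.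
  apply/matrixP => i j; rewrite !mxE; under eq_bigr do rewrite !mxE mul1r.
  by rewrite ord1 sumrB z1 y1 subrr.
have rle i : `|rho i 0| <= e.
  have -> : rho i 0 = (M *m z) i 0 - (M *m z) i0 0; last exact: zM.
  rewrite /rho /m /D mulmxBr; have := yM i i0.
  by move: (M *m z) (M *m y) => a b ab; rewrite !mxE ab; ring.
have e0 : 0 <= e by exact: le_trans (normr_ge0 _) (rle i0).
have DE : D = usubmx (B *m col_mx rho 0) by rewrite -E mulKmx ?bordered_unit// col_mxKu.
have -> : z k 0 - y k 0 = \sum_i B (lshift 1 k) (lshift 1 i) * rho i 0.
  have := congr1 (fun M : 'cV[R]_n => M k 0) DE; rewrite /= [D k 0]mxE [(- y) k 0]mxE => ->.
  rewrite mxE mxE big_split_ord/= [X in _ + X]big1 ?addr0; last first.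
    by move=> i _; rewrite col_mxEd mxE mulr0.
  by apply: eq_bigr => i _; rewrite col_mxEu.
apply: (le_trans (ler_norm_sum _ _ _)).
apply: (@le_trans _ _ (\sum_i `|B (lshift 1 k) (lshift 1 i)| * e)).
  by apply: ler_sum => i _; rewrite normrM ler_wpM2l.
rewrite -mulr_suml ler_wpM2r// [leRHS](bigD1 k)//= lerDl.
by apply: sumr_ge0 => j _; exact: sumr_ge0.
Qed.

Local Notation yhat := (mean_point pi).

Let retr_range k x : 0 <= retr (x : 'cV[R]_n) k 0 <= 1.
Proof. by have [[]] := int_simplex_retr x n0. Qed.

Lemma measurable_retr k : measurable_fun [set: state_space] (fun x : state_space => retr (x : 'cV[R]_n) k 0).
Proof.
have l6 : lip 6 (fun a : 'I_n -> R => softmax a k 0) by move=> a b e; exact: lip_softmax.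
rewrite (_ : (fun x => _) = (fun x : state_space => softmax (lnv (retr (x : 'cV[R]_n))) k 0)).
  exact: (measurable_lnv_retr l6).
by apply/funext => x; rewrite -[in LHS](retr_id (int_simplex_retr (x : 'cV[R]_n) n0)).
Qed.

Let retr_integrable k : pi.-integrable setT (EFin \o (fun x : state_space => retr (x : 'cV[R]_n) k 0)).
Proof.
apply: (bounded_integrable pi (measurable_retr k) (B := 1)) => x.
by have /andP[a0 a1] := retr_range k x; rewrite ger0_norm.
Qed.

Lemma mean_pointE k : yhat k 0 = \int[pi]_x retr (x : 'cV[R]_n) k 0.
Proof.
rewrite mxE; apply: Ex_ae; [exact: measurable_coord|exact: measurable_retr|].
exists (~` int_simplex); split => //; first by apply: measurableC; exact: measurable_int_simplex.
by move=> x /= nx xI; apply: nx; rewrite retr_id.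
Qed.

Lemma integral_linear (c : 'I_n -> R) :
  \int[pi]_x (\sum_k c k * retr (x : 'cV[R]_n) k 0) = \sum_k c k * yhat k 0.
Proof.
suff [] : pi.-integrable setT (EFin \o (fun x : state_space => \sum_k c k * retr (x : 'cV[R]_n) k 0)) /\
  \int[pi]_x (\sum_k c k * retr (x : 'cV[R]_n) k 0) = \sum_k c k * yhat k 0 by [].
elim: (index_enum _) => [|k r [ih1 ih2]].
  under [X in _ \o X]funext do rewrite big_nil; under eq_Rintegral do rewrite big_nil.
  by rewrite Ex_cst big_nil; split => //; exact: Ex_integrable_cst.
under [X in _ \o X]funext do rewrite big_cons; under eq_Rintegral do rewrite big_cons.
have ik := Ex_integrableZ (c k) (retr_integrable k).
split; first exact: Ex_integrableD.
by rewrite (RintegralD measurableT ik ih1) ih2 big_cons (RintegralZl _ measurableT (retr_integrable k)) -mean_pointE.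
Qed.

Lemma mean_point_contrast u : \sum_l u l = 0 -> contrast_payoff A sigma u yhat = 0.
Proof.
move=> u0; rewrite contrast_payoffE -integral_linear -[RHS](stationary_mean_zero hW n0 hX pi_int pi_inv u0).
by apply: eq_Rintegral => x _; rewrite contrast_payoffE.
Qed.

Lemma mean_point_int_simplex : int_simplex yhat.
Proof.
have y0 k : 0 <= yhat k 0.
  rewrite mean_pointE -(Ex_cst pi 0); apply: Ex_le => //; first exact: Ex_integrable_cst.
  by move=> x; have /andP[] := retr_range k x.
have y1 : \sum_k yhat k 0 = 1.
  have := integral_linear (fun=> 1); under [RHS]eq_bigr do rewrite mul1r; move=> <-.
  rewrite -[RHS](Ex_cst pi); apply: eq_Rintegral => x _.
  by under eq_bigr do rewrite mul1r; have [[_ ->]] := int_simplex_retr (x : 'cV[R]_n) n0.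
have yle k : yhat k 0 <= 1 by rewrite -y1 (bigD1 k)//= lerDl; apply: sumr_ge0 => j _.
split; first by split => // k; rewrite y0 yle.
(* If the mean of this nonnegative coordinate were 0, the coordinate would vanish [pi]-almost
   everywhere, while [retr] makes it positive everywhere. *)
move=> k; rewrite lt_neqAle y0 andbT; apply/negP => /eqP/esym E.
have : (\int[pi]_x `|(retr (x : 'cV[R]_n) k 0)%:E| = 0)%E.
  under eq_integral => x _ do rewrite abse_EFin ger0_norm ?(proj1 (andP (retr_range k x)))//.
  by rewrite (Ex_fineE (retr_integrable k)) -mean_pointE E.
move/(ae_eq_integral_abs pi measurableT) => h.
have {}h := h (proj2 (measurable_EFinP _ _) (measurable_retr k)).
have : pi setT = 0%E.
  case: h => N [mN N0 hN].
  have -> : [set: state_space] = N; last by [].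
  apply/seteqP; split=> // x _; apply: hN => /= /(_ I) [] /eqP.
  by rewrite gt_eqF//; have [_] := int_simplex_retr (x : 'cV[R]_n) n0.
by rewrite [X in X = _]probability_setT => /eqP; rewrite onee_eq0.
Qed.

End stationary_point.

(** * Time averages *)

Lemma sublinear_cvg0 {R : realType} (f T : nat -> R) : T @ \oo --> +oo ->
  (forall eps : R, 0 < eps -> exists C : R, \forall k \near \oo, `|f k| <= C + T k * eps) ->
  (fun k => f k / T k) @ \oo --> (0 : R).
Proof.
move=> Too hf; apply/cvgrPdist_le => e e0.
have e2 : 0 < e / 2 by rewrite divr_gt0.
have [C hC] := hf _ e2.
near=> k; rewrite sub0r normrN normrM normfV.
have T1 : 1 <= T k by near: k; exact: (cvgryPge _).1.
have TC : 2 * `|C| / e <= T k by near: k; exact: (cvgryPge _).1.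
have T0 : 0 < T k by exact: lt_le_trans T1.
rewrite (gtr0_norm T0) ler_pdivrMr//.
apply: (@le_trans _ _ (C + T k * (e / 2))); first by near: k.
have : C <= e / 2 * T k.
  apply: (le_trans (ler_norm C)); move: TC; rewrite ler_pdivrMr// => h; lra.
lra.
Unshelve. all: by end_near. Qed.

(** * Limit points of sequences with vanishing payoff gaps *)

Section payoff_gap.
Context {R : realType} {n : nat}.
Implicit Types (M : 'M[R]_n) (y z : 'cV[R]_n).

Definition gap M (i j : 'I_n) z : R := (M *m z) i 0 - (M *m z) j 0.

Lemma gapE M i j z : gap M i j z = contrast (fun k => M i k - M j k) (fun k => z k 0).
Proof.
by rewrite /gap !mxE -sumrB; apply: eq_bigr => k _; rewrite mulrBl.
Qed.

(* Stated for a coordinate map, to cover both row and column vectors. *)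
Lemma closed_almost_equal_payoff (T : topologicalType) (c : 'I_n -> T -> R) M (e : R) :
  (forall i, continuous (c i)) ->
  closed [set t | [/\ forall i, 0 <= c i t <= 1, \sum_i c i t = 1 &
    forall i j, `|contrast (fun k => M i k - M j k) (c ^~ t)| <= e]].
Proof.
move=> cc.
have cs (w : 'I_n -> R) : continuous (fun t => contrast w (c ^~ t)).
  rewrite /contrast; elim: (index_enum _) => [|k r ih].
    by rewrite (_ : (fun t => _) = fun=> 0); [move=> t; exact: cvg_cst|apply/funext => t; rewrite big_nil].
  rewrite (_ : (fun t => _) = (fun t => w k * c k t + \sum_(l <- r) w l * c l t)); last first.
    by apply/funext => t; rewrite big_cons.
  by move=> t; apply: cvgD; [apply: cvgMr; exact: cc|exact: ih].
have E : [set t | [/\ forall i, 0 <= c i t <= 1, \sum_i c i t = 1 &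
    forall i j, `|contrast (fun k => M i k - M j k) (c ^~ t)| <= e]] =
  (\bigcap_(i in [set: 'I_n]) (c i @^-1` `[0, 1]%classic)) `&`
  ((fun t => contrast (fun=> 1) (c ^~ t)) @^-1` `[1, 1]%classic) `&`
  (\bigcap_(ij in [set: 'I_n * 'I_n]) ((fun t => contrast (fun k => M ij.1 k - M ij.2 k) (c ^~ t)) @^-1` `[- e, e]%classic)).
  apply/seteqP; split=> t /=.
    move=> [h1 h2 h3]; split; [split|].
    - by move=> i _; rewrite /= in_itv/=; exact: h1.
    - by rewrite in_itv/= /contrast; under eq_bigr do rewrite mul1r; rewrite h2 lexx.
    - by move=> ij _; rewrite /= in_itv/= -ler_norml.
  move=> [[h1 h2] h3]; split.
  - by move=> i; have := h1 i I; rewrite /= in_itv.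
  - have c1 : contrast (fun=> 1) (c ^~ t) = \sum_i c i t by apply: eq_bigr => i _; rewrite mul1r.
    by move: h2; rewrite in_itv/= c1 -eq_le => /eqP.
  - by move=> i j; have := h3 (i, j) I; rewrite /= in_itv/= -ler_norml.
rewrite E; apply: closedI; first apply: closedI.
- apply: closed_bigI => i _; apply: closed_comp => [t _|]; [exact: cc|exact: interval_closed].
- by apply: closed_comp => [t _|]; [exact: cs|exact: interval_closed].
- by apply: closed_bigI => ij _; apply: closed_comp => [t _|]; [exact: cs|exact: interval_closed].
Qed.

Lemma equal_payoff_limit M z : simplex z -> (forall (e : R), 0 < e -> forall i j, `|gap M i j z| <= e) ->
  equal_payoff_set M z.
Proof.
move=> zS h; split => // i j; apply/eqP; rewrite -subr_eq0 -normr_le0.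
by apply/ler_addgt0Pr => e e0; rewrite add0r; exact: h.
Qed.

(** The points of the simplex with gaps at most [e] form a closed set that eventually contains the
    sequence, hence contains its cluster points; then [e] tends to 0. *)
Lemma cluster_equal_payoff M (z : nat -> 'cV[R]_n) :
  (\forall k \near \oo, simplex (z k)) ->
  (forall e : R, 0 < e -> \forall k \near \oo, forall i j, `|gap M i j (z k)| <= e) ->
  cluster (z @ \oo) `<=` equal_payoff_set M.
Proof.
move=> zS zM y; rewrite clusterE => hy.
pose S (e : R) := [set t : 'cV[R]_n | [/\ forall i, 0 <= t i 0 <= 1, \sum_i t i 0 = 1 &
    forall i j, `|contrast (fun k => M i k - M j k) (fun k => t k 0)| <= e]].
have cS e : closed (S e).
  by apply: (closed_almost_equal_payoff (c := fun i (t : 'cV[R]_n) => t i 0)) => i; exact: coord_continuous.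
have yS (e : R) : 0 < e -> S e y.
  move=> e0; rewrite ((closure_id _).1 (cS e)); apply: hy.
  have : \forall k \near \oo, S e (z k); last by [].
  near=> k; have [z01 z1] : simplex (z k) by near: k.
  split => // i j; rewrite -gapE; move: i j; near: k; exact: zM.
have [y01 y1 _] := yS 1 ltr01.
apply: equal_payoff_limit => [//|e e0 i j]; rewrite gapE; by have [_ _] := yS e e0.
Unshelve. all: by end_near. Qed.

(** Compactness of the cube, used for row vectors and hence for the transposed sequence, provides a
    cluster point. *)
Lemma equal_payoff_nonempty M (z : nat -> 'cV[R]_n) : (\forall k \near \oo, simplex (z k)) ->
  (forall e : R, 0 < e -> \forall k \near \oo, forall i j, `|gap M i j (z k)| <= e) ->
  equal_payoff_set M !=set0.
Proof.
move=> zS zM.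
have cpt := rV_compact (fun i : 'I_n => @segment_compact R 0 1).
pose S (e : R) := [set t : 'rV[R]_n | [/\ forall i, 0 <= t 0 i <= 1, \sum_i t 0 i = 1 &
    forall i j, `|contrast (fun k => M i k - M j k) (fun k => t 0 k)| <= e]].
have cS e : closed (S e).
  by apply: (closed_almost_equal_payoff (c := fun i (t : 'rV[R]_n) => t 0 i)) => i; exact: coord_continuous.
have nS (e : R) : 0 < e -> \forall k \near \oo, S e (z k)^T.
  move=> e0; near=> k; have [z01 z1] : simplex (z k) by near: k.
  split => [i|| i j].
  - by rewrite mxE.
  - by under eq_bigr do rewrite mxE.
  - under [X in contrast _ X]funext do rewrite mxE.
    rewrite -gapE; move: i j; near: k; exact: zM.
have [y [_ hy]] : [set v : 'rV[R]_n | forall i, `[0, 1]%classic (v 0 i)] `&`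
    cluster ((fun k => (z k)^T) @ \oo) !=set0.
  apply: cpt; apply: filterS (nS 1 ltr01) => k [z01 _ _] i.
  by rewrite /= in_itv/=; exact: z01.
have yS (e : R) : 0 < e -> S e y.
  by move=> e0; rewrite ((closure_id _).1 (cS e)); move: hy; rewrite clusterE; apply; exact: nS.
have [y01 y1 _] := yS 1 ltr01.
exists y^T; apply: equal_payoff_limit => [|e e0 i j].
  by split => [i|]; [rewrite mxE|under eq_bigr do rewrite mxE].
rewrite gapE; under [X in contrast _ X]funext do rewrite mxE.
by have [_ _] := yS e e0.
Unshelve. all: by end_near. Qed.

End payoff_gap.

(** * Time averages along one path *)

Section pathwise.
Context {R : realType} {n : nat}.
Variables (M : 'M[R]_n) (x : 'cV[R]_n) (X : R -> 'cV[R]_n) (b : 'I_n -> R -> R).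
Hypotheses (cX : forall i, cts0 (fun t => X t i 0))
  (Xs : forall t, 0 <= t -> int_simplex (X t))
  (lr : forall t, 0 <= t -> forall i j,
    lnv (X t) i - lnv (X t) j = lnv x i - lnv x j + J (fun s => gap M i j (X s)) t + b i t - b j t)
  (bs : forall i (eps : R), 0 < eps -> exists C : R, forall t, 0 <= t -> `|b i t| <= C + t * eps).

Definition average (T : R) : 'cV[R]_n := \col_i (T^-1 * J (fun t => X t i 0) T).

(** The identity for log ratios, solved for the integral of the gap and divided by [T]: gaps are
    linear, hence commute with the time average. *)
Lemma gap_average T i j : 0 < T -> gap M i j (average T) =
  T^-1 * (lnv (X T) i - lnv (X T) j - (lnv x i - lnv x j) - b i T + b j T).
Proof.
move=> T0; rewrite (lr (ltW T0)).
have -> : J (fun s => gap M i j (X s)) T = contrast (fun k => M i k - M j k) (fun k => J (fun s => X s k 0) T).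
  by rewrite -(J_sum _ (g := fun k s => X s k 0))//; apply: eq_J => s _ _; rewrite gapE.
rewrite gapE /contrast.
transitivity (T^-1 * \sum_l (M i l - M j l) * J (fun s => X s l 0) T).
  by rewrite mulr_sumr; apply: eq_bigr => k _; rewrite mxE mulrCA.
by congr (_ * _); ring.
Qed.

Lemma J_coord i (S T : R) : 0 <= S -> S <= T ->
  0 <= J (fun t => X t i 0) T - J (fun t => X t i 0) S <= T - S.
Proof.
move=> S0 ST; have cXi : cts0 (fun t => X t i 0) by exact: cX.
have := @J_incr R (fun t => X t i 0) S T (1 / 2) (1 / 2) (cts0_integrable T cXi) S0 ST.
have h u : S < u -> u <= T -> `|X u i 0 - 1 / 2| <= 1 / 2.
  move=> Su uT; have [[/(_ i)/andP[a0 a1] _] _] := Xs (le_trans S0 (ltW Su)).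
  by rewrite ler_norml; apply/andP; split; lra.
by move=> /(_ h); rewrite ler_norml => /andP[h1 h2]; apply/andP; split; lra.
Qed.

Lemma average_simplex T : 0 < T -> simplex (average T).
Proof.
move=> T0; have Ti i := J_coord i (lexx 0) (ltW T0).
split => [i|].
  have := Ti i; rewrite J0 !subr0 mxE => /andP[h1 h2].
  by rewrite mulr_ge0 ?invr_ge0 ?(ltW T0)//= mulrC ler_pdivrMr// mul1r.
transitivity (T^-1 * \sum_i J (fun t => X t i 0) T).
  by rewrite mulr_sumr; apply: eq_bigr => i _; rewrite mxE.
have := J_sum (fun=> 1) T cX; rewrite /contrast.
under [X in _ = X]eq_bigr do rewrite mul1r; move=> <-.
rewrite (eq_J (h := fun=> 1)) ?J_cst ?(ltW T0)// ?mul1r ?mulVf ?gt_eqF// => s s0 _.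
by under eq_bigr do rewrite mul1r; have [[_ ->]] := Xs s0.
Qed.

Lemma average_slow S T i : 0 < S -> S <= T -> T <= S + 1 ->
  `|average T i 0 - average S i 0| <= 2 / S.
Proof.
move=> S0 ST TS; have T0 : 0 < T by exact: lt_le_trans ST.
have /andP[h1 h2] := J_coord i (ltW S0) ST.
have := J_coord i (lexx 0) (ltW S0); rewrite J0 !subr0 => /andP[h3 h4].
rewrite !mxE; move: h1 h2 h3 h4; move: (J _ T) (J _ S) => a c h1 h2 h3 h4.
have -> : T^-1 * a - S^-1 * c = T^-1 * (a - c) - (T - S) * (S^-1 * c) / T by field; rewrite !gt_eqF.
have i0 : 0 <= T^-1 by rewrite invr_ge0 ltW.
have q0 : 0 <= S^-1 * c <= 1.
  by rewrite mulr_ge0 ?invr_ge0 ?(ltW S0)//= mulrC ler_pdivrMr// mul1r.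
have e1 : `|T^-1 * (a - c)| <= T^-1.
  by rewrite ger0_norm ?mulr_ge0// ler_piMr//; move: h1 h2 TS; lra.
have e2 : `|(T - S) * (S^-1 * c) / T| <= T^-1.
  have /andP[a0 a1] := q0.
  have TS0 : 0 <= T - S by rewrite subr_ge0.
  have p0 : 0 <= (T - S) * (S^-1 * c) by exact: mulr_ge0.
  rewrite (ger0_norm (mulr_ge0 p0 i0)) ler_piMl// mulr_ile1//.
  by rewrite lerBlDl.
apply: (le_trans (ler_normB _ _)); apply: (@le_trans _ _ (2 * T^-1)); first by lra.
by rewrite ler_pM2l// lef_pV2.
Qed.

Lemma gap_average_cvg (T : nat -> R) : T @ \oo --> +oo ->
  (forall i j, (fun k => (lnv (X (T k)) i - lnv (X (T k)) j) / T k) @ \oo --> (0 : R)) ->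
  forall e : R, 0 < e -> \forall k \near \oo, forall i j, `|gap M i j (average (T k))| <= e.
Proof.
move=> Too hV e e0.
have T0 : \forall k \near \oo, 0 < T k.
  by apply: filterS ((cvgryPge _).1 Too 1) => k; exact: lt_le_trans.
have bc i : (fun k => b i (T k) / T k) @ \oo --> (0 : R).
  apply: sublinear_cvg0 => // eps eps0; have [C hC] := bs i eps0; exists C.
  by apply: filterS T0 => k Tk; exact: hC (ltW Tk).
have cc (c : R) : (fun k => c / T k) @ \oo --> (0 : R).
  apply: sublinear_cvg0 => // eps eps0; exists `|c|.
  by apply: filterS T0 => k Tk; rewrite lerDl mulr_ge0// ltW.
have main i j : \forall k \near \oo, `|gap M i j (average (T k))| <= e.
  have : (fun k => (lnv (X (T k)) i - lnv (X (T k)) j) / T k - (lnv x i - lnv x j) / T k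
      - b i (T k) / T k + b j (T k) / T k) @ \oo --> (0 - 0 - 0 + 0 : R).
    by apply: cvgD; [apply: cvgB; [apply: cvgB; [exact: hV|exact: cc]|exact: bc]|exact: bc].
  rewrite subr0 subr0 addr0 => /cvgrPdist_le /(_ _ e0); apply: filterS2 T0 => k Tk.
  rewrite sub0r normrN gap_average//; congr (`|_| <= _).
  by rewrite -!mulrBl -mulrDl mulrC.
by apply: filter_forall => i; apply: filter_forall => j; exact: main.
Qed.

(** The logarithms are controlled at the times [1 + k] only; between two consecutive ones the
    average moves by at most [2 / (1 + k)]. *)
Lemma average_cvg (y : 'cV[R]_n) (C : R) : 0 <= C ->
  (forall z e, simplex z -> (forall i j, `|gap M i j z| <= e) -> forall k, `|z k 0 - y k 0| <= C * e) ->
  (forall i j, (fun k => (lnv (X (1 + k%:R)) i - lnv (X (1 + k%:R)) j) / (1 + k%:R)) @ \oo --> (0 : R)) ->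
  average T @[T --> +oo] --> y.
Proof.
move=> C0 stable hV; apply/cvg_ballP => e e0.
have Too : (fun k : nat => 1 + k%:R : R) @ \oo --> +oo.
  apply/cvgryPge => a; near=> k; rewrite (@le_trans _ _ k%:R)//; last by rewrite lerDr.
  by near: k; exact: nbhs_infty_ger.
have d0 : 0 < e / (4 * (C + 1)) by rewrite divr_gt0// mulr_gt0// ltr_wpDl.
have [K1 _ hK1] := gap_average_cvg Too hV d0.
have [K2 hK2] : exists K2 : nat, 8 / e <= K2%:R :> R.
  by exists (Num.truncn (8 / e)).+1; apply: ltW; exact: truncnS_gt.
pose K := maxn K1 K2.
exists (1 + K%:R); split; first exact: num_real.
move=> T KT; split => // i j; rewrite (ord1 j).
have T1 : 0 <= T - 1 by rewrite subr_ge0 (le_trans _ (ltW KT))// lerDl.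
pose k := Num.truncn (T - 1).
have k1 : k%:R <= T - 1 by rewrite truncn_le.
have k2 : T - 1 < k.+1%:R by exact: truncnS_gt.
have Kk : (K <= k)%N by rewrite -ltnS -(ltr_nat R) (le_lt_trans _ k2)// lerBrDl ltW.
have S0 : 0 < 1 + k%:R :> R by rewrite ltr_wpDr.
have slow : `|average T i 0 - average (1 + k%:R) i 0| <= 2 / (1 + k%:R).
  by apply: average_slow => //; move: k1 k2; rewrite -natr1; lra.
have hk := stable _ _ (average_simplex S0) (hK1 k (leq_trans (leq_maxl _ _) Kk)) i.
have s2 : 2 / (1 + k%:R) <= e / 4 :> R.
  rewrite ler_pdivrMr//; move: hK2; rewrite ler_pdivrMr// => hK2.
  have : K2%:R <= k%:R :> R by rewrite ler_nat (leq_trans _ Kk)// leq_maxr.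
  by move: hK2 e0; move: (k%:R : R) (K2%:R : R) => a c; nra.
have s3 : C * (e / (4 * (C + 1))) <= e / 4.
  have c1 : 0 < C + 1 by rewrite ltr_wpDl.
  rewrite mulrA ler_pdivrMr ?mulr_gt0//.
  have -> : e / 4 * (4 * (C + 1)) = e * (C + 1) by field.
  by rewrite mulrC ler_pM2l// lerDl.
rewrite -ball_normE /= distrC.
have := ler_distD (average (1 + k%:R) i 0) (average T i 0) (y i 0).
move=> /le_lt_trans; apply; move: slow hk s2 s3 e0.
move: (`|_ - _|) (`|_ - _|) => p q; lra.
Unshelve. all: by end_near. Qed.

End pathwise.

(** * Interior Nash equilibria and equal payoffs *)

Section equilibria.
Context {R : realType} {n : nat}.
Implicit Types (M : 'M[R]_n) (p q : 'cV[R]_n).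

Lemma payoff_sum M p q : (q^T *m M *m p) 0 0 = \sum_i q i 0 * (M *m p) i 0.
Proof. by rewrite -mulmxA mxE; apply: eq_bigr => i _; rewrite mxE. Qed.

Lemma equal_payoff_nash M p : equal_payoff_set M p -> nash_equilibrium M p.
Proof.
move=> [pS pM]; split => // q [_ q1]; rewrite !payoff_sum.
have [n0|n0] := posnP n.
  by apply: eq_ler; apply: eq_bigr => i _; have := ltn_ord i; rewrite [X in (_ < X)%N]n0.
pose i0 := Ordinal n0.
have E (r : 'cV[R]_n) : \sum_i r i 0 = 1 -> \sum_i r i 0 * (M *m p) i 0 = (M *m p) i0 0.
  by move=> r1; under eq_bigr do rewrite (pM _ i0); rewrite -mulr_suml r1 mul1r.
by rewrite !E//; case: pS.
Qed.

(** Testing against the vertices shows that no payoff exceeds the mean payoff [v]; since [v] is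
    their average with the positive weights [q], all payoffs are equal to [v]. *)
Lemma interior_nash_equal_payoff M q : nash_equilibrium M q -> int_simplex q -> equal_payoff_set M q.
Proof.
move=> [qS qN] [_ q0]; split => //.
set v := (q^T *m M *m q) 0 0 in qN.
have le i : (M *m q) i 0 <= v.
  pose e : 'cV[R]_n := \col_j (j == i)%:R.
  have eS : simplex e.
    split => [j|]; first by rewrite mxE; case: eqP => _; rewrite ler01 lexx.
    by rewrite (bigD1 i)//= mxE eqxx big1 ?addr0// => j /negbTE ji; rewrite mxE ji.
  have := qN e eS; rewrite payoff_sum (bigD1 i)//= mxE eqxx mul1r big1 ?addr0// => j /negbTE ji.
  by rewrite mxE ji mul0r.
have vE i : (M *m q) i 0 = v.
  have : \sum_j q j 0 * (v - (M *m q) j 0) = 0.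
    under eq_bigr do rewrite mulrBr; rewrite sumrB -mulr_suml qS.2 mul1r.
    by rewrite -payoff_sum subrr.
  move/eqP; rewrite psumr_eq0 => [/allP/(_ i)|j _]; last first.
    by rewrite mulr_ge0 ?subr_ge0// ltW.
  rewrite mem_index_enum => /(_ isT)/=; rewrite mulf_eq0 gt_eqF//= subr_eq0.
  by move=> /eqP.
by move=> i j; rewrite !vE.
Qed.

End equilibria.

Lemma ae_exists {d : measure_display} {T : measurableType d} {R : realType}
  (P : probability T R) (Q : T -> Prop) : {ae P, forall w, Q w} -> exists w, Q w.
Proof.
move=> [N [mN N0 hN]]; apply: contrapT => nQ.
have : P setT = 0%E.
  have -> : [set: T] = N; last by [].
  by apply/seteqP; split=> // w _; apply: hN => Qw; apply: nQ; exists w.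
by rewrite [X in X = _]probability_setT => /eqP; rewrite onee_eq0.
Qed.

Section invariant.
Context {R : realType} {n : nat} {d : measure_display} {Omega : measurableType d}.
Variables (P : probability Omega R) (X : 'cV[R]_n -> R -> Omega -> 'cV[R]_n).
Notation state_space := (@state_space R n).
Hypothesis n0 : (0 < n)%N.
Variable pi : probability state_space R.
Hypothesis hpi : invariant_distribution P X pi.

Lemma invariant_distribution_int : pi (~` int_simplex) = 0%E.
Proof.
case: hpi => nu [[_ nu0 _ _] _ ->]; first by rewrite nu0 mule0.
by apply: measurableC; exact: (measurable_int_simplex n0).
Qed.

(** The normalising constant is moved across the integral of the transition function, which is
    assumed measurable; for the level sets to which the invariance is applied, [mTc] supplies
    this. *)
Lemma invariant_distribution_stationary (t : R) (B : set state_space) : 0 <= t -> measurable B ->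
  measurable_fun (int_simplex : set state_space) (fun x : state_space => transition P X t x B) ->
  (\int[pi]_(x in int_simplex) transition P X t x B = pi B)%E.
Proof.
move=> t0 mB mt; case: hpi => nu [[_ _ nu1 nuI] nuf piE].
have c0 : 0 <= (fine (nu int_simplex))^-1 by rewrite invr_ge0 fine_ge0// ltW.
rewrite (piE _ mB) -(nuI _ _ t0 mB).
pose c : {nonneg R} := NngNum c0.
rewrite -[(fine _)^-1]/(c%:num) -ge0_integral_mscale//; last exact: (measurable_int_simplex n0).
apply: eq_measure_integral => A mA _; exact: piE.
Qed.

End invariant.

(** * From almost sure path properties to the two cases *)

Section final.
Context {R : realType} {n : nat} {d : measure_display} {Omega : measurableType d}.
Variables (P : probability Omega R) (W : 'I_n -> R -> {RV P >-> R}).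
Hypothesis hW : brownian_motion W.
Variables (A : 'M[R]_n) (sigma : 'I_n -> R).
Hypothesis sigma0 : forall i, 0 < sigma i.
Hypothesis n0 : (0 < n)%N.
Notation M := (modified_payoff A sigma).

Let scaled_sublinear : {ae P, forall w, forall i (eps : R), 0 < eps ->
  exists C : R, forall t, 0 <= t -> `|sigma i * W i t w| <= C + t * eps}.
Proof.
have : {ae P, forall w, forall i (eps : R), 0 < eps ->
    exists C : R, forall t : R, 0 <= t -> `|W i t w| <= C + t * eps}.
  by apply: filter_forall => i; exact: brownian_sublinear.
apply: filterS => w hw i eps e0; have s0 := sigma0 i.
have [C hC] := hw i _ (divr_gt0 e0 s0); exists (sigma i * C) => t t0.
rewrite normrM (gtr0_norm s0).
have -> : sigma i * C + t * eps = sigma i * (C + t * (eps / sigma i)) by field; rewrite gt_eqF.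
by rewrite ler_pM2l// hC.
Qed.

Section one_process.
Variables (x : 'cV[R]_n) (X : R -> Omega -> 'cV[R]_n).
Hypotheses (xI : int_simplex x) (hX : replicator_process A sigma W x X).

Lemma regular_paths : {ae P, forall w, [/\ forall t, 0 <= t -> int_simplex (X t w),
  forall t, 0 <= t -> forall i j, lnv (X t w) i - lnv (X t w) j = lnv x i - lnv x j +
     J (fun s => gap M i j (X s w)) t + sigma i * W i t w - sigma j * W j t w
  & forall i (eps : R), 0 < eps ->
    exists C : R, forall t, 0 <= t -> `|sigma i * W i t w| <= C + t * eps]}.
Proof.
have Xs : {ae P, forall w, forall t : R, 0 <= t -> int_simplex (X t w)} by case: hX.
by apply: filterS3 Xs (log_ratio hW hX) scaled_sublinear => w h1 h2 h3; split.
Qed.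

Let cX w i : cts0 (fun t => X t w i 0). Proof. exact: (process_cts hX). Qed.

(** Recurrence is used at the starting point itself. With [c] below all its coordinates, the visits
    to the ball of radius [c / 2] have coordinates at least [c / 2], hence bounded logarithms. A
    single good path gives a point of the set. *)
Lemma equal_payoff_nonempty_of_recurrent : recurrent P X -> equal_payoff_set M !=set0.
Proof.
move=> rX; have [c c0 hc] := finite_pos_lower xI.2.
have [T hT] := rX x (c / 2) xI (divr_gt0 c0 (ltr0n _ 2)).
have [w [[T0 _ Too Tb] [Xs lr bs]]] := ae_exists (filterI hT regular_paths).
pose b i t := sigma i * W i t w.
have Tpos : \forall k \near \oo, 0 < T k w.
  by apply: filterS ((cvgryPge _).1 Too 1) => k; exact: lt_le_trans.
have c20 : 0 < c / 2 by rewrite divr_gt0.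
have lower i k : c / 2 <= X (T k w) w i 0.
  have [_ dist] := Tb k.
  have : `|X (T k w) w i 0 - x i 0| < c / 2.
    apply: le_lt_trans dist; rewrite -sqrtr_sqr ler_wsqrtr// (bigD1 i)//= lerDl.
    by apply: sumr_ge0 => j _; exact: sqr_ge0.
  by rewrite ltr_norml => /andP[h1 _]; have := hc i; lra.
apply: (@equal_payoff_nonempty _ _ M (fun k => average (fun t => X t w) (T k w))).
  by apply: filterS Tpos => k Tk; apply: average_simplex => // i; exact: cX.
apply: (@gap_average_cvg _ _ M x (fun t => X t w) b) => // i j.
apply: sublinear_cvg0 => // eps eps0; exists (- ln (c / 2)); near=> k.
have Tk : 0 < T k w by near: k.
have ln_range l : ln (c / 2) <= lnv (X (T k w) w) l <= 0.
  have [[xr _] xp] := Xs _ (T0 k); rewrite /lnv ler_ln ?posrE ?lower//=.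
  by rewrite ln_le0//; have /andP[] := xr l.
have /andP[i1 i2] := ln_range i; have /andP[j1 j2] := ln_range j.
have : 0 <= T k w * eps by rewrite mulr_ge0// ltW.
by move=> h; rewrite ler_norml; apply/andP; split; lra.
Unshelve. all: by end_near. Qed.

Lemma accumulation_points (T : nat -> {RV P >-> R}) : (forall k w, 0 <= T k w) ->
  {ae P, forall w, (forall k, T k w <= T k.+1 w) /\ (fun k => T k w) @ \oo --> +oo} ->
  (forall i, {ae P, forall w, (fun k => ln (X (T k w) w i 0) / T k w) @ \oo --> (0 : R)}) ->
  {ae P, forall w, cluster ((fun k => time_average X (T k w) w) @ \oo) `<=` equal_payoff_set M}.
Proof.
move=> T0 hT hl; have hl' : {ae P, forall w i, (fun k => ln (X (T k w) w i 0) / T k w) @ \oo --> (0 : R)} by apply: filter_forall.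
apply: filterS3 hT hl' regular_paths => w [_ Too] l0 [Xs lr bs].
pose b i t := sigma i * W i t w.
apply: (@cluster_equal_payoff _ _ M (fun k => average (fun t => X t w) (T k w))).
  apply: filterS ((cvgryPge _).1 Too 1) => k T1; apply: average_simplex => //.
  exact: lt_le_trans T1.
apply: (@gap_average_cvg _ _ M x (fun t => X t w) b) => // i j.
rewrite -[X in _ --> X](subr0 0).
rewrite (_ : (fun k => _) = (fun k => ln (X (T k w) w i 0) / T k w - ln (X (T k w) w j 0) / T k w)).
  by apply: cvgB; exact: l0.
by apply/funext => k; rewrite -mulrBl.
Qed.

End one_process.

Section positive.
Variable X : 'cV[R]_n -> R -> Omega -> 'cV[R]_n.
Hypothesis hX : forall x, int_simplex x -> replicator_process A sigma W x (X x).
Variable x0 : 'cV[R]_n.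
Hypothesis x0I : int_simplex x0.
Variable pi : probability (@state_space R n) R.
Hypothesis hpi : invariant_distribution P X pi.

Let pi0 := invariant_distribution_int n0 hpi.
Let piI := invariant_distribution_stationary n0 hpi.

Let u (i j l : 'I_n) : R := (l == i)%:R - (l == j)%:R.

Let contrast_u i j (a : 'I_n -> R) : contrast (u i j) a = a i - a j.
Proof.
rewrite /contrast /u; under eq_bigr do rewrite mulrBl; rewrite sumrB.
have E k : \sum_l (l == k)%:R * a l = a k.
  by rewrite (bigD1 k)//= eqxx mul1r big1 ?addr0// => l /negbTE ->; rewrite mul0r.
by rewrite !E.
Qed.

Let sum_u i j : \sum_l u i j l = 0.
Proof.
have := contrast_u i j (fun=> 1); rewrite subrr => E; rewrite -[RHS]E.
by apply: eq_bigr => l _; rewrite mulr1.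
Qed.

Lemma mean_point_interior : int_simplex (mean_point pi).
Proof. exact: (mean_point_int_simplex n0 pi0). Qed.

Lemma mean_point_equal_payoff : equal_payoff_set M (mean_point pi).
Proof.
split => [|i j]; first exact: mean_point_interior.1.
have := mean_point_contrast hW n0 hX pi0 piI (sum_u i j).
by rewrite /contrast_payoff contrast_u => /eqP; rewrite subr_eq0 => /eqP.
Qed.

(** Both points have equal payoffs, so the stability estimate with [e = 0] identifies them. *)
Lemma interior_nash_unique q : nash_equilibrium M q -> int_simplex q -> q = mean_point pi.
Proof.
move=> qN qI; have [qS qM] := interior_nash_equal_payoff qN qI.
have [C [C0 hC]] := equal_payoff_stable hW sigma0 n0 hX pi0 piI.
apply/matrixP => k l; rewrite (ord1 l); apply/eqP; rewrite -subr_eq0 -normr_le0 -(mulr0 C).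
apply: hC => //; first exact: mean_point_equal_payoff.
by move=> i j; rewrite (qM i j) subrr normr0.
Qed.

Lemma time_average_cvg : {ae P, forall w,
  time_average (X x0) T w @[T --> +oo] --> mean_point pi}.
Proof.
have [C [C0 hC]] := equal_payoff_stable hW sigma0 n0 hX pi0 piI.
have hV : {ae P, forall w i j (eps : R), 0 < eps -> exists C : R, forall k : nat,
    `|contrast (u i j) (lnv (X x0 (1 + k%:R) w))| <= C + (k%:R + 1) * eps}.
  apply: filter_forall => i; apply: filter_forall => j.
  exact: (contrast_sublinear hW sigma0 n0 hX pi0 piI x0I (sum_u i j)).
apply: filterS2 hV (regular_paths (hX x0I)) => w hV [Xs lr bs].
apply: (@average_cvg _ _ M x0 (fun t => X x0 t w) (fun i t => sigma i * W i t w) _ _ _ _ _ C) => //.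
- by move=> i; exact: (process_cts (hX x0I)).
- move=> z e zS zM k; apply: hC => //; exact: mean_point_equal_payoff.
move=> i j; apply: (@sublinear_cvg0 _ _ (fun k : nat => 1 + k%:R : R)).
  apply/cvgryPge => a; near=> k; rewrite (@le_trans _ _ k%:R)//; last by rewrite lerDr.
  by near: k; exact: nbhs_infty_ger.
move=> eps e0; have [D hD] := hV i j eps e0; exists D; apply: nearW => k.
by have := hD k; rewrite contrast_u [k%:R + 1]addrC.
Unshelve. all: by end_near. Qed.

End positive.
End final.

Unset Implicit Arguments.
Set Strict Implicit.
Set Printing Implicit Defensive.

Theorem theorem3p1 (R : realType) (n : nat) (hn : (2 <= n)%N)
  (d : measure_display) (Omega : measurableType d) (P : probability Omega R)
  (W : 'I_n -> R -> {RV P >-> R}) (hW : brownian_motion W)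
  (A : 'M[R]_n) (sigma : 'I_n -> R) (hsigma : forall i, 0 < sigma i)
  (X : 'cV[R]_n -> R -> Omega -> 'cV[R]_n)
  (hX : forall x, int_simplex x -> replicator_process A sigma W x (X x))
  (x0 : 'cV[R]_n) (hx0 : int_simplex x0) :
  (positive_recurrent P X x0 ->
   forall pi : probability state_space R, invariant_distribution P X pi ->
   [/\ nash_equilibrium (modified_payoff A sigma) (mean_point pi),
       int_simplex (mean_point pi),
       forall q, nash_equilibrium (modified_payoff A sigma) q ->
         int_simplex q -> q = mean_point pi
     & {ae P, forall w,
         time_average (X x0) T w @[T --> +oo] --> mean_point pi}])
  /\
  (null_recurrent P X x0 ->
   equal_payoff_set (modified_payoff A sigma) !=set0 /\
   forall T : nat -> {RV P >-> R},
     (forall k w, 0 <= T k w) ->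
     {ae P, forall w, (forall k, T k w <= T k.+1 w) /\
                      (fun k => T k w) @ \oo --> +oo} ->
     (forall i, {ae P, forall w,
        (fun k => ln (X x0 (T k w) w i 0) / T k w) @ \oo --> 0}) ->
     {ae P, forall w,
        cluster ((fun k => time_average (X x0) (T k w) w) @ \oo)
          `<=` equal_payoff_set (modified_payoff A sigma)}).
Proof.
have n0 : (0 < n)%N by exact: ltnW.
split=> [_ pi hpi|[rX _]].
  split.
  - exact: equal_payoff_nash (mean_point_equal_payoff hW n0 hX hpi).
  - exact: (mean_point_interior n0 hpi).
  - by move=> q; exact: (interior_nash_unique hW hsigma n0 hX hpi).
  - exact: (time_average_cvg hW hsigma n0 hX hx0 hpi).
split; first exact: (equal_payoff_nonempty_of_recurrent hW hsigma hx0 (hX x0 hx0) rX).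
move=> T T0 hT hl; exact: (accumulation_points hW hsigma (hX x0 hx0) T0 hT hl).
Qed.
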